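(* Let $Q$ be an admissible harmonic map with $\|dQ\|_{L^2_x}<\mu_1$, $\|e^{\varrho r}|dQ|\|_{L^\infty_x}<\mu_1$, $\|\nabla^2dQ\|_{L^\infty_x}+\|\nabla dQ\|_{L^\infty_x}<\mu_1$. Let $u$ be a solution of the wave map equation in $\mathcal{X}_T$ admitting a caloric gauge relative to $Q$ with the limit frame fixed as $\Xi_i(x)=\Theta_i(Q(x))$, $i=1,2$. Then the heat tension field $\phi_s$ satisfies $$\begin{aligned}(\partial_t^2-\Delta)\phi_s+W\phi_s=&-2A_t\partial_t\phi_s-A_tA_t\phi_s-\partial_tA_t\,\phi_s+\partial_s\mathfrak{W}+\mathbf{R}(\partial_t\widetilde u,\partial_s\widetilde u)(\partial_t\widetilde u)+2h^{ii}A_i^{con}\partial_i\phi_s\\&+h^{ii}A_i^{con}A_i^\infty\phi_s+h^{ii}A_i^\infty A_i^{con}\phi_s+h^{ii}A_i^{con}A_i^{con}\phi_s+h^{ii}(\partial_iA_i^{con}-\Gamma^k_{ii}A_k^{con})\phi_s\\&+h^{ii}(\phi_s\wedge\phi_i^\infty)\phi_i^{con}+h^{ii}(\phi_s\wedge\phi_i^{con})\phi_i^\infty+h^{ii}(\phi_s\wedge\phi_i^{con})\phi_i^{con},\end{aligned}$$ where $$W\varphi=-2h^{ii}A_i^\infty\partial_i\varphi-h^{ii}A_i^\infty A_i^\infty\varphi-h^{ii}(\varphi\wedge\phi_i^\infty)\phi_i^\infty-h^{ii}(\partial_iA_i^\infty-\Gamma^k_{ii}A_k^\infty)\varphi .$$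 Furthermore, $-\Delta+W$ is a self-adjoint operator in $L^2(\mathbb{H}^2;\mathbb{C}^2)$, and it is strictly positive if $0<\mu_1\ll1$.
   Context: Domain and target are the hyperbolic plane $\mathbb{H}^2$ with global coordinates $\Psi(x_1,x_2)=(\cosh x_2+e^{-x_2}x_1^2/2,\sinh x_2+e^{-x_2}x_1^2/2,e^{-x_2}x_1)$ (hyperboloid model), metric $h=e^{-2x_2}dx_1^2+dx_2^2$ with Christoffel symbols $\Gamma^k_{ij}$; repeated indices $i,k\in\{1,2\}$ are summed, and $h^{ij}$ is diagonal. Wave map equation: $-\partial_t^2u^k+\Delta u^k+\eta^{\alpha\beta}\overline\Gamma^k_{ij}(u)\partial_\alpha u^i\partial_\beta u^j=0$, $\eta=-dt^2+h$. $\mathcal{X}_T=C([0,T];\mathbf{H}^3\times\mathbf{H}^2)$, where $\mathbf{H}^k\times\mathbf{H}^{k-1}$ consists of $(u,\partial_tu)$ with $\sum_j\|u^j-Q^j\|_{H^k}+\|\partial_tu^j\|_{H^{k-1}}<\infty$ in coordinates. Admissible harmonic map: harmonic $Q:D\to D$ (Poincaré disk) with $Q(D)$ of compact closure contained in a geodesic ball of radius $R_0$ about $0$, $\|\nabla^kdQ\|_{L^2}<\infty$ ($k=0,1,2$), and $e^{\varrho r}|dQ|\in L^\infty$ for some $\varrho>0$, $r$ = distance to the origin. Caloric gauge: $\widetilde u(s,t,x)$, $s\ge0$, solves the harmonic map heat flow $\partial_s\widetilde u=\tau(\widetilde u)$, $\widetilde u|_{s=0}=u(t,x)$, with $\widetilde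 u\to Q$ as $s\to\infty$, and $\{\Omega_1,\Omega_2\}$ is an orthonormal frame of $\widetilde u^*T\mathbb{H}^2$ with $\nabla_s\Omega_j=0$ and $\Omega_j\to\Xi_j=\Theta_j(Q)$ as $s\to\infty$ (i.e. $\langle\Omega_i,\Theta_j(\widetilde u)\rangle\to\langle\Xi_i,\Theta_j(Q)\rangle$), where $\Theta_1(y)=e^{y_2}\partial_{y_1}$, $\Theta_2(y)=\partial_{y_2}$. For $\alpha\in\{s,t,1,2\}$: $\phi_\alpha=(\langle\partial_\alpha\widetilde u,\Omega_1\rangle,\langle\partial_\alpha\widetilde u,\Omega_2\rangle)$, $[A_\alpha]^k_j=\langle\nabla_\alpha\Omega_j,\Omega_k\rangle$ (so $A_s=0$), $D_\alpha=\partial_\alpha+A_\alpha$. $\mathbb{R}^2$-valued functions $\phi$ are identified with sections $\sum_j\phi^j\Omega_j$. $(\mathbf{a}\wedge\mathbf{b})\mathbf{c}=\langle\mathbf{a},\mathbf{c}\rangle\mathbf{b}-\langle\mathbf{b},\mathbf{c}\rangle\mathbf{a}$ (extended to $\mathbb{C}^2$ by complex inner products), and $\mathbf{R}(X,Y)Z=(X\wedge Y)Z$ is the curvature of the target. Wave tension field: $\mathfrak{W}=D_t\phi_t-h^{ij}D_i\phi_j+h^{ij}\Gamma^k_{ij}\phi_k$. Limit and remainder parts: $[A_i^\infty]^j_k=\langle\nabla_i\Xi_k,\Xi_j\rangle$ is the limit of $A_i$ as $s\to\infty$, $\phi_i^\infty=(\langle\partial_iQ,\Xi_1\rangle,\langle\partial_iQ,\Xi_2\rangle)$,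 $A_i^{con}=A_i-A_i^\infty$, $\phi_i^{con}=\phi_i-\phi_i^\infty$. Strictly positive means $\langle(-\Delta+W)f,f\rangle\ge\delta\langle f,f\rangle$ for some $\delta>0$. *)

(* Defs.v *)
From HB Require Import structures.
From mathcomp Require Import all_boot all_order all_algebra.
From mathcomp Require Import all_classical all_reals all_analysis.
From mathcomp Require Import measurable_realfun ess_sup_inf complex.

Set Implicit Arguments.
Unset Strict Implicit.
Unset Printing Implicit Defensive.

Import Order.TTheory GRing.Theory Num.Theory.
Import numFieldNormedType.Exports.

Local Open Scope classical_set_scope.
Local Open Scope ring_scope.

(** * Hyperbolic plane in the global coordinates (x1, x2) *)

(* Points of H^2, both of the domain and of the target, are their coordinate
   pairs.  The indices 1, 2 of the mathematical text are ord0, ord_max : 'I_2. *)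
Definition crd {R : realType} (k : 'I_2) (x : R * R) : R :=
  if k == ord0 then x.1 else x.2.

Definition ex {R : realType} (i : 'I_2) : R * R :=
  if i == ord0 then (1, 0) else (0, 1).

Definition pd {R : realType} {W : normedModType R} (i : 'I_2) (f : R * R -> W)
  (x : R * R) : W := 'D_(ex i) f x.

(* Coordinates Psi of the hyperboloid -X0^2 + X1^2 + X2^2 = -1, X0 > 0. *)
Definition Psi {R : realType} (x : R * R) : R * R * R :=
  ((expR x.2 + expR (- x.2)) / 2 + expR (- x.2) * x.1 ^+ 2 / 2,
   (expR x.2 - expR (- x.2)) / 2 + expR (- x.2) * x.1 ^+ 2 / 2,
   expR (- x.2) * x.1).

Definition minkowski {R : realType} (X Y : R * R * R) : R :=
  - (X.1.1 * Y.1.1) + X.1.2 * Y.1.2 + X.2 * Y.2.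

Definition arcosh {R : realType} (z : R) : R := ln (z + Num.sqrt (z ^+ 2 - 1)).

(* Geodesic distance: cosh d(x, y) = - [Psi x, Psi y]. *)
Definition hdist {R : realType} (x y : R * R) : R :=
  arcosh (- minkowski (Psi x) (Psi y)).

(* Psi (0, 0) = (1, 0, 0) corresponds to the centre of the Poincare disk. *)
Definition radius {R : realType} (x : R * R) : R := hdist (0, 0) x.

Definition metric {R : realType} (i j : 'I_2) (x : R * R) : R :=
  if i == j then (if i == ord0 then expR (- 2 * x.2) else 1) else 0.

Definition cometric {R : realType} (i j : 'I_2) (x : R * R) : R :=
  if i == j then (metric i i x)^-1 else 0.

(* chris k i j is Gamma^k_{ij}. *)
Definition chris {R : realType} (k i j : 'I_2) (x : R * R) : R :=
  2^-1 * \sum_(l < 2) cometric k l x *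
    (pd i (metric l j) x + pd j (metric l i) x - pd l (metric i j) x).

Definition inner {R : realType} (y : R * R) (v w : 'cV[R]_2) : R :=
  \sum_(i < 2) \sum_(j < 2) metric i j y * v i 0 * w j 0.

(* Curvature R(X, Y) Z = <X, Z> Y - <Y, Z> X of the target. *)
Definition curv {R : realType} (y : R * R) (X Y Z : 'cV[R]_2) : 'cV[R]_2 :=
  inner y X Z *: Y - inner y Y Z *: X.

Definition Lap {R : realType} {W : normedModType R} (f : R * R -> W)
    (x : R * R) : W :=
  \sum_(i < 2) \sum_(j < 2) cometric i j x *:
    (pd i (pd j f) x - \sum_(k < 2) chris k i j x *: pd k f x).

(** * Maps into the hyperbolic plane *)

(* Coordinates of the derivative of w in the direction v. *)
Definition dmap {R : realType} {V : normedModType R} (w : V -> R * R) (v z : V)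
  : 'cV[R]_2 := \col_k 'D_v (crd k \o w) z.

(* Covariant derivative, in the direction v, of a section X of w^* T H^2. *)
Definition nablaX {R : realType} {V : normedModType R} (w : V -> R * R)
    (X : V -> 'cV[R]_2) (v z : V) : 'cV[R]_2 :=
  'D_v X z +
  \col_k \sum_(l < 2) \sum_(m < 2)
    chris k l m (w z) * dmap w v z l 0 * X z m 0.

Definition tension {R : realType} (w : R * R -> R * R) (x : R * R)
    : 'cV[R]_2 :=
  \col_k (Lap (crd k \o w : R * R -> R) x +
    \sum_(a < 2) \sum_(b < 2) cometric a b x *
      \sum_(i < 2) \sum_(j < 2) chris k i j (w x) *
        dmap w (ex a) x i 0 * dmap w (ex b) x j 0).

Definition Theta {R : realType} (j : 'I_2) (y : R * R) : 'cV[R]_2 :=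
  if j == ord0 then expR y.2 *: delta_mx ord0 0 else delta_mx ord_max 0.

(* f is of class C^n on the open set U, through the iterated partial
   derivatives in the directions e i; e ranges over a basis of V. *)
Fixpoint Cn {R : realType} {V : normedModType R} {I : Type} (e : I -> V)
    (U : set V) (n : nat) (f : V -> R) : Prop :=
  (forall z, U z -> {for z, continuous f}) /\
  (if n is m.+1 then
     forall i, (forall z, U z -> derivable f z (e i)) /\
               Cn e U m (fun z => 'D_(e i) f z)
   else True).

Definition smooth {R : realType} (f : R * R -> R) : Prop :=
  forall n, Cn (@ex R) setT n f.

(* A w^* T H^2-valued covariant tensor T on the domain is given by its
   components: T [:: i1; ...; in] x is the value at the coordinate fields
   (d_i1, ..., d_in).  The index of the new derivative comes first. *)
Definition nablaT {R : realType} (w : R * R -> R * R)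
    (T : seq 'I_2 -> R * R -> 'cV[R]_2) (I : seq 'I_2) (x : R * R)
    : 'cV[R]_2 :=
  if I is p :: J then
    nablaX w (T J) (ex p) x -
    \sum_(a < size J) \sum_(m < 2)
      chris m p (nth ord0 J a) x *: T (set_nth ord0 J a m) x
  else 0.

Definition dtensor {R : realType} (w : R * R -> R * R) (I : seq 'I_2)
    (x : R * R) : 'cV[R]_2 :=
  if I is [:: i] then dmap w (ex i) x else 0.

(* | nabla^k dw | at x *)
Definition norm_nabla_d {R : realType} (k : nat) (w : R * R -> R * R)
    (x : R * R) : R :=
  let T := iter k (nablaT w) (dtensor w) in
  Num.sqrt (\sum_(I : k.+1.-tuple 'I_2)
    (\prod_(i <- I) cometric i i x) * inner (w x) (T I x) (T I x)).

(** * Volume measure and Sobolev spaces *)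

(* R * R with its Borel sigma-algebra, in the form used by lebesgue_measure *)
Definition mplane (R : realType) : measurableType _ :=
  (measurableTypeR R * measurableTypeR R)%type.

Definition leb2 {R : realType} : {measure set (mplane R) -> \bar R} :=
  (@lebesgue_measure R \x @lebesgue_measure R)%E.

(* Riemannian volume sqrt(det h) dx1 dx2 *)
Definition vol {R : realType} (A : set (mplane R)) : \bar R :=
  (\int[leb2]_(x in A) (expR (- x.2))%:E)%E.

Section vol_measure.
Context {R : realType}.
Local Open Scope ereal_scope.

Let vol0 : @vol R set0 = 0.
Proof. by rewrite /vol integral_set0. Qed.

Let vol_ge0 A : 0 <= @vol R A.
Proof. by rewrite /vol integral_ge0// => x _; rewrite lee_fin expR_ge0. Qed.

Let vol_sigma_additive : semi_sigma_additive (@vol R).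
Proof.
move=> A mA tA mUA; rewrite /vol ge0_integral_bigcup//=; last first.
  apply/measurable_EFinP; apply: measurable_funTS; apply: measurableT_comp => //.
  by apply: measurableT_comp => //; exact: measurable_snd.
apply: is_cvg_ereal_nneg_natsum_cond => n _ _.
by apply: integral_ge0 => x _; rewrite lee_fin expR_ge0.
Qed.

HB.instance Definition _ := isMeasure.Build _ _ _
  (@vol R) vol0 vol_ge0 vol_sigma_additive.
End vol_measure.

Definition L2norm {R : realType} (f : R * R -> R) : \bar R :=
  ('N[vol]_(2%:E) [EFin \o f])%E.

Definition Linfnorm {R : realType} (f : R * R -> R) : \bar R :=
  ('N[vol]_(+oo) [EFin \o f])%E.

Definition test_function {R : realType} (chi : R * R -> R) : Prop :=
  smooth chi /\ compact (closure [set x | chi x != 0]).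

Definition loc_integrable {R : realType} (f : R * R -> R) : Prop :=
  measurable_fun [set: mplane R] f /\
  forall K, compact K -> (\int[leb2]_(x in K) `|f x|%:E < +oo)%E.

(* g is the distributional partial derivative d_i f. *)
Definition weak_pd {R : realType} (i : 'I_2) (f g : R * R -> R) : Prop :=
  [/\ loc_integrable f, loc_integrable g &
    forall chi, test_function chi ->
      \int[leb2]_x (f x * pd i chi x) = - \int[leb2]_x (g x * chi x)].

(* T I, for size I <= n, are the components of the weak covariant derivatives
   of order at most n of the function f = T [::]; as in nablaT, the index of the
   last derivative taken comes first. *)
Definition weak_nabla {R : realType} (n : nat) (f : R * R -> R)
    (T : seq 'I_2 -> R * R -> R) : Prop :=
  [/\ T [::] = f,
      forall J, (size J <= n)%N -> loc_integrable (T J) &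
      forall p J, (size J < n)%N -> weak_pd p (T J) (fun x =>
        T (p :: J) x + \sum_(a < size J) \sum_(m < 2)
          chris m p (nth ord0 J a) x * T (set_nth ord0 J a m) x)].

Definition tensor_norm {R : realType} (l : nat) (T : seq 'I_2 -> R * R -> R)
    (x : R * R) : R :=
  Num.sqrt (\sum_(I : l.-tuple 'I_2)
    (\prod_(i <- I) cometric i i x) * T I x ^+ 2).

(* Norm sum_(l <= n) || nabla^l f ||_{L^2} of H^n(H^2; R).  The infimum is over
   the a.e.-unique weak derivatives; it is +oo when there are none. *)
Definition Hnorm {R : realType} (n : nat) (f : R * R -> R) : \bar R :=
  ereal_inf [set (\sum_(l < n.+1) L2norm (tensor_norm l T))%E
            | T in weak_nabla n f].

(** * Admissible harmonic maps *)

Definition harmonic_map {R : realType} (Q : R * R -> R * R) : Prop :=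
  (forall k, smooth (crd k \o Q)) /\ (forall x, tension Q x = 0).

Definition exp_weighted_d {R : realType} (rho : R) (Q : R * R -> R * R)
  (x : R * R) : R := expR (rho * radius x) * norm_nabla_d 0 Q x.

Record admissible {R : realType} (rho R0 : R) (Q : R * R -> R * R) : Prop := {
  adm_harmonic : harmonic_map Q;
  adm_R0 : 0 < R0;
  adm_compact : compact (closure (range Q));
  adm_ball : closure (range Q) `<=` [set y | radius y < R0];
  adm_L2 : forall k, (k <= 2)%N -> (L2norm (norm_nabla_d k Q) < +oo)%E;
  adm_rho : 0 < rho;
  adm_decay : (Linfnorm (exp_weighted_d rho Q) < +oo)%E }.

(** * The wave map equation in X_T *)

Definition energy_norm {R : realType} (v vt : 'I_2 -> R * R -> R) : \bar R :=
  (\sum_(k < 2) (Hnorm 3 (v k) + Hnorm 2 (vt k)))%E.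

(* (u, ut) in C([0, T]; H^3 x H^2); ut t x is the coordinate vector of the
   velocity. *)
Definition in_XT {R : realType} (T : R) (Q : R * R -> R * R)
    (u : R -> R * R -> R * R) (ut : R -> R * R -> 'cV[R]_2) : Prop :=
  (forall t, 0 <= t <= T ->
    (energy_norm (fun k x => (crd k (u t x) - crd k (Q x))%R)
                 (fun k x => (ut t x k 0)%R) < +oo)%E) /\
  (forall t0 (eps : R), 0 <= t0 <= T -> 0 < eps ->
    exists2 d : R, 0 < d & forall t, 0 <= t <= T -> `|t - t0| < d ->
    (energy_norm (fun k x => (crd k (u t x) - crd k (u t0 x))%R)
                 (fun k x => (ut t x k 0 - ut t0 x k 0)%R) < eps%:E)%E).

(* f' is the derivative in time of f, on [0, T], in the L^2(H^2) sense
   (one-sided at t = 0 and t = T). *)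
Definition L2_time_derivative {R : realType} (T : R) (f f' : R -> R * R -> R)
    : Prop :=
  forall t (eps : R), 0 <= t <= T -> 0 < eps ->
  exists2 d : R, 0 < d & forall t', 0 <= t' <= T -> t' != t -> `|t' - t| < d ->
  (L2norm (fun x => ((f t' x - f t x) / (t' - t) - f' t x)%R) < eps%:E)%E.

(* The spatial derivatives of u(t) are the weak ones DU. *)
Definition wave_map_solution {R : realType} (T : R) (Q : R * R -> R * R)
    (u : R -> R * R -> R * R) (ut : R -> R * R -> 'cV[R]_2) : Prop :=
  [/\ in_XT T Q u ut,
      forall k, L2_time_derivative T (fun t x => crd k (u t x))
                                     (fun t x => ut t x k 0) &
      exists DU : R -> 'I_2 -> seq 'I_2 -> R * R -> R,
        (forall t k, 0 <= t <= T -> weak_nabla 2 (crd k \o u t) (DU t k)) /\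
        (forall k, L2_time_derivative T (fun t x => ut t x k 0) (fun t x =>
           \sum_(a < 2) \sum_(b < 2) cometric a b x * DU t k [:: a; b] x
           - \sum_(i < 2) \sum_(j < 2)
               chris k i j (u t x) * ut t x i 0 * ut t x j 0
           + \sum_(a < 2) \sum_(b < 2) cometric a b x *
               \sum_(i < 2) \sum_(j < 2)
                 chris k i j (u t x) * DU t i [:: a] x * DU t j [:: b] x))].

(** * Caloric gauge *)

(* Points (s, t, x) : R * R * (R * R) and the coordinate directions s, t, 1, 2 *)
Inductive dir := ds | dt | dx of 'I_2.

Definition edir {R : realType} (a : dir) : R * R * (R * R) :=
  match a with
  | ds => ((1, 0), (0, 0))
  | dt => ((0, 1), (0, 0))
  | dx i => ((0, 0), ex i)
  end.

Definition gauge_domain {R : realType} (T : R) : set (R * R * (R * R)) :=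
  [set z | 0 < z.1.1 /\ 0 < z.1.2 < T].

(* The regularity fields make explicit the smoothness for s > 0 (a consequence of
   parabolic smoothing) that gives the equations their classical meaning. *)
Record caloric_gauge {R : realType} (T : R) (Q : R * R -> R * R)
    (Xi : 'I_2 -> R * R -> 'cV[R]_2) (u : R -> R * R -> R * R)
    (U : R * R * (R * R) -> R * R) (Om : 'I_2 -> R * R * (R * R) -> 'cV[R]_2)
    : Prop := {
  cg_regular_map : forall k, Cn (@edir R) (gauge_domain T) 3 (crd k \o U);
  cg_regular_frame : forall j k,
    Cn (@edir R) (gauge_domain T) 2 (fun z => Om j z k 0);
  cg_slice : forall s t k, 0 < s -> 0 <= t <= T ->
    Cn (@ex R) setT 2 (fun x => crd k (U (s, t, x)));
  cg_heat : forall s t x k, 0 < s -> 0 <= t <= T ->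
    is_derive ((s, t, x) : R * R * (R * R)) (edir ds) (crd k \o U)
      (tension (fun y => U (s, t, y)) x k 0);
  cg_initial : forall t x, 0 <= t <= T -> U (0, t, x) = u t x;
  cg_initial_cvg : forall t x, 0 <= t <= T ->
    U (s, t, x) @[s --> 0^'+] --> u t x;
  cg_limit : forall t x, 0 <= t <= T -> U (s, t, x) @[s --> +oo] --> Q x;
  cg_orthonormal : forall s t x i j, 0 <= s -> 0 <= t <= T ->
    inner (U (s, t, x)) (Om i (s, t, x)) (Om j (s, t, x)) = (i == j)%:R;
  cg_frame_derivable : forall s t x j, 0 < s -> 0 <= t <= T ->
    derivable (Om j) ((s, t, x) : R * R * (R * R)) (edir ds);
  cg_parallel : forall s t x j, 0 < s -> 0 <= t <= T ->
    nablaX U (Om j) (edir ds) (s, t, x) = 0;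
  cg_frame_initial : forall t x j, 0 <= t <= T ->
    Om j (s, t, x) @[s --> 0^'+] --> Om j (0, t, x);
  cg_frame_limit : forall t x i j, 0 <= t <= T ->
    inner (U (s, t, x)) (Om i (s, t, x)) (Theta j (U (s, t, x)))
      @[s --> +oo] --> inner (Q x) (Xi i x) (Theta j (Q x)) }.

Section gauge_quantities.
Context {R : realType}.
Variables (U : R * R * (R * R) -> R * R)
          (Om : 'I_2 -> R * R * (R * R) -> 'cV[R]_2).

Definition frame_coord (z : R * R * (R * R)) (v : 'cV[R]_2) : 'cV[R]_2 :=
  \col_k inner (U z) v (Om k z).

Definition phi (a : dir) (z : R * R * (R * R)) : 'cV[R]_2 :=
  frame_coord z (dmap U (edir a) z).

Definition conn (a : dir) (z : R * R * (R * R)) : 'M[R]_2 :=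
  \matrix_(k, j) inner (U z) (nablaX U (Om j) (edir a) z) (Om k z).

Definition Dcov (a : dir) (f : R * R * (R * R) -> 'cV[R]_2)
    (z : R * R * (R * R)) : 'cV[R]_2 :=
  'D_(edir a) f z + conn a z *m f z.

Definition wave_tension (z : R * R * (R * R)) : 'cV[R]_2 :=
  Dcov dt (phi dt) z
  - \sum_(i < 2) \sum_(j < 2) cometric i j z.2 *: Dcov (dx i) (phi (dx j)) z
  + \sum_(i < 2) \sum_(j < 2) \sum_(k < 2)
      (cometric i j z.2 * chris k i j z.2) *: phi (dx k) z.

End gauge_quantities.

(** * Limit parts and the operator W *)

Section limit_quantities.
Context {R : realType}.
Variables (Q : R * R -> R * R) (Xi : 'I_2 -> R * R -> 'cV[R]_2).

Definition phi_inf (i : 'I_2) (x : R * R) : 'cV[R]_2 :=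
  \col_k inner (Q x) (dmap Q (ex i) x) (Xi k x).

Definition conn_inf (i : 'I_2) (x : R * R) : 'M[R]_2 :=
  \matrix_(j, k) inner (Q x) (nablaX Q (Xi k) (ex i) x) (Xi j x).

(* (a /\ b) c = <a, c> b - <b, c> a, for the inner product which is
   antilinear, through cj, in its second argument; cj is the identity over R and
   the conjugation over C. *)
Definition dotp {F : comNzRingType} (cj : F -> F) (a b : 'cV[F]_2) : F :=
  \sum_(j < 2) a j 0 * cj (b j 0).

Definition wedge {F : comNzRingType} (cj : F -> F) (a b c : 'cV[F]_2)
  : 'cV[F]_2 := dotp cj a c *: b - dotp cj b c *: a.

(* W applied at x to a function with value v and partial derivatives dv i;
   iota embeds R in the scalars F (F = R or C). *)
Definition Wpoint {F : comNzRingType} (iota : R -> F) (cj : F -> F)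
    (x : R * R) (v : 'cV[F]_2) (dv : 'I_2 -> 'cV[F]_2) : 'cV[F]_2 :=
  \sum_(i < 2) iota (cometric i i x) *:
    (let A := map_mx iota (conn_inf i x) in
     let p := map_mx iota (phi_inf i x) in
     - 2 *: (A *m dv i) - A *m (A *m v) - wedge cj v p p
     - map_mx iota (pd i (conn_inf i) x
                    - \sum_(k < 2) chris k i i x *: conn_inf k x) *m v).

Definition Wreal (f : R * R -> 'cV[R]_2) (x : R * R) : 'cV[R]_2 :=
  Wpoint id id x (f x) (fun i => pd i f x).

End limit_quantities.

(** * Unbounded operators in L^2(H^2; C^2) *)

Section complex_L2.
Context {R : realType}.
Local Notation CV := ('cV[complex R]_2).
Implicit Types f g : R * R -> CV.

Definition re_part f (j : 'I_2) (x : R * R) : R := complex.Re (f x j 0).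
Definition im_part f (j : 'I_2) (x : R * R) : R := complex.Im (f x j 0).

Definition sqnormC (v : CV) : R :=
  \sum_(j < 2) (complex.Re (v j 0) ^+ 2 + complex.Im (v j 0) ^+ 2).

Definition L2normC f : \bar R := L2norm (fun x => Num.sqrt (sqnormC (f x))).

Definition L2C f : Prop :=
  (forall j, measurable_fun [set: mplane R] (re_part f j) /\
             measurable_fun [set: mplane R] (im_part f j)) /\ (L2normC f < +oo)%E.

(* L^2 inner product, antilinear in the second argument *)
Definition innerC f g : complex R :=
  Complex (\int[vol]_x complex.Re (dotp (@conjc R) (f x) (g x)))
          (\int[vol]_x complex.Im (dotp (@conjc R) (f x) (g x))).

Definition weak_pdC (i : 'I_2) f g : Prop :=
  forall j, weak_pd i (re_part f j) (re_part g j) /\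
            weak_pd i (im_part f j) (im_part g j).

(* g is the distributional Laplacian of f. *)
Definition weak_lap (f g : R * R -> R) : Prop :=
  [/\ loc_integrable f, loc_integrable g &
    forall chi, test_function chi ->
      \int[vol]_x (f x * Lap (chi : R * R -> R) x) = \int[vol]_x (g x * chi x)].

Definition weak_lapC f g : Prop :=
  forall j, weak_lap (re_part f j) (re_part g j) /\
            weak_lap (im_part f j) (im_part g j).

(* Unbounded operators in L^2(H^2; C^2) are given by their graphs, as relations
   on representatives. *)
Definition self_adjoint (G : (R * R -> CV) -> (R * R -> CV) -> Prop) : Prop :=
  [/\ forall f g, G f g -> L2C f /\ L2C g,
      forall f (eps : R), L2C f -> 0 < eps ->
        exists f' g', G f' g' /\ (L2normC (fun x => f x - f' x)%R < eps%:E)%E &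
      forall f g, L2C f -> L2C g ->
        (G f g <-> forall f' g', G f' g' -> innerC g' f = innerC f' g)].

Definition strictly_positive (G : (R * R -> CV) -> (R * R -> CV) -> Prop)
    : Prop :=
  exists2 delta : R, 0 < delta & forall f g, G f g ->
    real_complex R delta * innerC f f <= innerC g f.

(* Graph of -Delta + W on the domain of the Laplacian,
   D(-Delta) = {f in H^1 | Delta f in L^2}; W is of first order with bounded
   coefficients. *)
Definition schroedinger (Q : R * R -> R * R) (Xi : 'I_2 -> R * R -> 'cV[R]_2)
    f g : Prop :=
  [/\ L2C f, L2C g &
    exists (Df : 'I_2 -> R * R -> CV) (Lf : R * R -> CV),
    [/\ forall i, weak_pdC i f (Df i),
        (L2norm (fun x => Num.sqrt
          (\sum_(i < 2) cometric i i x * sqnormC (Df i x))%R) < +oo)%E,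
        weak_lapC f Lf,
        L2C Lf &
        {ae vol, forall x, g x =
          - Lf x + Wpoint Q Xi (real_complex R) (@conjc R) x
                     (f x) (fun i => Df i x)}]].

End complex_L2.

(* Main.v *)
(** The equation is the covariant commutation of [D_t], [D_i] with [D_s = d_s], after
    expanding [A_i = A_i^inf + A_i^con] and [phi_i = phi_i^inf + phi_i^con].

    With [Xi = Theta(Q)] the limit connection is [A_i^inf = p_i J] for the rotation [J], and
    harmonicity of [Q] turns the divergence of [p] into a quadratic expression in [dQ].  Hence
    [-Delta + W] comes from a symmetric form [B], acting separately on real and imaginary parts,
    whose value [B(f, f)] is a sum of squares.

    Self-adjointness: [H + 1] is onto by Riesz representation in the form domain.  Symmetry on the
    maximal domain is [int (v Delta f + <grad f, grad v>) = 0] for [H^1] functions with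
    [Delta f] in [L^2], which follows from the weak formulation by mollification and cut-off;
    surjectivity and symmetry give maximality.

    Positivity: the volume density is [exp(- x_2)], so [int f^2 = 2 int f d_2 f], whence
    [int f^2 <= 4 int |grad f|^2]; the form [B] is a small perturbation of the Dirichlet form
    when [|dQ|] is small. *)

Require Import Defs.
From HB Require Import structures.
From mathcomp Require Import all_boot all_order all_algebra.
From mathcomp Require Import all_classical all_reals all_analysis.
From mathcomp Require Import measurable_realfun ess_sup_inf complex.
From mathcomp Require Import ring lra.

Set Implicit Arguments.
Unset Strict Implicit.
Unset Printing Implicit Defensive.

Import Order.TTheory GRing.Theory Num.Theory.
Import numFieldNormedType.Exports.

Local Open Scope classical_set_scope.
Local Open Scope ring_scope.

(** The form [B] is the second variation of the energy at [Q]: it integrates the square of the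
    covariant gradient for [A^inf] plus the squared area spanned by [f] and [phi_i^inf]. The sign of
    the area term is that of minus the curvature of the target, which is why no smallness enters
    self-adjointness. The analytic obstacle is a mismatch of measures: weak derivatives are taken
    against dx_1 dx_2, norms against exp(- x_2) dx_1 dx_2, and the weights relating the two are
    unbounded. One global divergence theorem for square integrable fields absorbs this. If [U] is
    the weak divergence of [c], then the integral of U v + <c, dv> vanishes for [v] in H^1. It is
    used with c = df (Laplacian), with c = f p (first order part of [W]), and with c = f dx_2
    (spectral gap). Mollification is Euclidean and acts only after a cut-off. It is carried out on
    the double integral of F(x) G(y) rho(x - y), where a derivative passes from one factor to the
    other through the kernel. Density of test functions follows from their being separating, again
    by Riesz representation. The threshold for [mu1] is 1/4 because coercivity is proved for |dQ|^2
    at most 1/16. *)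

Section pointwise_derivatives.
Context {R : realType} {V W : normedModType R}.
Implicit Types (f g : V -> W) (z v : V).

Lemma is_derive_add f g z v df dg : is_derive z v f df -> is_derive z v g dg ->
  is_derive z v (fun y => f y + g y) (df + dg).
Proof. exact: is_deriveD. Qed.

Lemma is_derive_sub f g z v df dg : is_derive z v f df -> is_derive z v g dg ->
  is_derive z v (fun y => f y - g y) (df - dg).
Proof. exact: is_deriveB. Qed.

Lemma is_derive_opp f z v df : is_derive z v f df ->
  is_derive z v (fun y => - f y) (- df).
Proof. exact: is_deriveN. Qed.

Lemma is_derive_mul (f g : V -> R) z v df dg :
  is_derive z v f df -> is_derive z v g dg ->
  is_derive z v (fun y => f y * g y) (df * g z + f z * dg).
Proof.
move=> Df Dg; apply: (is_derive_eq (is_deriveM Df Dg)).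
by rewrite addrC [df * _]mulrC.
Qed.

End pointwise_derivatives.

(** * Derivatives along lines and symmetry of mixed derivatives *)

Lemma is_derive_line {R : realType} {V W : normedModType R} (f : V -> W)
    (v z : V) (a : R) (df : W) :
  is_derive (a *: v + z) v f df <->
  is_derive a 1 (fun h => f (h *: v + z)) df.
Proof.
have E : (fun h : R => h^-1 *: ((f \o shift (a *: v + z)) (h *: v)
    - f (a *: v + z))) = (fun h : R => h^-1 *: (((fun h => f (h *: v + z))
    \o shift a) (h *: 1) - f (a *: v + z))).
  by apply/funext => h /=; rewrite /shift /= scalerDl addrA [h *: 1]mulr1.
by split=> -[D1 D2]; split; move: D1 D2; rewrite /derivable /derive E.
Qed.

Lemma is_derive_line0 {R : realType} {V W : normedModType R} (f : V -> W)
    (v z : V) (df : W) :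
  is_derive z v f df <->
  is_derive (0 : R) 1 (fun h => f (h *: v + z)) df.
Proof.
have := is_derive_line f v z 0 df.
by rewrite [X in is_derive X v f df](_ : _ = z)// scale0r add0r.
Qed.

(** Restriction to the line through [z] reduces this to the chain rule in one variable, where
    derivability is differentiability; so [f] needs no more than a directional derivative. *)
Lemma is_derive_comp1 {R : realType} {V : normedModType R} (f : V -> R)
    (g : R -> R) (v z : V) (df dg : R) :
  is_derive z v f df -> is_derive (f z) 1 g dg ->
  is_derive z v (g \o f) (dg * df).
Proof.
move=> /is_derive_line0 Df Dg; apply/is_derive_line0.
pose F h := f (h *: v + z).
have F0 : F 0 = f z by rewrite /F scale0r add0r.
change (is_derive (0 : R) 1 F df) in Df.
change (is_derive (0 : R) 1 (g \o F) (dg * df)).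
have D1 : derivable F 0 1 by case: Df.
have D2 : derivable g (F 0) 1 by rewrite F0; case: Dg.
split.
  apply/(derivable1_diffP (g \o F) 0)/(@differentiable_comp R R R R F g 0).
    by move/(derivable1_diffP F 0): D1.
  by move/(derivable1_diffP g (F 0)): D2.
have := @derive1_comp R F g 0 D1 D2; rewrite !derive1E F0 => ->.
by case: Df => _ ->; case: Dg => _ ->.
Qed.

Lemma derivable_continuous_line {R : realType} {V : normedModType R}
    (f : V -> R) (v z : V) (h : R) :
  (forall a, 0 <= a <= h -> derivable f (a *: v + z) v) ->
  {within `[0, h], continuous (fun a => f (a *: v + z))}.
Proof.
move=> D; apply: derivable_within_continuous => a /itvP ah.
have /D/derivableP/(is_derive_line f v z)[] // : 0 <= a <= h by rewrite !ah.
Qed.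

Lemma mean_value_line {R : realType} {V : normedModType R} (f df : V -> R)
    (v z : V) (h : R) : 0 <= h ->
  (forall a, 0 <= a <= h -> is_derive (a *: v + z) v f (df (a *: v + z))) ->
  exists2 a, 0 <= a <= h & f (h *: v + z) - f z = df (a *: v + z) * h.
Proof.
move=> h0 D.
have [||a /itvP ah] := @MVT_segment R (fun a => f (a *: v + z))
  (fun a => df (a *: v + z)) 0 h h0.
- move=> x; rewrite in_itv /= => /andP[x0 xh].
  by apply/(is_derive_line f v z); apply: D; rewrite (ltW x0) (ltW xh).
- by apply: derivable_continuous_line => a /D [].
- by rewrite /= scale0r add0r subr0 => ->; exists a; rewrite ?ah.
Qed.

(** The mean value theorem twice: along [v] for the difference of [f] between the two parallel
    edges, then along [w] for 'D_v f. *)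
Lemma second_difference {R : realType} {V : normedModType R} (f : V -> R)
    (v w z : V) (h : R) : 0 <= h ->
  (forall a b, 0 <= a <= h -> 0 <= b <= h ->
     derivable f (a *: v + (b *: w + z)) v /\
     derivable ('D_v f) (a *: v + (b *: w + z)) w) ->
  exists a b, [/\ 0 <= a <= h, 0 <= b <= h &
    f (h *: v + (h *: w + z)) - f (h *: v + z) - f (h *: w + z) + f z
    = 'D_w ('D_v f) (a *: v + (b *: w + z)) * h ^+ 2].
Proof.
move=> h0 D; have h00 : (0 : R) <= 0 <= h by rewrite lexx h0.
have hh : 0 <= h <= h by rewrite lexx h0.
have D0 a : 0 <= a <= h -> derivable f (a *: v + z) v.
  by move=> ah; have [+ _] := D a 0 ah h00; rewrite scale0r add0r.
have [||a /itvP ah] := @MVT_segment R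
    (fun a => f (a *: v + (h *: w + z)) - f (a *: v + z))
    (fun a => 'D_v f (a *: v + (h *: w + z)) - 'D_v f (a *: v + z)) 0 h h0.
- move=> a; rewrite in_itv /= => /andP[a0 ah].
  have ah' : 0 <= a <= h by rewrite (ltW a0) (ltW ah).
  apply: is_derive_sub.
    apply/(is_derive_line f v (h *: w + z)); apply: derivableP.
    exact: (D a h ah' hh).1.
  by apply/(is_derive_line f v z); apply: derivableP; exact: D0.
- apply: derivable_within_continuous => a /itvP ah.
  have ah' : 0 <= a <= h by rewrite !ah.
  have /derivableP/(is_derive_line f v (h *: w + z)) d1 := (D a h ah' hh).1.
  have /derivableP/(is_derive_line f v z) d2 := D0 a ah'.
  by have [] := is_derive_sub d1 d2.
have ah' : 0 <= a <= h by rewrite !ah.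
have C b : a *: v + (b *: w + z) = b *: w + (a *: v + z) by rewrite addrCA.
have [|b bh] := @mean_value_line R V ('D_v f) ('D_w ('D_v f)) w (a *: v + z) h h0.
  by move=> b bh; apply: derivableP; rewrite -C; case: (D a b ah' bh).
rewrite -!C => E1 E2; exists a, b; split => //.
move: E2; rewrite !scale0r !add0r subr0 E1 => E2.
by rewrite exprS expr1 mulrA -E2; ring.
Qed.

Lemma dist_le_of_common {R : realFieldType} (p q p' q' e : R) :
  `|p - p'| < e / 2 -> `|q - q'| < e / 2 -> p' = q' -> `|p - q| <= e.
Proof.
move=> pp qq pq; have -> : p - q = (p - p') - (q - q').
  by rewrite pq opprB addrA subrK.
apply: (le_trans (ler_normB _ _)); rewrite [leRHS]splitr.
by rewrite lerD// ltW.
Qed.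

(** The second difference over a parallelogram is symmetric in [v] and [w]. Hence the two mixed
    derivatives agree at two points of every small parallelogram, and continuity at [z] carries the
    equality to [z]. *)
Lemma derive_commute {R : realType} {V : normedModType R} (f : V -> R)
    (U : set V) (v w z : V) : open U -> U z ->
  (forall y, U y -> [/\ derivable f y v, derivable f y w,
     derivable ('D_v f) y w & derivable ('D_w f) y v]) ->
  {for z, continuous ('D_w ('D_v f))} -> {for z, continuous ('D_v ('D_w f))} ->
  'D_w ('D_v f) z = 'D_v ('D_w f) z.
Proof.
move=> oU Uz D c1 c2; apply/eqP; rewrite -subr_eq0 -normr_le0.
apply/ler_addgt0Pl => e e0; rewrite addr0; have e2 : 0 < e / 2 by rewrite divr_gt0.
have nU : nbhs z U by exact: open_nbhs_nbhs.
have /nbhs_ballP[r /= r0 B] : nbhs z (U `&`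
    ([set y | `|'D_w ('D_v f) z - 'D_w ('D_v f) y| < e / 2] `&`
     [set y | `|'D_v ('D_w f) z - 'D_v ('D_w f) y| < e / 2])).
  apply: filterI => //; apply: filterI.
    by move/cvgrPdist_lt : c1 => /(_ _ e2).
  by move/cvgrPdist_lt : c2 => /(_ _ e2).
pose N := `|v| + `|w| + 1.
have N0 : 0 < N by rewrite ltr_wpDl// addr_ge0.
(* With this side, h (|v| + |w|) < h N = r / 2, so the parallelogram stays in the ball of radius
   [r]. *)
pose h := r / (2 * N); have h0 : 0 < h by rewrite divr_gt0// mulr_gt0.
have Bin a b : 0 <= a <= h -> 0 <= b <= h -> ball z r (a *: v + (b *: w + z)).
  move=> /andP[a0 ah] /andP[b0 bh]; rewrite -ball_normE /ball_ /=.
  rewrite addrA opprD addrCA subrr addr0 normrN.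
  apply: (le_lt_trans (ler_normD _ _)); rewrite !normrZ !ger0_norm//.
  apply: (@le_lt_trans _ _ (h * (`|v| + `|w|))).
    by rewrite mulrDr lerD// ler_wpM2r.
  apply: (@lt_trans _ _ (h * N)); first by rewrite ltr_pM2l// /N ltrDl.
  rewrite /h invfM mulrA -mulrA mulVf ?gt_eqF// mulr1.
  by rewrite ltr_pdivrMr// ltr_pMr// ltrDl.
have [|a [b [ah bh E1]]] := @second_difference R V f v w z h (ltW h0).
  move=> a b ah bh; have [d1 _ d3 _] := D _ (B _ (Bin a b ah bh)).1.
  by split; [exact: d1|exact: d3].
have [|b' [a' [bh' ah' E2]]] := @second_difference R V f w v z h (ltW h0).
  move=> b' a' bh' ah'; rewrite addrCA.
  have [_ d2 _ d4] := D _ (B _ (Bin a' b' ah' bh')).1.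
  by split; [exact: d2|exact: d4].
have {E2} : 'D_w ('D_v f) (a *: v + (b *: w + z)) =
            'D_v ('D_w f) (a' *: v + (b' *: w + z)).
  have hn : h ^+ 2 != 0 by rewrite expf_neq0// gt_eqF.
  rewrite [b' *: w + _]addrCA in E2.
  apply: (mulIf hn); apply: (etrans (esym E1)); apply: (etrans _ E2).
  by rewrite [h *: w + (h *: v + z)]addrCA; congr (_ + _); rewrite addrAC.
exact: (dist_le_of_common (B _ (Bin a b ah bh)).2.1
                          (B _ (Bin a' b' ah' bh')).2.2).
Qed.

(** * Calculus of functions of class C^n *)

Section Cn_projections.
Context {R : realType} {V : normedModType R} {I : Type} (e : I -> V).
Variables (U : set V).

Lemma Cn_continuous n f z : Cn e U n f -> U z -> {for z, continuous f}.
Proof. by case: n => [|n] [c _] Uz; exact: c. Qed.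

Lemma Cn_derivable n f i z : Cn e U n.+1 f -> U z -> derivable f z (e i).
Proof. by move=> [_ /(_ i)[d _]] Uz; exact: d. Qed.

Lemma Cn_pd n f i : Cn e U n.+1 f -> Cn e U n ('D_(e i) f).
Proof. by move=> [_ /(_ i)[]]. Qed.

End Cn_projections.

Section Cn_calculus.
Context {R : realType} {V : normedModType R} {I : Type} (e : I -> V).
Variables (U : set V) (oU : open U).
Implicit Types (f g : V -> R) (n m : nat) (i : I).

Let near_open f g z : U z -> (forall y, U y -> f y = g y) ->
  \forall y \near z, f y = g y.
Proof. by move=> Uz E; exact: filterS E (open_nbhs_nbhs (conj oU Uz)). Qed.

Lemma Cn_ext n f g : (forall z, U z -> f z = g z) -> Cn e U n f -> Cn e U n g.
Proof.
elim: n f g => [|n IH] f g E /= [c d]; split=> //.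
- move=> z Uz; have nz := near_open Uz E.
  rewrite /prop_for /continuous_at -(E _ Uz); apply: cvg_trans (c z Uz).
  exact: near_eq_cvg.
- move=> z Uz; have nz := near_open Uz E.
  rewrite /prop_for /continuous_at -(E _ Uz); apply: cvg_trans (c z Uz).
  exact: near_eq_cvg.
- move=> i; have [di Ci] := d i; split.
    by move=> z Uz; apply: near_eq_derivable (di z Uz); exact: near_open.
  apply: IH Ci => z Uz; apply: near_eq_derive; exact: near_open.
Qed.

Lemma CnS n f : Cn e U n.+1 f -> Cn e U n f.
Proof.
elim: n f => [|n IH] f [c d]; split=> // i; have [di Ci] := d i.
by split=> //; exact: IH.
Qed.

Lemma Cn_cst n (c : R) : Cn e U n (fun=> c).
Proof.
elim: n c => [|n IH] c; split=> //; try by move=> z _; exact: cvg_cst.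
move=> i; split; first by move=> z _; exact: derivable_cst.
apply: (@Cn_ext _ (fun=> 0)) => // z _; by rewrite derive_cst.
Qed.

Lemma CnD n f g : Cn e U n f -> Cn e U n g -> Cn e U n (fun z => f z + g z).
Proof.
elim: n f g => [|n IH] f g [cf df] [cg dg]; split=> //.
- by move=> z Uz; apply: cvgD; [exact: cf|exact: cg].
- by move=> z Uz; apply: cvgD; [exact: cf|exact: cg].
- move=> i; have [dfi Cfi] := df i; have [dgi Cgi] := dg i; split.
    by move=> z Uz; apply: (@derivableD _ _ _ f g); [exact: dfi|exact: dgi].
  apply: Cn_ext (IH _ _ Cfi Cgi) => z Uz.
  by rewrite -(@deriveD _ _ _ f g)//; [exact: dfi|exact: dgi].
Qed.

Lemma CnM n f g : Cn e U n f -> Cn e U n g -> Cn e U n (fun z => f z * g z).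
Proof.
elim: n f g => [|n IH] f g Hf Hg.
  split=> // z Uz; apply: (@cvgM _ _ _ _ f g); first exact: Cn_continuous Hf Uz.
  exact: Cn_continuous Hg Uz.
split.
  move=> z Uz; apply: (@cvgM _ _ _ _ f g); first exact: Cn_continuous Hf Uz.
  exact: Cn_continuous Hg Uz.
move=> i; split.
  move=> z Uz; apply: (@derivableM _ _ f g); first exact: Cn_derivable Hf Uz.
  exact: Cn_derivable Hg Uz.
have H1 := IH _ _ (CnS Hf) (Cn_pd i Hg).
have H2 := IH _ _ (CnS Hg) (Cn_pd i Hf).
apply: Cn_ext (CnD H1 H2) => z Uz; rewrite (@deriveM _ _ f g)//.
  exact: Cn_derivable Hf Uz.
exact: Cn_derivable Hg Uz.
Qed.

Lemma CnZ n (c : R) f : Cn e U n f -> Cn e U n (fun z => c * f z).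
Proof. by apply: CnM; exact: Cn_cst. Qed.

Lemma CnN n f : Cn e U n f -> Cn e U n (fun z => - f z).
Proof. by move=> /(CnZ (-1)); apply: Cn_ext => z _; rewrite mulN1r. Qed.

Lemma CnB n f g : Cn e U n f -> Cn e U n g -> Cn e U n (fun z => f z - g z).
Proof. by move=> Hf /CnN; exact: CnD. Qed.

(** [Cn] for the one-point index set and the direction 1 is the class C^n on the real line. The
    induction varies [g] as well, since the chain rule replaces it by its derivative. *)
Lemma Cn_comp n f (g : R -> R) : (forall n, Cn (fun _ : unit => 1 : R) setT n g) ->
  Cn e U n f -> Cn e U n (g \o f).
Proof.
elim: n f g => [|n IH] f g Hg Hf.
  split=> // z Uz; apply: continuous_comp; first exact: Cn_continuous Hf Uz.
  exact: Cn_continuous (Hg 0%N) _.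
have D z i : U z -> is_derive z (e i) (g \o f) ('D_1 g (f z) * 'D_(e i) f z).
  move=> Uz; apply: is_derive_comp1; apply: derivableP.
    exact: Cn_derivable Hf Uz.
  by have := @Cn_derivable; have [_ /(_ tt)[+ _] _] := Hg 1%N; exact.
split.
  move=> z Uz; apply: continuous_comp; first exact: Cn_continuous Hf Uz.
  exact: Cn_continuous (Hg 0%N) _.
move=> i; split; first by move=> z Uz; have [] := D z i Uz.
have H1 : Cn e U n ('D_1 g \o f).
  apply: IH (CnS Hf) => m; by have [_ /(_ tt)[]] := Hg m.+1.
apply: Cn_ext (CnM H1 (Cn_pd i Hf)) => z Uz.
by have [_ ->] := D z i Uz.
Qed.

Lemma Cn_derive_commute f i j z : Cn e U 2 f -> U z ->
  'D_(e i) ('D_(e j) f) z = 'D_(e j) ('D_(e i) f) z.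
Proof.
move=> Hf Uz; apply: (derive_commute oU Uz).
- move=> y Uy; split.
  + exact: Cn_derivable Hf Uy.
  + exact: Cn_derivable Hf Uy.
  + exact: Cn_derivable (Cn_pd j Hf) Uy.
  + exact: Cn_derivable (Cn_pd i Hf) Uy.
- exact: Cn_continuous (Cn_pd i (Cn_pd j Hf)) Uz.
- exact: Cn_continuous (Cn_pd j (Cn_pd i Hf)) Uz.
Qed.

Lemma Cn_affine n (L : V -> R) (c : I -> R) : continuous L ->
  (forall i z (t : R), L (t *: e i + z) = t * c i + L z) -> Cn e U n L.
Proof.
move=> cL hL.
have D z i : is_derive z (e i) L (c i).
  have -> : z = 0 *: e i + z by rewrite scale0r add0r.
  apply/(is_derive_line L (e i) z); under eq_fun do rewrite hL.
  apply: is_derive_eq.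
  by rewrite scaler0 add0r addr0; exact: mulr1.
case: n => [|n]; split=> //; try by move=> z _; exact: cL.
move=> i; split; first by move=> z _; have [] := D z i.
by apply: Cn_ext (Cn_cst n (c i)) => z _; have [_ ->] := D z i.
Qed.

End Cn_calculus.

Lemma sum_ord2 {V : nmodType} (F : 'I_2 -> V) :
  \sum_(i < 2) F i = F ord0 + F ord_max.
Proof. by rewrite big_ord_recl big_ord1; congr (_ + F _); apply: val_inj. Qed.

Lemma ord2_cases (P : 'I_2 -> Prop) : P ord0 -> P ord_max -> forall i, P i.
Proof.
move=> P0 P1 i; have [->//|] := eqVneq i ord0; rewrite -val_eqE /= => i0.
suff -> : i = ord_max by [].
by apply: val_inj => /=; case: i i0 => -[|[]].
Qed.

Lemma Cn_expR {R : realType} n : Cn (fun _ : unit => 1 : R) setT n (@expR R).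
Proof.
have D (x : R) : is_derive x 1 (@expR R) (expR x) by exact: is_derive_expR.
elim: n => [|n IH]; split=> //; try by move=> z _; exact: continuous_expR.
move=> _; split; first by move=> z _; have [] := D z.
by apply: (Cn_ext openT) IH => z _; have [_ ->] := D z.
Qed.

(** * The metric in coordinates and covariant derivatives in components *)

Section coordinates.
Context {R : realType}.
Implicit Types (x y : R * R) (i j k l : 'I_2).

Lemma pd_expR_snd (c : R) i x :
  is_derive x (ex i) (fun y : R * R => expR (c * y.2))
    (if i == ord0 then 0 else c * expR (c * x.2)).
Proof.
have D2 : is_derive x (ex i) (fun y : R * R => c * y.2)
    (if i == ord0 then 0 else c).
  apply/is_derive_line0.
  have -> : (fun h : R => c * (h *: (@ex R i) + x).2) =
     (fun h => h * (if i == ord0 then 0 else c) + c * x.2).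
    apply/funext => h; rewrite /ex; case: ifP => _ /=.
      by rewrite mulr0 add0r [h *: 0]mulr0 add0r.
    by rewrite [h *: 1]mulr1; ring.
  by apply: is_derive_eq; rewrite scaler0 add0r addr0; exact: mulr1.
apply: is_derive_eq.
  exact: (@is_derive_comp1 _ _ _ expR _ _ _ _ D2 (is_derive_expR _)).
by case: ifP => _; rewrite ?mulr0 // mulrC.
Qed.

Lemma pd_metric i j k x : pd i (metric j k) x =
  if [&& i == ord_max, j == ord0 & k == ord0] then - 2 * expR (- 2 * x.2)
  else 0 :> R.
Proof.
rewrite /pd /metric; have [<-|jk] := eqVneq j k; last first.
  rewrite (_ : (fun=> 0) = cst 0)// derive_cst; case: ifP => // /and3P[_].
  by move=> /eqP j0 /eqP k0; rewrite j0 k0 eqxx in jk.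
elim/ord2_cases: j => /=.
  have [_ ->] := pd_expR_snd (- 2) i x.
  by elim/ord2_cases: i.
by rewrite (_ : (fun=> 1) = cst 1)// derive_cst andbF.
Qed.

Lemma cometric0 x : cometric ord0 ord0 x = expR (2 * x.2).
Proof. by rewrite /cometric /= /metric /= -expRN mulNr opprK. Qed.
Lemma cometric1 x : cometric ord_max ord_max x = 1 :> R.
Proof. by rewrite /cometric /= /metric /= invr1. Qed.
Lemma cometric_neq i j x : i != j -> cometric i j x = 0 :> R.
Proof. by rewrite /cometric => /negbTE ->. Qed.
Lemma cometric_gt0 i x : 0 < cometric i i x :> R.
Proof.
by elim/ord2_cases: i; rewrite ?cometric0 ?cometric1 ?expR_gt0 ?ltr01.
Qed.

Lemma chrisE k i j x : chris k i j x =
  if k == ord0 then (if i == j then 0 else - 1)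
  else if (i == ord0) && (j == ord0) then expR (- 2 * x.2) else 0 :> R.
Proof.
have E : expR (2 * x.2) * expR (- 2 * x.2) = 1.
  by rewrite mulNr -expRD subrr expR0.
rewrite /chris sum_ord2 !pd_metric.
elim/ord2_cases: k => /=; elim/ord2_cases: i => /=; elim/ord2_cases: j => /=;
  rewrite ?cometric0 ?cometric1 ?(@cometric_neq ord0 ord_max)//
    ?(@cometric_neq ord_max ord0)//; try ring.
- by transitivity (- (expR (2 * x.2) * expR (- 2 * x.2))); [field|rewrite E].
- by transitivity (- (expR (2 * x.2) * expR (- 2 * x.2))); [field|rewrite E].
- by field.
Qed.

Lemma expRN2 (t : R) : expR (- 2 * t) = expR (- t) ^+ 2.
Proof. by rewrite expr2 -expRD; congr expR; ring. Qed.

Lemma innerE y (v w : 'cV[R]_2) :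
  inner y v w = expR (- y.2) ^+ 2 * (v ord0 0 * w ord0 0)
              + v ord_max 0 * w ord_max 0.
Proof.
rewrite /inner !sum_ord2 /metric /= expRN2; ring.
Qed.

End coordinates.

Section directional.
Context {R : realType} {V : normedModType R}.
Variables (m n : nat).
Implicit Types (F : V -> 'M[R]_(m, n)).

Lemma derive_entry F (z v : V) i j : (forall i j, derivable (fun y => F y i j) z v) ->
  ('D_v F z) i j = 'D_v (fun y => F y i j) z.
Proof. by move=> D; rewrite derive_mx ?mxE//; apply/derivable_mxP. Qed.

End directional.

Section normalized_frame.
Context {R : realType} {V : normedModType R}.
Variable (w : V -> R * R).
Implicit Types (X : V -> 'cV[R]_2) (v z : V).

Lemma dmap0 v z : dmap w v z ord0 0 = 'D_v (fst \o w) z.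
Proof. by rewrite mxE. Qed.
Lemma dmap1 v z : dmap w v z ord_max 0 = 'D_v (snd \o w) z.
Proof. by rewrite mxE. Qed.

Lemma nablaXE X v z : (forall k, derivable (fun y => X y k 0) z v) ->
  (nablaX w X v z ord0 0 = 'D_v (fun y => X y ord0 0) z
     - ('D_v (fst \o w) z * X z ord_max 0 + 'D_v (snd \o w) z * X z ord0 0)) *
  (nablaX w X v z ord_max 0 = 'D_v (fun y => X y ord_max 0) z
     + expR (- (w z).2) ^+ 2 * 'D_v (fst \o w) z * X z ord0 0).
Proof.
move=> D; have D' i j : derivable (fun y => X y i j) z v by rewrite ord1.
rewrite /nablaX !mxE !derive_entry// !sum_ord2 !chrisE/= dmap0 dmap1 expRN2.
move: ('D_v _ z) ('D_v _ z) ('D_v _ z) ('D_v _ z) (expR _) => a b c d E.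
by split; ring.
Qed.

End normalized_frame.

(** * Pointwise algebra of orthonormal frames and of the gauge *)

Section frame_algebra.
Context {R : realFieldType}.
Variables (o00 o01 o10 o11 : R).
Hypotheses (n0 : o00 * o00 + o01 * o01 = 1) (n1 : o10 * o10 + o11 * o11 = 1)
  (n01 : o00 * o10 + o01 * o11 = 0).
Let eps := o00 * o11 - o01 * o10.

(** In the plane an orthonormal pair is a unit vector and its rotation by a right angle, up to the
    sign [eps], its determinant. The orientation of the frame is left free. *)
Lemma frame_rot : o10 = - eps * o01 /\ o11 = eps * o00.
Proof.
split; rewrite /eps.
  transitivity (o10 * (o00 * o00 + o01 * o01) - o00 * (o00 * o10 + o01 * o11)).
    by rewrite n0 n01 mulr1 mulr0 subr0.
  by ring.
transitivity (o11 * (o00 * o00 + o01 * o01) - o01 * (o00 * o10 + o01 * o11)).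
  by rewrite n0 n01 mulr1 mulr0 subr0.
by ring.
Qed.

Lemma frame_det2 : eps * eps = 1.
Proof.
have -> : eps * eps = (o00 * o00 + o01 * o01) * (o10 * o10 + o11 * o11)
   - (o00 * o10 + o01 * o11) * (o00 * o10 + o01 * o11) by rewrite /eps; ring.
by rewrite n0 n1 n01; ring.
Qed.

Variables (d00 d01 d10 d11 : R).
Hypotheses (e0 : d00 * o00 + d01 * o01 = 0) (e1 : d10 * o10 + d11 * o11 = 0)
  (e01 : (d00 * o10 + d01 * o11) + (o00 * d10 + o01 * d11) = 0).
Let beta := d00 * o10 + d01 * o11.

(** [e0], [e1] and [e01] are the differentiated orthonormality relations, the first two up to a
    factor 2. They force the derivative of the frame to be an infinitesimal rotation of speed
    [beta]. *)
Lemma frame_rot_derive :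
  [/\ d00 = beta * o10, d01 = beta * o11, d10 = - beta * o00 &
      d11 = - beta * o01].
Proof.
have [r0 r1] := frame_rot; have ee := frame_det2.
have c00 : o00 * o00 + o10 * o10 = 1.
  by rewrite r0 -n0; transitivity (o00 * o00 + (eps * eps) * (o01 * o01));
    [ring|rewrite ee mul1r].
have c11 : o01 * o01 + o11 * o11 = 1.
  by rewrite r1 -n0; transitivity ((eps * eps) * (o00 * o00) + o01 * o01);
    [ring|rewrite ee mul1r].
have c01 : o00 * o01 + o10 * o11 = 0.
  by rewrite r0 r1; transitivity (o00 * o01 * (1 - eps * eps));
    [ring|rewrite ee subrr mulr0].
have e10 : d10 * o00 + d11 * o01 = - beta.
  by apply/eqP; rewrite -addr_eq0 -e01 /beta; apply/eqP; ring.
split.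
- transitivity (d00 * (o00 * o00 + o10 * o10) + d01 * (o00 * o01 + o10 * o11)).
    by rewrite c00 c01 mulr1 mulr0 addr0.
  transitivity (o00 * (d00 * o00 + d01 * o01) + beta * o10).
    by rewrite /beta; ring.
  by rewrite e0 mulr0 add0r.
- transitivity (d01 * (o01 * o01 + o11 * o11) + d00 * (o00 * o01 + o10 * o11)).
    by rewrite c11 c01 mulr1 mulr0 addr0.
  transitivity (o01 * (d00 * o00 + d01 * o01) + beta * o11).
    by rewrite /beta; ring.
  by rewrite e0 mulr0 add0r.
- transitivity (d10 * (o00 * o00 + o10 * o10) + d11 * (o00 * o01 + o10 * o11)).
    by rewrite c00 c01 mulr1 mulr0 addr0.
  transitivity (o10 * (d10 * o10 + d11 * o11) + (d10 * o00 + d11 * o01) * o00).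
    by ring.
  by rewrite e1 mulr0 add0r e10.
- transitivity (d11 * (o01 * o01 + o11 * o11) + d10 * (o00 * o01 + o10 * o11)).
    by rewrite c11 c01 mulr1 mulr0 addr0.
  transitivity (o11 * (d10 * o10 + d11 * o11) + (d10 * o00 + d11 * o01) * o01).
    by ring.
  by rewrite e1 mulr0 add0r e10.
Qed.

(** The derivative of the frame cancels against the connection terms. What remains are the frame
    components of a covariant derivative computed in the frame [Theta], for which [pa] is the
    connection coefficient. *)
Lemma covariant_frame_coord0 (pa pb qb P Q : R) :
  (P * o00 + pb * d00) + (Q * o01 + qb * d01) +
  (((d00 - pa * o01) * o00 + (d01 + pa * o00) * o01) * (pb * o00 + qb * o01) +
   ((d10 - pa * o11) * o00 + (d11 + pa * o10) * o01) * (pb * o10 + qb * o11)) =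
  (P - pa * qb) * o00 + (Q + pa * pb) * o01.
Proof.
have [r0 r1] := frame_rot; have ee := frame_det2.
have [f0 f1 f2 f3] := frame_rot_derive.
have x0 : eps * o10 = - o01 by rewrite r0 mulNr mulrN mulrA ee mul1r.
have x1 : eps * o11 = o00 by rewrite r1 mulrA ee mul1r.
transitivity (P * o00 + Q * o01 + pb * (d00 - beta * o10) + qb * (d01 - beta * o11)
  + (d00 * o00 + d01 * o01) * (pb * o00 + qb * o01)
  + ((d10 + beta * o00) * o00 + (d11 + beta * o01) * o01) * (pb * o10 + qb * o11)
  - beta * (o00 * o00 + o01 * o01 - 1) * (pb * o10 + qb * o11)
  - pa * (pb * (eps * o10) + qb * (eps * o11))).
  by rewrite /eps; ring.
by rewrite e0 n0 x0 x1 {1}f0 {1}f1 {1}f2 {1}f3; ring.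
Qed.

Lemma covariant_frame_coord1 (pa pb qb P Q : R) :
  (P * o10 + pb * d10) + (Q * o11 + qb * d11) +
  (((d00 - pa * o01) * o10 + (d01 + pa * o00) * o11) * (pb * o00 + qb * o01) +
   ((d10 - pa * o11) * o10 + (d11 + pa * o10) * o11) * (pb * o10 + qb * o11)) =
  (P - pa * qb) * o10 + (Q + pa * pb) * o11.
Proof.
have [r0 r1] := frame_rot; have ee := frame_det2.
have [f0 f1 f2 f3] := frame_rot_derive.
transitivity (P * o10 + Q * o11 + pb * (d10 + beta * o00) + qb * (d11 + beta * o01)
  + (d10 * o10 + d11 * o11) * (pb * o10 + qb * o11)
  + pa * (pb * (eps * o00) - qb * (- eps * o01))).
  by rewrite /beta /eps; ring.
by rewrite e1 -r0 -r1 {1}f2 {1}f3; ring.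
Qed.

End frame_algebra.

(** As the frame moves by rotations, the quadratic terms cancel and only the curl [Pab - Pba] of the
    connection coefficient of [Theta] survives; absence of torsion makes it the area spanned by the
    two derivatives of the map. *)
Lemma curvature_algebra {R : comRingType} (o da db : 'I_2 -> 'I_2 -> R)
    (Sa Sb : 'I_2 -> R) (ba bb Pab Pba pa pb qa qb : R) (j k : 'I_2) :
  (forall c, da ord0 c = ba * o ord_max c) ->
  (forall c, da ord_max c = - ba * o ord0 c) ->
  (forall c, db ord0 c = bb * o ord_max c) ->
  (forall c, db ord_max c = - bb * o ord0 c) ->
  (forall c, Sa c = Sb c) -> Pab - Pba = qb * pa - qa * pb ->
  (((Sa ord0 - (Pab * o j ord_max + pb * da j ord_max)) * o k ord0
    + (db j ord0 - pb * o j ord_max) * da k ord0)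
   + ((Sa ord_max + (Pab * o j ord0 + pb * da j ord0)) * o k ord_max
    + (db j ord_max + pb * o j ord0) * da k ord_max)) -
  (((Sb ord0 - (Pba * o j ord_max + pa * db j ord_max)) * o k ord0
    + (da j ord0 - pa * o j ord_max) * db k ord0)
   + ((Sb ord_max + (Pba * o j ord0 + pa * db j ord0)) * o k ord_max
    + (da j ord_max + pa * o j ord0) * db k ord_max)) =
  (pa * o j ord0 + qa * o j ord_max) * (pb * o k ord0 + qb * o k ord_max)
  - (pb * o j ord0 + qb * o j ord_max) * (pa * o k ord0 + qa * o k ord_max).
Proof.
move=> a0 a1 b0 b1 S /eqP; rewrite subr_eq => /eqP ->; rewrite !S.
by elim/ord2_cases: j; elim/ord2_cases: k; rewrite !(a0, a1, b0, b1); ring.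
Qed.

(* The whole identity is linear in the second order quantities, so that it only
   involves the values at one point of the fields and of their derivatives. *)
Section gauge_algebra.
Context {R : realType}.
Local Notation v2 := 'cV[R]_2.
Local Notation M2 := 'M[R]_2.
Local Notation wdg := (@wedge R id).

Lemma dotp_id_addr (a b c : v2) : dotp id a (b + c) = dotp id a b + dotp id a c.
Proof. by rewrite /dotp !sum_ord2 !mxE; ring. Qed.
Lemma dotp_id_addl (a b c : v2) : dotp id (a + b) c = dotp id a c + dotp id b c.
Proof. by rewrite /dotp !sum_ord2 !mxE; ring. Qed.
Lemma dotp_id_oppr (a b : v2) : dotp id a (- b) = - dotp id a b.
Proof. by rewrite /dotp !sum_ord2 !mxE; ring. Qed.
Lemma dotp_id_oppl (a b : v2) : dotp id (- a) b = - dotp id a b.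
Proof. by rewrite /dotp !sum_ord2 !mxE; ring. Qed.

Lemma wedge_id_addr (a b c d : v2) : wdg a b (c + d) = wdg a b c + wdg a b d.
Proof. by rewrite /wedge !dotp_id_addr !scalerDl opprD addrACA. Qed.
Lemma wedge_id_addm (a b c d : v2) : wdg a (b + c) d = wdg a b d + wdg a c d.
Proof. by rewrite /wedge dotp_id_addl scalerDr scalerDl opprD addrACA. Qed.
Lemma wedge_id_oppr (a b c : v2) : wdg a b (- c) = - wdg a b c.
Proof. by rewrite /wedge !dotp_id_oppr !scaleNr opprB opprK addrC. Qed.
Lemma wedge_id_oppm (a b c : v2) : wdg a (- b) c = - wdg a b c.
Proof. by rewrite /wedge dotp_id_oppl scaleNr scalerN opprB opprK addrC. Qed.
Lemma wedge_idC (a b c : v2) : wdg a b c = - wdg b a c.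
Proof. by rewrite /wedge opprB. Qed.

Lemma heat_tension_algebra (h : 'I_2 -> R) (G : 'I_2 -> 'I_2 -> R)
  (ph phtt pht dst phit dsW Rt : v2) (At dAt : M2)
  (L d ps pinf : 'I_2 -> v2) (A Ai dA dAi : 'I_2 -> M2) :
  dst = phtt + (dAt *m ph + At *m pht) ->
  dsW = dst + (wdg ph phit phit + At *m (pht + At *m ph))
    - \sum_(i < 2) h i *: (L i + (dA i *m ph + A i *m d i)
         + (wdg ph (ps i) (ps i) + A i *m (d i + A i *m ph)))
    + \sum_(i < 2) \sum_(k < 2) (h i * G k i) *: (d k + A k *m ph) ->
  Rt = wdg phit ph phit ->
  phtt - \sum_(i < 2) h i *: (L i - \sum_(k < 2) G k i *: d k)
  + \sum_(i < 2) h i *: (- 2 *: (Ai i *m d i) - Ai i *m (Ai i *m ph)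
      - wdg ph (pinf i) (pinf i)
      - (dAi i - \sum_(k < 2) G k i *: Ai k) *m ph)
  = - 2 *: (At *m pht) - At *m (At *m ph) - dAt *m ph + dsW + Rt
   + 2 *: (\sum_(i < 2) h i *: ((A i - Ai i) *m d i))
   + \sum_(i < 2) h i *: ((A i - Ai i) *m (Ai i *m ph))
   + \sum_(i < 2) h i *: (Ai i *m ((A i - Ai i) *m ph))
   + \sum_(i < 2) h i *: ((A i - Ai i) *m ((A i - Ai i) *m ph))
   + \sum_(i < 2) h i *:
      ((dA i - dAi i - \sum_(k < 2) G k i *: (A k - Ai k)) *m ph)
   + \sum_(i < 2) h i *: wdg ph (pinf i) (ps i - pinf i)
   + \sum_(i < 2) h i *: wdg ph (ps i - pinf i) (pinf i)
   + \sum_(i < 2) h i *: wdg ph (ps i - pinf i) (ps i - pinf i).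
Proof.
move=> -> -> ->; apply/matrixP => r c; rewrite ord1 {c}.
have cD (u v : v2) : (u + v) r 0 = u r 0 + v r 0 by rewrite mxE.
have cN (u : v2) : (- u) r 0 = - u r 0 by rewrite mxE.
have cZ (a : R) (u : v2) : (a *: u) r 0 = a * u r 0 by rewrite mxE.
(* By antisymmetry of the wedge in its first two arguments, [Rt] cancels the curvature term that
   [dsW] receives from D_t phi_t. After expansion by bilinearity, matrix products and wedges can be
   made opaque and the rest is linear in them. *)
rewrite !sum_ord2 !(mulmxDl, mulmxDr, mulmxBl, mulmxBr, mulNmx, mulmxN,
  wedge_id_addr, wedge_id_oppr, wedge_id_addm, wedge_id_oppm)
  [wdg phit _ _]wedge_idC -!scalemxAl
  !mulmxBl.
move: (@mulmx R 2 2 1) (@wedge R id) => mul wdg.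
rewrite !(cD, cN, cZ).
move: (h ord0) (h ord_max) (G _ _) (G _ _) (G _ _) (G _ _) => h0 h1 g0 g1 g2 g3.
ring.
Qed.
End gauge_algebra.

Lemma open_gauge_domain {R : realType} (T : R) : open (gauge_domain T).
Proof.
have c1 : continuous (fun z : R * R * (R * R) => z.1.1).
  by move=> z; apply: continuous_comp; exact: cvg_fst.
have c2 : continuous (fun z : R * R * (R * R) => z.1.2).
  by move=> z; apply: continuous_comp; [exact: cvg_fst|exact: cvg_snd].
have -> : gauge_domain T = (fun z : R * R * (R * R) => z.1.1) @^-1` [set t | 0 < t]
   `&` ((fun z : R * R * (R * R) => z.1.2) @^-1` [set t | 0 < t]
   `&` (fun z : R * R * (R * R) => z.1.2) @^-1` [set t | t < T]).
  by apply/seteqP; split=> z /= [? H]; split=> //; apply/andP.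
apply: openI; first by move/continuousP : c1; apply; exact: open_gt.
by apply: openI; move/continuousP : c2; apply; [exact: open_gt|exact: open_lt].
Qed.

(** * Structure equations of the moving frame *)

Section gauge_equations.
Context {R : realType}.
Local Notation Z := (R * R * (R * R))%type.
Variables (D : set Z) (oD : open D) (U : Z -> R * R) (Om : 'I_2 -> Z -> 'cV[R]_2).
Hypothesis U3 : forall k, Cn (@edir R) D 3 (crd k \o U).
Hypothesis Om2 : forall j k, Cn (@edir R) D 2 (fun z => Om j z k 0).
Hypothesis Om_on : forall z i j, D z -> inner (U z) (Om i z) (Om j z) = (i == j)%:R.

Local Notation der a f := ('D_(edir a) f).

(** Components in the orthonormal frame [Theta] along [U], where the target metric becomes
    Euclidean: ([p a], [q a]) represents d_a U, and [o j] the frame vector [Om j]. *)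
Let E (z : Z) : R := expR (- (U z).2).
Let p (a : dir) (z : Z) : R := E z * der a (fst \o U) z.
Let q (a : dir) (z : Z) : R := der a (snd \o U) z.
Let o (j c : 'I_2) (z : Z) : R := (if c == ord0 then E z else 1) * Om j z c 0.

Let U1_3 : Cn (@edir R) D 3 (fst \o U). Proof. exact: (U3 ord0). Qed.
Let U2_3 : Cn (@edir R) D 3 (snd \o U). Proof. exact: (U3 ord_max). Qed.

Let E3 : Cn (@edir R) D 3 E.
Proof.
by apply: (@Cn_comp _ _ _ _ _ oD 3 (fun z => - (U z).2)); [exact: Cn_expR|exact: CnN].
Qed.

Let p2 a : Cn (@edir R) D 2 (p a).
Proof. by apply: CnM => //; [exact: CnS|exact: Cn_pd]. Qed.

Let q2 a : Cn (@edir R) D 2 (q a).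
Proof. exact: Cn_pd. Qed.

Let o2 j c : Cn (@edir R) D 2 (o j c).
Proof.
apply: CnM => //; case: (c == ord0); last exact: Cn_cst.
exact: CnS.
Qed.

Lemma phi_entry a z k :
  phi U Om a z k 0 = p a z * o k ord0 z + q a z * o k ord_max z.
Proof.
by rewrite /phi /frame_coord mxE innerE dmap0 dmap1 /p /q /o /E /= expr2; ring.
Qed.

Lemma Cn_phi a k : Cn (@edir R) D 2 (fun z => phi U Om a z k 0).
Proof.
apply: (Cn_ext oD) => [z Dz|]; first by rewrite phi_entry.
by apply: CnD => //; apply: CnM.
Qed.

Let dE a z : D z -> is_derive z (edir a) E (- q a z * E z).
Proof.
move=> Dz.
have H := is_derive_opp (derivableP (Cn_derivable (i:=a) U2_3 Dz)).
apply: (is_derive_eq (is_derive_comp1 H (is_derive_expR _))).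
by rewrite mulrC.
Qed.

Let dp a b z : D z -> is_derive z (edir a) (p b)
  (- q a z * p b z + E z * der a (der b (fst \o U)) z).
Proof.
move=> Dz; have H := derivableP (Cn_derivable (i:=a) (Cn_pd b U1_3) Dz).
apply: (is_derive_eq (is_derive_mul (dE a Dz) H)).
by rewrite /p mulrA.
Qed.

(** First structure equation of [Theta]: second derivatives of the coordinate commute, so only the
    derivative of the factor [E] is left. *)
Let torsion a b z : D z -> der a (p b) z - der b (p a) z = q b z * p a z - q a z * p b z.
Proof.
move=> Dz; have [_ H1] := dp a b Dz; have [_ H2] := dp b a Dz.
have H3 := Cn_derive_commute oD a b (CnS U1_3) Dz.
rewrite H3 in H1; apply: (etrans (congr2 (fun x y => x - y) H1 H2)).
by move: (q a z) (q b z) (p a z) (p b z) (E z) (der b (der a (fst \o U)) z); clear;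
  move=> *; ring.
Qed.

Let torsion' a b z : D z -> der a (q b) z = der b (q a) z.
Proof. exact: (Cn_derive_commute oD a b (CnS U2_3)). Qed.

Let don a i j z : D z ->
  (der a (o i ord0) z * o j ord0 z + o i ord0 z * der a (o j ord0) z) +
  (der a (o i ord_max) z * o j ord_max z + o i ord_max z * der a (o j ord_max) z) = 0.
Proof.
move=> Dz; have H k c := derivableP (Cn_derivable (i:=a) (o2 k c) Dz).
have [_ <-] := is_derive_add (is_derive_mul (H i ord0) (H j ord0))
                             (is_derive_mul (H i ord_max) (H j ord_max)).
rewrite -(derive_cst ((i == j)%:R : R) z (edir a)); apply: near_eq_derive.
apply: filterS (open_nbhs_nbhs (conj oD Dz)) => y Dy.
by rewrite -(Om_on i j Dy) innerE /o /E /=; ring.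
Qed.

Let on i j z : D z -> o i ord0 z * o j ord0 z + o i ord_max z * o j ord_max z = (i == j)%:R.
Proof. by move=> Dz; rewrite -(Om_on i j Dz) innerE /o /E /=; ring. Qed.

(** In the frame [Theta] the covariant derivative along [a] is the derivative of the components plus
    the rotation by a right angle times [p a]. *)
Lemma conn_entry a z k j : D z -> conn U Om a z k j =
  (der a (o j ord0) z - p a z * o j ord_max z) * o k ord0 z +
  (der a (o j ord_max) z + p a z * o j ord0 z) * o k ord_max z.
Proof.
move=> Dz; rewrite /conn mxE innerE.
have H i := Cn_derivable (i:=a) (Om2 j i) Dz.
rewrite !(nablaXE _ H).
have -> : der a (o j ord_max) z = der a (fun y => Om j y ord_max 0) z.
  apply: (congr1 (fun f : Z -> R => 'D_(edir a) f z)).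
  by apply/funext => y; rewrite /o mul1r.
have -> : der a (o j ord0) z = - q a z * o j ord0 z + E z * der a (fun y => Om j y ord0 0) z.
  have [_ ->] := is_derive_mul (dE a Dz) (derivableP (H ord0)).
  by rewrite /o /= mulrA.
rewrite /o /p /q /= -/(E z).
move: (der a _ z) (der a _ z) (der a _ z) (der a _ z) => x1 x2 x3 x4.
by ring.
Qed.

Lemma Cn_conn a k j : Cn (@edir R) D 1 (fun z => conn U Om a z k j).
Proof.
apply: (Cn_ext oD) => [z Dz|]; first by rewrite (conn_entry _ _ _ Dz).
apply: CnD => //; apply: CnM => //; try exact: CnS.
  apply: CnB => //; first exact: Cn_pd.
  by apply: CnM => //; exact: CnS.
apply: CnD => //; first exact: Cn_pd.
by apply: CnM => //; exact: CnS.
Qed.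

Let on00 z : D z -> o ord0 ord0 z * o ord0 ord0 z + o ord0 ord_max z * o ord0 ord_max z = 1.
Proof. exact: on. Qed.
Let on11 z : D z ->
  o ord_max ord0 z * o ord_max ord0 z + o ord_max ord_max z * o ord_max ord_max z = 1.
Proof. exact: on. Qed.
Let on01 z : D z ->
  o ord0 ord0 z * o ord_max ord0 z + o ord0 ord_max z * o ord_max ord_max z = 0.
Proof. exact: on. Qed.

Let half (x : R) : x + x = 0 -> x = 0.
Proof. by move=> H; lra. Qed.

Let don00 a z : D z -> der a (o ord0 ord0) z * o ord0 ord0 z
  + der a (o ord0 ord_max) z * o ord0 ord_max z = 0.
Proof.
move=> Dz; apply: half; have := don a ord0 ord0 Dz => H.
apply: etrans H; move: (der a (o ord0 ord0) z) (der a (o ord0 ord_max) z).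
by move: (o ord0 ord0 z) (o ord0 ord_max z); clear; move=> *; ring.
Qed.
Let don11 a z : D z -> der a (o ord_max ord0) z * o ord_max ord0 z
  + der a (o ord_max ord_max) z * o ord_max ord_max z = 0.
Proof.
move=> Dz; apply: half; have := don a ord_max ord_max Dz => H.
apply: etrans H; move: (der a (o ord_max ord0) z) (der a (o ord_max ord_max) z).
by move: (o ord_max ord0 z) (o ord_max ord_max z); clear; move=> *; ring.
Qed.
Let don01 a z : D z ->
  (der a (o ord0 ord0) z * o ord_max ord0 z
   + der a (o ord0 ord_max) z * o ord_max ord_max z)
  + (o ord0 ord0 z * der a (o ord_max ord0) z
     + o ord0 ord_max z * der a (o ord_max ord_max) z) = 0.
Proof. by move=> Dz; rewrite addrACA; exact: don. Qed.

Let dphi a b k z : D z -> ('D_(edir a) (phi U Om b) z) k 0 =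
  (der a (p b) z * o k ord0 z + p b z * der a (o k ord0) z)
  + (der a (q b) z * o k ord_max z + q b z * der a (o k ord_max) z).
Proof.
move=> Dz; rewrite derive_entry => [|i j]; last first.
  by rewrite ord1; exact: Cn_derivable (Cn_phi b i) Dz.
have H c := derivableP (Cn_derivable (i:=a) (o2 k c) Dz).
have Hp := derivableP (Cn_derivable (i:=a) (p2 b) Dz).
have Hq := derivableP (Cn_derivable (i:=a) (q2 b) Dz).
have [_ <-] := is_derive_add (is_derive_mul Hp (H ord0)) (is_derive_mul Hq (H ord_max)).
apply: (congr1 (fun f : Z -> R => 'D_(edir a) f z)).
by apply/funext => y; exact: phi_entry.
Qed.

Let cov_phi a b k z : D z -> (Dcov U Om a (phi U Om b) z) k 0 =
  (der a (p b) z - p a z * q b z) * o k ord0 z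
  + (der a (q b) z + p a z * p b z) * o k ord_max z.
Proof.
move=> Dz; rewrite /Dcov mxE dphi// mxE sum_ord2 !phi_entry !conn_entry//.
by elim/ord2_cases: k; [apply: covariant_frame_coord0|apply: covariant_frame_coord1];
  auto.
Qed.

(** By [cov_phi] both sides are frame components of the second covariant derivative of the map,
    whose symmetry is [torsion] and [torsion']. *)
Lemma Dcov_phi_sym a b z : D z ->
  Dcov U Om a (phi U Om b) z = Dcov U Om b (phi U Om a) z.
Proof.
move=> Dz; apply/colP => k; apply: (etrans (cov_phi a b k Dz)).
apply: (etrans _ (esym (cov_phi b a k Dz))).
apply: (congr2 (fun x y => x * o k ord0 z + y * o k ord_max z)).
  have /eqP := torsion a b Dz; rewrite subr_eq => /eqP H.
  apply: (etrans (congr1 (fun t => t - p a z * q b z) H)).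
  by move: (der b (p a) z) (p a z) (p b z) (q a z) (q b z); clear; move=> *; ring.
apply: (congr2 (fun x y => x + y)); [exact: torsion'|exact: mulrC].
Qed.

Let dconn a b j k z : D z -> der a (fun y => conn U Om b y k j) z =
  ((der a (der b (o j ord0)) z
     - (der a (p b) z * o j ord_max z + p b z * der a (o j ord_max) z)) * o k ord0 z
   + (der b (o j ord0) z - p b z * o j ord_max z) * der a (o k ord0) z)
  + ((der a (der b (o j ord_max)) z
     + (der a (p b) z * o j ord0 z + p b z * der a (o j ord0) z)) * o k ord_max z
   + (der b (o j ord_max) z + p b z * o j ord0 z) * der a (o k ord_max) z).
Proof.
move=> Dz.
have H i c := derivableP (Cn_derivable (i:=a) (o2 i c) Dz).
have H2 c := derivableP (Cn_derivable (i:=a) (Cn_pd b (o2 j c)) Dz).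
have Hp := derivableP (Cn_derivable (i:=a) (p2 b) Dz).
have [_ <-] := is_derive_add
  (is_derive_mul (is_derive_sub (H2 ord0) (is_derive_mul Hp (H j ord_max))) (H k ord0))
  (is_derive_mul (is_derive_add (H2 ord_max) (is_derive_mul Hp (H j ord0)))
                 (H k ord_max)).
apply: near_eq_derive; apply: filterS (open_nbhs_nbhs (conj oD Dz)) => y Dy.
exact: conn_entry.
Qed.

(** Curvature of the induced connection. The commutator of A_a and A_b is absent because
    skew-symmetric matrices of size two commute. *)
Lemma conn_curvature a b j k z : D z ->
  der a (fun y => conn U Om b y k j) z - der b (fun y => conn U Om a y k j) z =
  phi U Om a z j 0 * phi U Om b z k 0 - phi U Om b z j 0 * phi U Om a z k 0.
Proof.
move=> Dz.
apply: (etrans (congr2 (fun x y => x - y) (dconn a b j k Dz) (dconn b a j k Dz))).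
have C c := Cn_derive_commute oD a b (o2 j c) Dz.
have T := torsion a b Dz.
apply: (etrans _ (esym (congr2 (fun x y => x - y)
  (congr2 *%R (phi_entry a z j) (phi_entry b z k))
  (congr2 *%R (phi_entry b z j) (phi_entry a z k))))).
pose beta c := der c (o ord0 ord0) z * o ord_max ord0 z
  + der c (o ord0 ord_max) z * o ord_max ord_max z.
have B0 c i : der c (o ord0 i) z = beta c * o ord_max i z.
  have [h0 h1 _ _] := frame_rot_derive (on00 Dz) (on11 Dz) (on01 Dz)
    (don00 c Dz) (don11 c Dz) (don01 c Dz).
  by elim/ord2_cases: i; [exact: h0|exact: h1].
have B1 c i : der c (o ord_max i) z = - beta c * o ord0 i z.
  have [_ _ h2 h3] := frame_rot_derive (on00 Dz) (on11 Dz) (on01 Dz)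
    (don00 c Dz) (don11 c Dz) (don01 c Dz).
  by elim/ord2_cases: i; [exact: h2|exact: h3].
exact: (@curvature_algebra _ (fun i c => o i c z) (fun i c => der a (o i c) z)
  (fun i c => der b (o i c) z) (fun c => der a (der b (o j c)) z)
  (fun c => der b (der a (o j c)) z) (beta a) (beta b) (der a (p b) z) (der b (p a) z)
  (p a z) (p b z) (q a z) (q b z) j k (B0 a) (B1 a) (B0 b) (B1 b) C T).
Qed.

(** An orthonormal pair is complete in a plane, so passing to frame components is an isometry; this
    transports the curvature to a wedge of components. *)
Lemma frame_coord_inner z (X Y : 'cV[R]_2) : D z ->
  inner (U z) X Y = dotp id (frame_coord U Om z X) (frame_coord U Om z Y).
Proof.
move=> Dz; have [r0 r1] := frame_rot (on00 Dz) (on01 Dz).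
have ee := frame_det2 (on00 Dz) (on11 Dz) (on01 Dz).
have n0 := on00 Dz.
rewrite /dotp sum_ord2 !mxE !innerE.
have EO k : expR (- (U z).2) * Om k z ord0 0 = o k ord0 z by [].
have O1 k : Om k z ord_max 0 = o k ord_max z by rewrite /o mul1r.
rewrite -[expR (- (U z).2)]/(E z) in EO *.
have I (V : 'cV[R]_2) k : E z ^+ 2 * (V ord0 0 * Om k z ord0 0)
    + V ord_max 0 * Om k z ord_max 0
  = (E z * V ord0 0) * o k ord0 z + V ord_max 0 * o k ord_max z.
  by rewrite -EO -O1; move: (E z) (V _ _) (Om _ _ _ _); clear; move=> *; ring.
rewrite !I; move: r0 r1 ee n0; clear.
move: (o ord0 ord0 z) (o ord0 ord_max z) (o ord_max ord0 z) (o ord_max ord_max z).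
move=> o00 o01 o10 o11; set eps := _ - _ => r0 r1 ee n0.
move: (E z) (X _ _) (X _ _) (Y _ _) (Y _ _) => E0 x0 x1 y0 y1.
rewrite r0 r1.
transitivity ((E0 ^+ 2 * (x1 * y1) + x0 * y0) * (o00 * o00 + o01 * o01)
  + (eps * eps - 1) * (x0 * o00 - E0 * x1 * o01) * (y0 * o00 - E0 * y1 * o01)).
  by rewrite n0 ee; ring.
by ring.
Qed.

End gauge_equations.

(** * Differentiation of matrix-valued fields and restriction to slices *)

Section matrix_valued.
Context {R : realType} {V : normedModType R} {I : Type} (e : I -> V).
Variables (U : set V) (oU : open U).

Definition mxCn m n (k : nat) (F : V -> 'M[R]_(m, n)) : Prop :=
  forall i j, Cn e U k (fun z => F z i j).

Lemma mxCn_derive m n k (F : V -> 'M[R]_(m, n)) a z : mxCn k.+1 F -> U z ->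
  is_derive z (e a) F ('D_(e a) F z).
Proof.
move=> H Uz; apply: derivableP; apply/derivable_mxP => i j.
exact: Cn_derivable (H i j) Uz.
Qed.

Lemma mxCn_entry m n k (F : V -> 'M[R]_(m, n)) a i j z : mxCn k.+1 F -> U z ->
  ('D_(e a) F z) i j = 'D_(e a) (fun y => F y i j) z.
Proof.
by move=> H Uz; apply: derive_entry => i' j'; exact: Cn_derivable (H i' j') Uz.
Qed.

Lemma mxCn_pd m n k (F : V -> 'M[R]_(m, n)) a : mxCn k.+1 F ->
  mxCn k ('D_(e a) F).
Proof.
move=> H i j; apply: (Cn_ext oU) (Cn_pd a (H i j)) => z Uz.
by rewrite (mxCn_entry _ _ _ H).
Qed.

Lemma mxCn_derive_commute m n (F : V -> 'M[R]_(m, n)) a b z : mxCn 2 F -> U z ->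
  'D_(e a) ('D_(e b) F) z = 'D_(e b) ('D_(e a) F) z.
Proof.
move=> H Uz; apply/matrixP => i j.
have N c : \near z, 'D_(e c) F z i j = 'D_(e c) (fun y => F y i j) z.
  apply: filterS (open_nbhs_nbhs (conj oU Uz)) => y Uy; exact: mxCn_entry H Uy.
apply: (etrans (mxCn_entry a i j (mxCn_pd b H) Uz)).
apply: (etrans _ (esym (mxCn_entry b i j (mxCn_pd a H) Uz))).
apply: (etrans (near_eq_derive _ (N b))).
apply: (etrans _ (esym (near_eq_derive _ (N a)))).
exact: (Cn_derive_commute oU a b (H i j) Uz).
Qed.

End matrix_valued.

Section matrix_derivatives.
Context {R : realType} {V : normedModType R}.

Lemma is_derive_mulmx m n l (A : V -> 'M[R]_(m, n)) (F : V -> 'M[R]_(n, l)) z v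
    dA dF : is_derive z v A dA -> is_derive z v F dF ->
  is_derive z v (fun y => A y *m F y) (dA *m F z + A z *m dF).
Proof.
move=> [dAz <-] [dFz <-].
have eA i j : is_derive z v (fun y => A y i j) ('D_v A z i j).
  by rewrite derive_mx// mxE; apply: derivableP; move/derivable_mxP : dAz; exact.
have eF i j : is_derive z v (fun y => F y i j) ('D_v F z i j).
  by rewrite derive_mx// mxE; apply: derivableP; move/derivable_mxP : dFz; exact.
have E i j : is_derive z v (fun y => (A y *m F y) i j)
    (('D_v A z *m F z + A z *m 'D_v F z) i j).
  have -> : (fun y => (A y *m F y) i j) = \sum_k (fun y => A y i k * F y k j).
    by apply/funext => y; rewrite mxE fct_sumE.
  rewrite !mxE -big_split /=; apply: is_derive_sum => k.
  exact: is_derive_mul.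
split; first by apply/derivable_mxP => i j; case: (E i j).
apply/matrixP => i j; rewrite derive_entry => [|i' j']; last by case: (E i' j').
by case: (E i j).
Qed.

Lemma is_derive_scale m n (c : V -> R) (F : V -> 'M[R]_(m, n)) z v dF :
  is_derive z v c 0 -> is_derive z v F dF ->
  is_derive z v (fun y => c y *: F y) (c z *: dF).
Proof.
move=> Dc [dFz <-].
have E i j : is_derive z v (fun y => (c y *: F y) i j) ((c z *: 'D_v F z) i j).
  rewrite mxE derive_mx// mxE.
  under eq_fun do rewrite mxE.
  have H : is_derive z v (fun y => F y i j) ('D_v (fun y => F y i j) z).
    by apply: derivableP; move/derivable_mxP : dFz; exact.
  by apply: (is_derive_eq (is_derive_mul Dc H)); rewrite mul0r add0r.
split; first by apply/derivable_mxP => i j; case: (E i j).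
apply/matrixP => i j; rewrite derive_entry => [|i' j']; last by case: (E i' j').
by case: (E i j).
Qed.

End matrix_derivatives.

Section slices.
Context {R : realType} {W : normedModType R}.
Local Notation Z := (R * R * (R * R))%type.

Lemma derive_slice (F : Z -> W) (s t : R) (y : R * R) i :
  'D_(ex i) (fun y => F (s, t, y)) y = 'D_(edir (dx i)) F (s, t, y).
Proof.
rewrite /derive; apply: (congr1 (fun f : R -> W => lim (f @ 0^'))).
apply/funext => h; congr (_ *: (F _ - _)).
transitivity ((h * 0 + s, h * 0 + t), h *: ex i + y); last by [].
by rewrite mulr0 !add0r.
Qed.

Lemma is_derive_dom (G : R * R -> W) (z : Z) i dG :
  is_derive z.2 (ex i) G dG ->
  is_derive z (edir (dx i)) (fun z => G z.2) dG.
Proof. by move=> [d1 d2]; split; [exact: d1|exact: d2]. Qed.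

Lemma is_derive_dom_s (G : R * R -> W) (z : Z) :
  is_derive z (edir ds) (fun z => G z.2) 0.
Proof.
apply/is_derive_line0.
have -> : (fun h : R => G (h *: (edir ds : Z) + z).2) = cst (G z.2).
  by apply/funext => h /=; rewrite scaler0 add0r.
exact: is_derive_cst.
Qed.

End slices.

Section diagonal_sums.
Context {R : realType} {W : lmodType R}.

Lemma sum_cometric (C : 'I_2 -> 'I_2 -> W) (x : R * R) :
  \sum_(i < 2) \sum_(j < 2) cometric i j x *: C i j =
  \sum_(i < 2) cometric i i x *: C i i.
Proof.
apply: eq_bigr => i _; rewrite (bigD1 i)//= [X in _ + X]big1 ?addr0// => j ji.
by rewrite cometric_neq 1?eq_sym// scale0r.
Qed.

Lemma sum_cometric_chris (F : 'I_2 -> W) (x : R * R) :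
  \sum_(i < 2) \sum_(j < 2) \sum_(k < 2) (cometric i j x * chris k i j x) *: F k =
  \sum_(i < 2) \sum_(k < 2) (cometric i i x * chris k i i x) *: F k.
Proof.
apply: eq_bigr => i _; rewrite (bigD1 i)//= [X in _ + X]big1 ?addr0// => j ji.
by rewrite big1// => k _; rewrite cometric_neq 1?eq_sym// mul0r scale0r.
Qed.

End diagonal_sums.

Lemma Lap_diag {R : realType} {W : normedModType R} (f : R * R -> W) (x : R * R) :
  Lap f x = \sum_(i < 2) cometric i i x *:
    (pd i (pd i f) x - \sum_(k < 2) chris k i i x *: pd k f x).
Proof.
exact: (sum_cometric (fun i j => pd i (pd j f) x
  - \sum_(k < 2) chris k i j x *: pd k f x)).
Qed.

Lemma is_derive_sum_ord {R : realType} {V W : normedModType R} n (F : 'I_n -> V -> W)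
    z v dF : (forall i, is_derive z v (F i) (dF i)) ->
  is_derive z v (fun y => \sum_(i < n) F i y) (\sum_(i < n) dF i).
Proof.
move=> H; have -> : (fun y => \sum_(i < n) F i y) = \sum_(i < n) F i.
  by apply/funext => y; rewrite fct_sumE.
exact: is_derive_sum.
Qed.

Lemma frame_coord_curv {R : realType} (D : set (R * R * (R * R)))
    (U : R * R * (R * R) -> R * R) (Om : 'I_2 -> R * R * (R * R) -> 'cV[R]_2)
    (z : R * R * (R * R)) (X Y Z : 'cV[R]_2) :
  (forall z i j, D z -> inner (U z) (Om i z) (Om j z) = (i == j)%:R) -> D z ->
  frame_coord U Om z (curv (U z) X Y Z) =
  wedge id (frame_coord U Om z X) (frame_coord U Om z Y) (frame_coord U Om z Z).
Proof.
move=> on Dz; rewrite /wedge.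
rewrite -(frame_coord_inner on X Z Dz) -(frame_coord_inner on Y Z Dz) /curv.
move: (inner (U z) X Z) (inner (U z) Y Z) => a b.
by apply/colP => k; rewrite !mxE !innerE !mxE; ring.
Qed.

(** * Commutation with D_s and the equation for the heat tension field *)

Section heat_tension.
Context {R : realType}.
Local Notation Z := (R * R * (R * R))%type.
Variables (D : set Z) (oD : open D) (U : Z -> R * R) (Om : 'I_2 -> Z -> 'cV[R]_2).
Hypothesis U3 : forall k, Cn (@edir R) D 3 (crd k \o U).
Hypothesis Om2 : forall j k, Cn (@edir R) D 2 (fun z => Om j z k 0).
Hypothesis Om_on : forall z i j, D z -> inner (U z) (Om i z) (Om j z) = (i == j)%:R.
Hypothesis As0 : forall z, D z -> conn U Om ds z = 0.
Local Notation der a f := ('D_(edir a) f).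
Local Notation Phi a := (phi U Om a).
Local Notation A a := (conn U Om a).

Let phi2 a : mxCn (@edir R) D 2 (Phi a).
Proof. by move=> i j; rewrite ord1; exact: Cn_phi. Qed.

Let conn1 a : mxCn (@edir R) D 1 (A a).
Proof. by move=> i j; exact: Cn_conn. Qed.

(** Since A_s = 0, the symmetry D_s phi_a = D_a phi_s has a plain derivative on the left. *)
Let ds_phi a z : D z -> der ds (Phi a) z = der a (Phi ds) z + A a z *m Phi ds z.
Proof.
move=> Dz; apply: (etrans _ (@Dcov_phi_sym R D oD U Om U3 Om2 Om_on ds a z Dz)).
have A0 : A ds z *m Phi a z = 0 by rewrite (As0 Dz) mul0mx.
exact: (esym (etrans (congr1 (fun v => der ds (Phi a) z + v) A0) (addr0 _))).
Qed.

(** Since A_s vanishes on an open set, its derivatives vanish too and the curvature identity is a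
    formula for d_s A_a alone. *)
Let ds_conn a z (v : 'cV[R]_2) : D z ->
  der ds (A a) z *m v = wedge id (Phi ds z) (Phi a z) v.
Proof.
move=> Dz; apply/colP => k; rewrite mxE sum_ord2.
have E j : der ds (A a) z k j = Phi ds z j 0 * Phi a z k 0 - Phi a z j 0 * Phi ds z k 0.
  apply: (etrans (mxCn_entry ds k j (conn1 a) Dz)).
  apply: (etrans _ (@conn_curvature R D oD U Om U3 Om2 Om_on ds a j k z Dz)).
  have N : \near z, A ds z k j = cst 0 z.
    by apply: filterS (open_nbhs_nbhs (conj oD Dz)) => y Dy; rewrite (As0 Dy) mxE.
  have N0 := etrans (near_eq_derive (edir a) N) (derive_cst _ _ _).
  exact: (esym (etrans (congr1 (fun t => _ - t) N0) (subr0 _))).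
move: E; move: (der ds (A a) z) (Phi ds z) (Phi a z) => M x y E.
by rewrite !E /wedge /dotp !mxE !sum_ord2; ring.
Qed.

Lemma ds_derive_phi a z : D z ->
  der ds (der a (Phi a)) z = der a (der a (Phi ds)) z
    + (der a (A a) z *m Phi ds z + A a z *m der a (Phi ds) z).
Proof.
move=> Dz; apply: (etrans (mxCn_derive_commute oD ds a (phi2 a) Dz)).
have N : \near z, der ds (Phi a) z = der a (Phi ds) z + A a z *m Phi ds z.
  by apply: filterS (open_nbhs_nbhs (conj oD Dz)) => y; exact: ds_phi.
apply: (etrans (near_eq_derive _ N)).
have H1 := mxCn_derive a (mxCn_pd oD a (phi2 ds)) Dz.
have H2 := is_derive_mulmx (mxCn_derive a (conn1 a) Dz) (mxCn_derive a (phi2 ds) Dz).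
by have [_ ->] := is_derive_add H1 H2.
Qed.

Lemma ds_Dcov_phi a z : D z -> is_derive z (edir ds) (Dcov U Om a (Phi a))
  (der ds (der a (Phi a)) z + (wedge id (Phi ds z) (Phi a z) (Phi a z)
     + A a z *m (der a (Phi ds) z + A a z *m Phi ds z))).
Proof.
move=> Dz; rewrite -(ds_conn a _ Dz) -(ds_phi a Dz).
have H1 := mxCn_derive ds (mxCn_pd oD a (phi2 a)) Dz.
have H2 := is_derive_mulmx (mxCn_derive ds (conn1 a) Dz) (mxCn_derive ds (phi2 a) Dz).
exact: is_derive_add H1 H2.
Qed.

(** The metric coefficients of the domain do not depend on s, so d_s passes through them and the two
    commutation formulas give every term. *)
Lemma ds_wave_tension z : D z -> der ds (wave_tension U Om) z =
  der ds (der dt (Phi dt)) z + (wedge id (Phi ds z) (Phi dt z) (Phi dt z)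
  + A dt z *m (der dt (Phi ds) z + A dt z *m Phi ds z))
  - \sum_(i < 2) cometric i i z.2 *: (der (dx i) (der (dx i) (Phi ds)) z
       + (der (dx i) (A (dx i)) z *m Phi ds z + A (dx i) z *m der (dx i) (Phi ds) z)
       + (wedge id (Phi ds z) (Phi (dx i) z) (Phi (dx i) z)
       + A (dx i) z *m (der (dx i) (Phi ds) z + A (dx i) z *m Phi ds z)))
  + \sum_(i < 2) \sum_(k < 2) (cometric i i z.2 * chris k i i z.2) *:
       (der (dx k) (Phi ds) z + A (dx k) z *m Phi ds z).
Proof.
move=> Dz.
have -> : wave_tension U Om = fun y => Dcov U Om dt (Phi dt) y
  - (\sum_(i < 2) cometric i i y.2 *: Dcov U Om (dx i) (Phi (dx i)) y)
  + (\sum_(i < 2) \sum_(k < 2) (cometric i i y.2 * chris k i i y.2) *: Phi (dx k) y).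
  apply/funext => y.
  apply: (congr2 (fun a b => Dcov U Om dt (Phi dt) y - a + b)).
    exact: (sum_cometric (fun i j => Dcov U Om (dx i) (Phi (dx j)) y)).
  exact: (sum_cometric_chris (fun k => Phi (dx k) y)).
have S (c : R * R -> R) := is_derive_dom_s c z.
have HC i := is_derive_scale (S (cometric i i))
  (is_derive_eq (ds_Dcov_phi (dx i) Dz)
     (congr1 (fun w => w + _) (ds_derive_phi (dx i) Dz))).
have HF i k := is_derive_scale (S (fun y => cometric i i y * chris k i i y))
  (is_derive_eq (mxCn_derive ds (phi2 (dx k)) Dz) (ds_phi (dx k) Dz)).
have [_ ->] := is_derive_add (is_derive_sub (ds_Dcov_phi dt Dz) (is_derive_sum_ord HC))
  (is_derive_sum_ord (fun i => is_derive_sum_ord (HF i))).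
by [].
Qed.

End heat_tension.

Lemma Wpoint_id {R : realType} (Q : R * R -> R * R) (Xi : 'I_2 -> R * R -> 'cV[R]_2)
    (x : R * R) (v : 'cV[R]_2) (dv : 'I_2 -> 'cV[R]_2) :
  Wpoint Q Xi id id x v dv = \sum_(i < 2) cometric i i x *:
    (- 2 *: (conn_inf Q Xi i x *m dv i)
      - conn_inf Q Xi i x *m (conn_inf Q Xi i x *m v)
      - wedge id v (phi_inf Q Xi i x) (phi_inf Q Xi i x)
      - (pd i (conn_inf Q Xi i) x
          - \sum_(k < 2) chris k i i x *: conn_inf Q Xi k x) *m v).
Proof. by apply: eq_bigr => i _; rewrite /= !map_mx_id. Qed.

Section caloric.
Context {R : realType}.
Local Notation Z := (R * R * (R * R))%type.

(** The limit frame [Xi] is arbitrary here: of the limit connection one needs the derivative of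
    A_i^inf in its own direction i, which gives that of A_i^con. *)
Lemma heat_tension_equation (T : R) (Q : R * R -> R * R)
    (Xi : 'I_2 -> R * R -> 'cV[R]_2) (u : R -> R * R -> R * R)
    (U : Z -> R * R) (Om : 'I_2 -> Z -> 'cV[R]_2) :
  (forall i x, derivable (conn_inf Q Xi i) x (ex i)) ->
  caloric_gauge T Q Xi u U Om ->
  forall (s t : R) (x : R * R), 0 < s -> 0 < t < T ->
  let z : Z := (s, t, x) in
  let phis : Z -> 'cV[R]_2 := phi U Om ds in
  let phis_slice : R * R -> 'cV[R]_2 := fun y => phis (s, t, y) in
  let At := conn U Om dt in
  let h (i : 'I_2) : R := cometric i i x in
  let Ainf (i : 'I_2) := conn_inf Q Xi i x in
  let Acon (i : 'I_2) (z' : Z) : 'M[R]_2 :=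
    conn U Om (dx i) z' - conn_inf Q Xi i z'.2 in
  let pinf (i : 'I_2) := phi_inf Q Xi i x in
  let pcon (i : 'I_2) : 'cV[R]_2 := phi U Om (dx i) z - phi_inf Q Xi i x in
  'D_(edir dt) (fun z' => 'D_(edir dt) phis z') z
    - Lap phis_slice x + Wreal Q Xi phis_slice x
  = - 2 *: (At z *m 'D_(edir dt) phis z)
    - At z *m (At z *m phis z)
    - 'D_(edir dt) At z *m phis z
    + 'D_(edir ds) (wave_tension U Om) z
    + frame_coord U Om z
        (curv (U z) (dmap U (edir dt) z) (dmap U (edir ds) z)
              (dmap U (edir dt) z))
    + 2 *: (\sum_(i < 2) h i *: (Acon i z *m 'D_(edir (dx i)) phis z))
    + \sum_(i < 2) h i *: (Acon i z *m (Ainf i *m phis z))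
    + \sum_(i < 2) h i *: (Ainf i *m (Acon i z *m phis z))
    + \sum_(i < 2) h i *: (Acon i z *m (Acon i z *m phis z))
    + \sum_(i < 2) h i *:
        (('D_(edir (dx i)) (Acon i) z
          - \sum_(k < 2) chris k i i x *: Acon k z) *m phis z)
    + \sum_(i < 2) h i *: wedge id (phis z) (pinf i) (pcon i)
    + \sum_(i < 2) h i *: wedge id (phis z) (pcon i) (pinf i)
    + \sum_(i < 2) h i *: wedge id (phis z) (pcon i) (pcon i).
Proof.
move=> Hinf cg s t x s0 tT z phis phis_slice At h Ainf Acon pinf pcon.
have oD := @open_gauge_domain R T.
have [U3 Om2] := (cg_regular_map cg, cg_regular_frame cg).
have Dz : gauge_domain T z by split.
have tT' y : gauge_domain T y -> [/\ 0 < y.1.1, 0 <= y.1.1 & 0 <= y.1.2 <= T].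
  by move=> [y0 /andP[y1 y2]]; split; rewrite ?ltW.
have Om_on y i j : gauge_domain T y -> inner (U y) (Om i y) (Om j y) = (i == j)%:R.
  by move=> /tT'[_ y0 y1]; case: y y0 y1 => -[a b] c; exact: (cg_orthonormal cg).
have As0 y : gauge_domain T y -> conn U Om ds y = 0.
  move=> /tT'[y0 _ y1]; apply/matrixP => k j; rewrite !mxE.
  have -> : nablaX U (Om j) (edir ds) y = 0.
    by case: y y0 y1 => -[a b] c; exact: (cg_parallel cg).
  by rewrite innerE !mxE !mul0r mulr0 addr0.
have phi2 a : mxCn (@edir R) (gauge_domain T) 2 (phi U Om a).
  by move=> i j; rewrite ord1; exact: Cn_phi.
have conn1 a : mxCn (@edir R) (gauge_domain T) 1 (conn U Om a).
  by move=> i j; exact: Cn_conn.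
have dAcon i : 'D_(edir (dx i)) (Acon i) z
    = 'D_(edir (dx i)) (conn U Om (dx i)) z - pd i (conn_inf Q Xi i) x.
  have H2 := is_derive_dom (z:=z) (derivableP (Hinf i x)).
  by have [_ ->] := is_derive_sub (mxCn_derive (dx i) (conn1 (dx i)) Dz) H2.
have pdE i y : pd i phis_slice y = 'D_(edir (dx i)) phis (s, t, y).
  exact: derive_slice.
have pd2E i y : pd i (pd i phis_slice) y
    = 'D_(edir (dx i)) ('D_(edir (dx i)) phis) (s, t, y).
  have -> : pd i phis_slice = fun y => 'D_(edir (dx i)) phis (s, t, y).
    by apply/funext => y'; exact: pdE.
  exact: derive_slice.
have LapE : Lap phis_slice x = \sum_(i < 2) h i *: (
    'D_(edir (dx i)) ('D_(edir (dx i)) phis) z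
    - \sum_(k < 2) chris k i i x *: 'D_(edir (dx k)) phis z).
  apply: (etrans (Lap_diag phis_slice x)); apply: eq_bigr => i _.
  apply: (congr1 (fun w => h i *: w)); apply: (congr2 (fun a b => a - b)).
    exact: pd2E.
  by apply: eq_bigr => k _; exact: (congr1 (fun w => _ *: w) (pdE k x)).
have WE : Wreal Q Xi phis_slice x = \sum_(i < 2) h i *:
    (- 2 *: (Ainf i *m 'D_(edir (dx i)) phis z) - Ainf i *m (Ainf i *m phis z)
      - wedge id (phis z) (pinf i) (pinf i)
      - (pd i (conn_inf Q Xi i) x - \sum_(k < 2) chris k i i x *: Ainf k) *m phis z).
  apply: (etrans (Wpoint_id _ _ _ _ _)).
  apply: eq_bigr => i _; apply: (congr1 (fun w => h i *: w)).
  exact: (congr1 (fun w => - 2 *: (Ainf i *m w) - _ - _ - _) (pdE i x)).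
have RE : frame_coord U Om z
        (curv (U z) (dmap U (edir dt) z) (dmap U (edir ds) z)
              (dmap U (edir dt) z)) = wedge id (phi U Om dt z) (phis z) (phi U Om dt z).
  exact: frame_coord_curv Om_on Dz.
have dst := @ds_derive_phi R _ oD U Om U3 Om2 Om_on As0 dt z Dz.
have dsW := @ds_wave_tension R _ oD U Om U3 Om2 Om_on As0 z Dz.
rewrite LapE WE.
have H := heat_tension_algebra (h:=h) (G:=fun k i => chris k i i x) pinf Ainf
  (fun i => pd i (conn_inf Q Xi i) x) dst dsW RE.
apply: (etrans H); do 3 apply: (congr1 (fun w => w + _)).
apply: (congr1 (fun w => _ + w)); apply: eq_bigr => i _.
exact: (congr1 (fun w => h i *: ((w - _) *m _)) (esym (dAcon i))).
Qed.

End caloric.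

(** * Integrals of real functions, square integrability, completeness of L^2 *)

Section real_integral.
Context {d : measure_display} {T : measurableType d} {R : realType}.
Variable mu : {measure set T -> \bar R}.
Implicit Types (f g : T -> R).

(** An integral that is infinite is sent to a default value by [Rintegral], so the linearity rules
    below always ask for [itg]. *)
Definition itg f : Prop := mu.-integrable setT (EFin \o f).

Lemma itg_measurable f : itg f -> measurable_fun setT f.
Proof. by move=> /(measurable_int mu)/measurable_EFinP. Qed.

Lemma itg_le f g : measurable_fun setT f -> (forall x, `|f x| <= g x) ->
  itg g -> itg f.
Proof.
move=> mf fg ig; apply: le_integrable ig => //; first exact/measurable_EFinP.
by move=> x _ /=; rewrite lee_fin (le_trans (fg x))// ler_norm.
Qed.

Lemma itgD f g : itg f -> itg g -> itg (fun x => f x + g x).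
Proof. by move=> If Ig; exact: (integrableD measurableT If Ig). Qed.

Lemma itgN f : itg f -> itg (fun x => - f x).
Proof. by move=> If; exact: (integrableN If). Qed.

Lemma itgB f g : itg f -> itg g -> itg (fun x => f x - g x).
Proof. by move=> If /itgN; exact: itgD. Qed.

Lemma itgZ (a : R) f : itg f -> itg (fun x => a * f x).
Proof. by move=> If; exact: (integrableZl measurableT a If). Qed.

Lemma itg0 : itg (fun=> 0).
Proof. exact: integrable0. Qed.

Lemma itg_abs f : itg f -> itg (fun x => `|f x|).
Proof. by move=> If; exact: (integrable_abse If). Qed.

Lemma itg_sum (I : Type) (r : seq I) (F : I -> T -> R) : (forall i, itg (F i)) ->
  itg (fun x => \sum_(i <- r) F i x).
Proof.
move=> H; elim: r => [|i r IH].
  by under eq_fun do rewrite big_nil; exact: itg0.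
by under eq_fun do rewrite big_cons; exact: itgD.
Qed.

Lemma IntD f g : itg f -> itg g ->
  \int[mu]_x (f x + g x) = \int[mu]_x f x + \int[mu]_x g x.
Proof. exact: RintegralD. Qed.

Lemma IntB f g : itg f -> itg g ->
  \int[mu]_x (f x - g x) = \int[mu]_x f x - \int[mu]_x g x.
Proof. exact: RintegralB. Qed.

Lemma IntZ (a : R) f : itg f -> \int[mu]_x (a * f x) = a * \int[mu]_x f x.
Proof. exact: RintegralZl. Qed.

Lemma IntN f : itg f -> \int[mu]_x (- f x) = - \int[mu]_x f x.
Proof.
move=> If; rewrite -mulN1r -IntZ//; apply: eq_Rintegral => x _.
by rewrite mulN1r.
Qed.

Lemma Int0 : \int[mu]_x (0 : R) = 0.
Proof. by rewrite /Rintegral integral0. Qed.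

Lemma Int_sum (I : Type) (r : seq I) (F : I -> T -> R) : (forall i, itg (F i)) ->
  \int[mu]_x (\sum_(i <- r) F i x) = \sum_(i <- r) \int[mu]_x F i x.
Proof.
move=> H; elim: r => [|i r IH].
  rewrite big_nil -[RHS]Int0.
  by apply: eq_Rintegral => x _; rewrite big_nil.
rewrite big_cons -IH -IntD//; last exact: itg_sum.
by apply: eq_Rintegral => x _; rewrite big_cons.
Qed.

Lemma eq_Int f g : f =1 g -> \int[mu]_x f x = \int[mu]_x g x.
Proof. by move=> fg; apply: eq_Rintegral => x _; exact: fg. Qed.

Lemma le_Int f g : itg f -> itg g -> (forall x, f x <= g x) ->
  \int[mu]_x f x <= \int[mu]_x g x.
Proof. by move=> If Ig fg; exact: le_Rintegral. Qed.

Lemma Int_ge0 f : (forall x, 0 <= f x) -> 0 <= \int[mu]_x f x.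
Proof. by move=> f0; exact: Rintegral_ge0. Qed.

Lemma Int_EFin f : itg f -> (\int[mu]_x (f x)%:E)%E = (\int[mu]_x f x)%:E.
Proof. by move=> If; rewrite /Rintegral fineK//; exact: integrable_fin_num. Qed.

Lemma itg_dct (F : nat -> T -> R) f g : (forall n, measurable_fun setT (F n)) ->
  itg g -> (forall n x, `|F n x| <= g x) ->
  (forall x, F ^~ x @ \oo --> f x) ->
  itg f /\ (fun n => \int[mu]_x F n x) @ \oo --> \int[mu]_x f x.
Proof.
move=> mF Ig Fg Ff.
have mf : measurable_fun setT f.
  by apply: measurable_fun_cvg mF _ => x _; exact: Ff.
have [|||||If _ c] := @dominated_convergence _ _ _ mu setT measurableT
  (fun n => EFin \o F n) (EFin \o f) (EFin \o g).
- by move=> n; exact/measurable_EFinP.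
- exact/measurable_EFinP.
- by apply: aeW => x _; apply: cvg_EFin; [exact: nearW|exact: Ff].
- exact: Ig.
- by apply: aeW => x n _ /=; rewrite lee_fin.
split; first exact: If.
rewrite /= (Int_EFin If) in c.
by move/fine_cvgP : c => [_ c]; exact: c.
Qed.

Lemma itg_ae f g : measurable_fun setT g -> itg f ->
  {ae mu, forall x, f x = g x} -> itg g.
Proof.
move=> mg If fg; apply/integrableP; split; first exact/measurable_EFinP.
have /integrableP[mf lt] := If; apply: le_lt_trans lt.
rewrite le_eqVlt; apply/orP; left; apply/eqP.
apply: ge0_ae_eq_integral => //.
- by apply: measurableT_comp => //; exact/measurable_EFinP.
- by apply: measurableT_comp => //.
- by apply: filterS fg => x /= -> _.
Qed.

Lemma Int_ae f g : measurable_fun setT f -> measurable_fun setT g ->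
  {ae mu, forall x, f x = g x} -> \int[mu]_x f x = \int[mu]_x g x.
Proof.
move=> mf mg fg; rewrite /Rintegral; congr fine; apply: ae_eq_integral => //.
- exact/measurable_EFinP.
- exact/measurable_EFinP.
- by apply: filterS fg => x /= -> _.
Qed.

Lemma Int_eq0_ae f : itg f -> (forall x, 0 <= f x) -> \int[mu]_x f x = 0 ->
  {ae mu, forall x, f x = 0}.
Proof.
move=> If f0 E.
have mf : measurable_fun setT (EFin \o f).
  by apply/measurable_EFinP; exact: itg_measurable.
have := (ae_eq_integral_abs mu measurableT mf).1.
have -> : (\int[mu]_x `|(EFin \o f) x| = \int[mu]_x (f x)%:E)%E.
  by apply: eq_integral => x _ /=; rewrite ger0_norm.
rewrite Int_EFin// E => /(_ erefl) H.
by apply: filterS H => x /= /(_ I) [].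
Qed.

Definition sqi f : Prop := measurable_fun setT f /\ itg (fun x => f x ^+ 2).

Lemma sqi_mul f g : sqi f -> sqi g -> itg (fun x => f x * g x).
Proof.
move=> [mf If] [mg Ig]; apply: itg_le (itgD If Ig).
  exact: measurable_funM.
move=> x; rewrite normrM -(real_normK (num_real (f x))) -(real_normK (num_real (g x))).
have := sqr_ge0 (`|f x| - `|g x|); rewrite sqrrB.
have := mulr_ge0 (normr_ge0 (f x)) (normr_ge0 (g x)).
by move: (`|f x|) (`|g x|) => a b ? ?; nra.
Qed.

Lemma sqiD f g : sqi f -> sqi g -> sqi (fun x => f x + g x).
Proof.
move=> If Ig; have [mf If2] := If; have [mg Ig2] := Ig; split.
  exact: measurable_funD.
have I := itgD (itgD If2 Ig2) (itgZ 2 (sqi_mul If Ig)).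
by apply: eq_integrable I => // x _ /=; congr EFin; ring.
Qed.

Lemma sqiZ (a : R) f : sqi f -> sqi (fun x => a * f x).
Proof.
move=> [mf If]; split; first exact: measurable_funM.
by apply: eq_integrable (itgZ (a ^+ 2) If) => // x _ /=; congr EFin; ring.
Qed.

Lemma sqiN f : sqi f -> sqi (fun x => - f x).
Proof.
move=> /(sqiZ (-1)) [m I]; split.
  by apply: eq_measurable_fun m => x _; rewrite mulN1r.
by apply: eq_integrable I => // x _ /=; congr EFin; ring.
Qed.

Lemma sqiB f g : sqi f -> sqi g -> sqi (fun x => f x - g x).
Proof. by move=> If /sqiN; exact: sqiD. Qed.

Lemma sqi0 : sqi (fun=> 0).
Proof.
split=> //; apply: eq_integrable itg0 => // x _ /=.
by rewrite expr0n.
Qed.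

Lemma sqi_sum (I : Type) (r : seq I) (F : I -> T -> R) : (forall i, sqi (F i)) ->
  sqi (fun x => \sum_(i <- r) F i x).
Proof.
move=> H; elim: r => [|i r IH].
  by under eq_fun do rewrite big_nil; exact: sqi0.
by under eq_fun do rewrite big_cons; exact: sqiD.
Qed.

Lemma sqi_le f g : measurable_fun setT f -> (forall x, `|f x| <= `|g x|) ->
  sqi g -> sqi f.
Proof.
move=> mf fg [_ Ig]; split=> //; apply: itg_le Ig.
  exact: measurable_funX.
move=> x; rewrite normrX -(real_normK (num_real (g x))).
by rewrite lerXn2r// nnegrE.
Qed.

Lemma sqi_bounded_mul (b f : T -> R) (M : R) : measurable_fun setT b ->
  (forall x, `|b x| <= M) -> sqi f -> sqi (fun x => b x * f x).
Proof.
move=> mb bM If; apply: sqi_le (sqiZ M If).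
  by apply: measurable_funM => //; case: If.
by move=> x; rewrite !normrM ler_wpM2r// (le_trans (bM x))// ler_norm.
Qed.

Lemma sqi_ae f g : measurable_fun setT g -> sqi f ->
  {ae mu, forall x, f x = g x} -> sqi g.
Proof.
move=> mg [mf If] fg; split=> //; apply: itg_ae If _.
  exact: measurable_funX.
by apply: filterS fg => x /= ->.
Qed.

End real_integral.

Section square_integrable_limits.
Context {d : measure_display} {T : measurableType d} {R : realType}.
Variable mu : {measure set T -> \bar R}.
Local Notation sqi := (sqi mu).
Local Notation itg := (itg mu).

Lemma sqi_fatou (F : nat -> T -> R) f c : (forall n, sqi (F n)) ->
  (forall n, \int[mu]_x (F n x ^+ 2) <= c) ->
  (forall x, F ^~ x @ \oo --> f x) -> sqi f /\ \int[mu]_x (f x ^+ 2) <= c.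
Proof.
move=> sF cF Ff.
have mf : measurable_fun setT f.
  by apply: measurable_fun_cvg (fun n => (sF n).1) _ => x _; exact: Ff.
have H : (\int[mu]_x (f x ^+ 2)%:E <= c%:E)%E.
  have mE n : measurable_fun setT (fun x => (F n x ^+ 2)%:E).
    by apply/measurable_EFinP; apply: measurable_funX; case: (sF n).
  have E0 n x : [set: T] x -> (0 <= (F n x ^+ 2)%:E)%E.
    by move=> _; rewrite lee_fin sqr_ge0.
  have := @fatou _ _ _ mu setT measurableT (fun n x => (F n x ^+ 2)%:E) mE E0.
  have -> : (\int[mu]_x limn_einf (fun n => (F n x ^+ 2)%:E) =
             \int[mu]_x (f x ^+ 2)%:E)%E.
    apply: eq_integral => x _.
    have C : (fun n => (F n x ^+ 2)%:E) @ \oo --> (f x ^+ 2)%:E.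
      apply: cvg_EFin; first exact: nearW.
      by apply: cvgM; exact: Ff.
    by have [-> _] := cvg_limn_einf_sup C.
  move=> /le_trans; apply; rewrite limn_einf_lim.
  apply: lime_le; first exact: is_cvg_einfs.
  apply: nearW => n.
  apply: (@le_trans _ _ (\int[mu]_x (F n x ^+ 2)%:E)%E).
    by apply: ereal_inf_lbound; exists n => //=.
  by rewrite (Int_EFin (sF n).2) lee_fin.
have If : itg (fun x => f x ^+ 2).
  apply/integrableP; split.
    by apply/measurable_EFinP; exact: measurable_funX.
  apply: (@le_lt_trans _ _ c%:E); last exact: ltry.
  apply: le_trans H; rewrite le_eqVlt; apply/orP; left; apply/eqP.
  by apply: eq_integral => x _ /=; rewrite ger0_norm// sqr_ge0.
by split; [split|rewrite (Int_EFin If) lee_fin in H].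
Qed.

(** The sum of 2^n |G_{n+1} - G_n|^2 has finite integral, hence is finite almost everywhere. There
    |y| <= 2^n y^2 + 2^{-n} makes the telescoping series absolutely convergent. *)
Lemma ae_cvg_fast (G : nat -> T -> R) : (forall n, sqi (G n)) ->
  (forall n, \int[mu]_x ((G n.+1 x - G n x) ^+ 2) <= (2^-1 ^+ n) ^+ 2) ->
  {ae mu, forall x, cvgn (G ^~ x)}.
Proof.
move=> sG cG.
pose a n x := 2 ^+ n * (G n.+1 x - G n x) ^+ 2.
have a0 n x : 0 <= a n x by apply: mulr_ge0; [exact: exprn_ge0|exact: sqr_ge0].
have sD n : sqi (fun x => G n.+1 x - G n x) by exact: sqiB.
have Ia n : itg (a n) by exact: itgZ (sD n).2.
have h01 : 0 <= 2^-1 :> R by rewrite invr_ge0.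
have h1 : `|2^-1| < 1 :> R by rewrite ger0_norm// invf_lt1// ltr1n.
have Sle n : \int[mu]_x a n x <= 2^-1 ^+ n.
  rewrite IntZ; last exact: (sD n).2.
  apply: (@le_trans _ _ (2 ^+ n * (2^-1 ^+ n) ^+ 2)).
    by rewrite ler_wpM2l// exprn_ge0.
  by rewrite expr2 mulrA -exprMn mulfV// expr1n mul1r.
have ma n : measurable_fun setT (fun x => (a n x)%:E).
  by apply/measurable_EFinP; exact: itg_measurable (Ia n).
have E0 n x : [set: T] x -> (0 <= (a n x)%:E)%E by rewrite lee_fin.
pose h x := (\sum_(n <oo) (a n x)%:E)%E.
have Ih : (\int[mu]_x h x < +oo)%E.
  rewrite /h (integral_nneseries mu measurableT ma E0).
  apply: (@le_lt_trans _ _ (\sum_(n <oo) (2^-1 ^+ n : R)%:E)%E).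
    apply: lee_nneseries => n _; first by rewrite Int_EFin// lee_fin Int_ge0.
    by rewrite Int_EFin// lee_fin.
  have C := @cvg_geometric_series R 1 2^-1 h1.
  rewrite (_ : (\sum_(n <oo) _)%E = (1 * (1 - 2^-1)^-1)%:E) ?ltry//.
  apply/cvg_lim => //.
  rewrite (_ : (fun n => _) = EFin \o series (geometric 1 2^-1)).
    by apply: cvg_EFin => //; exact: nearW.
  apply/funext => n /=; rewrite /series/= -sumEFin.
  by apply: eq_bigr => i _; rewrite /= mul1r.
have h0 x : (0 <= h x)%E by apply: nneseries_ge0 => n _ _; rewrite lee_fin.
have mh : measurable_fun setT h.
  by apply: ge0_emeasurable_sum => // n x _ _; rewrite lee_fin.
have Ihi : mu.-integrable setT h.
  apply/integrableP; split=> //; apply: le_lt_trans Ih.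
  by rewrite le_eqVlt; apply/orP; left; apply/eqP; apply: eq_integral => x _;
    rewrite gee0_abs.
apply: filterS (integrable_ae measurableT Ihi) => x /(_ I) hx.
have Ca : cvgn (series (a ^~ x)).
  apply: nondecreasing_is_cvgn.
    by apply: nondecreasing_series => n _ _; exact: a0.
  exists (fine (h x)) => _ [n _ <-].
  rewrite -lee_fin fineK// /series/= -sumEFin.
  by apply: nneseries_lim_ge => k _ _; rewrite lee_fin.
have Cv : cvgn (series (fun n => a n x + geometric 1 2^-1 n)).
  rewrite (_ : series _ = series (a ^~ x) + series (geometric 1 2^-1)).
    by apply: is_cvgD => //; exact: is_cvg_geometric_series.
  by apply/funext => n; rewrite /series/= big_split.
have Ct : cvgn (series (telescope (G ^~ x))).
  apply: normed_cvg; apply: series_le_cvg Cv => [n|n|n] /=.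
  - exact: normr_ge0.
  - by rewrite addr_ge0// mul1r exprn_ge0.
  rewrite mul1r /a /telescope /= -(real_normK (num_real (G n.+1 x - G n x))).
  have t0 : 0 < 2 ^+ n :> R by rewrite exprn_gt0.
  rewrite exprVn; move: (`|_|) (2 ^+ n) t0 => y t t0.
  rewrite -subr_ge0 (_ : _ - _ = t * (y - (2 * t)^-1) ^+ 2 + (3 / 4) * t^-1).
    apply: addr_ge0; apply: mulr_ge0; rewrite ?sqr_ge0 ?invr_ge0 ?(ltW t0)//.
  by field; rewrite gt_eqF.
rewrite (_ : G ^~ x = fun n => G 0%N x + series (telescope (G ^~ x)) n).
  by apply: is_cvgD => //; exact: is_cvg_cst.
by apply/funext => n; exact: eq_sum_telescope.
Qed.

(** A fast subsequence converges almost everywhere. Fatou's lemma for F_m minus that subsequence,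
    with m fixed, shows both that the limit is square integrable and that the whole sequence
    converges to it. *)
Lemma sqi_complete (F : nat -> T -> R) : (forall n, sqi (F n)) ->
  (forall e, 0 < e -> exists N, forall m n, (N <= m)%N -> (N <= n)%N ->
     \int[mu]_x ((F m x - F n x) ^+ 2) <= e) ->
  exists f, sqi f /\ forall e, 0 < e -> exists N, forall n, (N <= n)%N ->
     \int[mu]_x ((F n x - f x) ^+ 2) <= e.
Proof.
move=> sF cF.
have e0 k : 0 < (2^-1 ^+ k) ^+ 2 :> R by rewrite !exprn_gt0// invr_gt0.
have [N HN] := choice (fun k => cF _ (e0 k)).
(* Partial sums of the thresholds are increasing and still dominate each [N k]. *)
pose s k := (\sum_(i < k.+1) N i)%N.
have sN k : (N k <= s k)%N by rewrite /s big_ord_recr /= leq_addl.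
have sS k : (s k <= s k.+1)%N by rewrite /s [X in (_ <= X)%N]big_ord_recr leq_addr.
have smono : {homo s : m n / (m <= n)%N}.
  by apply: homo_leq => //; exact: leq_trans.
pose G k := F (s k).
have sG k : sqi (G k) by exact: sF.
have cG k : \int[mu]_x ((G k.+1 x - G k x) ^+ 2) <= (2^-1 ^+ k) ^+ 2.
  by apply: HN => //; exact: leq_trans (sN k) (sS k).
have [Z [mZ Z0 subZ]] := ae_cvg_fast sG cG.
(* Cancelling the functions on the exceptional null set makes them converge at every point, as
   [sqi_fatou] requires. *)
pose G' k x := \1_(~` Z) x * G k x.
have aeZ : {ae mu, forall x, ~ Z x}.
  by exists Z; split => // x /= /contrapT.
have mG' k : measurable_fun setT (G' k).
  apply: measurable_funM; last by case: (sG k).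
  by apply: measurable_indic; exact: measurableC.
have aeG : {ae mu, forall x, forall k, G k x = G' k x}.
  apply: filterS aeZ => x Zx k; rewrite /G' indicE mem_set ?mul1r//.
have sG' k : sqi (G' k).
  by apply: sqi_ae (sG k) _ => //; apply: filterS aeG => x; exact.
have CG' x : cvgn (G' ^~ x).
  have [Zx|Zx] := pselect (Z x).
    rewrite (_ : G' ^~ x = cst 0); first exact: is_cvg_cst.
    by apply/funext => k; rewrite /G' indicE memNset ?mul0r//= => /(_ Zx).
  rewrite (_ : G' ^~ x = G ^~ x).
    by apply: contrapT => Cx; apply: Zx; exact: subZ.
  by apply/funext => k; rewrite /G' indicE mem_set ?mul1r.
pose f x := limn (G' ^~ x).
have B m k : (N k <= m)%N -> sqi (fun x => F m x - f x) /\
    \int[mu]_x ((F m x - f x) ^+ 2) <= (2^-1 ^+ k) ^+ 2.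
  move=> Nm; apply: (@sqi_fatou (fun n x => F m x - G' (n + k)%N x)).
  - by move=> n; exact: sqiB.
  - move=> n; apply: le_trans (HN k m (s (n + k)%N) Nm _); last first.
      by apply: (leq_trans (sN k)); apply: smono; exact: leq_addl.
    rewrite le_eqVlt; apply/orP; left; apply/eqP.
    apply: Int_ae.
    + by apply: measurable_funX; case: (sqiB (sF m) (sG' (n + k)%N)).
    + by apply: measurable_funX; case: (sqiB (sF m) (sG (n + k)%N)).
    + by apply: filterS aeG => x Gx; rewrite -Gx.
  - move=> x; apply: cvgB; first exact: cvg_cst.
    by rewrite (cvg_shiftn k (G' ^~ x)); exact: CG'.
exists f; split.
  have [s1 _] := B (N 0%N) 0%N (leqnn _).
  have := sqiB (sF (N 0%N)) s1; congr sqi.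
  by apply/funext => x; rewrite opprB addrC subrK.
move=> e e_gt0.
have h1 : `|2^-1| < 1 :> R by rewrite ger0_norm ?invr_ge0// invf_lt1// ltr1n.
have : (fun k => (2^-1 ^+ k) ^+ 2 : R) @ \oo --> (0 : R).
  rewrite -[X in _ --> X](expr0n _ 2).
  have C : (fun k => 2^-1 ^+ k : R) @ \oo --> (0 : R) by exact: cvg_expr.
  by apply: cvgM.
move=> /cvgrPdist_lt/(_ _ e_gt0)[k _ /(_ k (leqnn _))] /=.
rewrite sub0r normrN ger0_norm ?sqr_ge0// => ke.
exists (N k) => n Nn; have [_ le] := B n k Nn.
exact: le_trans le (ltW ke).
Qed.

End square_integrable_limits.

(** * Riesz representation by minimisation *)

Lemma discriminant_le {R : realFieldType} (B d c : R) : 0 <= B -> 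
  (forall t, 0 <= B * t ^+ 2 + 2 * d * t + c) -> d ^+ 2 <= B * c.
Proof.
rewrite le_eqVlt => /orP[/eqP <-|B0] H.
  have [->|d0] := eqVneq d 0; first by rewrite expr0n mul0r.
  (* In the degenerate case B = 0 the affine function 2 d t + c takes the value -1 at this t. *)
  have := H (- (c + 1) / (2 * d)); rewrite mul0r add0r mulrA mulrC.
  by rewrite mulrA mulVf ?mulf_neq0// ?pnatr_eq0// mul1r opprD addrAC addNr; lra.
have := H (- d / B); rewrite -(pmulr_rge0 _ B0) => {}H.
rewrite -subr_ge0; apply: le_trans H _; rewrite le_eqVlt; apply/orP; left; apply/eqP.
by field; rewrite gt_eqF.
Qed.

(* The minimisation of [b v v - 2 l v]: by the parallelogram identity minimising
   sequences are Cauchy, and the minimiser represents [l]. *)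
Section riesz.
Context {R : realType} {V : lmodType R}.
Variables (S : V -> Prop) (b : V -> V -> R) (l : V -> R) (C : R).
Hypotheses (SD : forall v w, S v -> S w -> S (v + w))
  (SZ : forall a v, S v -> S (a *: v)) (S0 : S 0).
Hypotheses (bC : forall v w, b v w = b w v)
  (bD : forall u v w, S u -> S v -> S w -> b (u + v) w = b u w + b v w)
  (bZ : forall a v w, S v -> S w -> b (a *: v) w = a * b v w)
  (b0 : forall v, S v -> 0 <= b v v).
Hypotheses (lD : forall v w, S v -> S w -> l (v + w) = l v + l w)
  (lZ : forall a v, S v -> l (a *: v) = a * l v)
  (C0 : 0 <= C) (lC : forall v, S v -> l v ^+ 2 <= C * b v v).
Hypothesis complete : forall s : nat -> V, (forall n, S (s n)) ->
  (forall e, 0 < e -> exists N, forall m n, (N <= m)%N -> (N <= n)%N ->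
     b (s m - s n) (s m - s n) <= e) ->
  exists p, S p /\ forall e, 0 < e -> exists N, forall n, (N <= n)%N ->
     b (s n - p) (s n - p) <= e.

Let SN v : S v -> S (- v). Proof. by rewrite -scaleN1r; exact: SZ. Qed.
Let SB v w : S v -> S w -> S (v - w). Proof. by move=> Sv /SN; exact: SD. Qed.
Let bDr u v w : S u -> S v -> S w -> b w (u + v) = b w u + b w v.
Proof. by move=> *; rewrite bC bD// (bC u) (bC v). Qed.
Let bZr a v w : S v -> S w -> b w (a *: v) = a * b w v.
Proof. by move=> *; rewrite bC bZ// (bC v). Qed.

Let expand t v w : S v -> S w ->
  b (v + t *: w) (v + t *: w) = b v v + 2 * t * b v w + t ^+ 2 * b w w.
Proof.
move=> Sv Sw; have St := SZ t Sw; have Sd := SD Sv St.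
by rewrite bD// !bDr// !bZ// !bZr// (bC w v); ring.
Qed.

Lemma form_cauchy_schwarz v w : S v -> S w -> b v w ^+ 2 <= b w w * b v v.
Proof.
move=> Sv Sw; apply: discriminant_le => [|t]; first exact: b0.
have := b0 (SD Sv (SZ t Sw)); rewrite expand// => H.
by apply: le_trans H _; rewrite le_eqVlt; apply/orP; left; apply/eqP; ring.
Qed.

Let J v := b v v - 2 * l v.

Let J_lb v : S v -> - C <= J v.
Proof.
move=> Sv; have lv := lC Sv; have bv := b0 Sv; rewrite /J.
have [s [s0 ss]] : exists s, 0 <= s /\ s ^+ 2 = b v v.
  by exists (Num.sqrt (b v v)); rewrite sqr_sqrtr// sqrtr_ge0.
have [c [c0 cc]] : exists c, 0 <= c /\ c ^+ 2 = C.
  by exists (Num.sqrt C); rewrite sqr_sqrtr// sqrtr_ge0.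
have : `|l v| <= c * s.
  rewrite -(@ler_pXn2r _ 2)// ?nnegrE ?mulr_ge0// exprMn cc ss.
  by rewrite real_normK// num_real.
rewrite ler_norml => /andP[_ h]; rewrite -ss -cc.
have := sqr_ge0 (s - c); nra.
Qed.

Lemma riesz_representation : exists p, S p /\ forall v, S v -> b p v = l v.
Proof.
pose A := [set J v | v in S]; pose m := inf A.
have hA : has_inf A.
  split; first by exists (J 0), 0.
  by exists (- C) => _ [v Sv <-]; exact: J_lb.
have mJ v : S v -> m <= J v by move=> Sv; apply: ge_inf; [case: hA|exists v].
have e0 n : 0 < n.+1%:R^-1 :> R by rewrite invr_gt0.
have /choice[s Hs] : forall n, exists v, S v /\ J v < m + n.+1%:R^-1.
  by move=> n; have [_ [v Sv <-] lt] := inf_adherent (e0 n) hA; exists v.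
have Ss n : S (s n) by case: (Hs n).
have par u v : S u -> S v ->
    b (u - v) (u - v) = 2 * (J u + J v) - 4 * J (2^-1 *: (u + v)).
  move=> Su Sv; have Sd := SD Su Sv; rewrite -scaleN1r expand// /J.
  rewrite bZ// ?bZr//; last exact: SZ.
  rewrite bD// !bDr// lZ// lD// (bC v u); by field.
have cau e : 0 < e -> exists N, forall p q, (N <= p)%N -> (N <= q)%N ->
    b (s p - s q) (s p - s q) <= e.
  move=> e_gt0.
  have [N HN] : exists N : nat, 4 / N.+1%:R <= e.
    exists (Num.truncn (4 / e)); rewrite ler_pdivrMr// mulrC -ler_pdivrMr//.
    exact: ltW (truncnS_gt _).
  exists N => p q Np Nq; rewrite par//.
  have hp : J (s p) <= m + N.+1%:R^-1.
    apply: le_trans (ltW (Hs p).2) _; rewrite lerD2l lef_pV2 ?posrE//.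
    by rewrite ler_nat ltnS.
  have hq : J (s q) <= m + N.+1%:R^-1.
    apply: le_trans (ltW (Hs q).2) _; rewrite lerD2l lef_pV2 ?posrE//.
    by rewrite ler_nat ltnS.
  have hm := mJ _ (SZ 2^-1 (SD (Ss p) (Ss q))).
  move: hp hq hm HN; move: (J (s p)) (J (s q)) (J (_ *: _)) (N.+1%:R^-1) => *.
  by lra.
have [p [Sp Hp]] := complete Ss cau.
exists p; split=> // v Sv; apply/eqP; rewrite -subr_eq0 -normr_le0.
apply/ler_addgt0Pl => e e_gt0; rewrite addr0.
pose B := b v v + 1; have B0 : 0 < B by rewrite ltr_wpDl// b0.
have he : 0 <= e / 2 by rewrite divr_ge0// ltW.
have e2 : 0 < (e / 2) ^+ 2 / B by rewrite divr_gt0// exprn_gt0// divr_gt0.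
have [N1 HN1] := Hp _ e2.
have [N2 HN2] : exists N : nat, N.+1%:R^-1 <= (e / 2) ^+ 2 / B.
  exists (Num.truncn ((e / 2) ^+ 2 / B)^-1).
  by rewrite invf_ple ?posrE//; exact: ltW (truncnS_gt _).
pose n := maxn N1 N2.
have d1 : `|b (s n - p) v| <= e / 2.
  have := form_cauchy_schwarz (SB (Ss n) Sp) Sv => h.
  rewrite -(@ler_pXn2r _ 2)// ?nnegrE//.
  rewrite real_normK ?num_real//; apply: le_trans h _.
  apply: (@le_trans _ _ (B * ((e / 2) ^+ 2 / B))).
    by rewrite ler_pM ?b0//; [exact: SB|rewrite /B lerDl|exact: HN1 (leq_maxl _ _)].
  by rewrite mulrC divfK// gt_eqF.
(* An almost minimiser almost solves the Euler-Lagrange equation: J (s_n + t v) - J (s_n) + 1/(n+1)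
   is a non-negative quadratic in t, and its discriminant bounds (b (s_n) v - l v)^2 by b v v /
   (n+1). *)
have d2 : `|b (s n) v - l v| <= e / 2.
  rewrite -(@ler_pXn2r _ 2)// ?nnegrE//.
  rewrite real_normK ?num_real//.
  apply: (@le_trans _ _ (b v v * n.+1%:R^-1)).
    apply: discriminant_le => [|t]; first exact: b0.
    have := mJ _ (SD (Ss n) (SZ t Sv)); have := (Hs n).2.
    rewrite /J expand// lD// ?lZ//; last exact: SZ.
    rewrite -subr_gt0 => h1; rewrite -subr_ge0 => h2.
    apply: le_trans (addr_ge0 h2 (ltW h1)) _.
    by rewrite le_eqVlt; apply/orP; left; apply/eqP; ring.
  apply: (@le_trans _ _ (B * ((e / 2) ^+ 2 / B))).
    rewrite ler_pM ?b0 ?invr_ge0//; first by rewrite /B lerDl.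
    apply: le_trans HN2; rewrite lef_pV2 ?posrE// ler_nat ltnS.
    exact: leq_maxr.
  by rewrite mulrC divfK// gt_eqF.
have -> : b p v - l v = (b (s n) v - l v) - b (s n - p) v.
  rewrite -scaleN1r bD// ?bZ//; last exact: SZ.
  by ring.
apply: (le_trans (ler_normB _ _)); lra.
Qed.

End riesz.

(** * Fubini's theorem, Lebesgue measure on the plane, the volume density *)

Section real_fubini.
Context d1 d2 (T1 : measurableType d1) (T2 : measurableType d2) (R : realType).
Variable m1 : {sigma_finite_measure set T1 -> \bar R}.
Variable m2 : {sigma_finite_measure set T2 -> \bar R}.
Variable f : T1 * T2 -> R.
Hypothesis If : itg (m1 \x m2)%E f.
Hypothesis I2 : forall x, itg m2 (fun y => f (x, y)).
Hypothesis I1 : forall y, itg m1 (fun x => f (x, y)).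

Let F1 x : (\int[m2]_y (f (x, y))%:E)%E = (\int[m2]_y f (x, y))%:E.
Proof. exact: Int_EFin. Qed.

Let F2 y : (\int[m1]_x (f (x, y))%:E)%E = (\int[m1]_x f (x, y))%:E.
Proof. exact: Int_EFin. Qed.

Lemma itg_fubini1 : itg m1 (fun x => \int[m2]_y f (x, y)).
Proof.
by apply: eq_integrable (integrable_fubini_F If) => // x _; exact: F1.
Qed.

Lemma Int_fubini1 :
  \int[m1]_x \int[m2]_y f (x, y) = \int[(m1 \x m2)%E]_z f z.
Proof.
rewrite [RHS]/Rintegral -(integral12_prod_meas1 If); congr fine.
by apply: eq_integral => x _; rewrite -F1.
Qed.

Lemma Int_fubini2 :
  \int[m2]_y \int[m1]_x f (x, y) = \int[(m1 \x m2)%E]_z f z.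
Proof.
rewrite [RHS]/Rintegral -(integral21_prod_meas1 If); congr fine.
by apply: eq_integral => y _; rewrite -F2.
Qed.

End real_fubini.

Section plane_measure.
Context {R : realType}.
Local Notation plane := (mplane R).

(** An open set is the union of the countably many boxes with rational centre and half-side 1/(n+1)
    that it contains; [F q] discards the others. *)
Lemma open_measurable_plane (U : set (R * R)) : open U ->
  measurable (U : set plane).
Proof.
move=> oU.
pose B (q : rat * rat * nat) : set (R * R) :=
  [set x | x.1 \in `](ratr q.1.1 - q.2.+1%:R^-1), (ratr q.1.1 + q.2.+1%:R^-1)[%R /\
           x.2 \in `](ratr q.1.2 - q.2.+1%:R^-1), (ratr q.1.2 + q.2.+1%:R^-1)[%R].
pose F q := if pselect (B q `<=` U) then B q else set0.
have mB q : measurable (B q : set plane).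
  rewrite (_ : B q = [set` `](ratr q.1.1 - q.2.+1%:R^-1), (ratr q.1.1 + q.2.+1%:R^-1)[%R]
    `*` [set` `](ratr q.1.2 - q.2.+1%:R^-1), (ratr q.1.2 + q.2.+1%:R^-1)[%R])//.
  by apply: measurableX; exact: measurable_itv.
have -> : U = \bigcup_q F q.
  apply/seteqP; split; last first.
    by move=> x [q _]; rewrite /F; case: pselect => [BU /= /BU|].
  move=> x Ux; have /nbhs_ballP[e /= e0 eU] : nbhs x U by exact: open_nbhs_nbhs.
  have [n ne] : exists n : nat, 2 * n.+1%:R^-1 <= e.
    exists (Num.truncn (2 / e)); rewrite ler_pdivrMr// mulrC -ler_pdivrMr//.
    exact: ltW (truncnS_gt _).
  have n0 : 0 < n.+1%:R^-1 :> R by rewrite invr_gt0.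
  have pick (t : R) : exists q : rat, t - n.+1%:R^-1 < ratr q < t + n.+1%:R^-1.
    move: n0 => /=; move: (n.+1%:R^-1) => r r0.
    have /rat_in_itvoo[q] : t - r < t + r by lra.
    by rewrite in_itv /=; exists q.
  have [q1 q1P] := pick x.1; have [q2 q2P] := pick x.2.
  exists (q1, q2, n) => //; rewrite /F /B; case: pselect => /= [_|].
    rewrite !in_itv /=; move: q1P q2P; move: (n.+1%:R^-1) => r.
    by move=> /andP[h1 h2] /andP[h3 h4]; split; apply/andP; split; lra.
  case=> y /=; rewrite !in_itv /=; move: n0 ne q1P q2P.
  move: (n.+1%:R^-1) => r r0 re /andP[h1 h2] /andP[h3 h4] [/andP[y1 y2] /andP[y3 y4]].
  by apply: eU; split; rewrite /ball /= ltr_norml; apply/andP; split; lra.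
apply: countable_bigcupT_measurable; first exact: countableP.
by move=> q; rewrite /F; case: pselect => [?|?] /=; [exact: mB|exact: measurable0].
Qed.

Lemma continuous_measurable_plane (f : R * R -> R) : continuous f ->
  measurable_fun [set: plane] f.
Proof.
move=> /continuousP cf; apply: (measurability _ (RGenOpens.measurableE R)).
move=> _ [_ [a [b ->] <-]]; rewrite setTI; apply: open_measurable_plane.
exact/cf/interval_open.
Qed.

Definition box (M : R) : set plane := [set` `[- M, M]%R] `*` [set` `[- M, M]%R].

Lemma measurable_box M : measurable (box M).
Proof. by apply: measurableX; exact: measurable_itv. Qed.

Lemma leb2_box M : (@leb2 R (box M) < +oo)%E.
Proof.
have -> : leb2 (box M) = (@lebesgue_measure R [set` `[- M, M]%R]
    * @lebesgue_measure R [set` `[- M, M]%R])%E.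
  exact: (product_measure1E (@lebesgue_measure R) (@lebesgue_measure R)).
by rewrite !lebesgue_measure_itv /=; case: ifP => _; rewrite ?mule0 ?ltry.
Qed.

Lemma leb2_sigma_finite : sigma_finite setT (@leb2 R).
Proof.
exists (fun n => box n%:R); last by move=> n; split; [exact: measurable_box|exact: leb2_box].
apply/esym/seteqP; split=> // x _.
pose n := Num.truncn (`|x.1| + `|x.2|); exists n.+1 => //=.
have h : `|x.1| + `|x.2| < n.+1%:R by exact: truncnS_gt.
have := normr_ge0 x.1; have := normr_ge0 x.2 => h1 h2.
split; rewrite /= in_itv /= -ler_norml; lra.
Qed.

(** The same measure as [leb2], under a name to which the sigma-finite structure used by Fubini's
    theorem is attached. *)
Definition leb2_fun : set plane -> \bar R :=
  (@lebesgue_measure R \x @lebesgue_measure R)%E.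
HB.instance Definition _ := Measure.on leb2_fun.
HB.instance Definition _ := @Measure_isSigmaFinite.Build _ _ _
  leb2_fun leb2_sigma_finite.
Definition leb2s : {sigma_finite_measure set plane -> \bar R} := leb2_fun.

End plane_measure.

Section volume_density.
Context {R : realType}.
Local Notation plane := (mplane R).
Local Open Scope ereal_scope.

Let w (x : plane) : R := expR (- x.2).

Lemma measurable_snd_expR (c : R) :
  measurable_fun [set: plane] (fun x => expR (c * x.2)).
Proof.
apply: measurableT_comp; first exact: measurable_expR.
by apply: measurable_funM => //; exact: measurable_snd.
Qed.

Let mw : measurable_fun [set: plane] w.
Proof.
by apply: eq_measurable_fun (measurable_snd_expR (-1)) => x _; rewrite mulN1r.
Qed.

Import HBNNSimple.

(** Monotone convergence along one sequence of simple functions on both sides reduces the claim to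
    indicators of level sets, where it is the definition of [vol]. *)
Lemma integral_vol (f : plane -> \bar R) : (forall x, 0 <= f x) ->
  measurable_fun setT f ->
  \int[vol]_x f x = \int[leb2]_x (f x * (w x)%:E).
Proof.
move=> f0 mf; have w0 x : 0 <= (w x)%:E by rewrite lee_fin expR_ge0.
pose h := nnsfun_approx measurableT mf.
have -> : \int[vol]_x f x = lim (\int[vol]_x (EFin \o h n) x @[n --> \oo]).
  have fE x : f x = lim ((EFin \o h n) x @[n --> \oo]).
    by apply/esym/cvg_lim => //; exact: cvg_nnsfun_approx.
  under eq_integral => x _ do rewrite fE.
  apply: monotone_convergence => //.
  - by move=> n; apply/measurable_EFinP.
  - by move=> n x _ //=; rewrite lee_fin.
  - by move=> x _ a b ab; rewrite lee_fin; exact/lefP/nd_nnsfun_approx.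
have -> : \int[leb2]_x (f x * (w x)%:E) =
    lim (\int[leb2]_x ((EFin \o h n) x * (w x)%:E) @[n --> \oo]).
  have fg x : f x * (w x)%:E = lim (((EFin \o h n) x * (w x)%:E) @[n --> \oo]).
    by apply/esym/cvg_lim => //; apply: cvgeZr => //; exact: cvg_nnsfun_approx.
  under eq_integral => x _ do rewrite fg.
  apply: monotone_convergence => [//| | |].
  - move=> n; apply: emeasurable_funM; exact/measurable_EFinP.
  - by move=> n x _ /=; apply: mule_ge0 => //; rewrite lee_fin.
  - by move=> x _ a b ab/=; rewrite lee_wpmul2r// lee_fin; exact/lefP/nd_nnsfun_approx.
suff suf n : \int[leb2]_x ((EFin \o h n) x * (w x)%:E) = \int[vol]_x (EFin \o h n) x.
  by under [in RHS]eq_fun do rewrite suf.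
transitivity (\int[vol]_x
   (\sum_(y \in range (h n)) (y * \1_(h n @^-1` [set y]) x)%:E)); last first.
  by apply: eq_integral => t tE; rewrite /= fimfunE -fsumEFin.
have indich m r : measurable_fun [set: plane] (fun x => (r * \1_(h m @^-1` [set r]) x)%:E).
  by apply: (measurable_comp measurableT) => //; exact: measurable_funM.
rewrite ge0_integral_fsum//; last by move=> m y Ey; exact: nnfun_muleindic_ge0.
transitivity (\int[leb2]_x (\sum_(y \in range (h n))
    (y * \1_(h n @^-1` [set y]) x)%:E * (w x)%:E)).
  under [RHS]eq_integral => x xE.
    rewrite -ge0_mule_fsuml => [|y]; last exact: nnfun_muleindic_ge0.
    rewrite fsumEFin // -(fimfunE _ x); over.
  by [].
have mwE : measurable_fun [set: plane] (EFin \o w) by exact/measurable_EFinP.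
rewrite ge0_integral_fsum//; last 2 first.
  - by move=> y; apply: emeasurable_funM.
  - by move=> m y Ey; apply: mule_ge0 => //; rewrite EFinM nnfun_muleindic_ge0.
apply: eq_fsbigr => r rhn.
under [RHS]eq_integral do rewrite EFinM.
rewrite integralZl_indic_nnsfun => //.
under eq_integral do rewrite EFinM -muleA.
rewrite ge0_integralZl//.
- under eq_integral do rewrite muleC.
  rewrite (eq_integral ((EFin \o w) \_ (h n @^-1` [set r]))); last first.
    by move=> x xE; rewrite epatch_indic.
  by rewrite -integral_mkcond integral_indic// setIT.
- by apply: emeasurable_funM => //; exact/measurable_EFinP.
- by move=> x _; rewrite mule_ge0 ?lee_fin ?expR_ge0// indicE.
- by move: rhn; rewrite inE => -[x _ <-]; rewrite lee_fin.
Qed.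

Lemma itg_vol (f : plane -> R) : measurable_fun setT f ->
  itg vol f <-> itg leb2 (fun x => f x * w x)%R.
Proof.
move=> mf; have E : \int[vol]_x `|(f x)%:E| = \int[leb2]_x `|(f x * w x)%:E|.
  rewrite integral_vol//; last by apply: measurableT_comp => //; exact/measurable_EFinP.
  by apply: eq_integral => x _; rewrite /= normrM [(`|w x|)%R]ger0_norm ?expR_ge0.
split=> /integrableP[_ lt]; apply/integrableP; split.
- by apply/measurable_EFinP; exact: measurable_funM.
- by rewrite -E.
- exact/measurable_EFinP.
- by rewrite E.
Qed.

Lemma Int_vol (f : plane -> R) : measurable_fun setT f ->
  (\int[vol]_x f x = \int[leb2]_x (f x * w x))%R.
Proof.
move=> mf; rewrite /Rintegral; congr fine.
have mE : measurable_fun setT (EFin \o f) by exact/measurable_EFinP.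
rewrite integralE [RHS]integralE; congr (_ - _).
  rewrite integral_vol//; last exact: measurable_funepos.
  apply: eq_integral => x _; rewrite !funeposE -EFin_max -EFinM -EFin_max.
  by rewrite maxr_pMl ?expR_ge0// mul0r.
rewrite integral_vol//; last exact: measurable_funeneg.
apply: eq_integral => x _; rewrite !funenegE -EFin_max -EFinM -EFin_max.
by rewrite maxr_pMl ?expR_ge0// mul0r mulNr.
Qed.

(** The density is positive, so both measures have the same null sets. *)
Lemma ae_vol (P : set plane) : {ae vol, forall x, P x} <-> {ae leb2, forall x, P x}.
Proof.
have E (A : set plane) : measurable A -> vol A = 0 <-> leb2 A = 0.
  move=> mA; have volA : vol A = \int[leb2]_x ((\1_A x)%:E * (w x)%:E).
    rewrite -integral_vol; last 2 first.
    + by move=> x; rewrite lee_fin.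
    + by apply/measurable_EFinP; exact: measurable_indic.
    by rewrite integral_indic// setIT.
  have leA : leb2 A = \int[leb2]_x (\1_A x)%:E by rewrite integral_indic// setIT.
  have m1 : measurable_fun [set: plane] (fun x => (\1_A x)%:E : \bar R).
    by apply/measurable_EFinP; exact: measurable_indic.
  have m2 : measurable_fun [set: plane] (fun x => (\1_A x)%:E * (w x)%:E).
    by apply: emeasurable_funM => //; exact/measurable_EFinP.
  have g1 x : `|(\1_A x)%:E| = (\1_A x)%:E :> \bar R by rewrite gee0_abs ?lee_fin.
  have g2 x : `|(\1_A x)%:E * (w x)%:E| = (\1_A x)%:E * (w x)%:E.
    by rewrite gee0_abs// mule_ge0 ?lee_fin ?expR_ge0.
  have := ae_eq_integral_abs leb2 measurableT m1.
  have := ae_eq_integral_abs leb2 measurableT m2.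
  under eq_integral do rewrite g2.
  under [in X in _ -> X -> _]eq_integral do rewrite g1.
  rewrite -volA -leA => -> ->; split; apply: filterS => x H /H /=.
    by move=> /eqP; rewrite mule_eq0 => /orP[/eqP //|/eqP[/eqP]]; rewrite gt_eqF ?expR_gt0.
  by move=> ->; rewrite mul0e.
by split=> -[N [mN N0 sN]]; exists N; split=> //; apply/(E _ mN).
Qed.

End volume_density.

Section leb2_vol.
Context {R : realType}.
Local Notation plane := (mplane R).

(** Multiplication by the square root of the density is an isometry between the two L^2 spaces. *)
Lemma sqi_vol (f : plane -> R) :
  sqi vol f <-> sqi leb2 (fun x => f x * expR (- 2^-1 * x.2)).
Proof.
have E x : expR (- 2^-1 * x) ^+ 2 = expR (- x) :> R.
  by rewrite expr2 -expRD; congr expR; field.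
have mE := @measurable_snd_expR R (- 2^-1).
split=> -[mf If].
  split; first exact: measurable_funM.
  apply: eq_integrable ((itg_vol (measurable_funX 2 mf)).1 If) => // x _ /=.
  by rewrite exprMn E.
have {}mf : measurable_fun setT f.
  apply: eq_measurable_fun (measurable_funM mf (@measurable_snd_expR R 2^-1)) => x _ /=.
  by rewrite -mulrA -expRD mulNr addNr expR0 mulr1.
split=> //; apply/itg_vol; first exact: measurable_funX.
by apply: eq_integrable If => // x _ /=; rewrite exprMn E.
Qed.

End leb2_vol.

(** * Smooth functions of compact support and their integration by parts *)

Section flat_functions.
Context {R : realType}.
Implicit Types (P : {poly R}) (t s : R).

(** This is the k-th power of s exp(- s/k) <= k, which follows from x <= exp x at x = s/k. *)
Lemma exprn_expRN_le k s : 0 <= s -> s ^+ k * expR (- s) <= k%:R ^+ k.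
Proof.
case: k => [|k] s0.
  by rewrite !expr0 mul1r expRN invf_le1 ?expR_gt0// -expR0 ler_expR.
have k0 : 0 < k.+1%:R :> R by [].
have h : s * expR (- (s / k.+1%:R)) <= k.+1%:R.
  rewrite expRN ler_pdivrMr ?expR_gt0// mulrC -ler_pdivrMr//.
  by apply: le_trans (expR_ge1Dx _); rewrite lerDr.
have -> : expR (- s) = expR (- (s / k.+1%:R)) ^+ k.+1.
  by rewrite -expRM_natl; congr expR; rewrite mulrN mulrCA divff ?mulr1 ?gt_eqF.
rewrite -exprMn lerXn2r// nnegrE ?mulr_ge0 ?expR_ge0//.
Qed.

Lemma horner_expRN_bounded P : exists C, forall s, 0 <= s -> `|P.[s]| * expR (- s) <= C.
Proof.
elim/poly_ind: P => [|P c _].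
  by exists 0 => s _; rewrite horner0 normr0 mul0r.
move: (P * 'X + c%:P) => {}P.
exists (\sum_(i < size P) `|P`_i| * i%:R ^+ i) => s s0.
rewrite horner_coef; apply: le_trans (_ : (\sum_(i < size P) `|P`_i * s ^+ i|) * expR (- s) <= _).
  by rewrite ler_wpM2r ?expR_ge0// ler_norm_sum.
rewrite mulr_suml; apply: ler_sum => i _.
rewrite normrM -mulrA ler_wpM2l// ger0_norm ?exprn_ge0//.
exact: exprn_expRN_le.
Qed.

(** Allowing any polynomial in 1/t in front of exp(- 1/t) makes the family stable under
    differentiation, so that smoothness is a direct induction. *)
Definition flat P t : R := if 0 < t then P.[t^-1] * expR (- t^-1) else 0.

Lemma flat_le_sqr P : exists C, forall t, `|flat P t| <= C * t ^+ 2.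
Proof.
have [C HC] := horner_expRN_bounded ('X^2 * P).
have C0 : 0 <= C by apply: le_trans (HC 0 (lexx _)); rewrite mulr_ge0 ?expR_ge0.
exists C => t; rewrite /flat; case: ifPn => [t0|_]; last first.
  by rewrite normr0 mulr_ge0// sqr_ge0.
have := HC t^-1; rewrite invr_ge0 ltW// => /(_ isT).
rewrite hornerM hornerXn normrM -mulrA (ger0_norm (sqr_ge0 _)) exprVn.
rewrite mulrC ler_pdivrMr ?exprn_gt0// normrM => H; apply: le_trans _ H.
by rewrite ler_wpM2l// ger0_norm ?expR_ge0.
Qed.

Lemma is_derive_horner P t : is_derive t 1 (horner P) P^`().[t].
Proof.
split; first exact: derivable_horner.
by rewrite derivE derive1E.
Qed.

(** For t > 0 this is the chain rule. At 0 the bound of [flat_le_sqr] makes the difference quotient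
    O(t). *)
Lemma is_derive_flat P t : is_derive t 1 (flat P) (flat ('X^2 * (P - P^`())) t).
Proof.
have [t0|t0|<-] := ltgtP 0 t.
- have nz : t != 0 by rewrite gt_eqF.
  apply: (@near_eq_is_derive _ _ _ (fun t => P.[t^-1] * expR (- t^-1))).
    near=> y; rewrite /flat; have -> // : 0 < y by near: y; exact: lt_nbhsr.
  have Dinv : is_derive t 1 (fun y : R => y^-1) (- t ^- 2).
    have Hid : is_derive t 1 (@idfun R) 1 by exact: is_derive_id.
    have d1 : derivable (@idfun R) t 1 by case: Hid.
    have e1 : 'D_1 (@idfun R) t = 1 by case: Hid.
    split; first exact: (@derivableV _ _ (@idfun R) t 1 nz d1).
    by rewrite (@deriveV _ _ (@idfun R) t 1 nz d1) e1 [_ *: _]mulr1.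
  have D1 := is_derive_comp1 Dinv (is_derive_horner P t^-1).
  have D2 := is_derive_comp1 (is_derive_opp Dinv) (is_derive_expR (- t^-1)).
  apply: (is_derive_eq (is_derive_mul D1 D2)).
  rewrite /flat t0 hornerM hornerXn !hornerE /=.
  move: (expR _) (P.[_]) (_.[_]) => a b c; rewrite exprVn; field.
  exact: nz.
- apply: (@near_eq_is_derive _ _ _ (cst 0)).
    near=> y; rewrite /flat; have -> // : (0 < y) = false.
    by apply/negbTE; rewrite -leNgt ltW//; near: y; exact: lt_nbhsl.
  rewrite /flat ltNge ltW//=; exact: is_derive_cst.
- have [C HC] := flat_le_sqr P.
  rewrite {2}/flat ltxx.
  have L : (fun h : R => h^-1 *: ((flat P \o shift 0) (h *: 1) - flat P 0)) @ 0^' --> (0 : R).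
    apply/cvgrPdist_le => e e0.
    have C1 : 0 < `|C| + 1 by rewrite ltr_wpDl.
    near=> h; rewrite /= /shift addr0 [h *: 1]mulr1 {2}/flat ltxx subr0 sub0r normrN.
    have h0 : h != 0 by near: h; exact: nbhs_dnbhs_neq.
    rewrite normrM normfV ler_pdivrMl ?normr_gt0//.
    apply: le_trans (HC h) _; apply: (@le_trans _ _ ((`|C| + 1) * `|h| ^+ 2)).
      rewrite real_normK ?num_real// ler_wpM2r ?sqr_ge0//.
      by rewrite (le_trans (ler_norm C))// lerDl.
    rewrite expr2 mulrCA ler_wpM2l// -ler_pdivlMl// mulrC.
    rewrite ltW//; near: h; apply: dnbhs0_lt; exact: divr_gt0.
  split; first by apply/cvg_ex; exists 0; exact: L.
  exact/cvg_lim/L.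
Unshelve. all: by end_near. Qed.

Lemma Cn_flat n P : Cn (fun _ : unit => 1 : R) setT n (flat P).
Proof.
have c Q : continuous (flat Q).
  move=> t; apply/differentiable_continuous/derivable1_diffP.
  by have [] := is_derive_flat Q t.
elim: n P => [|n IH] P; split=> //; try by move=> z _; exact: c.
move=> _; split; first by move=> z _; have [] := is_derive_flat P z.
apply: (Cn_ext openT) (IH _) => z _; by have [_ ->] := is_derive_flat P z.
Qed.

End flat_functions.

Section test_functions.
Context {R : realType}.
Local Notation plane := (mplane R).
Implicit Types (f g chi : R * R -> R).

Lemma smooth_cst (c : R) : smooth (fun=> c).
Proof. by move=> n; exact: (Cn_cst _ openT). Qed.

Lemma smoothM f g : smooth f -> smooth g -> smooth (fun x => f x * g x).
Proof. by move=> sf sg n; apply: (CnM openT). Qed.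

Lemma smoothD f g : smooth f -> smooth g -> smooth (fun x => f x + g x).
Proof. by move=> sf sg n; apply: (CnD openT). Qed.

Lemma smooth_ext f g : f =1 g -> smooth f -> smooth g.
Proof. by move=> /funext ->. Qed.

Lemma smooth_pd i f : smooth f -> smooth (pd i f).
Proof. by move=> sf n; exact: Cn_pd (sf n.+1). Qed.

Lemma smooth_continuous f : smooth f -> continuous f.
Proof. by move=> sf x; exact: Cn_continuous (sf 0%N) I. Qed.

Lemma smooth_derivable f i x : smooth f -> derivable f x (ex i).
Proof. by move=> sf; exact: (Cn_derivable (i := i) (sf 1%N) I). Qed.

Lemma smooth_is_derive f i x : smooth f -> is_derive x (ex i) f (pd i f x).
Proof. by move=> sf; apply: DeriveDef => //; exact: smooth_derivable. Qed.

Lemma smooth_measurable f : smooth f -> measurable_fun [set: plane] f.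
Proof. by move=> /smooth_continuous; exact: continuous_measurable_plane. Qed.

Lemma pdM f g i x : smooth f -> smooth g ->
  pd i (fun y => f y * g y) x = pd i f x * g x + f x * pd i g x.
Proof.
move=> sf sg.
by have [_] := is_derive_mul (smooth_is_derive i x sf) (smooth_is_derive i x sg).
Qed.

Lemma smooth_comp_affine (g : R -> R) (L : R * R -> R) (c : 'I_2 -> R) :
  (forall n, Cn (fun _ : unit => 1 : R) setT n g) -> continuous L ->
  (forall i z (t : R), L (t *: ex i + z) = t * c i + L z) -> smooth (g \o L).
Proof.
move=> sg cL hL n; apply: (@Cn_comp _ _ _ _ _ openT n L) => //.
exact: (@Cn_affine _ _ _ _ _ openT n L c).
Qed.

Lemma boxP M (x : R * R) : box M x <-> `|x.1| <= M /\ `|x.2| <= M.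
Proof. by rewrite /box /= !in_itv /= !ler_norml. Qed.

Lemma box_le M M' (x : R * R) : M <= M' -> box M x -> box M' x.
Proof. by move=> MM /boxP[h1 h2]; apply/boxP; split; exact: le_trans MM. Qed.

Lemma box_compact M : compact (box M : set (R * R)).
Proof. by apply: compact_setX; exact: segment_compact. Qed.

Lemma box_closed M : closed (box M : set (R * R)).
Proof. by apply: compact_closed; [exact: norm_hausdorff|exact: box_compact]. Qed.

Lemma compact_box (K : set (R * R)) : compact K -> exists M, K `<=` box M.
Proof.
move=> /compact_bounded[M [_ HM]]; exists (`|M| + 1) => x Kx.
have := HM (`|M| + 1) _ x Kx; rewrite (le_lt_trans (ler_norm M)) ?ltrDl// => /(_ isT).
rewrite /= prod_normE ge_max => /andP[h1 h2].
exact/boxP.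
Qed.

Definition csupp f := exists M, forall x, ~ box M x -> f x = 0.

(** Trades compactness of the closed support for vanishing off a box, a condition that passes at
    once to products, sums and derivatives. *)
Lemma test_functionP chi : test_function chi <-> smooth chi /\ csupp chi.
Proof.
split=> -[sc]; [move=> cc|move=> [M HM]]; split=> //.
  have [M HM] := compact_box cc; exists M => x nx.
  apply/eqP/negP => /negP h; apply: nx; apply: HM; exact: subset_closure.
apply: (subclosed_compact (@closed_closure _ _) (box_compact (M := M))).
rewrite closureE => x; apply; split; first exact: box_closed.
by move=> y /= hy; apply: contrapT => /HM /eqP; exact/negP.
Qed.

Lemma csuppM f g : csupp g -> csupp (fun x => f x * g x).
Proof. by move=> [M HM]; exists M => x /HM ->; rewrite mulr0. Qed.

Lemma csuppD f g : csupp f -> csupp g -> csupp (fun x => f x + g x).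
Proof.
move=> [M HM] [N HN]; exists (Num.max M N) => x nx.
rewrite HM ?HN ?addr0// => b; apply: nx; apply: box_le b.
  by rewrite le_max lexx orbT.
by rewrite le_max lexx.
Qed.

Lemma pd_box0 f i M (x : R * R) :
  (forall y : R * R, ~ box M y -> f y = 0) -> ~ box M x -> pd i f x = 0.
Proof.
move=> HM nx; rewrite /pd.
have H : is_derive x (ex i) f 0.
  have K : is_derive x (ex i) (cst (0 : R) : R * R -> R) (0 : R) := is_derive_cst _ _ _.
  apply: (near_eq_is_derive _ K).
  have oC : open (~` (box M : set (R * R))) by apply: closed_openC; exact: box_closed.
  have : \forall y \near x, (~` (box M : set (R * R))) y by exact: open_nbhs_nbhs.
  by apply: filterS => y /HM ->.
by have [_ ->] := H.
Qed.

Lemma csupp_pd f i : csupp f -> csupp (pd i f).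
Proof. by move=> [M HM]; exists M => x; exact: pd_box0. Qed.

Lemma testM f chi : smooth f -> test_function chi -> test_function (fun x => f x * chi x).
Proof.
move=> sf /test_functionP[sc cc]; apply/test_functionP; split; first exact: smoothM.
exact: csuppM.
Qed.

Lemma testD chi1 chi2 : test_function chi1 -> test_function chi2 ->
  test_function (fun x => chi1 x + chi2 x).
Proof.
move=> /test_functionP[s1 c1] /test_functionP[s2 c2]; apply/test_functionP.
by split; [exact: smoothD|exact: csuppD].
Qed.

Lemma testZ (a : R) chi : test_function chi -> test_function (fun x => a * chi x).
Proof. by move=> tc; apply: testM => //; exact: smooth_cst. Qed.

Lemma test0 : test_function (fun=> 0 : R).
Proof. by apply/test_functionP; split; [exact: smooth_cst|exists 0]. Qed.

Lemma test_sum (J : Type) (r : seq J) (F : J -> R * R -> R) :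
  (forall j, test_function (F j)) -> test_function (fun x => \sum_(j <- r) F j x).
Proof.
move=> H; elim: r => [|j r IH].
  by rewrite (_ : (fun _ => _) = fun=> 0) ?funeqE// => [|x]; [exact: test0|rewrite big_nil].
rewrite (_ : (fun _ => _) = fun x => F j x + \sum_(j <- r) F j x); first exact: testD.
by apply/funext => x; rewrite big_cons.
Qed.

Lemma test_ext f g : f =1 g -> test_function f -> test_function g.
Proof. by move=> /funext ->. Qed.

Lemma test_pd i chi : test_function chi -> test_function (pd i chi).
Proof.
move=> /test_functionP[sc cc]; apply/test_functionP.
by split; [exact: smooth_pd|exact: csupp_pd].
Qed.

Lemma test_smooth chi : test_function chi -> smooth chi.
Proof. by case. Qed.

Lemma test_continuous chi : test_function chi -> continuous chi.
Proof. by move=> /test_smooth /smooth_continuous. Qed.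

Lemma test_measurable chi : test_function chi -> measurable_fun [set: plane] chi.
Proof. by move=> /test_smooth /smooth_measurable. Qed.

Lemma continuous_box_bounded f (M : R) : continuous f ->
  exists2 C : R, 0 <= C & forall x, box M x -> `|f x| <= C.
Proof.
move=> cf; have : compact (f @` (box M : set (R * R))).
  apply: continuous_compact; last exact: box_compact.
  exact: continuous_subspaceT.
move=> /compact_bounded[C [_ HC]]; exists (`|C| + 1); first by rewrite addr_ge0.
move=> x bx; apply: (HC (`|C| + 1)); last by exists x.
by rewrite (le_lt_trans (ler_norm C)) ?ltrDl.
Qed.

Lemma csupp_bounded f : continuous f -> csupp f ->
  exists2 C : R, 0 <= C & forall x, `|f x| <= C.
Proof.
move=> cf [M HM]; have [C C0 HC] := continuous_box_bounded M cf; exists C => // x.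
by have [/HC//|/HM ->] := pselect (box M x); rewrite normr0.
Qed.

Lemma itg_indic_box M : itg (@leb2 R) (\1_(box M) : plane -> R).
Proof.
have mB : measurable (box M : set plane) by exact: measurable_box.
apply/integrableP; split; first by apply/measurable_EFinP; exact: measurable_indic.
under eq_integral => x _ do rewrite /= ger0_norm//.
rewrite integral_indic// setIT; exact: leb2_box.
Qed.

Lemma itg_csupp f : continuous f -> csupp f -> itg (@leb2 R) f.
Proof.
move=> cf sf; have [C C0 HC] := csupp_bounded cf sf; have [M HM] := sf.
apply: itg_le (itgZ C (itg_indic_box M)); first exact: continuous_measurable_plane.
move=> x; rewrite indicE; have [bx|nx] := pselect (box M x).
  by rewrite mem_set// mulr1.
by rewrite HM// normr0 mulr_ge0.
Qed.

Lemma sqi_csupp f : continuous f -> csupp f -> sqi (@leb2 R) f.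
Proof.
move=> cf sf; split; first exact: continuous_measurable_plane.
apply: itg_csupp; first by move=> x; apply: (@cvgM _ _ _ _ f f); exact: cf.
by under eq_fun do rewrite expr2; exact: csuppM.
Qed.

Lemma test_itg chi : test_function chi -> itg (@leb2 R) chi.
Proof. by move=> /test_functionP[/smooth_continuous]; exact: itg_csupp. Qed.

Lemma test_sqi chi : test_function chi -> sqi (@leb2 R) chi.
Proof. by move=> /test_functionP[/smooth_continuous]; exact: sqi_csupp. Qed.

End test_functions.

Section integration_by_parts.
Context {R : realType}.
Local Notation plane := (mplane R).
Local Notation leb := (@lebesgue_measure R).
Implicit Types (f g chi : R * R -> R).

Lemma integral_derive_csupp (F F' : R -> R) (M : R) :
  (forall t : R, is_derive t (1 : R) F (F' t)) -> continuous F' ->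
  (forall t, M < `|t| -> F t = 0) -> (forall t, M < `|t| -> F' t = 0) ->
  (\int[leb]_t F' t)%R = 0.
Proof.
move=> dF cF' F0 F'0; pose N := `|M| + 1.
have MN : M < N by rewrite (le_lt_trans (ler_norm M)) ?ltrDl.
have N0 : 0 < N by rewrite ltr_wpDl.
pose J : set (measurableTypeR R) := [set` `[- N, N]].
have E : (\int[leb]_(x in J) (F' x)%:E = (F N)%:E - (F (- N)%R)%:E)%E.
  apply: (@continuous_FTC2 _ F' F); first by rewrite -subr_gt0 opprK addr_gt0.
  - exact: continuous_subspaceT.
  - split.
    + by move=> t _; have [] := dF t.
    + apply: cvg_at_right_filter; apply: differentiable_continuous; apply/derivable1_diffP.
      by have [] := dF (- N).
    + apply: cvg_at_left_filter; apply: differentiable_continuous; apply/derivable1_diffP.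
      by have [] := dF N.
  - by move=> t _; rewrite derive1E; have [_ ->] := dF t.
rewrite /Rintegral.
have -> : (\int[leb]_t (F' t)%:E = \int[leb]_(x in J) (F' x)%:E)%E.
  rewrite [RHS]integral_mkcond; apply: eq_integral => t _.
  rewrite /J patchE; case: ifPn => //; rewrite notin_setE /= in_itv /= -ler_norml => /negP.
  by rewrite -ltNge => h; rewrite F'0// (lt_trans MN).
by rewrite E !F0 ?normrN ?(gtr0_norm N0)// sube0.
Qed.

Lemma itg_csupp1 (g : R -> R) (M : R) : continuous g ->
  (forall t, M < `|t| -> g t = 0) -> itg leb g.
Proof.
move=> cg g0; pose J : set (measurableTypeR R) := [set` `[- M, M]].
have : compact (g @` (J : set R)).
  apply: continuous_compact; last exact: segment_compact.
  exact: continuous_subspaceT.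
move=> /compact_bounded[C [_ HC]].
have IJ : itg leb (\1_J : R -> R) := integrable_indic_itv _ _ _ _.
apply: itg_le (itgZ (`|C| + 1) IJ); first exact: continuous_measurable_fun.
move=> t; rewrite indicE; have [tM|tM] := leP `|t| M.
  rewrite mem_set ?mulr1 /J/= ?in_itv/= -?ler_norml//.
  apply: (HC (`|C| + 1)); first by rewrite (le_lt_trans (ler_norm C)) ?ltrDl.
  by exists t => //; rewrite /J /= in_itv /= -ler_norml.
by rewrite g0// normr0 mulr_ge0// addr_ge0.
Qed.

(** Fubini's theorem in the order that integrates along the derivative first, then the fundamental
    theorem of calculus with zero values at both ends. *)
Lemma Int_pd_test i chi : test_function chi -> (\int[leb2]_x pd i chi x)%R = 0.
Proof.
move=> tc; have tp := test_pd i tc.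
have [sc [M HM]] := (test_functionP chi).1 tc.
have HM' x : ~ box M x -> pd i chi x = 0 by exact: pd_box0.
have cp := test_continuous tp.
have D (v : R * R) (t : R) : v = ex i ->
    forall z : R * R, is_derive t 1 (fun h => chi (h *: v + z)) (pd i chi (t *: v + z)).
  by move=> -> z; apply/(is_derive_line chi (ex i) z t); exact: smooth_is_derive.
have L (v z : R * R) : continuous (fun h : R => pd i chi (h *: v + z)).
  move=> h; apply: (@continuous_comp _ _ _ (fun h : R => h *: v + z) (pd i chi)); last exact: cp.
  apply: continuousD; last exact: cvg_cst.
  by apply: continuousZl; exact: cvg_id.
have e0 (h y : R) : h *: ex ord0 + (0, y) = (h, y).
  rewrite (_ : h *: _ = (h * 1, h * 0))// mulr1 mulr0.
  by rewrite (_ : _ + _ = (h + 0, 0 + y))// addr0 add0r.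
have e1 (h y : R) : h *: ex ord_max + (y, 0) = (y, h).
  rewrite (_ : h *: _ = (h * 0, h * 1))// mulr1 mulr0.
  by rewrite (_ : _ + _ = (0 + y, h + 0))// addr0 add0r.
have c0 y : continuous (fun h : R => pd i chi (h, y)).
  by under eq_fun do rewrite -e0; exact: L.
have c1 y : continuous (fun h : R => pd i chi (y, h)).
  by under eq_fun do rewrite -e1; exact: L.
have Ip : itg leb2 (pd i chi) := test_itg tp.
have itgc (g : R -> R) : continuous g -> (forall t, M < `|t| -> g t = 0) -> itg leb g.
  exact: itg_csupp1.
have nb1 (t y : R) : M < `|t| -> ~ box M (t, y).
  by move=> h /boxP[/= h1 _]; rewrite ltNge h1 in h.
have nb2 (t y : R) : M < `|t| -> ~ box M (y, t).
  by move=> h /boxP[/= _ h1]; rewrite ltNge h1 in h.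
have s1 x := itgc _ (c1 x) (fun t h => HM' (x, t) (nb2 t x h)).
have s0 y := itgc _ (c0 y) (fun t h => HM' (t, y) (nb1 t y h)).
move: tp HM' cp D L c0 c1 Ip s1 s0.
elim/ord2_cases: i => tp HM' cp D L c0 c1 Ip s1 s0.
  rewrite -(Int_fubini2 Ip s0) -[RHS](@Int0 _ _ _ leb); apply: eq_Int => y.
  apply: (@integral_derive_csupp (fun h => chi (h, y)) _ M).
  - by move=> t; have := D _ t erefl (0, y); under eq_fun do rewrite e0; rewrite e0.
  - exact: c0.
  - by move=> t /(nb1 t y) /HM.
  - by move=> t /(nb1 t y) /HM'.
rewrite -(Int_fubini1 Ip s1) -[RHS](@Int0 _ _ _ leb); apply: eq_Int => y.
apply: (@integral_derive_csupp (fun h => chi (y, h)) _ M).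
- by move=> t; have := D _ t erefl (y, 0); under eq_fun do rewrite e1; rewrite e1.
- exact: c1.
- by move=> t /(nb2 t y) /HM.
- by move=> t /(nb2 t y) /HM'.
Qed.

End integration_by_parts.

Section mollifier.
Context {R : realType}.
Local Notation plane := (mplane R).
Local Notation leb := (@lebesgue_measure R).
Implicit Types (f g chi : R * R -> R).

(** The set where f > C is open, and a non-empty open set contains a product of two balls, which has
    positive measure. *)
Lemma ae_le_everywhere f (C : R) : continuous f ->
  {ae leb2, forall x, f x <= C} -> forall x, f x <= C.
Proof.
move=> cf [N [mN N0 HN]] x; rewrite leNgt; apply/negP => Cx.
have : \forall y \near x, C < f y by exact: cf x _ (lt_nbhsr Cx).
case=> -[A B] /= [nA nB] AB.
have [a /= a0 HA] := (nbhs_ballP _ _).1 nA.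
have [b /= b0 HB] := (nbhs_ballP _ _).1 nB.
have sub : (ball x.1 a `*` ball x.2 b : set plane) `<=` N.
  move=> y [y1 y2]; apply: HN => /=; apply/negP; rewrite -ltNge.
  by apply: (AB y); split; [exact: HA|exact: HB].
have pos (c : R) (r : R) : 0 < r -> (0 < leb (ball c r))%E.
  by move=> r0; rewrite lebesgue_measure_ball ?ltW// lte_fin mulrn_wgt0.
have mb (c : R) (r : R) : measurable (ball c r : set (measurableTypeR R)).
  exact: measurable_ball.
have : (leb2 (ball x.1 a `*` ball x.2 b : set plane) <= @leb2 R N)%E.
  by apply: le_measure; rewrite ?inE//; exact: measurableX.
have -> : @leb2 R (ball x.1 a `*` ball x.2 b) = (leb (ball x.1 a) * leb (ball x.2 b))%E.
  by apply: product_measure1E; exact: mb.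
by rewrite N0 leNgt mule_gt0//; exact: pos.
Qed.

Definition bump (t : R) : R := flat 1 (1 + t) * flat 1 (1 - t).

Lemma flat1E (t : R) : flat 1 t = if 0 < t then expR (- t^-1) else 0.
Proof. by rewrite /flat hornerC mul1r. Qed.

Lemma flat1_ge0 (t : R) : 0 <= flat 1 t.
Proof. by rewrite flat1E; case: ifP => // _; exact: expR_ge0. Qed.

Lemma flat1_gt0 (t : R) : 0 < t -> 0 < flat 1 t.
Proof. by move=> t0; rewrite flat1E t0 expR_gt0. Qed.

Lemma flat1_le1 (t : R) : flat 1 t <= 1.
Proof.
rewrite flat1E; case: ifP => // t0.
by rewrite -expR0 ler_expR oppr_le0 invr_ge0 ltW.
Qed.

Lemma bump_smooth n : Cn (fun _ : unit => 1 : R) setT n bump.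
Proof.
have A (c : R) : c = 1 \/ c = -1 -> forall n,
    Cn (fun _ : unit => 1 : R) setT n (fun t => flat 1 (1 + c * t)).
  move=> _ m; apply: (@Cn_comp _ _ _ _ _ openT m (fun t : R => 1 + c * t)).
    by move=> k; exact: Cn_flat.
  apply: (@Cn_affine _ _ _ _ _ openT m (fun t : R => 1 + c * t) (fun=> c)).
    by move=> t; apply: continuousD; [exact: cvg_cst|exact: mulrl_continuous].
  by move=> _ z t; rewrite [t *: 1]mulr1; ring.
have E : bump = (fun t => flat 1 (1 + 1 * t) * flat 1 (1 + -1 * t)).
  by apply/funext => t; rewrite mul1r mulN1r.
by rewrite E; apply: (CnM openT); apply: A; [left|right].
Qed.

Lemma bump_ge0 t : 0 <= bump t.
Proof. by rewrite mulr_ge0 ?flat1_ge0. Qed.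

Lemma bump_le1 t : bump t <= 1.
Proof. by rewrite mulr_ile1 ?flat1_ge0 ?flat1_le1. Qed.

Lemma bump_gt0 t : `|t| < 1 -> 0 < bump t.
Proof. by rewrite ltr_norml => /andP[h1 h2]; rewrite mulr_gt0 ?flat1_gt0; lra. Qed.

Lemma bump_eq0 t : 1 <= `|t| -> bump t = 0.
Proof.
rewrite ler_normr /bump !flat1E => /orP[h|h].
  by rewrite (_ : 0 < 1 - t = false) ?mulr0//; apply/negbTE; rewrite -leNgt; lra.
by rewrite (_ : 0 < 1 + t = false) ?mul0r//; apply/negbTE; rewrite -leNgt; lra.
Qed.

Lemma bumpN t : bump (- t) = bump t.
Proof. by rewrite /bump opprK mulrC. Qed.

Lemma bump_continuous : continuous bump.
Proof. by move=> t; exact: Cn_continuous (bump_smooth 0%N) I. Qed.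

(** A bump centred at (c, d) with half-sides 1/a and 1/b. Equal scales give the mollifier, unequal
    ones the anisotropic cut-off. *)
Definition tbump (a b c d : R) (x : R * R) : R :=
  bump (a * (x.1 - c)) * bump (b * (x.2 - d)).

Lemma smooth_affine_coord (g : R -> R) (i : 'I_2) (a c : R) :
  (forall n, Cn (fun _ : unit => 1 : R) setT n g) ->
  smooth (fun x => g (a * (crd i x - c))).
Proof.
move=> sg; apply: (@smooth_comp_affine _ g (fun x => a * (crd i x - c))
  (fun j => a * crd i (ex j))) => //.
  elim/ord2_cases: i => x; apply: cvgMr; apply: cvgB; try exact: cvg_cst.
    exact: cvg_fst.
  exact: cvg_snd.
move=> j z t; have -> : crd i (t *: ex j + z) = t * crd i (ex j) + crd i z.
  by elim/ord2_cases: i.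
by move: (crd _ _) (crd _ _) => p q; ring.
Qed.

Lemma tbump_test a b c d : 0 < a -> 0 < b -> test_function (tbump a b c d).
Proof.
move=> a0 b0; apply/test_functionP; split.
  apply: smoothM; first exact: (@smooth_affine_coord bump ord0 a c bump_smooth).
  exact: (@smooth_affine_coord bump ord_max b d bump_smooth).
exists (Num.max (`|c| + a^-1) (`|d| + b^-1)) => x nx; apply/eqP; apply/negPn/negP.
rewrite mulf_eq0 negb_or => /andP[h1 h2]; apply: nx; apply/boxP.
have K (k e t : R) : 0 < k -> bump (k * (t - e)) != 0 -> `|t| <= `|e| + k^-1.
  move=> k0 h; have : `|k * (t - e)| < 1.
    by rewrite ltNge; apply/negP => /bump_eq0 /eqP; exact/negP.
  rewrite normrM (gtr0_norm k0) -ltr_pdivlMl// mulr1 => {}h.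
  by rewrite -(subrK e t) (le_trans (ler_normD _ _))// addrC lerD2l ltW.
by split; rewrite le_max; apply/orP; [left|right]; exact: K.
Qed.

Lemma tbump_ge0 a b c d x : 0 <= tbump a b c d x.
Proof. by rewrite mulr_ge0 ?bump_ge0. Qed.

Lemma tbump_le1 a b c d x : tbump a b c d x <= 1.
Proof. by rewrite mulr_ile1 ?bump_ge0 ?bump_le1. Qed.

(** The bump is not normalised; the kernel of scale k on the plane has integral [mass k ^+ 2], which
    is divided out in the limits. *)
Definition mass (k : R) : R := \int[leb]_t bump (k * t).

Lemma bump_scale_continuous (k c : R) : continuous (fun t : R => bump (k * (t - c))).
Proof.
move=> t; apply: (@continuous_comp _ _ _ (fun t : R => k * (t - c)) bump).
  by apply: cvgMr; apply: cvgB; [exact: cvg_id|exact: cvg_cst].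
exact: bump_continuous.
Qed.

Lemma itg_bump (k c : R) : 0 < k -> itg leb (fun t : R => bump (k * (t - c))).
Proof.
move=> k0; apply: (@itg_csupp1 _ _ (`|c| + k^-1)); first exact: bump_scale_continuous.
move=> t h; apply: bump_eq0; rewrite normrM (gtr0_norm k0) -ler_pdivrMl// mulr1.
by have := ler_normD (t - c) c; rewrite subrK; move: h; lra.
Qed.

Lemma Int_bump_translate (k c : R) : 0 < k -> \int[leb]_t bump (k * (t - c)) = mass k.
Proof.
move=> k0; rewrite /mass /Rintegral; apply: (congr1 fine).
pose F (t : R) := t - c.
have dF t : is_derive t (1 : R) F 1.
  by apply: is_derive_eq (is_derive_sub (is_derive_id _ _) (is_derive_cst c _ _)) _; rewrite subr0.
have F'E : (F^`())%classic = cst 1 by apply/funext => t; rewrite derive1E; have [_ ->] := dF t.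
have cB : continuous (fun t : R => bump (k * t)).
  by move=> t; have := @bump_scale_continuous k 0 t; under eq_fun do rewrite subr0.
rewrite [RHS](@increasing_ge0_integration_by_substitutionT _ F (fun t => bump (k * t))).
- by apply: eq_integral => t _; rewrite F'E; rewrite (_ : (_ * _) t = bump (k * (t - c)) * 1)// mulr1.
- by move=> x y xy; rewrite ltrD2r.
- by rewrite F'E => t; exact: cvg_cst.
- by rewrite F'E; exact: is_cvg_cst.
- by rewrite F'E; exact: is_cvg_cst.
- by move=> t; have [] := dF t.
- exact: cvg_addrr_Ny.
- exact: cvg_addrr.
- exact: cB.
- by move=> t; exact: bump_ge0.
Qed.

Lemma Int_tbump (k c d : R) : 0 < k -> \int[leb2]_x tbump k k c d x = mass k ^+ 2.
Proof.
move=> k0; have It := test_itg (tbump_test c d k0 k0).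
have E x y : tbump k k c d (x, y) = bump (k * (x - c)) * bump (k * (y - d)) by [].
have s1 (x : R) : itg leb (fun y => tbump k k c d (x, y)).
  by under eq_fun do rewrite E; apply: itgZ; exact: itg_bump.
rewrite -(Int_fubini1 It s1).
transitivity (\int[leb]_x (mass k * bump (k * (x - c)))).
  apply: eq_Int => x; 
  transitivity (\int[leb]_y (bump (k * (x - c)) * bump (k * (y - d)))); first exact: eq_Int.
  rewrite IntZ; last exact: itg_bump.
  by rewrite Int_bump_translate// mulrC.
by rewrite IntZ ?Int_bump_translate ?expr2//; exact: itg_bump.
Qed.

(** With zero mass the continuous non-negative bump would vanish almost everywhere, hence
    everywhere, although it is positive at the origin. *)
Lemma mass_gt0 (k : R) : 0 < k -> 0 < mass k.
Proof.
move=> k0; have m0 : 0 <= mass k by apply: Int_ge0 => t; exact: bump_ge0.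
rewrite lt_neqAle m0 andbT eq_sym; apply/negP => /eqP E.
have tt := tbump_test 0 0 k0 k0; have It := test_itg tt.
have := Int_tbump 0 0 k0; rewrite E expr0n /=.
move=> /(Int_eq0_ae It (fun x => tbump_ge0 k k 0 0 x)) H.
have : tbump k k 0 0 (0, 0) <= 0.
  apply: ae_le_everywhere; first exact: test_continuous tt.
  by apply: filterS H => x ->.
rewrite /tbump /= subr0 mulr0 leNgt => /negP; apply.
by rewrite mulr_gt0// bump_gt0// normr0.
Qed.

End mollifier.

Lemma ae_imply2 d (T : measurableType d) (R : realType)
    (mu : {measure set T -> \bar R}) (P Q S : T -> Prop) :
  (forall x, P x -> Q x -> S x) -> {ae mu, forall x, P x} ->
  {ae mu, forall x, Q x} -> {ae mu, forall x, S x}.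
Proof. by move=> H; apply: filterS2. Qed.

(** * Test functions separate and are dense in L^2 *)

Section separation.
Context {R : realType}.
Local Notation plane := (mplane R).
Implicit Types (f g : R * R -> R).

Definition quadrant (a b : R) : set plane :=
  [set` `]a, +oo[] `*` [set` `]b, +oo[].

Definition quadrants : set (set plane) := [set A | exists a b, A = quadrant a b].

Lemma quadrantP a b (x : plane) : quadrant a b x <-> a < x.1 /\ b < x.2.
Proof. by rewrite /quadrant /= !in_itv /= !andbT. Qed.

Lemma measurable_quadrant a b : measurable (quadrant a b).
Proof. by apply: measurableX; exact: measurable_itv. Qed.

(** It suffices that both projections are measurable for the sigma-algebra of quadrants, and a
    half-plane is a countable union of quadrants. *)
Lemma quadrants_generate : @measurable _ plane = <<s quadrants >>.
Proof.
apply/seteqP; split=> [|A]; last first.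
  by apply; split; [exact: sigma_algebra_measurable|move=> _ [a [b ->]]; exact: measurable_quadrant].
pose T := g_sigma_algebraType quadrants.
have gen a b : @measurable _ T (quadrant a b) by apply: sub_sigma_algebra; exists a, b.
have un (t : R) : exists n : nat, - n%:R < t.
  exists (Num.truncn `|t|).+1; rewrite ltrNl (le_lt_trans (ler_norm _))// normrN.
  exact: truncnS_gt.
have m1 : measurable_fun setT (fst : T -> measurableTypeR R).
  apply: (measurability _ (RGenOInfty.measurableE R)) => _ [_ [a ->] <-]; rewrite setTI.
  rewrite (_ : _ @^-1` _ = \bigcup_n (quadrant a (- n%:R) : set T)).
    by apply: bigcup_measurable => n _; exact: gen.
  apply/seteqP; split=> [x /=|x [n _] /quadrantP[h _]]; last by rewrite /= in_itv /= andbT.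
  rewrite in_itv /= andbT => h; have [n Hn] := un x.2; exists n => //.
  exact/quadrantP.
have m2 : measurable_fun setT (snd : T -> measurableTypeR R).
  apply: (measurability _ (RGenOInfty.measurableE R)) => _ [_ [a ->] <-]; rewrite setTI.
  rewrite (_ : _ @^-1` _ = \bigcup_n (quadrant (- n%:R) a : set T)).
    by apply: bigcup_measurable => n _; exact: gen.
  apply/seteqP; split=> [x /=|x [n _] /quadrantP[_ h]]; last by rewrite /= in_itv /= andbT.
  rewrite in_itv /= andbT => h; have [n Hn] := un x.1; exists n => //.
  exact/quadrantP.
rewrite measurable_prod_measurableType; apply: smallest_sub.
  exact: smallest_sigma_algebra.
move=> _ [A mA [B mB <-]].
have -> : A `*` B = (setT `&` fst @^-1` A) `&` (setT `&` snd @^-1` B) :> set T.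
  by rewrite !setTI.
by apply: (@measurableI _ T); [exact: m1|exact: m2].
Qed.

Lemma itg_indicM f (A : set plane) : itg leb2 f -> measurable A ->
  itg leb2 (fun x => f x * \1_A x).
Proof.
move=> If mA; apply: itg_le (itg_abs If).
  by apply: measurable_funM; [exact: itg_measurable If|exact: measurable_indic].
by move=> x; rewrite normrM indicE; case: (x \in A); rewrite ?normr1 ?mulr1// normr0 mulr0.
Qed.

Lemma Int_dct_mul f (F : nat -> R * R -> R) (G : R * R -> R) : itg leb2 f ->
  (forall n, measurable_fun [set: plane] (F n)) -> (forall n x, `|F n x| <= 1) ->
  (forall x, F ^~ x @ \oo --> G x) -> (forall n, \int[leb2]_x (f x * F n x) = 0) ->
  \int[leb2]_x (f x * G x) = 0.
Proof.
move=> If mF F1 FG F0.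
have mfF n : measurable_fun [set: plane] (fun x => f x * F n x).
  by apply: measurable_funM; [exact: itg_measurable If|exact: mF].
have b n x : `|f x * F n x| <= `|f x| by rewrite normrM ler_piMr.
have c x : (fun n => f x * F n x) @ \oo --> f x * G x by apply: cvgMr; exact: FG.
have [_] := itg_dct mfF (itg_abs If) b c.
rewrite (_ : (fun n => _) = fun=> 0); last by apply/funext => n; exact: F0.
by move=> H; apply/esym; apply: (cvg_unique _ (cvg_cst _) H); exact: norm_hausdorff.
Qed.

(** Quadrants are stable under intersection, while the sets whose indicator is orthogonal to [f] are
    stable under complements and countable disjoint unions: Dynkin's theorem applies. *)
Lemma quadrant_separation f : itg leb2 f ->
  (forall a b, \int[leb2]_x (f x * \1_(quadrant a b) x) = 0) ->
  forall A : set plane, measurable A -> \int[leb2]_x (f x * \1_A x) = 0.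
Proof.
move=> If H A mA; move: (mA); rewrite {1}quadrants_generate.
have un (t : R) : \forall n \near \oo, - n%:R < t.
  by near=> n; rewrite ltrNl; near: n; exact: nbhs_infty_gtr.
have PT : \int[leb2]_x (f x * \1_[set: plane] x) = 0.
  apply: (Int_dct_mul If (F := fun n => \1_(quadrant (- n%:R) (- n%:R)))) => //.
  - by move=> n; apply: measurable_indic; exact: measurable_quadrant.
  - by move=> n x; rewrite indicE; case: (_ \in _); rewrite ?normr1 ?normr0.
  - move=> x; apply: cvg_near_cst; near=> n; rewrite !indicE in_setT mem_set//.
    by apply/quadrantP; split; near: n; exact: un.
move: A {mA}; apply: (@dynkin_induction _ plane quadrants
  (fun A => \int[leb2]_x (f x * \1_A x) = 0)).
- exact: quadrants_generate.
- move=> _ _ [a [b ->]] [c [d ->]]; exists (Num.max a c), (Num.max b d).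
  apply/seteqP; split=> x; rewrite quadrantP !gt_max.
    by move=> [/quadrantP[-> ->] /quadrantP[-> ->]].
  by move=> [/andP[h1 h2] /andP[h3 h4]]; split; exact/quadrantP.
- exact: PT.
- by move=> _ [a [b ->]]; exact: H.
- move=> S mS PS; rewrite (@eq_Int _ _ _ leb2 _ (fun x => f x * \1_[set: plane] x - f x * \1_S x)).
    by rewrite IntB ?PT ?PS ?subr0//; apply: itg_indicM.
  by move=> x; rewrite !indicE in_setT in_setC; case: (_ \in _) => /=; ring.
- move=> F mF tF PF.
  pose A n := \big[setU/set0]_(k < n) F k.
  have mA n : measurable (A n) by exact: bigsetU_measurable.
  apply: (Int_dct_mul If (F := fun n => \1_(A n))).
  + by move=> n; exact: measurable_indic.
  + by move=> n x; rewrite indicE; case: (_ \in _); rewrite ?normr1 ?normr0.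
  + move=> x; apply: cvg_near_cst.
    have [[K _ FK]|nF] := pselect ((\bigcup_k F k) x).
      near=> n; have h1 : A n x.
        by rewrite /A -bigcup_mkord; exists K => //=; near: n; exact: nbhs_infty_gt.
      have h2 : (\bigcup_k F k) x by exists K.
      by rewrite !indicE !mem_set.
    near=> n; rewrite !indicE !memNset// /A -bigcup_mkord => -[k _ Fk].
    by apply: nF; exists k.
  + elim=> [|n IH].
      rewrite (@eq_Int _ _ _ leb2 _ (fun=> 0)) ?Int0// => x.
      by rewrite /A big_ord0 indicE in_set0 mulr0.
    rewrite (@eq_Int _ _ _ leb2 _ (fun x => f x * \1_(A n) x + f x * \1_(F n) x)).
      by rewrite IntD ?IH ?PF ?addr0//; exact: itg_indicM.
    move=> x; rewrite -mulrDr /A big_ord_recr /= !indicE in_setU.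
    case: (boolP (x \in F n)) => xF; last by rewrite orbF addr0.
    suff /negbTE -> : x \notin \big[setU/set0]_(k < n) F k by rewrite add0r.
    apply/negP; rewrite -bigcup_mkord inE => -[k /= kn Fk]; rewrite inE in xF.
    have := tF k n I I; have : k <> n by move=> kn'; rewrite kn' ltnn in kn.
    by move=> nk /(_ (ex_intro _ x (conj Fk xF))).
Unshelve. all: by end_near. Qed.

(** Testing with the set where the function is positive shows that it is non-positive almost
    everywhere; this is applied to [f] and to its opposite. *)
Lemma measurable_sets_separation f : itg leb2 f ->
  (forall A : set plane, measurable A -> \int[leb2]_x (f x * \1_A x) = 0) ->
  {ae leb2, forall x, f x = 0}.
Proof.
move=> If H.
have half g : itg leb2 g ->
    (forall A : set plane, measurable A -> \int[leb2]_x (g x * \1_A x) = 0) ->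
    {ae leb2, forall x, g x <= 0}.
  move=> Ig Hg; pose A : set plane := [set x | 0 < g x].
  have mA : measurable A.
    have := itg_measurable Ig measurableT (measurable_itv `]0, +oo[).
    by rewrite setTI; congr measurable; apply/seteqP; split=> x /=; rewrite in_itv /= andbT.
  have := Int_eq0_ae (itg_indicM Ig mA) _ (Hg _ mA).
  move=> /(_ _)/wrap[].
    move=> x; rewrite indicE; case: (boolP (x \in A)); rewrite ?mulr0// mulr1 inE => h.
    exact: ltW.
  apply: filterS => x; rewrite indicE; case: (boolP (x \in A)).
    by rewrite mulr1 => _ ->.
  by rewrite notin_setE /A /= => /negP; rewrite -leNgt.
have h1 := half f If H.
have h2 := half (fun x => - f x) (itgN If) _.
have /h2 {}h2 : forall A : set plane, measurable A -> \int[leb2]_x (- f x * \1_A x) = 0.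
  move=> A mA; rewrite (@eq_Int _ _ _ leb2 _ (fun x => - (f x * \1_A x))) => [|x]; last by rewrite mulNr.
  by rewrite IntN ?H ?oppr0//; exact: itg_indicM.
by apply: ae_imply2 h1 h2 => x a b; apply/eqP; rewrite eq_le a -oppr_le0.
Qed.

End separation.

Section density_of_separating_subspaces.
Context d (T : measurableType d) (R : realType) (mu : {measure set T -> \bar R}).
Variable TT : (T -> R) -> Prop.
Hypothesis TT0 : TT (fun=> 0).
Hypothesis TTD : forall f g, TT f -> TT g -> TT (fun x => f x + g x).
Hypothesis TTZ : forall (a : R) f, TT f -> TT (fun x => a * f x).
Hypothesis TTs : forall f, TT f -> sqi mu f.
Hypothesis separating : forall f, sqi mu f ->
  (forall g, TT g -> \int[mu]_x (f x * g x) = 0) -> {ae mu, forall x, f x = 0}.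

Lemma Int_sqrD (f g : T -> R) : sqi mu f -> sqi mu g ->
  \int[mu]_x ((f x + g x) ^+ 2) <=
  2 * \int[mu]_x (f x ^+ 2) + 2 * \int[mu]_x (g x ^+ 2).
Proof.
move=> sf sg; have [_ If] := sf; have [_ Ig] := sg.
rewrite -!IntZ// -IntD; [|exact: itgZ|exact: itgZ].
apply: le_Int; [by have [] := sqiD sf sg|by apply: itgD; exact: itgZ|].
by move=> x; have := sqr_ge0 (f x - g x); move: (f x) (g x) => a b; nra.
Qed.

Lemma Int_cauchy_schwarz (f g : T -> R) : sqi mu f -> sqi mu g ->
  (\int[mu]_x (f x * g x)) ^+ 2 <=
  \int[mu]_x (f x * f x) * \int[mu]_x (g x * g x).
Proof.
move=> sf sg; pose q (f g : T -> R) := \int[mu]_x (f x * g x).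
rewrite [leRHS]mulrC.
apply: (@form_cauchy_schwarz R (T -> R) (sqi mu) q _ _ _ _ _ _ f g sf sg).
- by move=> v w; exact: sqiD.
- by move=> a v; exact: sqiZ.
- by move=> v w; apply: eq_Int => x; rewrite mulrC.
- move=> u v w su sv sw; rewrite /q -IntD; try exact: sqi_mul.
  by apply: eq_Int => x; rewrite -mulrDl.
- move=> a v w sv sw; rewrite /q -IntZ; last exact: sqi_mul.
  by apply: eq_Int => x; rewrite mulrA.
- by move=> v _; apply: Int_ge0 => x; rewrite -expr2 sqr_ge0.
Qed.

Let S (g : T -> R) := sqi mu g /\
  forall e, 0 < e -> exists2 h, TT h & \int[mu]_x ((g x - h x) ^+ 2) <= e.

Let b (f g : T -> R) := \int[mu]_x (f x * g x).

Let e22 (e : R) : 2 * (e / 4) + 2 * (e / 4) = e.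
Proof. by field. Qed.

Let SD f g : S f -> S g -> S (f + g).
Proof.
move=> [sf Hf] [sg Hg]; split=> [|e e0]; first exact: sqiD.
have e4 : 0 < e / 4 by rewrite divr_gt0.
have [h Th lh] := Hf _ e4; have [k Tk lk] := Hg _ e4.
exists (fun x => h x + k x); first exact: TTD.
rewrite (@eq_Int _ _ _ mu _ (fun x => ((f x - h x) + (g x - k x)) ^+ 2)).
  apply: le_trans (Int_sqrD (sqiB sf (TTs Th)) (sqiB sg (TTs Tk))) _.
  by rewrite -[leRHS]e22 lerD// ler_pM2l.
by move=> x; change ((f x + g x - (h x + k x)) ^+ 2 = (f x - h x + (g x - k x)) ^+ 2); ring.
Qed.

Let SZ a f : S f -> S (a *: f).
Proof.
move=> [sf Hf]; split=> [|e e0]; first exact: sqiZ.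
have a0 : 0 < a ^+ 2 + 1 by rewrite ltr_wpDl ?sqr_ge0.
have [h Th lh] := Hf (e / (a ^+ 2 + 1)) (divr_gt0 e0 a0).
exists (fun x => a * h x); first exact: TTZ.
have sq : sqi mu (fun x => f x - h x) := sqiB sf (TTs Th).
rewrite (@eq_Int _ _ _ mu _ (fun x => a ^+ 2 * (f x - h x) ^+ 2)); last first.
  by move=> x; change ((a * f x - a * h x) ^+ 2 = a ^+ 2 * (f x - h x) ^+ 2); ring.
rewrite IntZ; last by case: sq.
apply: (@le_trans _ _ (a ^+ 2 * (e / (a ^+ 2 + 1)))); first by rewrite ler_wpM2l ?sqr_ge0.
by rewrite mulrCA ler_piMr ?(ltW e0)// ler_pdivrMr// mul1r lerDl.
Qed.

(** Riesz representation on [S], the L^2 closure of [TT], yields the orthogonal projection p of [f].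
    Then f - p is orthogonal to [TT], hence zero almost everywhere. *)
Lemma separating_dense f (e : R) : sqi mu f -> 0 < e ->
  exists2 g, TT g & \int[mu]_x ((f x - g x) ^+ 2) <= e.
Proof.
move=> sf e0.
have ST g : TT g -> S g.
  move=> Tg; split=> [|r r0]; first exact: TTs.
  exists g => //; rewrite (@eq_Int _ _ _ mu _ (fun=> 0)) ?Int0 ?ltW// => x.
  by rewrite subrr expr0n.
have [p [Sp Hp]] : exists p, S p /\ forall v, S v -> b p v = b f v.
  apply: (@riesz_representation R _ S b (b f) (b f f)).
  - exact: SD.
  - exact: SZ.
  - exact: ST.
  - by move=> v w; apply: eq_Int => x; rewrite mulrC.
  - move=> u v w [su _] [sv _] [sw _]; rewrite /b -IntD; try exact: sqi_mul.
    by apply: eq_Int => x; rewrite -mulrDl.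
  - move=> a v w [sv _] [sw _]; rewrite /b -IntZ; last exact: sqi_mul.
    by apply: eq_Int => x; rewrite mulrA.
  - by move=> v _; apply: Int_ge0 => x; rewrite -expr2 sqr_ge0.
  - move=> v w [sv _] [sw _]; rewrite /b -IntD; try exact: sqi_mul.
    by apply: eq_Int => x; rewrite -mulrDr.
  - move=> a v [sv _]; rewrite /b -IntZ; last exact: sqi_mul.
    by apply: eq_Int => x; rewrite mulrCA.
  - by apply: Int_ge0 => x; rewrite -expr2 sqr_ge0.
  - move=> v [sv _].
    exact: Int_cauchy_schwarz.
  - move=> s Ss cs.
    have [p [sp Hp]] := @sqi_complete _ _ _ mu s (fun n => (Ss n).1) cs.
    exists p; split=> //; split=> // r r0.
    have r4 : 0 < r / 4 by rewrite divr_gt0.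
    have [N HN] := Hp _ r4; have [h Th lh] := (Ss N).2 _ r4.
    exists h => //.
    rewrite (@eq_Int _ _ _ mu _ (fun x => ((p x - s N x) + (s N x - h x)) ^+ 2)).
      apply: le_trans (Int_sqrD (sqiB sp (Ss N).1) (sqiB (Ss N).1 (TTs Th))) _.
      rewrite -[leRHS]e22 lerD// ler_pM2l//.
      apply: le_trans (HN N (leqnn N)); rewrite le_eqVlt.
      by apply/orP; left; apply/eqP; apply: eq_Int => x; change ((p x - s N x) ^+ 2 = (s N x - p x) ^+ 2); ring.
    by move=> x /=; ring.
have [sp Dp] := Sp.
have pf : {ae mu, forall x, f x - p x = 0}.
  apply: separating; first exact: sqiB.
  move=> g Tg; have sg := TTs Tg.
  rewrite (@eq_Int _ _ _ mu _ (fun x => f x * g x - p x * g x)) => [|x]; last by rewrite mulrBl.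
  rewrite IntB; try exact: sqi_mul.
  by apply/eqP; rewrite subr_eq0 eq_sym; apply/eqP; exact: Hp (ST g Tg).
have [g Tg lg] := Dp e e0; exists g => //; apply: le_trans lg; rewrite le_eqVlt.
apply/orP; left; apply/eqP; apply: Int_ae.
- by have [] := sqiB sf (TTs Tg) => m _; apply: (@measurable_funX _ _ _ _ _ 2).
- by have [] := sqiB sp (TTs Tg) => m _; apply: (@measurable_funX _ _ _ _ _ 2).
- by apply: filterS pf => x /eqP; rewrite subr_eq0 => /eqP ->.
Qed.

End density_of_separating_subspaces.

Lemma ae_imply d (T : measurableType d) (R : realType)
    (mu : {measure set T -> \bar R}) (P S : T -> Prop) :
  (forall x, P x -> S x) -> {ae mu, forall x, P x} -> {ae mu, forall x, S x}.
Proof. by move=> H; apply: filterS. Qed.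

Section test_density.
Context {R : realType}.
Local Notation plane := (mplane R).
Implicit Types (f g chi : R * R -> R).

(** A smooth bounded approximation of the indicator of the open half-line; products of two of these
    approximate quadrants. *)
Lemma flat1_cvg (t : R) : (fun n : nat => flat 1 (n.+1%:R * t) : R) @ \oo --> (((0 < t)%R : nat)%:R : R).
Proof.
have [t0|t0] := ltP 0 t; last first.
  apply: cvg_near_cst; near=> n; rewrite flat1E; have -> // : (0 < n.+1%:R * t) = false.
  by apply/negbTE; rewrite -leNgt mulr_ge0_le0.
rewrite [nbhs _]/= -[X in _ --> X]expR0.
have -> : (fun n => flat 1 (n.+1%:R * t)) = (fun n => expR (- (t^-1 * n.+1%:R^-1))).
  by apply/funext => n; rewrite flat1E mulr_gt0// invfM mulrC.
apply: continuous_cvg; first exact: continuous_expR.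
rewrite -[X in _ --> X]oppr0; apply: cvgN.
rewrite -[X in _ --> X](mulr0 t^-1); apply: cvgMr; exact: cvg_harmonic.
Unshelve. all: by end_near. Qed.

Lemma flat1_norm_le1 (t : R) : `|flat 1 t| <= 1.
Proof. by rewrite ger0_norm ?flat1_ge0// flat1_le1. Qed.

(** After multiplication by a cut-off [f] becomes integrable, and a quadrant indicator times the
    cut-off is a bounded limit of test functions. The cut-offs [th n] are positive on squares that
    exhaust the plane. *)
Lemma test_separation f : sqi leb2 f ->
  (forall chi, test_function chi -> \int[leb2]_x (f x * chi x) = 0) ->
  {ae leb2, forall x, f x = 0}.
Proof.
move=> sf H.
pose th (n : nat) := tbump (n.+1%:R^-1) (n.+1%:R^-1) (0 : R) 0.
have n0 n : 0 < n.+1%:R^-1 :> R by rewrite invr_gt0.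
have tth n : test_function (th n) by exact: tbump_test.
have A n : {ae leb2, forall x, f x * th n x = 0}.
  have If : itg leb2 (fun x => f x * th n x) by exact: sqi_mul (test_sqi (tth n)).
  apply: (measurable_sets_separation If); apply: (quadrant_separation If) => a b.
  pose F m (x : R * R) := flat 1 (m.+1%:R * (crd ord0 x - a)) * flat 1 (m.+1%:R * (crd ord_max x - b)).
  have sF m : smooth (F m).
    apply: smoothM.
      apply: (@smooth_affine_coord R (flat 1) ord0) => k; exact: Cn_flat.
    apply: (@smooth_affine_coord R (flat 1) ord_max) => k; exact: Cn_flat.
  apply: (Int_dct_mul If (F := F)).
  - by move=> m; exact: smooth_measurable.
  - by move=> m x; rewrite normrM mulr_ile1// flat1_norm_le1.
  - move=> x; have -> : \1_(quadrant a b) x = ((0 < x.1 - a)%R : nat)%:R * ((0 < x.2 - b)%R : nat)%:R :> R.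
      rewrite -natrM mulnb !subr_gt0 indicE; congr (_%:R); congr nat_of_bool.
      by apply/idP/andP; rewrite inE => /quadrantP.
    apply: cvgM; exact: flat1_cvg.
  - move=> m; rewrite -[RHS](H (fun x => F m x * th n x)); last exact: testM.
    by apply: eq_Int => x; ring.
have : {ae leb2, forall x, forall n, f x * th n x = 0}.
  by apply: ae_foralln => n; exact: A.
apply: ae_imply => x fx; have [N HN] : exists N : nat, `|x.1| < N.+1%:R /\ `|x.2| < N.+1%:R.
  exists (Num.truncn (Num.max `|x.1| `|x.2|)).
  by have := truncnS_gt (Num.max `|x.1| `|x.2|); rewrite gt_max => /andP.
have [h1 h2] := HN.
have /eqP := fx N; rewrite mulf_eq0 => /orP[/eqP //|]; rewrite gt_eqF// mulr_gt0// bump_gt0//.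
  by rewrite subr0 normrM normfV normr_nat mulrC ltr_pdivrMr// mul1r.
by rewrite subr0 normrM normfV normr_nat mulrC ltr_pdivrMr// mul1r.
Qed.

Lemma test_dense f (e : R) : sqi leb2 f -> 0 < e ->
  exists2 chi, test_function chi & \int[leb2]_x ((f x - chi x) ^+ 2) <= e.
Proof.
apply: separating_dense.
- exact: test0.
- exact: testD.
- exact: testZ.
- exact: test_sqi.
- exact: test_separation.
Qed.

Lemma smooth_expR_snd (c : R) : smooth (fun x : R * R => expR (c * x.2)).
Proof.
have := @smooth_affine_coord R (@expR R) ord_max c 0 (@Cn_expR R).
by apply: smooth_ext => x; rewrite subr0.
Qed.

(** Density is transported through the isometry of [sqi_vol], whose exponential factor preserves
    test functions. *)
Lemma test_dense_vol f (e : R) : sqi vol f -> 0 < e ->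
  exists2 chi, test_function chi & \int[vol]_x ((f x - chi x) ^+ 2) <= e.
Proof.
move=> sf e0; have [mf _] := sf; have /(sqi_vol f).1 sg := sf.
have [chi tc lc] := test_dense sg e0.
have tc' : test_function (fun x => expR (2^-1 * x.2) * chi x).
  by apply: testM => //; exact: smooth_expR_snd.
exists (fun x => expR (2^-1 * x.2) * chi x) => //.
have mm : measurable_fun [set: plane] (fun x => (f x - expR (2^-1 * x.2) * chi x) ^+ 2).
  by apply: measurable_funX; apply: measurable_funB => //; exact: test_measurable tc'.
rewrite Int_vol//; apply: le_trans lc; rewrite le_eqVlt; apply/orP; left; apply/eqP.
apply: eq_Int => x.
have -> : - x.2 = - 2^-1 * x.2 + - 2^-1 * x.2 by field.
have := expRxMexpNx_1 (2^-1 * x.2); rewrite expRD -mulNr.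
move: (expR _) (expR _) (f x) (chi x) => a b c d ab.
transitivity ((c * a - (b * a) * d) ^+ 2); first by ring.
by rewrite ab mul1r.
Qed.

End test_density.

(** * Mollified pairings of two functions *)

Section kernel_fubini.
Context d (T : measurableType d) (R : realType).
Variable mu : {sigma_finite_measure set T -> \bar R}.
Implicit Types (F G : T -> R) (K : T * T -> R).

Lemma itg_tensor F G : itg mu F -> itg mu G ->
  itg (mu \x mu)%E (fun z => F z.1 * G z.2).
Proof.
move=> iF iG.
have m : measurable_fun setT (EFin \o (fun z : T * T => F z.1 * G z.2)).
  apply/measurable_EFinP; apply: measurable_funM.
    by apply: measurableT_comp => //; exact: itg_measurable iF.
  by apply: measurableT_comp => //; exact: itg_measurable iG.
rewrite /itg integrable12ltyP//.
have E x : (\int[mu]_y `|(EFin \o (fun z : T * T => F z.1 * G z.2)%R) (x, y)|)%E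
    = (`|F x| * \int[mu]_y `|G y|)%:E.
  rewrite -IntZ; last exact: itg_abs.
  rewrite -Int_EFin; last by apply: itgZ; exact: itg_abs.
  by apply: eq_integral => y _ /=; rewrite normrM.
under eq_integral do rewrite E.
rewrite Int_EFin ?ltry//.
have /(itgZ (\int[mu]_y `|G y|)) := itg_abs iF.
by apply: eq_integrable => // x _ /=; rewrite mulrC.
Qed.

Variables (F G : T -> R) (K : T * T -> R) (C : R).
Hypotheses (iF : itg mu F) (iG : itg mu G) (mK : measurable_fun setT K)
  (KC : forall z, `|K z| <= C).

Let K' F' G' : (forall z : T * T, `|F' z.1 * G' z.2 * K z| <= C * `|F' z.1 * G' z.2|).
Proof. by move=> z; rewrite normrM mulrC ler_wpM2r. Qed.

(** A bounded kernel is dominated by a multiple of the tensor product of [F] and [G], so their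
    integrability is all that Fubini's theorem asks for. *)
Lemma itg_kernel : itg (mu \x mu)%E (fun z => F z.1 * G z.2 * K z).
Proof.
apply: itg_le (itgZ C (itg_abs (itg_tensor iF iG))); last exact: K'.
by apply: measurable_funM => //; exact: itg_measurable (itg_tensor iF iG).
Qed.

Lemma itg_kernel1 x : itg mu (fun y => F x * G y * K (x, y)).
Proof.
apply: itg_le (itgZ C (itg_abs (itgZ (F x) iG))); last by move=> y; exact: (K' F G (x, y)).
apply: measurable_funM; first exact: itg_measurable (itgZ (F x) iG).
exact: measurableT_comp mK (measurable_pair1 x).
Qed.

Lemma itg_kernel2 y : itg mu (fun x => F x * G y * K (x, y)).
Proof.
apply: itg_le (itgZ C (itg_abs (itgZ (G y) iF))).
  apply: measurable_funM; last exact: measurableT_comp mK (measurable_pair2 y).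
  by apply: measurable_funM => //; exact: itg_measurable iF.
by move=> x; rewrite [G y * _]mulrC; exact: (K' F G (x, y)).
Qed.

Lemma itg_kernel_int : itg mu (fun x => \int[mu]_y (F x * G y * K (x, y))).
Proof. exact: (itg_fubini1 itg_kernel itg_kernel1). Qed.

Lemma kernel_swap : \int[mu]_x \int[mu]_y (F x * G y * K (x, y)) =
  \int[mu]_y \int[mu]_x (F x * G y * K (x, y)).
Proof.
by rewrite (Int_fubini1 itg_kernel itg_kernel1) (Int_fubini2 itg_kernel itg_kernel2).
Qed.

End kernel_fubini.

Section mollification.
Context {R : realType}.
Local Notation plane := (mplane R).
Implicit Types (f g chi F G : R * R -> R).

Definition rho (k : R) (x y : R * R) : R := tbump k k y.1 y.2 x.

Lemma rhoC k x y : rho k x y = rho k y x.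
Proof.
by rewrite /rho /tbump -(bumpN (k * (x.1 - _))) -(bumpN (k * (x.2 - _))) -!mulrN !opprB.
Qed.

Lemma rho_ge0 k x y : 0 <= rho k x y.
Proof. exact: tbump_ge0. Qed.

Lemma rho_bound k x y : `|rho k x y| <= 1.
Proof. by rewrite ger0_norm ?rho_ge0 // tbump_le1. Qed.

Lemma rho_test k y : 0 < k -> test_function (rho k ^~ y).
Proof. by move=> k0; exact: tbump_test. Qed.

Lemma rho_testr k x : 0 < k -> test_function (rho k x).
Proof. by move=> k0; apply: test_ext (rho_test x k0) => y; rewrite rhoC. Qed.

(** The kernel depends only on x - y. This sign is what lets a derivative pass from one factor of a
    pairing to the other. *)
Lemma pd_rhoC (k : R) i x y : 0 < k -> pd i (rho k x) y = - pd i (rho k ^~ y) x.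
Proof.
move=> k0; have D : is_derive x (ex i) (rho k ^~ y) (pd i (rho k ^~ y) x).
  by apply: smooth_is_derive; have [] := rho_test y k0.
have /is_derive_line0 D0 := D.
have D1 : is_derive (0 : R) 1 (fun h : R => - h) (-1).
  by apply: is_derive_opp; exact: is_derive_id.
have := @is_derive_comp1 _ _ (fun h : R => - h) (fun h => rho k (h *: ex i + x) y) 1 0 _ _ D1.
rewrite oppr0 => /(_ _ D0); rewrite mulrN1.
have -> : (fun h : R => rho k (h *: ex i + x) y) \o -%R = fun h => rho k x (h *: ex i + y).
  apply/funext => h; rewrite /rho /tbump /=; congr (bump (k * _) * bump (k * _)).
    by move: (ex i) => v; rewrite /GRing.scale /=; ring.
  by move: (ex i) => v; rewrite /GRing.scale /=; ring.
move=> H; have [_ E] : is_derive y (ex i) (rho k x) (- pd i (rho k ^~ y) x).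
  by apply/is_derive_line0.
exact: E.
Qed.

Lemma Int_rho k x : 0 < k -> \int[leb2]_y rho k x y = mass k ^+ 2.
Proof.
move=> k0; rewrite (@eq_Int _ _ _ leb2 _ (rho k ^~ x)) => [|y]; last exact: rhoC.
exact: Int_tbump.
Qed.

Lemma rho_near k x y : 0 < k -> rho k x y != 0 -> `|x.1 - y.1| < k^-1 /\ `|x.2 - y.2| < k^-1.
Proof.
move=> k0; rewrite mulf_eq0 negb_or => /andP[h1 h2].
have K t : bump (k * t) != 0 -> `|t| < k^-1.
  move=> h; have : `|k * t| < 1.
    by rewrite ltNge; apply/negP => /bump_eq0 /eqP; exact/negP.
  by rewrite normrM (gtr0_norm k0) -ltr_pdivlMl// mulr1.
by split; exact: K.
Qed.

Lemma measurable_rho k : measurable_fun setT (fun z : plane * plane => rho k z.1 z.2).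
Proof.
have mB (f g : plane * plane -> R) : measurable_fun setT f -> measurable_fun setT g ->
    measurable_fun setT (fun z => bump (k * (f z - g z))).
  move=> mf mg; apply: measurableT_comp; first exact: continuous_measurable_fun bump_continuous.
  by apply: measurable_funM => //; exact: measurable_funB.
have m1 (p : plane * plane -> plane) : measurable_fun setT p ->
    measurable_fun setT (fun z => (p z).1 : R) /\ measurable_fun setT (fun z => (p z).2 : R).
  by move=> mp; split; exact: measurableT_comp.
have [a1 a2] := m1 _ (@measurable_fst _ _ plane plane).
have [b1 b2] := m1 _ (@measurable_snd _ _ plane plane).
by apply: measurable_funM; exact: mB.
Qed.

End mollification.

Section mollified_pairing.
Context {R : realType}.
Local Notation plane := (mplane R).
Implicit Types (f g chi F G : R * R -> R).

Definition vanishes_off (N : R) F := forall x : R * R, ~ box N x -> F x = 0.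

Lemma sqi_indic_box N : sqi leb2 (\1_(box N) : R * R -> R).
Proof.
split; first by apply: measurable_indic; exact: measurable_box.
apply: eq_integrable (itg_indic_box N) => // x _ /=; rewrite indicE.
by case: (_ \in _); rewrite ?expr1n ?expr0n.
Qed.

Lemma vanishes_indic N F x : vanishes_off N F -> F x * \1_(box N) x = F x.
Proof.
move=> FN; rewrite indicE; case: (boolP (x \in box N)); rewrite ?mulr1// notin_setE => /FN ->.
by rewrite mul0r.
Qed.

Lemma sqi_itg_box N F : sqi leb2 F -> vanishes_off N F -> itg leb2 F.
Proof.
move=> sF FN; apply: eq_integrable (sqi_mul sF (sqi_indic_box N)) => // x _ /=.
by rewrite vanishes_indic.
Qed.

(** The pairing of [F] with the unnormalised mollification of [G], kept as a double integral that is
    symmetric in [F] and [G]; the mollified functions themselves are never studied. *)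
Definition moll (k : R) F G := \int[leb2]_x \int[leb2]_y (F x * G y * rho k x y).

Let mrho k := @measurable_rho R k.
Let brho k := (fun z => @rho_bound R k z.1 z.2).

Lemma itg_moll k F G : itg leb2 F -> itg leb2 G ->
  itg leb2 (fun x => \int[leb2]_y (F x * G y * rho k x y)).
Proof. by move=> iF iG; exact: (@itg_kernel_int _ _ _ leb2s F G _ 1 iF iG (mrho k) (brho k)). Qed.

Lemma itg_moll1 k F G x : itg leb2 F -> itg leb2 G ->
  itg leb2 (fun y => F x * G y * rho k x y).
Proof. by move=> iF iG; exact: (@itg_kernel1 _ _ _ leb2s F G _ 1 iG (mrho k) (brho k)). Qed.

Lemma mollC k F G : itg leb2 F -> itg leb2 G -> moll k F G = moll k G F.
Proof.
move=> iF iG; rewrite /moll [LHS](@kernel_swap _ _ _ leb2s F G _ 1 iF iG (mrho k) (brho k)).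
by apply: eq_Int => y; apply: eq_Int => x /=; rewrite rhoC [F x * _]mulrC.
Qed.

Lemma mollD k F G G' : itg leb2 F -> itg leb2 G -> itg leb2 G' ->
  moll k F (fun y => G y + G' y) = moll k F G + moll k F G'.
Proof.
move=> iF iG iG'; rewrite -IntD; [|exact: itg_moll|exact: itg_moll].
apply: eq_Int => x; rewrite -IntD; [|exact: itg_moll1|exact: itg_moll1].
by apply: eq_Int => y; rewrite mulrDr mulrDl.
Qed.

Lemma moll_indic k N F : 0 < k -> itg leb2 F -> (forall x, 0 <= F x) ->
  moll k F \1_(box N) <= mass k ^+ 2 * \int[leb2]_x F x.
Proof.
move=> k0 iF F0; rewrite -IntZ//; apply: le_Int; [|exact: itgZ|].
  by apply: itg_moll => //; exact: itg_indic_box.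
move=> x; rewrite mulrC -(Int_rho x k0) -IntZ; last exact: test_itg (rho_testr x k0).
apply: le_Int; first by apply: itg_moll1 => //; exact: itg_indic_box.
  by apply: itgZ; exact: test_itg (rho_testr x k0).
move=> y; rewrite -mulrA ler_wpM2l// ler_piMl ?rho_ge0//.
Qed.

(** Young's inequality with weight [lam] under the double integral. The indicator of the box,
    outside which both functions vanish, replaces the constant 1 to keep every term integrable. *)
Lemma moll_bound k N F G (lam : R) : 0 < k -> 0 < lam -> sqi leb2 F -> sqi leb2 G ->
  vanishes_off N F -> vanishes_off N G ->
  moll k F G <= mass k ^+ 2 *
    (lam / 2 * \int[leb2]_x (F x ^+ 2) + lam^-1 / 2 * \int[leb2]_x (G x ^+ 2)).
Proof.
move=> k0 l0 sF sG FN GN.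
have iF := sqi_itg_box sF FN; have iG := sqi_itg_box sG GN.
have [_ iF2] := sF; have [_ iG2] := sG; have i1 := @itg_indic_box R N.
apply: (@le_trans _ _ (lam / 2 * moll k (fun x => F x ^+ 2) \1_(box N) +
                       lam^-1 / 2 * moll k \1_(box N) (fun x => G x ^+ 2))); last first.
  rewrite mulrDr; apply: lerD.
    rewrite [leRHS]mulrCA ler_wpM2l ?divr_ge0 ?(ltW l0)//.
    by apply: moll_indic => // x; rewrite sqr_ge0.
  rewrite [leRHS]mulrCA ler_wpM2l ?divr_ge0 ?invr_ge0 ?(ltW l0)//.
  by rewrite mollC//; apply: moll_indic => // x; rewrite sqr_ge0.
rewrite -!IntZ; [|exact: itg_moll|exact: itg_moll].
rewrite -IntD; [|by apply: itgZ; exact: itg_moll|by apply: itgZ; exact: itg_moll].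
apply: le_Int; first exact: itg_moll.
  by apply: itgD; apply: itgZ; exact: itg_moll.
move=> x; have s1 := @itg_moll1 k (fun x => F x ^+ 2) \1_(box N) x iF2 i1.
have s2 := @itg_moll1 k \1_(box N) (fun x => G x ^+ 2) x i1 iG2.
rewrite -!IntZ// -IntD; [|exact: itgZ|exact: itgZ].
apply: le_Int; [exact: itg_moll1|by apply: itgD; exact: itgZ|].
move=> y; rewrite -(vanishes_indic x FN) -(vanishes_indic y GN) !indicE.
have r0 := rho_ge0 k x y; move: (rho k x y) r0 (F x) (G y) => r r0 a b.
have key : a * b <= lam / 2 * a ^+ 2 + lam^-1 / 2 * b ^+ 2.
  rewrite -subr_ge0 (_ : _ - _ = lam / 2 * (a - lam^-1 * b) ^+ 2); last first.
    by field; rewrite gt_eqF.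
  by rewrite mulr_ge0 ?sqr_ge0 ?divr_ge0 ?(ltW l0)//.
case: (_ \in _); case: (_ \in _); rewrite /= ?(mulr1, mulr0, mul0r, mul1r, expr0n, addr0)//=.
by rewrite (mulrA (lam / 2)) (mulrA (lam^-1 / 2)) -mulrDl ler_wpM2r.
Qed.

(** The local averages of a test function converge pointwise by continuity and stay below its
    supremum, so dominated convergence needs only that [F] be integrable. *)
Lemma moll_test_cvg N F chi : sqi leb2 F -> vanishes_off N F -> test_function chi ->
  (fun n => moll n.+1%:R F chi / mass n.+1%:R ^+ 2) @ \oo --> \int[leb2]_x (F x * chi x).
Proof.
move=> sF FN tc; have iF := sqi_itg_box sF FN; have ic := test_itg tc.
have [_ /(csupp_bounded (test_continuous tc))[C C0 HC]] := (test_functionP chi).1 tc.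
have m0 n : 0 < mass n.+1%:R ^+ 2 :> R by rewrite exprn_gt0// mass_gt0.
have rt n x := @rho_testr R n.+1%:R x (ltr0Sn _ _).
pose A n x := (mass n.+1%:R ^+ 2)^-1 * \int[leb2]_y (F x * chi y * rho n.+1%:R x y).
have mA n : measurable_fun [set: plane] (A n).
  by apply: itg_measurable; apply: itgZ; exact: itg_moll.
have icr n x : itg leb2 (fun y => chi y * rho n.+1%:R x y).
  exact: sqi_mul (test_sqi tc) (test_sqi (rt n x)).
have A1 n x : A n x = F x * ((mass n.+1%:R ^+ 2)^-1 * \int[leb2]_y (chi y * rho n.+1%:R x y)).
  rewrite mulrCA -IntZ//; congr (_ * _).
  by apply: eq_Int => y; rewrite mulrA.
have bnd n x (c e : R) : (forall y, rho n.+1%:R x y != 0 -> `|chi y - c| <= e) ->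
    `|(mass n.+1%:R ^+ 2)^-1 * \int[leb2]_y (chi y * rho n.+1%:R x y) - c| <= e.
  move=> H; have ir := test_itg (rt n x).
  have mI := Int_rho x (ltr0Sn R n).
  have up : \int[leb2]_y (chi y * rho n.+1%:R x y) <= (c + e) * mass n.+1%:R ^+ 2.
    rewrite -mI -IntZ//; apply: le_Int => //; first exact: itgZ.
    move=> y; have [->|/H] := eqVneq (rho n.+1%:R x y) 0; first by rewrite !mulr0.
    by rewrite ler_norml => /andP[_ h]; rewrite ler_wpM2r ?rho_ge0//; lra.
  have lo : (c - e) * mass n.+1%:R ^+ 2 <= \int[leb2]_y (chi y * rho n.+1%:R x y).
    rewrite -mI -IntZ//; apply: le_Int => //; first exact: itgZ.
    move=> y; have [->|/H] := eqVneq (rho n.+1%:R x y) 0; first by rewrite !mulr0.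
    by rewrite ler_norml => /andP[h _]; rewrite ler_wpM2r ?rho_ge0//; lra.
  rewrite -ler_pdivrMr// in up; rewrite -ler_pdivlMr// in lo; rewrite mulrC.
  move: up lo; move: (_ / _) => I up lo.
  by rewrite ler_norml; apply/andP; split; lra.
have Fb n x : `|A n x| <= C * `|F x|.
  rewrite A1 normrM mulrC ler_wpM2r//.
  have := @bnd n x 0 C; rewrite subr0; apply=> y _; rewrite subr0; exact: HC.
have Fc (x : R * R) : A ^~ x @ \oo --> F x * chi x.
  under eq_fun do rewrite A1.
  apply: cvgMr; apply/cvgrPdist_le => e e0.
  have cx : chi y @[y --> x] --> chi x := test_continuous tc (x := x).
  move/cvgrPdist_le: cx => /(_ e e0).
  move=> /nbhs_ballP[r /= r0 Hr]; near=> n.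
  rewrite distrC; apply: bnd => y /rho_near => /(_ (ltr0Sn _ _)) [h1 h2].
  rewrite distrC; apply: Hr.
  have nr : n.+1%:R^-1 < r by near: n; exact: near_infty_natSinv_lt (PosNum r0).
  by split; [exact: lt_trans nr|exact: lt_trans nr].
have [_] := itg_dct mA (itgZ C (itg_abs iF)) Fb Fc.
apply: cvg_trans; apply: near_eq_cvg; near=> n; rewrite /A IntZ; last exact: itg_moll.
by rewrite mulrC.
Unshelve. all: by end_near. Qed.

(** [G] is replaced by a test function and the error is absorbed by [moll_bound]. An upper bound
    suffices, the lower one being the same statement for the opposite of [F]. *)
Lemma moll_le_near N F G (e : R) : sqi leb2 F -> sqi leb2 G ->
  vanishes_off N F -> vanishes_off N G -> 0 < e ->
  \forall n \near \oo, moll n.+1%:R F G / mass n.+1%:R ^+ 2 <=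
     \int[leb2]_x (F x * G x) + e.
Proof.
move=> sF sG FN GN e0.
pose a := \int[leb2]_x (F x ^+ 2).
have a0 : 0 <= a by apply: Int_ge0 => x; rewrite sqr_ge0.
(* One Young term is then at most e/4, and the accuracy lam e/4 required of [chi] makes the other at
   most e/8. Together with the error on the limit pairing, at most 3e/8, and e/8 from convergence,
   the total is 7e/8. *)
pose lam := e / 2 / (a + 1).
have l0 : 0 < lam by rewrite !divr_gt0// ltr_wpDl.
have la : lam * a <= e / 2 by rewrite /lam mulrAC ler_pdivrMr ?ltr_wpDl// ler_wpM2l ?lerDl// divr_ge0// ltW.
have [chi tc lc] := test_dense sG (mulr_gt0 l0 (divr_gt0 e0 (ltr0Sn R 3))).
have [_ [N' HN']] := (test_functionP chi).1 tc.
pose M := Num.max N N'.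
have FM : vanishes_off M F.
  by move=> x nx; apply: FN => b; apply: nx; apply: box_le b; rewrite le_max lexx.
have cM : vanishes_off M chi.
  by move=> x nx; apply: HN' => b; apply: nx; apply: box_le b; rewrite le_max lexx orbT.
have GM : vanishes_off M G.
  by move=> x nx; apply: GN => b; apply: nx; apply: box_le b; rewrite le_max lexx.
pose H x := G x - chi x.
have sH : sqi leb2 H := sqiB sG (test_sqi tc).
have HM : vanishes_off M H by move=> x nx; rewrite /H GM// cM// subr0.
have iF := sqi_itg_box sF FN; have iG := sqi_itg_box sG GN; have ic := test_itg tc.
have iH := sqi_itg_box sH HM.
have gam n : 0 < mass n.+1%:R ^+ 2 :> R by rewrite exprn_gt0// mass_gt0.
have cv := moll_test_cvg sF FN tc.
have lH : lam^-1 / 2 * \int[leb2]_x (H x ^+ 2) <= e / 8.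
  rewrite -ler_pdivlMl ?divr_gt0 ?invr_gt0//; apply: le_trans lc _.
  by rewrite invf_div invrK; lra.
have Fchi : \int[leb2]_x (F x * chi x) <= \int[leb2]_x (F x * G x) + 3 / 8 * e.
  have E : \int[leb2]_x (F x * chi x) = \int[leb2]_x (F x * G x) - \int[leb2]_x (F x * H x).
    rewrite -IntB; [|exact: sqi_mul|exact: sqi_mul].
    by apply: eq_Int => x; rewrite /H; ring.
  have B : - (\int[leb2]_x (F x * H x)) <= lam / 2 * a + lam^-1 / 2 * \int[leb2]_x (H x ^+ 2).
    rewrite -IntN; last exact: sqi_mul.
    have [_ iF2] := sF; have [_ iH2] := sH.
    rewrite -!IntZ// -IntD; [|exact: itgZ|exact: itgZ].
    apply: le_Int; [by apply: itgN; exact: sqi_mul|by apply: itgD; exact: itgZ|].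
    move=> x; rewrite -subr_ge0 (_ : _ - _ = lam / 2 * (F x + lam^-1 * H x) ^+ 2); last first.
      by field; rewrite gt_eqF.
    by apply: mulr_ge0; [apply: divr_ge0 => //; exact: ltW|exact: sqr_ge0].
  by rewrite E; lra.
have : \forall n \near \oo, moll n.+1%:R F chi / mass n.+1%:R ^+ 2 <=
    \int[leb2]_x (F x * chi x) + e / 8.
  move/cvgrPdist_le: cv => /(_ (e / 8) (divr_gt0 e0 (ltr0Sn _ _))).
  by apply: filterS => n; rewrite ler_norml => /andP[h _]; lra.
apply: filterS => n h.
have -> : moll n.+1%:R F G = moll n.+1%:R F chi + moll n.+1%:R F H.
  rewrite -(mollD _ iF ic iH); apply: (congr1 (moll _ F)); apply/funext => y.
  by rewrite /H; move: (G y) (chi y) => a' b'; ring.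
have := moll_bound (ltr0Sn R n) l0 sF sH FM HM.
rewrite mulrC -ler_pdivrMr; last exact: gam.
move=> h'.
rewrite mulrDl; apply: le_trans (lerD h h') _.
rewrite -/a; move: e0 lH Fchi la; clear.
move: (\int[leb2]_x (F x * chi x)) (\int[leb2]_x (F x * G x)) (\int[leb2]_x (H x ^+ 2)).
rewrite (_ : lam / 2 * a = lam * a / 2); last by ring.
move: (lam * a) => la p q r; move: (lam^-1 / 2 * r) => s; lra.
Qed.

End mollified_pairing.

(** * The divergence theorem in Lebesgue measure *)

Section flux.
Context {R : realType}.
Local Notation plane := (mplane R).
Implicit Types (f g chi F G : R * R -> R).

Definition wpd (i : 'I_2) f g := forall chi, test_function chi ->
  \int[leb2]_x (f x * pd i chi x) = - (\int[leb2]_x (g x * chi x)).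

Lemma is_derive_scale_line f (c : R) (v z z' : R * R) d (g : R * R -> R) :
  is_derive z v f d -> (forall h, f ((c * h) *: v + z) = g (h *: v + z')) ->
  is_derive z' v g (c * d).
Proof.
move=> /is_derive_line0 D H; apply/is_derive_line0.
have D1 : is_derive (0 : R) 1 (fun h : R => c * h) c.
  have := is_derive_mul (is_derive_cst c (0 : R) 1) (is_derive_id (0 : R) 1).
  by move=> D1; apply: (is_derive_eq D1); rewrite mul0r add0r mulr1.
have := @is_derive_comp1 _ _ (fun h : R => c * h) (fun h => f (h *: v + z)) 1 0 _ _ D1.
rewrite mulr0 => /(_ _ D); rewrite mulrC.
by rewrite (_ : _ \o _ = fun h => g (h *: v + z'))//; apply/funext => h /=.
Qed.

Lemma tbump11_test : test_function (tbump 1 1 0 0 : R * R -> R).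
Proof. exact: tbump_test. Qed.

(** By scaling, all kernels and all cut-offs share the gradient bound of a single bump. *)
Lemma pd_tbump (a b c d : R) i (x : R * R) : pd i (tbump a b c d) x =
  (if i == ord0 then a else b) * pd i (tbump 1 1 0 0) (a * (x.1 - c), b * (x.2 - d)).
Proof.
have D := smooth_is_derive i (a * (x.1 - c), b * (x.2 - d)) (test_smooth tbump11_test).
set e := if i == ord0 then a else b.
have H h : tbump 1 1 0 0 ((e * h) *: ex i + (a * (x.1 - c), b * (x.2 - d)))
    = tbump a b c d (h *: ex i + x).
  rewrite /e /tbump; clear; elim/ord2_cases: i; rewrite /ex /=;
  congr (bump _ * bump _); rewrite /GRing.scale /=; ring.
by have [_ E] := is_derive_scale_line D H.
Qed.

Lemma pd_tbump11_bounded : exists2 C : R, 0 <= C &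
  forall i x, `|pd i (tbump 1 1 0 0) x| <= C.
Proof.
have B i : exists2 C : R, 0 <= C & forall x, `|pd i (tbump 1 1 0 0 : R * R -> R) x| <= C.
  have /test_functionP[s c] := test_pd i tbump11_test.
  by apply: csupp_bounded => //; exact: smooth_continuous.
have [A A0 HA] := B ord0; have [A' A'0 HA'] := B ord_max.
exists (A + A'); first exact: addr_ge0.
elim/ord2_cases => x; first by apply: le_trans (HA x) _; rewrite lerDl.
by apply: le_trans (HA' x) _; rewrite lerDr.
Qed.

Lemma measurable_pd_rho i (k : R) : measurable_fun setT
  (fun z : plane * plane => pd i (rho k ^~ z.2) z.1).
Proof.
rewrite (_ : (fun _ => _) = fun z : plane * plane => (if i == ord0 then k else k) *
    pd i (tbump 1 1 0 0) (k * (z.1.1 - z.2.1), k * (z.1.2 - z.2.2))); last first.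
  by apply/funext => z; rewrite /rho pd_tbump.
apply: measurable_funM => //.
have m1 : measurable_fun [set: plane] (pd i (tbump 1 1 0 0) : plane -> R).
  by apply: continuous_measurable_plane; apply: test_continuous; apply: test_pd; exact: tbump11_test.
apply: (measurableT_comp m1).
have mm (p : plane * plane -> plane) : measurable_fun setT p ->
    measurable_fun setT (fun z => (p z).1 : R) /\ measurable_fun setT (fun z => (p z).2 : R).
  by move=> mp; split; exact: measurableT_comp.
have [a1 a2] := mm _ (@measurable_fst _ _ plane plane).
have [b1 b2] := mm _ (@measurable_snd _ _ plane plane).
by apply/measurable_fun_pairP; split; apply: measurable_funM => //; exact: measurable_funB.
Qed.

Lemma mollN k F G : itg leb2 F -> itg leb2 G -> moll k (fun x => - F x) G = - moll k F G.
Proof.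
move=> iF iG; rewrite -(IntN (itg_moll k iF iG)); apply: eq_Int => x.
rewrite -(IntN (itg_moll1 k x iF iG)); apply: eq_Int => y.
by rewrite !mulNr.
Qed.

Lemma moll_cvg N F G : sqi leb2 F -> sqi leb2 G ->
  vanishes_off N F -> vanishes_off N G ->
  (fun n => moll n.+1%:R F G / mass n.+1%:R ^+ 2) @ \oo --> \int[leb2]_x (F x * G x).
Proof.
move=> sF sG FN GN; apply/cvgrPdist_le => e e0.
have FN' : vanishes_off N (fun x => - F x) by move=> x /FN ->; rewrite oppr0.
have h1 := moll_le_near sF sG FN GN e0.
have h2 := moll_le_near (sqiN sF) sG FN' GN e0.
apply: filterS2 h1 h2 => n.
rewrite (mollN _ (sqi_itg_box sF FN) (sqi_itg_box sG GN)) mulNr.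
have -> : \int[leb2]_x (- F x * G x) = - (\int[leb2]_x (F x * G x)).
  by rewrite -(IntN (sqi_mul sF sG)); apply: eq_Int => x; rewrite mulNr.
move: (_ / _) (\int[leb2]_x _) => a b h1 h2.
by rewrite ler_norml; apply/andP; split; lra.
Qed.

Section compact_flux.
Variables (N : R) (u0 v : R * R -> R) (u w : 'I_2 -> R * R -> R).
Hypotheses (su0 : sqi leb2 u0) (su : forall i, sqi leb2 (u i))
  (sv : sqi leb2 v) (sw : forall i, sqi leb2 (w i)).
Hypotheses (u0N : vanishes_off (N + 1) u0) (uN : forall i, vanishes_off (N + 1) (u i))
  (vN : vanishes_off N v) (wN : forall i, vanishes_off N (w i)).
Hypothesis vw : forall i, wpd i v (w i).
Hypothesis uflux : forall n y, box N y ->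
  \int[leb2]_x (u0 x * rho n.+1%:R x y) +
  \sum_(i < 2) \int[leb2]_x (u i x * pd i (rho n.+1%:R ^~ y) x) = 0.

Let vN1 : vanishes_off (N + 1) v.
Proof. by move=> x nx; apply: vN => b; apply: nx; apply: box_le b; rewrite lerDl. Qed.
Let wN1 i : vanishes_off (N + 1) (w i).
Proof. by move=> x nx; apply: wN => b; apply: nx; apply: box_le b; rewrite lerDl. Qed.

(** Tested against the kernel in y, the weak derivative [w i] becomes [v] times the derivative of
    the kernel in x. After exchanging the integrals, y is fixed: in the box the kernel obeys
    [uflux], and outside it [v] vanishes. *)
Lemma moll_flux n : moll n.+1%:R u0 v + \sum_(i < 2) moll n.+1%:R (u i) (w i) = 0.
Proof.
set k := n.+1%:R; have k0 : 0 < k by [].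
have iu0 := sqi_itg_box su0 u0N; have iu i := sqi_itg_box (su i) (@uN i).
have iv := sqi_itg_box sv vN; have iw i := sqi_itg_box (sw i) (@wN i).
have [C C0 HC] := pd_tbump11_bounded.
have Db i z : `|pd i (rho k ^~ z.2) z.1| <= k * C.
  by rewrite /rho pd_tbump if_same normrM (gtr0_norm k0) ler_pM2l.
have swap0 := @kernel_swap _ _ _ (@leb2s R) u0 v _ 1 iu0 iv (@measurable_rho R k)
  (fun z => @rho_bound R k z.1 z.2).
have swap1 i := @kernel_swap _ _ _ (@leb2s R) (u i) v _ _ (iu i) iv
  (@measurable_pd_rho i k) (Db i).
have step i : moll k (u i) (w i) =
    \int[leb2s]_x \int[leb2s]_y (u i x * v y * pd i (rho k ^~ y) x).
  apply: eq_Int => x; have tx := rho_testr x k0; have := vw i tx.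
  move=> /(congr1 (fun t => - (u i x * t))); rewrite mulrN opprK.
  have sp := test_sqi (test_pd i tx).
  rewrite -(IntZ _ (sqi_mul sv sp)) -(IntZ _ (sqi_mul (sw i) (test_sqi tx))).
  rewrite -IntN; last by apply: itgZ; exact: sqi_mul sv sp.
  move=> E; transitivity (\int[leb2]_y (u i x * (w i y * rho k x y))).
    by apply: eq_Int => y; rewrite mulrA.
  rewrite -E; apply: eq_Int => y; rewrite (pd_rhoC i x y k0).
  by move: (pd _ _ _) => p; ring.
pose K i (z : plane * plane) := pd i (rho k ^~ z.1) z.2.
have mK i : measurable_fun setT (K i) := measurableT_comp (@measurable_pd_rho i k) (@measurable_swap _ _ plane plane).
have bK i z : `|K i z| <= k * C by exact: (Db i (z.2, z.1)).
have I1 i : itg leb2 (fun y => \int[leb2]_x (v y * u i x * K i (y, x))) := @itg_kernel_int _ _ _ (@leb2s R) v (u i) (K i) _ iv (iu i) (mK i) (bK i).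
have I0 := itg_moll k iv iu0.
have E0 : moll k u0 v = \int[leb2]_y \int[leb2]_x (v y * u0 x * rho k y x) := mollC k iu0 iv.
have E1 i : moll k (u i) (w i) = \int[leb2]_y \int[leb2]_x (v y * u i x * K i (y, x)).
  rewrite step [LHS]swap1; apply: eq_Int => y; apply: eq_Int => x.
  by rewrite [v y * _]mulrC.
rewrite E0 (eq_bigr _ (fun i _ => E1 i)) -(Int_sum _ I1) -(IntD I0 (itg_sum _ I1)).
rewrite -[RHS](@Int0 _ _ _ leb2); apply: eq_Int => y.
have [yN|yN] := pselect (box N y); last first.
  have z (h : R * R -> R) : \int[leb2]_x (v y * h x) = 0.
    by rewrite -[RHS](@Int0 _ _ _ leb2); apply: eq_Int => x; rewrite (vN yN) mul0r.
  rewrite big1 => [|i _]; first by rewrite addr0 -[RHS](z (fun x => u0 x * rho k y x)); apply: eq_Int => x; rewrite mulrA.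
  by rewrite -[RHS](z (fun x => u i x * K i (y, x))); apply: eq_Int => x; rewrite mulrA.
have ty := rho_test y k0.
have := uflux n yN; rewrite -/k => /(congr1 (fun t => v y * t)); rewrite mulr0 mulrDr mulr_sumr.
move=> E; apply: (etrans _ E); clear E.
congr (_ + _).
  rewrite -IntZ; last exact: sqi_mul su0 (test_sqi ty).
  by apply: eq_Int => x; rewrite mulrA rhoC.
apply: eq_bigr => i _.
rewrite -IntZ; last exact: sqi_mul (su i) (test_sqi (test_pd i ty)).
by apply: eq_Int => x; rewrite mulrA.
Qed.

Lemma compact_flux :
  \int[leb2]_x (u0 x * v x) + \sum_(i < 2) \int[leb2]_x (u i x * w i x) = 0.
Proof.
have c0 := moll_cvg su0 sv u0N vN1.
have ci i := moll_cvg (su i) (sw i) (@uN i) (@wN1 i).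
pose a n i := moll n.+1%:R (u i) (w i) / mass n.+1%:R ^+ 2 : R.
have : (fun n => moll n.+1%:R u0 v / mass n.+1%:R ^+ 2 + (a n ord0 + a n ord_max)) @ \oo -->
    \int[leb2]_x (u0 x * v x) + (\int[leb2]_x (u ord0 x * w ord0 x) +
     \int[leb2]_x (u ord_max x * w ord_max x)).
  by apply: cvgD; [exact: c0|apply: cvgD; exact: ci].
rewrite -(sum_ord2 (fun i => \int[leb2]_x (u i x * w i x))).
rewrite (_ : (fun n : nat => _ + _) = fun=> 0); last first.
  apply/funext => n; have := moll_flux n; rewrite (sum_ord2 (fun i => moll n.+1%:R (u i) (w i))).
  by move=> E; rewrite -[RHS](mul0r (mass n.+1%:R ^- 2)) -E !mulrDl.
by move=> H; apply/esym; apply: (cvg_unique _ (cvg_cst _) H); exact: norm_hausdorff.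
Qed.

End compact_flux.

End flux.

Section global_flux.
Context {R : realType}.
Local Notation plane := (mplane R).
Implicit Types (f g chi F G : R * R -> R).

(** Local square integrability is stable under the unbounded weights exp(c x_2), which relate the
    two measures and would destroy global integrability. *)
Definition loc2 f := measurable_fun [set: plane] f /\
  forall N, sqi leb2 (fun x => f x * \1_(box N) x).

Lemma loc2M g f : continuous g -> loc2 f -> loc2 (fun x => g x * f x).
Proof.
move=> cg [mf sf]; have mg := continuous_measurable_plane cg.
split=> [|N]; first exact: measurable_funM.
have [C C0 HC] := continuous_box_bounded N cg.
have m1 : measurable_fun [set: plane] (\1_(box N) : plane -> R).
  by apply: measurable_indic; exact: measurable_box.
apply: (@sqi_le _ _ _ leb2 _ (fun x => C * (f x * \1_(box N) x))).
- by apply: measurable_funM => //; exact: measurable_funM.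
- move=> x; rewrite -mulrA !normrM (ger0_norm C0) indicE.
  have [xN|xN] := pselect (box N x); last by rewrite (memNset xN) normr0 !mulr0.
  by rewrite ler_wpM2r ?mulr_ge0//; exact: HC.
- exact: sqiZ.
Qed.

Lemma loc2D f g : loc2 f -> loc2 g -> loc2 (fun x => f x + g x).
Proof.
move=> [mf sf] [mg sg]; split=> [|N]; first exact: measurable_funD.
by under eq_fun do rewrite mulrDl; exact: sqiD.
Qed.

Lemma sqi_loc2 f : sqi leb2 f -> loc2 f.
Proof.
move=> sf; split=> [|N]; first by case: sf.
under eq_fun do rewrite mulrC.
apply: (@sqi_bounded_mul _ _ _ leb2 _ f 1) => //.
  by apply: measurable_indic; exact: measurable_box.
by move=> x; rewrite indicE; case: (_ \in _); rewrite ?normr1 ?normr0.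
Qed.

Lemma sqi_vol_loc2 f : sqi vol f -> loc2 f.
Proof.
move=> /sqi_vol /sqi_loc2 h.
have := @loc2M (fun x => expR (2^-1 * x.2)) _ (smooth_continuous (smooth_expR_snd _)) h.
rewrite (_ : (fun _ => _) = f)//; apply/funext => x.
by rewrite mulrCA mulNr expRxMexpNx_1 mulr1.
Qed.

Lemma loc2_test f chi : loc2 f -> test_function chi -> itg leb2 (fun x => f x * chi x).
Proof.
move=> [mf sf] tc; have [_ [N HN]] := (test_functionP chi).1 tc.
apply: eq_integrable (sqi_mul (sf N) (test_sqi tc)) => // x _ /=; congr EFin.
by rewrite -mulrA [\1_ _ _ * _]mulrC vanishes_indic.
Qed.

Lemma wpdM i v w eta : loc2 v -> loc2 w -> smooth eta -> wpd i v w ->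
  wpd i (fun x => eta x * v x) (fun x => eta x * w x + pd i eta x * v x).
Proof.
move=> lv lw se H chi tc.
have t1 := testM se tc; have t2 := testM (smooth_pd i se) tc.
have tp := test_pd i t1.
have := H _ t1.
have -> : \int[leb2]_x (v x * pd i (fun x => eta x * chi x) x) =
    \int[leb2]_x (v x * (pd i eta x * chi x)) + \int[leb2]_x (eta x * v x * pd i chi x).
  rewrite -IntD; last 1 first.
  - have := loc2_test lv (testM se (test_pd i tc)).
    by apply: eq_integrable => // x _ /=; congr EFin; rewrite mulrCA mulrA.
  - apply: eq_Int => x; rewrite (pdM i x se (test_smooth tc)).
    by move: (pd _ _ _) (pd _ _ _) => a b; ring.
  - exact: loc2_test.
move=> E.
have -> : \int[leb2]_x ((eta x * w x + pd i eta x * v x) * chi x) =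
    \int[leb2]_x (w x * (eta x * chi x)) + \int[leb2]_x (v x * (pd i eta x * chi x)).
  rewrite -IntD; [|exact: loc2_test|exact: loc2_test].
  by apply: eq_Int => x; move: (pd _ _ _) => a; ring.
by move: E; move: (\int[leb2]_x _) (\int[leb2]_x _) (\int[leb2]_x _) => a b c; lra.
Qed.

Section flux_identity.
Variables (u0 v : R * R -> R) (u w : 'I_2 -> R * R -> R).
Hypotheses (lu0 : loc2 u0) (lu : forall i, loc2 (u i)) (lv : loc2 v) (lw : forall i, loc2 (w i)).
Hypothesis vw : forall i, wpd i v (w i).
Hypothesis uflux : forall chi, test_function chi ->
  \int[leb2]_x (u0 x * chi x) + \sum_(i < 2) \int[leb2]_x (u i x * pd i chi x) = 0.

(** [compact_flux] for eta v, whose weak gradient is given by the Leibniz rule, and for the fields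
    truncated to a box. *)
Lemma flux_cutoff eta : test_function eta ->
  \int[leb2]_x (u0 x * v x * eta x) +
  \sum_(i < 2) \int[leb2]_x (u i x * (eta x * w i x + pd i eta x * v x)) = 0.
Proof.
move=> te; have [se [N HN]] := (test_functionP eta).1 te.
have ce := test_continuous te; have cp i := test_continuous (test_pd i te).
pose ind (f : R * R -> R) x := f x * \1_(box (N + 1)) x.
have indV f : vanishes_off (N + 1) (ind f).
  by move=> x nx; rewrite /ind indicE memNset// mulr0.
have indE f (g : R * R -> R) : vanishes_off (N + 1) g -> forall x, ind f x * g x = f x * g x.
  by move=> gN x; rewrite /ind -mulrA [\1_ _ _ * _]mulrC vanishes_indic.
have up (g : R * R -> R) : vanishes_off N g -> vanishes_off (N + 1) g.
  by move=> gN x nx; apply: gN => b; apply: nx; apply: box_le b; rewrite lerDl.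
have pN i : vanishes_off N (pd i eta) by move=> x; exact: pd_box0.
have vV : vanishes_off N (fun x => eta x * v x) by move=> x /HN ->; rewrite mul0r.
have wV i : vanishes_off N (fun x => eta x * w i x + pd i eta x * v x).
  by move=> x nx; rewrite (HN x nx) (pN i x nx) !mul0r addr0.
have sq (g : R * R -> R) : vanishes_off N g -> loc2 g -> sqi leb2 g.
  move=> gN [_ /(_ N)]; rewrite (_ : (fun _ => _) = g)//; apply/funext => x.
  exact: vanishes_indic.
have sv : sqi leb2 (fun x => eta x * v x) by apply: sq => //; exact: loc2M.
have sw i : sqi leb2 (fun x => eta x * w i x + pd i eta x * v x).
  by apply: sq => //; apply: loc2D; exact: loc2M.
(* The kernel has width 1/(n+1), at most 1, so around a point of the box of size N it lives in the
   box of size N + 1. Truncating the fields there does not affect the identity they satisfy. *)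
have rN n y : box N y -> vanishes_off (N + 1) (rho n.+1%:R ^~ y).
  move=> /boxP[y1 y2] x nx; apply/eqP/negP => /negP /rho_near => /(_ (ltr0Sn _ _)) [h1 h2].
  have n1 : n.+1%:R^-1 <= 1 :> R by rewrite invf_le1 ?ltr0Sn// ler1n.
  apply: nx; apply/boxP; split.
    rewrite -(subrK y.1 x.1) (le_trans (ler_normD _ _))// addrC lerD//.
    exact: le_trans (ltW h1) n1.
  rewrite -(subrK y.2 x.2) (le_trans (ler_normD _ _))// addrC lerD//.
  exact: le_trans (ltW h2) n1.
have := @compact_flux R N (ind u0) (fun x => eta x * v x) (fun i => ind (u i))
  (fun i x => eta x * w i x + pd i eta x * v x) (lu0.2 _) (fun i => (lu i).2 _) sv sw
  (indV _) (fun i => indV _) vV wV (fun i => wpdM lv (lw i) se (@vw i)) _.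
have H n y : box N y ->
    \int[leb2]_x (ind u0 x * rho n.+1%:R x y) +
    \sum_(i < 2) \int[leb2]_x (ind (u i) x * pd i (rho n.+1%:R ^~ y) x) = 0.
  move=> yN; apply: etrans (uflux (rho_test y (ltr0Sn R n))); congr (_ + _).
    by apply: eq_Int => x; exact: (indE u0 _ (rN n y yN) x).
  apply: eq_bigr => i _; apply: eq_Int => x.
  by apply: (indE (u i) (pd i (rho n.+1%:R ^~ y))) => z; apply: pd_box0; exact: rN.
move=> /(_ H) E; apply: etrans E; congr (_ + _).
  apply: eq_Int => x; rewrite (indE u0 (fun x => eta x * v x) (up _ vV)) -mulrA; congr (_ * _).
  exact: mulrC.
by apply: eq_bigr => i _; apply: eq_Int => x; rewrite (indE (u i) _ (up _ (wV i))).
Qed.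

Hypotheses (iu0 : itg leb2 (fun x => u0 x * v x))
  (iu : forall i, itg leb2 (fun x => u i x * w i x))
  (iw0 : itg leb2 (fun x => expR (- x.2) * u ord0 x * v x))
  (iw1 : itg leb2 (fun x => u ord_max x * v x)).

(* The cut-off has size [n] in the second variable and [n exp n] in the first
   one, which is what makes its gradient [O(1/n)] in the hyperbolic metric. *)
Lemma flux_identity :
  \int[leb2]_x (u0 x * v x) + \sum_(i < 2) \int[leb2]_x (u i x * w i x) = 0.
Proof.
pose b n : R := n.+1%:R^-1; pose a n : R := b n * expR (- n.+1%:R).
have b0 n : 0 < b n by rewrite invr_gt0.
have b1 n : b n <= 1 by rewrite invf_le1 ?ltr0Sn// ler1n.
have a0 n : 0 < a n by rewrite mulr_gt0 ?expR_gt0.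
have ab n : a n <= b n by rewrite ler_piMr ?(ltW (b0 n))// -expR0 ler_expR oppr_le0.
have bc : b @ \oo --> (0 : R) by exact: cvg_harmonic.
have ac : a @ \oo --> (0 : R).
  apply: (squeeze_cvgr _ (cvg_cst 0) bc); near=> n.
  by rewrite (ltW (a0 n)) ab.
pose eta n : R * R -> R := tbump (a n) (b n) 0 0.
have te n : test_function (eta n) by exact: tbump_test.
have [C C0 HC] := @pd_tbump11_bounded R.
(* The cut-offs tend to this positive constant rather than to 1; it is divided out at the end. *)
pose L := bump (0 : R) * bump 0.
have L0 : 0 < L by rewrite mulr_gt0 ?bump_gt0 ?normr0.
have etac x : eta ^~ x @ \oo --> L.
  have bb (c : nat -> R) t : c @ \oo --> (0 : R) -> (fun n => bump (c n * (t - 0))) @ \oo --> bump (0 : R).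
    move=> cc; apply: continuous_cvg; first exact: bump_continuous.
    by rewrite -[X in _ --> X](mul0r (t - 0)); apply: cvgM => //; exact: cvg_cst.
  by apply: cvgM; exact: bb.
have pe n i x : `|pd i (eta n) x| <= (if i == ord0 then expR (- x.2) else 1) * (C * b n).
  rewrite pd_tbump normrM.
  (* For |x_2| > n + 1 the cut-off and its gradient vanish. Elsewhere the factor exp(- (n+1)) in the
     scale of the first variable is at most exp(- x_2), which is the length of dx_1 up to
     inversion. *)
  have [x2|x2] := ltP 1 `|b n * (x.2 - 0)|.
    rewrite (@pd_box0 _ _ i 1) ?normr0 ?mulr0 => [||/boxP[_ /=]].
    - by case: ifP => _; rewrite ?mulr_ge0 ?expR_ge0 ?(ltW (b0 n)).
    - move=> y /boxP ny; rewrite /tbump !mul1r !subr0.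
      have [y1|y1] := leP 1 `|y.1|; first by rewrite bump_eq0// mul0r.
      have [y2|y2] := leP 1 `|y.2|; first by rewrite (bump_eq0 y2) mulr0.
      by exfalso; apply: ny; split; exact: ltW.
    - by rewrite leNgt x2.
  have h := HC i (a n * (x.1 - 0), b n * (x.2 - 0)).
  elim/ord2_cases: i h => h /=; rewrite gtr0_norm//; last first.
    by rewrite mul1r mulrC ler_wpM2r// (ltW (b0 n)).
  apply: le_trans (ler_wpM2l (ltW (a0 n)) h) _.
  rewrite [C * _]mulrC mulrA ler_wpM2r// /a mulrC ler_wpM2r ?(ltW (b0 n))// ler_expR.
  move: x2; rewrite subr0 normrM (gtr0_norm (b0 n)) mulrC /b ler_pdivrMr// mul1r => x2.
  by rewrite lerN2 (le_trans (ler_norm _)).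
have eb n x : `|eta n x| <= 1 by rewrite ger0_norm ?tbump_ge0// tbump_le1.
have me n := test_measurable (te n).
have mv := lv.1.
have dct (F : R * R -> R) : itg leb2 F ->
    (fun n => \int[leb2]_x (F x * eta n x)) @ \oo --> \int[leb2]_x (F x * L).
  move=> iF.
  have mF n : measurable_fun [set: plane] (fun x => F x * eta n x).
    by apply: measurable_funM => //; exact: itg_measurable iF.
  have bF n x : `|F x * eta n x| <= `|F x| by rewrite normrM ler_piMr.
  have cF x : (fun n => F x * eta n x) @ \oo --> F x * L by apply: cvgMr; exact: etac.
  by have [] := itg_dct mF (itg_abs iF) bF cF.
pose g i x := (if i == ord0 then expR (- x.2) else 1) * (u i x * v x).
have ig i : itg leb2 (g i).
  rewrite /g; elim/ord2_cases: i => /=.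
    by apply: eq_integrable iw0 => // x _ /=; rewrite mulrA.
  by apply: eq_integrable iw1 => // x _ /=; rewrite mul1r.
have key i n x : `|u i x * v x * pd i (eta n) x| <= C * b n * `|g i x|.
  rewrite normrM [leRHS]mulrC /g.
  have := pe n i x; set e := (if _ then _ else _).
  have e0 : 0 <= e by rewrite /e; case: ifP => _ //; exact: expR_ge0.
  rewrite !normrM (ger0_norm e0) => h; rewrite [e * _]mulrC -[leRHS]mulrA.
  by apply: ler_wpM2l => //; exact: mulr_ge0.
have mg i n : measurable_fun [set: plane] (fun x => u i x * v x * pd i (eta n) x).
  apply: measurable_funM; last exact: test_measurable (test_pd i (te n)).
  by apply: measurable_funM => //; have [] := lu i.
have Cb n : 0 <= C * b n by rewrite mulr_ge0// ltW.
have igr i n : itg leb2 (fun x => u i x * v x * pd i (eta n) x).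
  exact: itg_le (mg i n) (key i n) (itgZ (C * b n) (itg_abs (ig i))).
have grad i : (fun n => \int[leb2]_x (u i x * v x * pd i (eta n) x)) @ \oo --> (0 : R).
  rewrite -[X in _ --> X](@Int0 _ _ _ (@leb2 R)).
  have bg n x : `|u i x * v x * pd i (eta n) x| <= C * `|g i x|.
    by apply: le_trans (key i n x) _; rewrite ler_wpM2r// ler_piMr.
  have cg x : (fun n => u i x * v x * pd i (eta n) x) @ \oo --> (0 : R).
    apply/norm_cvg0P.
    apply: (@squeeze_cvgr _ _ _ _ (fun=> 0) (fun n => C * b n * `|g i x|)).
    + by near=> n; rewrite normr_ge0 key.
    + exact: cvg_cst.
    + rewrite -[X in _ --> X](mul0r `|g i x|) -[X in X * _](mulr0 C).
      by apply: cvgM; [apply: cvgMr; exact: bc|exact: cvg_cst].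
  by have [] := itg_dct (mg i) (itgZ C (itg_abs (ig i))) bg cg.
have iue i n : itg leb2 (fun x => u i x * w i x * eta n x).
  apply: itg_le (itg_abs (iu i)); last by move=> x; rewrite normrM ler_piMr.
  by apply: measurable_funM => //; exact: itg_measurable (iu i).
pose A n i := \int[leb2]_x (u i x * w i x * eta n x) + \int[leb2]_x (u i x * v x * pd i (eta n) x).
have Ac i : A ^~ i @ \oo --> \int[leb2]_x (u i x * w i x * L) + 0.
  by apply: cvgD; [exact: dct|exact: grad].
have : (fun n => \int[leb2]_x (u0 x * v x * eta n x) + (A n ord0 + A n ord_max)) @ \oo -->
   \int[leb2]_x (u0 x * v x * L) + ((\int[leb2]_x (u ord0 x * w ord0 x * L) + 0) +
    (\int[leb2]_x (u ord_max x * w ord_max x * L) + 0)).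
  by apply: cvgD; [exact: dct|apply: cvgD; exact: Ac].
rewrite (_ : (fun n : nat => _ + _) = fun=> 0); last first.
  apply/funext => n; rewrite -(flux_cutoff (te n)) sum_ord2; congr (_ + (_ + _));
    rewrite /A -(IntD (iue _ n) (igr _ n)); apply: eq_Int => x; move: (pd _ _ _) => p; ring.
move=> H.
have {}H : 0 = \int[leb2]_x (u0 x * v x * L) + ((\int[leb2]_x (u ord0 x * w ord0 x * L) + 0) +
    (\int[leb2]_x (u ord_max x * w ord_max x * L) + 0)) :> R.
  by apply: (cvg_unique _ (cvg_cst _) H); exact: norm_hausdorff.
have out F : itg leb2 F -> \int[leb2]_x (F x * L) = L * \int[leb2]_x F x.
  by move=> iF; rewrite -IntZ//; apply: eq_Int => x; rewrite mulrC.
move/esym: H; rewrite !addr0 !out//.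
rewrite -!mulrDr => /eqP; rewrite mulf_eq0 gt_eqF//= => /eqP E.
by rewrite sum_ord2.
Unshelve. all: by end_near. Qed.

End flux_identity.
End global_flux.

Lemma smooth_cometric {R : realType} i : smooth (fun x : R * R => cometric i i x).
Proof.
elim/ord2_cases: i.
  by apply: smooth_ext (smooth_expR_snd 2) => x; rewrite cometric0.
by apply: smooth_ext (smooth_cst 1) => x; rewrite cometric1.
Qed.

(** * The limit connection and the harmonic map equation in components *)

Section target_coefficients.
Context {R : realType}.
Variable Q : R * R -> R * R.
Hypothesis sQ : forall k, smooth (crd k \o Q).
Local Notation Xi := (fun i x => Theta i (Q x)).
Local Notation plane := (mplane R).

(* The components of [dQ] in the frame [Xi]: [phi_inf i = (pco i, qco i)]. *)
Definition pco (i : 'I_2) (x : R * R) : R := expR (- (Q x).2) * pd i (crd ord0 \o Q) x.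
Definition qco (i : 'I_2) (x : R * R) : R := pd i (crd ord_max \o Q) x.

Definition rot_mx : 'M[R]_2 :=
  \matrix_(j, k) (if j == k then 0 else if j == ord0 then -1 else 1).

Lemma smooth_exp_target (c : R) : smooth (fun x => expR (c * (Q x).2)).
Proof.
move=> n; apply: (@Cn_comp _ _ _ _ _ openT n (fun x => c * (Q x).2)).
  by move=> m; exact: Cn_expR.
exact: (CnZ openT c (sQ ord_max n)).
Qed.

Lemma smooth_pco i : smooth (pco i).
Proof.
apply: smoothM; last exact: smooth_pd (sQ ord0).
by apply: smooth_ext (smooth_exp_target (-1)) => x; rewrite mulN1r.
Qed.

Lemma smooth_qco i : smooth (qco i).
Proof. exact: smooth_pd (sQ ord_max). Qed.

Lemma is_derive_exp_target (c : R) i x :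
  is_derive x (ex i) (fun x => expR (c * (Q x).2)) (expR (c * (Q x).2) * (c * qco i x)).
Proof.
have D := smooth_is_derive i x (sQ ord_max).
have D2 := is_derive_mul (is_derive_cst c x (ex i)) D.
apply: (is_derive_eq (is_derive_comp1 D2 (is_derive_expR _))).
by rewrite /qco /=; move: (pd _ _ _) (expR _) => a b; ring.
Qed.

Lemma phi_infE i x : (phi_inf Q Xi i x ord0 0 = pco i x) *
  (phi_inf Q Xi i x ord_max 0 = qco i x).
Proof.
have e0 : dmap Q (ex i) x ord0 0 = pd i (crd ord0 \o Q) x by rewrite mxE.
have e1 : dmap Q (ex i) x ord_max 0 = qco i x by rewrite mxE.
rewrite /phi_inf !mxE !innerE e0 e1 /Theta /= !mxE /pco /=.
move: (pd _ _ _) (qco _ _) => a b; have := expRxMexpNx_1 (Q x).2.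
move: (expR _) (expR _) => c d cd; split; last by ring.
by transitivity ((d * c) * c * a); [ring|rewrite cd mul1r].
Qed.

Lemma conn_infE i : conn_inf Q Xi i = fun x => pco i x *: rot_mx.
Proof.
apply/funext => x.
have d0 : derivable (fun y => expR (1 * (Q y).2)) x (ex i).
  by have [] := is_derive_exp_target 1 i x.
have t0 k : (fun y => Theta k (Q y) ord0 0) =
    if k == ord0 then (fun y => expR (1 * (Q y).2)) else cst 0.
  by elim/ord2_cases: k; apply/funext => y; rewrite /Theta /= !mxE /= ?mulr1 ?mul1r.
have t1 k : (fun y => Theta k (Q y) ord_max 0) = cst (if k == ord0 then 0 else 1).
  by elim/ord2_cases: k; apply/funext => y; rewrite /Theta /= !mxE /= ?mulr0.
have D k l : derivable (fun y => Theta k (Q y) l 0) x (ex i).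
  elim/ord2_cases: l; last by rewrite t1; exact: derivable_cst.
  rewrite t0; case: (k == ord0); [exact: d0|exact: derivable_cst].
have f1 : 'D_(ex i) (fst \o Q) x = pd i (crd ord0 \o Q) x by [].
have f2 : 'D_(ex i) (snd \o Q) x = qco i x by [].
have N k : (nablaX Q (Theta k \o Q) (ex i) x ord0 0 =
    if k == ord0 then 0 else - pd i (crd ord0 \o Q) x) *
  (nablaX Q (Theta k \o Q) (ex i) x ord_max 0 = if k == ord0 then pco i x else 0).
  have [N0 N1] := nablaXE Q (D k).
  rewrite [nablaX _ _ _ _ ord0 _]N0 [nablaX _ _ _ _ ord_max _]N1 t0 t1 f1 f2.
  have T0 := congr1 (fun h => h x) (t0 k); have T1 := congr1 (fun h => h x) (t1 k).
  rewrite /= in T0 T1; rewrite T0 T1 derive_cst.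
  clear t0 t1 D N0 N1 T0 T1; have [_ E] := is_derive_exp_target 1 i x.
  elim/ord2_cases: k => /=; rewrite ?E ?derive_cst /pco ?mul1r.
    move: (pd _ _ _) (qco _ _) => a b; have := expRxMexpNx_1 (Q x).2.
    move: (expR _) (expR _) => c d cd; split; first by ring.
    by transitivity ((d * c) * c * a); [ring|rewrite cd mul1r].
  by move: (pd _ _ _) (qco _ _) => a b; split; ring.
apply/matrixP => j k; rewrite mxE innerE [nablaX _ _ _ _ ord0 _](N k).1 [nablaX _ _ _ _ ord_max _](N k).2.
rewrite !mxE /pco; move: (pd _ _ _) => a; clear t0 t1 D N.
have := expRxMexpNx_1 (Q x).2.
elim/ord2_cases: j; elim/ord2_cases: k; rewrite /Theta /= !mxE /=;
  move: (expR _) (expR _) => c d cd; try ring.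
by transitivity (- ((d * c) * c * a)); [ring|rewrite cd mul1r mulrN1].
Qed.

Lemma is_derive_scale_rot i x :
  is_derive x (ex i) (fun y => pco i y *: rot_mx) (pd i (pco i) x *: rot_mx).
Proof.
have E j k : is_derive x (ex i) (fun y => (pco i y *: rot_mx) j k) ((pd i (pco i) x *: rot_mx) j k).
  have := is_derive_mul (smooth_is_derive i x (smooth_pco i)) (is_derive_cst (rot_mx j k) x (ex i)).
  move=> H; have -> : (fun y => (pco i y *: rot_mx) j k) = fun y => pco i y * rot_mx j k.
    by apply/funext => y; rewrite [LHS]mxE.
  have -> : (pd i (pco i) x *: rot_mx) j k = pd i (pco i) x * rot_mx j k by rewrite [LHS]mxE.
  by apply: (is_derive_eq H); rewrite mulr0 addr0.
split; first by apply/derivable_mxP => j k; case: (E j k).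
apply/matrixP => j k; rewrite derive_entry => [|j' k']; last by case: (E j' k').
by case: (E j k).
Qed.

Lemma derivable_conn_inf i x : derivable (conn_inf Q Xi i) x (ex i).
Proof. by rewrite conn_infE; have [] := is_derive_scale_rot i x. Qed.

Lemma pd_conn_inf i x : pd i (conn_inf Q Xi i) x = pd i (pco i) x *: rot_mx.
Proof. by rewrite /pd conn_infE; have [_ ->] := is_derive_scale_rot i x. Qed.

(** The only term that survives in this trace is h^{11} Gamma^2_{11} = 1. It is the source of the
    first order term - d_2 in the Laplacian and in the divergence. *)
Lemma sum_chris (F : 'I_2 -> R) x :
  \sum_(i < 2) cometric i i x * (\sum_(k < 2) chris k i i x * F k) = F ord_max.
Proof.
rewrite !sum_ord2 cometric0 cometric1 !chrisE /=.
have : expR (2 * x.2) * expR (- 2 * x.2) = 1 by rewrite mulNr -expRD subrr expR0.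
move: (expR _) (expR _) => a b ab.
by transitivity ((b * a) * F ord_max); [ring|rewrite ab mul1r].
Qed.

Lemma chris0_quadratic (x y : R * R) (v : 'I_2 -> 'cV[R]_2) :
  \sum_(a < 2) \sum_(b < 2) cometric a b x *
    (\sum_(i < 2) \sum_(j < 2) chris ord0 i j y * v a i 0 * v b j 0) =
  - 2 * \sum_(a < 2) cometric a a x * (v a ord0 0 * v a ord_max 0).
Proof.
have n1 : cometric ord0 ord_max x = 0 :> R by apply: cometric_neq.
have n2 : cometric ord_max ord0 x = 0 :> R by apply: cometric_neq.
rewrite !sum_ord2 n1 n2 !chrisE /=; ring.
Qed.

Lemma pd_pco i x : pd i (pco i) x =
  expR (- (Q x).2) * pd i (pd i (crd ord0 \o Q)) x - pco i x * qco i x.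
Proof.
have D := is_derive_mul (is_derive_exp_target (-1) i x) (smooth_is_derive i x (smooth_pd i (sQ ord0))).
have -> : pco i = fun y => expR (-1 * (Q y).2) * pd i (crd ord0 \o Q) y.
  by apply/funext => y; rewrite mulN1r.
have [_ E] := D; apply: (etrans E); rewrite mulN1r.
by move: (pd _ _ _) (pd _ _ _) (qco _ _) (expR _) => a b c d; ring.
Qed.

(** The first component of the equation for [Q] reads Delta Q^1 = 2 <dQ^1, dQ^2>. Differentiating
    the factor exp(- Q^2) of p removes one of the two copies. *)
Lemma harmonic_divergence x : tension Q x = 0 ->
  \sum_(i < 2) cometric i i x * pd i (pco i) x - pco ord_max x =
  \sum_(i < 2) cometric i i x * (pco i x * qco i x).
Proof.
move=> /(congr1 (fun A : 'cV[R]_2 => A ord0 0)).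
rewrite [X in X = _]mxE [X in _ = X]mxE => H.
have := etrans (esym (congr1 (fun t => Lap (crd ord0 \o Q : R * R -> R) x + t)
  (chris0_quadratic x (Q x) (fun a => dmap Q (ex a) x)))) H.
have d0 i : dmap Q (ex i) x ord0 0 = pd i (crd ord0 \o Q) x by rewrite mxE.
have d1 i : dmap Q (ex i) x ord_max 0 = qco i x by rewrite mxE.
have -> : Lap (crd ord0 \o Q : R * R -> R) x =
    \sum_(i < 2) cometric i i x * pd i (pd i (crd ord0 \o Q)) x - pd ord_max (crd ord0 \o Q) x.
  apply: (etrans (Lap_diag _ _)).
  rewrite -(sum_chris (fun k => pd k (crd ord0 \o Q) x) x) -sumrB.
  by apply: eq_bigr => i _; rewrite -mulrBr.
clear H; rewrite !sum_ord2 !d0 !d1 (pd_pco ord0) (pd_pco ord_max) /pco; clear d0 d1.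
move: (pd ord0 (pd ord0 (crd ord0 \o Q)) x) (pd ord_max (pd ord_max (crd ord0 \o Q)) x).
move: (pd ord0 (crd ord0 \o Q) x) (pd ord_max (crd ord0 \o Q) x) (qco ord0 x) (qco ord_max x).
move: (expR (- (Q x).2)) (cometric ord0 ord0 x) (cometric ord_max ord_max x).
move=> E h g b0 b1 q0 q1 a0 a1 H.
transitivity (E * ((h * a0 + g * a1 - b1 + - 2 * (h * (b0 * q0) + g * (b1 * q1)))
  + (h * (b0 * q0) + g * (b1 * q1)))); first by ring.
by rewrite H; ring.
Qed.

(** The hyperbolic cosine of the radius is cosh x_2 + exp(- x_2) x_1^2 / 2, which is at least 1. *)
Lemma radius_ge0 (x : R * R) : 0 <= Defs.radius x.
Proof.
have e t : 2 <= expR t + expR (- t) :> R.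
  have := expRxMexpNx_1 t; have := expR_gt0 t; have := expR_gt0 (- t).
  move: (expR _) (expR _) => a b b0 a0 ab.
  rewrite leNgt; apply/negP => h; have := sqr_ge0 (a - b).
  have : 0 < (2 - (a + b)) * (2 + (a + b)) by apply: mulr_gt0; lra.
  nra.
have z1 : 1 <= - Defs.minkowski (Defs.Psi (0, 0)) (Defs.Psi x).
  have -> : - Defs.minkowski (Defs.Psi (0, 0)) (Defs.Psi x) =
      (expR x.2 + expR (- x.2)) / 2 + expR (- x.2) * x.1 ^+ 2 / 2.
    rewrite /Defs.minkowski /Defs.Psi /= oppr0 expR0.
    by move: (expR _) (expR _) x.1 => a b c; field.
  have := e x.2; have : 0 <= expR (- x.2) * x.1 ^+ 2 / 2.
    by apply: divr_ge0 => //; apply: mulr_ge0; [exact: expR_ge0|exact: sqr_ge0].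
  by move: (_ * _ / 2) (expR _ + expR _) => a b; lra.
rewrite /Defs.radius /hdist /arcosh; apply: ln_ge0; apply: (le_trans z1).
by rewrite lerDl; exact: sqrtr_ge0.
Qed.

Lemma coefficients_le_norm i x :
  cometric i i x * (pco i x ^+ 2 + qco i x ^+ 2) <= norm_nabla_d 0 Q x ^+ 2.
Proof.
have E (I : 1.-tuple 'I_2) : (\prod_(i <- I) cometric i i x) *
    inner (Q x) (dtensor Q I x) (dtensor Q I x) =
    cometric (tnth I ord0) (tnth I ord0) x * (pco (tnth I ord0) x ^+ 2 + qco (tnth I ord0) x ^+ 2).
  case: I => -[|j [|? ?]]//= sI; rewrite big_seq1 (tnth_nth ord0) /=; congr (_ * _).
  by rewrite innerE !mxE /pco /qco /=; rewrite -/(pd j (crd ord0 \o Q) x) -/(pd j (crd ord_max \o Q) x);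
    move: (pd _ _ _) (pd _ _ _) (expR _) => a b c; ring.
have p0 j : 0 <= cometric j j x * (pco j x ^+ 2 + qco j x ^+ 2).
  by apply: mulr_ge0; [exact: ltW (cometric_gt0 _ _)|apply: addr_ge0; exact: sqr_ge0].
rewrite /norm_nabla_d /= sqr_sqrtr; last first.
  by apply: sumr_ge0 => I _; rewrite E.
rewrite (bigD1 [tuple i])//= E.
rewrite (tnth_nth ord0) /= lerDl sumr_ge0// => I _; rewrite E; exact: p0.
Qed.

(** The exponential weight is at least 1, so the weighted bound controls |dQ| almost everywhere,
    hence everywhere by continuity of the coefficients. The value mu1^2 is the [K0] of the later
    sections. *)
Lemma coefficients_bounded (rho mu1 : R) : 0 < rho ->
  (Linfnorm (exp_weighted_d rho Q) < mu1%:E)%E ->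
  forall i x, cometric i i x * (pco i x ^+ 2 + qco i x ^+ 2) <= mu1 ^+ 2.
Proof.
move=> r0 H i.
have H1 : {ae vol, forall x, norm_nabla_d 0 Q x <= mu1}.
  have K : {ae vol, forall x, `|exp_weighted_d rho Q x| <= mu1}.
    move: H; rewrite /Linfnorm unlock; case: ifPn => [_ /ltW/ess_supP|v0 _].
      by apply: ae_imply => x; rewrite /= lee_fin.
    (* The branch where the total volume is not positive, in which the norm is a default value: the
       whole space is then a null set. *)
    exists setT; split => //; apply/eqP; rewrite eq_le measure_ge0 andbT leNgt.
    exact: v0.
  apply: ae_imply K => x /(le_trans (ler_norm _)); apply: le_trans.
  rewrite /exp_weighted_d ler_peMl ?sqrtr_ge0// -expR0 ler_expR.
  by apply: mulr_ge0; [exact: ltW|exact: radius_ge0].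
have H2 : {ae leb2, forall x, cometric i i x * (pco i x ^+ 2 + qco i x ^+ 2) <= mu1 ^+ 2}.
  move/ae_vol: H1; apply: ae_imply => x h; apply: le_trans (coefficients_le_norm i x) _.
  by rewrite lerXn2r// ?nnegrE ?sqrtr_ge0// (le_trans _ h)// sqrtr_ge0.
apply: ae_le_everywhere H2.
apply: smooth_continuous; apply: smoothM; first exact: smooth_cometric.
by apply: smoothD; apply: smoothM; by [exact: smooth_pco|exact: smooth_qco].
Qed.

End target_coefficients.

(** * The operator [W] in components *)

Section wpoint.
Context {R : realType}.

(** One computation for real and complex scalars: the conjugation only meets the real vectors [P i],
    which it fixes. [D i] is the divergence term of the limit connection, and the hypothesis on it
    is harmonicity. *)
Lemma Wpoint_algebra (F : comNzRingType) (iota : {rmorphism R -> F}) (cj : F -> F)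
    (h p q D : 'I_2 -> R) (P : 'I_2 -> 'cV[R]_2) (v : 'cV[F]_2) (dv : 'I_2 -> 'cV[F]_2) :
  (forall r, cj (iota r) = iota r) ->
  (forall i, P i ord0 0 = p i) -> (forall i, P i ord_max 0 = q i) ->
  h ord0 * D ord0 + h ord_max * D ord_max =
    h ord0 * (p ord0 * q ord0) + h ord_max * (p ord_max * q ord_max) ->
  let W := \sum_(i < 2) iota (h i) *:
    (- 2 *: (map_mx iota (p i *: rot_mx) *m dv i)
     - map_mx iota (p i *: rot_mx) *m (map_mx iota (p i *: rot_mx) *m v)
     - wedge cj v (map_mx iota (P i)) (map_mx iota (P i))
     - map_mx iota (D i *: rot_mx) *m v) in
  (W ord0 0 =
     \sum_(i < 2) (iota (h i * (2 * p i)) * dv i ord_max 0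
       + iota (h i * (p i ^+ 2 + q i ^+ 2)) * v ord0 0)) *
  (W ord_max 0 =
     \sum_(i < 2) (iota (h i * (- 2 * p i)) * dv i ord0 0
       + iota (h i * (2 * p i ^+ 2)) * v ord_max 0
       + iota (h i * (- 2 * (p i * q i))) * v ord0 0)).
Proof.
move=> cji P0 P1 E.
have r0 (a : R) (u : 'cV[F]_2) : (map_mx iota (a *: rot_mx) *m u) ord0 0 = - (iota a * u ord_max 0).
  by rewrite !mxE sum_ord2 !mxE /= mulr0 rmorph0 mul0r add0r mulrN1 rmorphN mulNr.
have r1 (a : R) (u : 'cV[F]_2) : (map_mx iota (a *: rot_mx) *m u) ord_max 0 = iota a * u ord0 0.
  by rewrite !mxE sum_ord2 !mxE /= mulr0 rmorph0 mul0r addr0 mulr1.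
have ent (a b c d : 'cV[F]_2) j : (- 2 *: a - b - c - d) j 0 = - 2 * a j 0 - b j 0 - c j 0 - d j 0.
  by rewrite !mxE.
have wed (a b : 'cV[F]_2) j : wedge cj a b b j 0 = dotp cj a b * b j 0 - dotp cj b b * a j 0.
  by rewrite !mxE.
have sm (a b : F) (u w : 'cV[F]_2) j : (a *: u + b *: w) j 0 = a * u j 0 + b * w j 0.
  by rewrite !mxE.
have ph0 i : map_mx iota (P i) ord0 0 = iota (p i) by rewrite mxE P0.
have ph1 i : map_mx iota (P i) ord_max 0 = iota (q i) by rewrite mxE P1.
have : iota (h ord0) * iota (D ord0) + iota (h ord_max) * iota (D ord_max) =
    iota (h ord0) * (iota (p ord0) * iota (q ord0)) +
    iota (h ord_max) * (iota (p ord_max) * iota (q ord_max)).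
  by rewrite -!rmorphM -!rmorphD E.
rewrite /= !(sum_ord2 (fun _ => _)) !sm !ent !r1 !r0 !r1 !wed /dotp !(sum_ord2 (fun _ => _)) !ph0 !ph1 !cji.
clear r0 r1 ent wed sm ph0 ph1 E P0 P1.
rewrite !(rmorphD, rmorphM, rmorphN, rmorphXn, rmorph_nat).
move: (v ord0 0) (v ord_max 0) (dv ord0 ord0 0) (dv ord0 ord_max 0) (dv ord_max ord0 0) (dv ord_max ord_max 0).
move: (iota (h ord0)) (iota (h ord_max)) (iota (p ord0)) (iota (p ord_max)).
move: (iota (q ord0)) (iota (q ord_max)) (iota (D ord0)) (iota (D ord_max)).
clear; move=> qa qb da db h0 h1 pa pb v0 v1 a b c d.
move=> /eqP; rewrite -subr_eq0 => /eqP E.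
split.
  transitivity (h0 * (2 * pa) * b + h0 * (pa ^+ 2 + qa ^+ 2) * v0 +
     (h1 * (2 * pb) * d + h1 * (pb ^+ 2 + qb ^+ 2) * v0) +
     (h0 * da + h1 * db - (h0 * (pa * qa) + h1 * (pb * qb))) * v1); first by ring.
  by rewrite E; ring.
transitivity (h0 * (- 2 * pa) * a + h0 * (2 * pa ^+ 2) * v1 + h0 * (- 2 * (pa * qa)) * v0 +
   (h1 * (- 2 * pb) * c + h1 * (2 * pb ^+ 2) * v1 + h1 * (- 2 * (pb * qb)) * v0) -
   (h0 * da + h1 * db - (h0 * (pa * qa) + h1 * (pb * qb))) * v0); first by ring.
by rewrite E; ring.
Qed.

Variable Q : R * R -> R * R.
Hypotheses (sQ : forall k, smooth (crd k \o Q)) (hQ : forall x, tension Q x = 0).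
Local Notation Xi := (fun i x => Theta i (Q x)).
Local Notation p := (pco Q).
Local Notation q := (qco Q).

(* The zeroth order coefficients simplify because harmonicity turns the
   divergence of [p] into [<p, q>]. *)
Lemma Wpoint_entries (F : comNzRingType) (iota : {rmorphism R -> F}) (cj : F -> F)
    (x : R * R) (v : 'cV[F]_2) (dv : 'I_2 -> 'cV[F]_2) :
  (forall r, cj (iota r) = iota r) ->
  (Wpoint Q Xi iota cj x v dv ord0 0 =
     \sum_(i < 2) (iota (cometric i i x * (2 * p i x)) * dv i ord_max 0
       + iota (cometric i i x * (p i x ^+ 2 + q i x ^+ 2)) * v ord0 0)) *
  (Wpoint Q Xi iota cj x v dv ord_max 0 =
     \sum_(i < 2) (iota (cometric i i x * (- 2 * p i x)) * dv i ord0 0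
       + iota (cometric i i x * (2 * p i x ^+ 2)) * v ord_max 0
       + iota (cometric i i x * (- 2 * (p i x * q i x))) * v ord0 0)).
Proof.
move=> cji.
pose D i := pd i (p i) x - \sum_(k < 2) chris k i i x * p k x.
have DE : \sum_(i < 2) cometric i i x * D i = \sum_(i < 2) cometric i i x * (p i x * q i x).
  rewrite -(harmonic_divergence sQ (hQ x)) -(sum_chris (fun k => p k x) x) -sumrB.
  by apply: eq_bigr => i _; rewrite -mulrBr.
have M i : pd i (conn_inf Q Xi i) x - \sum_(k < 2) chris k i i x *: conn_inf Q Xi k x = D i *: rot_mx.
  rewrite (pd_conn_inf sQ) scalerBl; congr (_ - _); rewrite scaler_suml.
  by apply: eq_bigr => k _; rewrite (conn_infE sQ) scalerA.
have E : Wpoint Q Xi iota cj x v dv = \sum_(i < 2) iota (cometric i i x) *: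
    (- 2 *: (map_mx iota (p i x *: rot_mx) *m dv i)
     - map_mx iota (p i x *: rot_mx) *m (map_mx iota (p i x *: rot_mx) *m v)
     - wedge cj v (map_mx iota (phi_inf Q Xi i x)) (map_mx iota (phi_inf Q Xi i x))
     - map_mx iota (D i *: rot_mx) *m v).
  by rewrite /Wpoint; under eq_bigr => i _ do rewrite M (conn_infE sQ).
rewrite E.
apply: (@Wpoint_algebra F iota cj (fun i => cometric i i x) (p ^~ x) (q ^~ x) D
  (fun i => phi_inf Q Xi i x) v dv cji).
- by move=> i; have [E0 E1] := phi_infE Q i x; rewrite ?E0 ?E1.
- by move=> i; have [E0 E1] := phi_infE Q i x; rewrite ?E0 ?E1.
- by move: DE; rewrite (sum_ord2 (fun i => _ * D i)) (sum_ord2 (fun i => _ * (_ * _))).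
Qed.
End wpoint.

(** * Integration by parts for the hyperbolic volume *)

Section weighted_identities.
Context {R : realType}.
Local Notation plane := (mplane R).
Implicit Types (f g chi F G : R * R -> R).

(* [sfac i] is the square root of [cometric i i], so that [sfac i * df i] are
   the components of the gradient in an orthonormal frame. *)
Definition sfac (i : 'I_2) (x : R * R) : R := expR ((if i == ord0 then 1 else 0) * x.2).

Lemma sfac_sqr i x : sfac i x ^+ 2 = cometric i i x.
Proof.
rewrite /sfac; elim/ord2_cases: i => /=; last by rewrite mul0r expR0 expr1n cometric1.
by rewrite cometric0 mul1r expr2 -expRD; congr expR; ring.
Qed.

Lemma smooth_sfac i : smooth (sfac i).
Proof. exact: smooth_expR_snd. Qed.

(** Membership in H^1 with an explicit gradient [df]: its derivatives are weak for Lebesgue measure,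
    its norms are those of the hyperbolic metric and volume. *)
Definition h1 f (df : 'I_2 -> R * R -> R) :=
  [/\ sqi vol f, forall i, sqi vol (fun x => sfac i x * df i x) & forall i, wpd i f (df i)].

Lemma sfacVM i x (a : R) : expR (- (if i == ord0 then 1 else 0) * x.2) * (sfac i x * a) = a.
Proof.
rewrite /sfac mulrA mulNr [expR _ * expR _]mulrC.
by rewrite expRxMexpNx_1 mul1r.
Qed.

Lemma loc2_ext f g : f =1 g -> loc2 f -> loc2 g.
Proof. by move=> /funext ->. Qed.

Lemma sqi_ext (mu : {measure set plane -> \bar R}) f g : f =1 g -> sqi mu f -> sqi mu g.
Proof. by move=> /funext ->. Qed.

Lemma itg_ext (mu : {measure set plane -> \bar R}) f g : f =1 g -> itg mu f -> itg mu g.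
Proof. by move=> /funext ->. Qed.

Lemma sfac_loc2 i f : sqi vol (fun x => sfac i x * f x) -> loc2 f.
Proof.
move=> /sqi_vol_loc2 /(@loc2M R (fun x => expR (- (if i == ord0 then 1 else 0) * x.2))) H.
apply: loc2_ext (H _) => [x|]; first exact: sfacVM.
by apply: smooth_continuous; exact: smooth_expR_snd.
Qed.

Lemma loc2_itg_vol f chi : loc2 f -> test_function chi -> itg vol (fun x => f x * chi x).
Proof.
move=> lf tc; apply/itg_vol; first by apply: measurable_funM; [case: lf|exact: test_measurable].
have := loc2_test lf (testM (smooth_expR_snd (-1)) tc); apply: itg_ext => x.
by rewrite mulN1r; ring.
Qed.

Lemma loc2_loc_integrable f : loc2 f -> loc_integrable f.
Proof.
move=> [mf sf]; split=> // K cK; have [M KM] := compact_box cK.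
have I1 := sqi_mul (sf M) (sqi_indic_box M).
have mK : measurable (K : set plane).
  rewrite -[K]setCK; apply: measurableC; apply: open_measurable_plane.
  by apply: closed_openC; apply: compact_closed; [exact: norm_hausdorff|].
have /integrableP[_] := I1; apply: le_lt_trans.
rewrite integral_mkcond; apply: ge0_le_integral => //.
- by move=> x _; apply: erestrict_ge0 => y _; rewrite lee_fin.
- apply/(measurable_restrictT _ _).1 => //; apply: measurable_funTS.
  by apply/measurable_EFinP; exact: measurableT_comp.
- by apply: measurableT_comp => //; exact: measurable_int I1.
- move=> x _; rewrite patchE; case: ifPn => [|_]; last exact: abse_ge0.
  by rewrite inE => /KM xM; rewrite /= !indicE !mem_set// !mulr1.
Qed.

(** Euclidean integration by parts against exp(- x_2) h^{ii} c_i. Dividing by the density produces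
    the hyperbolic divergence of the one-form c, with its zeroth order term - c_2. *)
Lemma weighted_ibp f (df c : 'I_2 -> R * R -> R) : loc2 f -> (forall i, loc2 (df i)) ->
  (forall i, wpd i f (df i)) -> (forall i, test_function (c i)) ->
  itg vol (fun x => \sum_(i < 2) cometric i i x * (df i x * c i x)
     + f x * (\sum_(i < 2) cometric i i x * pd i (c i) x - c ord_max x)) /\
  \int[vol]_x (\sum_(i < 2) cometric i i x * (df i x * c i x)
     + f x * (\sum_(i < 2) cometric i i x * pd i (c i) x - c ord_max x)) = 0.
Proof.
move=> lf ldf w tc.
pose e (i : 'I_2) : R := if i == ord0 then 1 else -1.
pose k (i : 'I_2) (x : R * R) := expR (e i * x.2) * c i x.
have tk i : test_function (k i) by apply: testM => //; exact: smooth_expR_snd.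
have ke i x : k i x = expR (- x.2) * (cometric i i x * c i x).
  rewrite /k /e; elim/ord2_cases: i => /=; last by rewrite cometric1 mulN1r mul1r.
  by rewrite cometric0 mulrA -expRD; congr (expR _ * _); ring.
have dk x : \sum_(i < 2) pd i (k i) x =
    expR (- x.2) * (\sum_(i < 2) cometric i i x * pd i (c i) x - c ord_max x).
  have P i : pd i (k i) x = (if i == ord0 then 0 else e i * expR (e i * x.2)) * c i x
      + expR (e i * x.2) * pd i (c i) x.
    have [_ E] := is_derive_mul (pd_expR_snd (e i) i x) (smooth_is_derive i x (test_smooth (tc i))).
    exact: E.
  rewrite (sum_ord2 (fun i => pd i (k i) x)) (sum_ord2 (fun i => cometric i i x * _)).
  rewrite !P /e /= cometric0 cometric1.
  have -> : expR (2 * x.2) = expR (1 * x.2) * expR (1 * x.2) by rewrite -expRD; congr expR; ring.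
  have := expRxMexpNx_1 x.2; rewrite !mul1r !mulN1r.
  move: (pd _ _ _) (pd _ _ _) (expR x.2) (expR (- x.2)) (c _ _) (c _ _) => a b E N c0 c1 EN.
  by transitivity (E * N * (E * b) + N * a - N * c0); [rewrite EN; ring|ring].
pose K x := \sum_(i < 2) (df i x * k i x + f x * pd i (k i) x).
have iK i : itg leb2 (fun x => df i x * k i x + f x * pd i (k i) x).
  by apply: itgD; apply: loc2_test => //; exact: test_pd.
have IK : \int[leb2]_x K x = 0.
  rewrite Int_sum//; apply: big1 => i _; rewrite IntD; [|exact: loc2_test|by apply: loc2_test => //; exact: test_pd].
  by rewrite (w i _ (tk i)) subrr.
set G := (fun x => _ + _).
have GK x : G x * expR (- x.2) = K x.
  rewrite /G /K big_split /= -mulr_sumr dk !(sum_ord2 (fun i => _ * _)) !ke.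
  by move: (pd ord0 (c ord0) x) (pd ord_max (c ord_max) x) => a b; ring.
have mG : measurable_fun [set: plane] G.
  have -> : G = fun x => expR (1 * x.2) * K x.
    apply/funext => x; rewrite -GK mul1r mulrCA [_ * expR (- _)]expRxMexpNx_1 mulr1 //.
  apply: measurable_funM; first exact: measurable_snd_expR.
  by apply: itg_measurable; exact: itg_sum.
split; first by apply/(itg_vol mG); apply: itg_ext (itg_sum _ iK) => x; rewrite GK.
rewrite (Int_vol mG) -IK; apply: eq_Int => x; exact: GK.
Qed.

(** The hypothesis says that U is the weak divergence of c. After multiplication by the density it
    is the hypothesis of [flux_identity], whose two extra integrability conditions become those of
    e^{- x_2} sfac_i c_i v. *)
Lemma weighted_flux U v (c dv : 'I_2 -> R * R -> R) : sqi vol U ->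
  (forall i, sqi vol (fun x => sfac i x * c i x)) -> h1 v dv ->
  (forall chi, test_function chi ->
     \int[vol]_x (U x * chi x + \sum_(i < 2) cometric i i x * (c i x * pd i chi x)) = 0) ->
  itg vol (fun x => U x * v x + \sum_(i < 2) cometric i i x * (c i x * dv i x)) /\
  \int[vol]_x (U x * v x + \sum_(i < 2) cometric i i x * (c i x * dv i x)) = 0.
Proof.
move=> sU sc [sv sdv w] H.
have hs i x (a b : R) : cometric i i x * (a * b) = (sfac i x * a) * (sfac i x * b).
  by rewrite -sfac_sqr; ring.
have iUv : itg vol (fun x => U x * v x) := sqi_mul sU sv.
have ic i : itg vol (fun x => cometric i i x * (c i x * dv i x)).
  by apply: itg_ext (sqi_mul (sc i) (sdv i)) => x; rewrite hs.
have icv i : itg vol (fun x => (sfac i x * c i x) * v x) := sqi_mul (sc i) sv.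
have itgL g : itg vol g -> itg leb2 (fun x => g x * expR (- x.2)).
  by move=> ig; apply/itg_vol => //; exact: itg_measurable ig.
have IntL g : itg vol g -> \int[vol]_x g x = \int[leb2]_x (g x * expR (- x.2)).
  by move=> ig; rewrite Int_vol//; exact: itg_measurable ig.
split; first by apply: itgD => //; exact: itg_sum.
rewrite IntD ?Int_sum//; last exact: itg_sum.
pose e (x : R * R) := expR (- x.2).
have se : smooth e by apply: smooth_ext (smooth_expR_snd (-1)) => x; rewrite mulN1r.
pose u0 x := e x * U x; pose u i x := e x * cometric i i x * c i x.
have lU := sqi_vol_loc2 sU; have lc i := sfac_loc2 (sc i).
have lu0 : loc2 u0 by apply: loc2M => //; exact: smooth_continuous.
have lu i : loc2 (u i).
  by apply: loc2M => //; apply: smooth_continuous; apply: smoothM => //; exact: smooth_cometric.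
rewrite (IntL _ iUv) (eq_bigr _ (fun i _ => IntL _ (ic i))).
have E1 : \int[leb2]_x (U x * v x * expR (- x.2)) = \int[leb2]_x (u0 x * v x).
  by apply: eq_Int => x; rewrite /u0 /e; ring.
have E2 i : \int[leb2]_x (cometric i i x * (c i x * dv i x) * expR (- x.2)) =
    \int[leb2]_x (u i x * dv i x) by apply: eq_Int => x; rewrite /u /e; ring.
rewrite E1 (eq_bigr _ (fun i _ => E2 i)).
apply: (@flux_identity R u0 v u dv lu0 lu (sqi_vol_loc2 sv) (fun i => sfac_loc2 (sdv i)) w).
- move=> chi tc; rewrite -[RHS](H _ tc).
  have I0 := loc2_itg_vol lU tc.
  have I1 i : itg vol (fun x => cometric i i x * (c i x * pd i chi x)).
    by apply: itg_ext (loc2_itg_vol (lc i) (testM (smooth_cometric i) (test_pd i tc))) => x; rewrite mulrCA.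
  rewrite IntD ?Int_sum//; last exact: itg_sum.
  rewrite (IntL _ I0) (eq_bigr _ (fun i _ => IntL _ (I1 i))); congr (_ + _).
    by apply: eq_Int => x; rewrite /u0 /e; ring.
  by apply: eq_bigr => i _; apply: eq_Int => x; rewrite /u /e; move: (pd _ _ _) => p; ring.
- by apply: itg_ext (itgL _ iUv) => x; rewrite /u0 /e; ring.
- by move=> i; apply: itg_ext (itgL _ (ic i)) => x; rewrite /u /e; ring.
- apply: itg_ext (itgL _ (icv ord0)) => x; rewrite /u -sfac_sqr /sfac /e /= mul1r.
  have := expRxMexpNx_1 x.2; move: (expR _) (expR _) => N E EN.
  have {}EN : E * N = 1 by rewrite -EN; ring.
  transitivity ((E * N) * (c ord0 x * v x)); first by ring.
  by transitivity ((E * N) * (E * N) * (c ord0 x * v x)); [rewrite EN; ring|ring].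
- apply: itg_ext (itgL _ (icv ord_max)) => x; rewrite /u -sfac_sqr /sfac /e /= mul0r expR0; ring.
Qed.

End weighted_identities.

(** * Green's formula for the operator on pairs of real functions *)

Section real_operator.
Context {R : realType}.
Variables (Q : R * R -> R * R) (K0 : R).
Hypotheses (sQ : forall k, smooth (crd k \o Q)) (hQ : forall x, tension Q x = 0).
Hypothesis bQ : forall i x, cometric i i x * (pco Q i x ^+ 2 + qco Q i x ^+ 2) <= K0.
Local Notation plane := (mplane R).
Local Notation p := (pco Q).
Local Notation q := (qco Q).
Implicit Types (g : R * R -> R) (dg : 'I_2 -> R * R -> R).
Implicit Types (f v : 'I_2 -> R * R -> R) (df dv : 'I_2 -> 'I_2 -> R * R -> R).

Lemma K0_ge0 : 0 <= K0.
Proof.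
apply: le_trans (bQ ord0 (0, 0)); apply: mulr_ge0; first exact: ltW (cometric_gt0 _ _).
by apply: addr_ge0; exact: sqr_ge0.
Qed.

Lemma pq_sqr_le i x : (sfac i x * p i x) ^+ 2 <= K0 /\ (sfac i x * q i x) ^+ 2 <= K0.
Proof.
have := bQ i x; rewrite -sfac_sqr; move: (sfac i x) (p i x) (q i x) => s a b h.
have e : s ^+ 2 * (a ^+ 2 + b ^+ 2) = (s * a) ^+ 2 + (s * b) ^+ 2 by ring.
rewrite e in h; have h1 := sqr_ge0 (s * a); have h2 := sqr_ge0 (s * b).
by move: h h1 h2; move: (_ ^+ 2) (_ ^+ 2) => c d h h1 h2; split; lra.
Qed.

Lemma abs_le_sqr (t : R) : t ^+ 2 <= K0 -> `|t| <= K0 + 1.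
Proof.
move=> h; have := sqr_ge0 (t - 1); have := sqr_ge0 (t + 1) => h1 h2.
by rewrite ler_norml; apply/andP; split; nra.
Qed.

Lemma sqi_pM i g : sqi vol g -> sqi vol (fun x => sfac i x * (p i x * g x)).
Proof.
move=> sg; apply: (sqi_ext (f := fun x => (sfac i x * p i x) * g x)) => [x|]; first by rewrite mulrA.
apply: (@sqi_bounded_mul _ _ _ vol _ g (K0 + 1)) sg.
  by apply: smooth_measurable; apply: smoothM; [exact: smooth_sfac|exact: smooth_pco].
by move=> x; apply: abs_le_sqr; have [] := pq_sqr_le i x.
Qed.

Lemma sqi_qM i g : sqi vol g -> sqi vol (fun x => sfac i x * (q i x * g x)).
Proof.
move=> sg; apply: (sqi_ext (f := fun x => (sfac i x * q i x) * g x)) => [x|]; first by rewrite mulrA.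
apply: (@sqi_bounded_mul _ _ _ vol _ g (K0 + 1)) sg.
  by apply: smooth_measurable; apply: smoothM; [exact: smooth_sfac|exact: smooth_qco].
by move=> x; apply: abs_le_sqr; have [] := pq_sqr_le i x.
Qed.

Lemma sqi_hpM i g : sqi vol (fun x => sfac i x * g x) -> sqi vol (fun x => cometric i i x * (p i x * g x)).
Proof.
move=> /(sqi_pM i); apply: sqi_ext => x; rewrite -sfac_sqr; ring.
Qed.

Lemma sqi_hqM i g : sqi vol (fun x => sfac i x * g x) -> sqi vol (fun x => cometric i i x * (q i x * g x)).
Proof.
move=> /(sqi_qM i); apply: sqi_ext => x; rewrite -sfac_sqr; ring.
Qed.

(** The divergence of the one-form g p, where harmonicity has replaced the divergence of p by <p,
    q>. *)
Definition Uop g dg (x : R * R) : R :=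
  \sum_(i < 2) cometric i i x * (p i x * dg i x + p i x * q i x * g x).

Lemma sqi_Uop g dg : h1 g dg -> sqi vol (Uop g dg).
Proof.
move=> [sg sdg _]; apply: sqi_sum => i.
apply: sqi_ext (sqiD (sqi_hpM (sdg i)) (sqi_hpM (sqi_qM i sg))) => x; ring.
Qed.

Lemma Lap_scalar (chi : R * R -> R) x : Lap chi x =
  \sum_(i < 2) cometric i i x * pd i (pd i chi) x - pd ord_max chi x.
Proof.
apply: (etrans (Lap_diag _ _)); rewrite -(sum_chris (fun k => pd k chi x) x) -sumrB.
by apply: eq_bigr => i _; rewrite -mulrBr.
Qed.

Lemma test_Lap (chi : R * R -> R) : test_function chi -> test_function (fun x => Lap chi x).
Proof.
move=> tc; apply: (test_ext (f := fun x => \sum_(i < 2) cometric i i x * pd i (pd i chi) x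
    + (-1) * pd ord_max chi x)).
  by move=> x; rewrite Lap_scalar mulN1r.
apply: testD; last by apply: testZ; exact: test_pd.
by apply: test_sum => i; apply: testM; [exact: smooth_cometric|do 2 apply: test_pd].
Qed.

Lemma h1_ibp g dg (c : 'I_2 -> R * R -> R) : h1 g dg -> (forall i, test_function (c i)) ->
  itg vol (fun x => \sum_(i < 2) cometric i i x * (dg i x * c i x)
     + g x * (\sum_(i < 2) cometric i i x * pd i (c i) x - c ord_max x)) /\
  \int[vol]_x (\sum_(i < 2) cometric i i x * (dg i x * c i x)
     + g x * (\sum_(i < 2) cometric i i x * pd i (c i) x - c ord_max x)) = 0.
Proof.
move=> [sg sdg w]; apply: weighted_ibp => //; first exact: sqi_vol_loc2.
by move=> i; exact: sfac_loc2.
Qed.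

Lemma test_lap_ibp g dg (chi : R * R -> R) : h1 g dg -> test_function chi ->
  itg vol (fun x => \sum_(i < 2) cometric i i x * (dg i x * pd i chi x) + g x * Lap chi x) /\
  \int[vol]_x (\sum_(i < 2) cometric i i x * (dg i x * pd i chi x) + g x * Lap chi x) = 0.
Proof.
move=> hg tc; have [I E] := h1_ibp hg (fun i => test_pd i tc).
have e x : \sum_(i < 2) cometric i i x * (dg i x * pd i chi x)
     + g x * (\sum_(i < 2) cometric i i x * pd i (pd i chi) x - pd ord_max chi x) =
   \sum_(i < 2) cometric i i x * (dg i x * pd i chi x) + g x * Lap chi x by rewrite Lap_scalar.
by split; [exact: itg_ext e I|apply: etrans E; apply: eq_Int => x; exact: esym (e x)].
Qed.

Lemma test_div_ibp g dg (chi : R * R -> R) : h1 g dg -> test_function chi ->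
  itg vol (fun x => Uop g dg x * chi x + \sum_(i < 2) cometric i i x * (p i x * g x * pd i chi x)) /\
  \int[vol]_x (Uop g dg x * chi x + \sum_(i < 2) cometric i i x * (p i x * g x * pd i chi x)) = 0.
Proof.
move=> hg tc.
have [I E] := h1_ibp (c := fun i x => p i x * chi x) hg (fun i => testM (smooth_pco sQ i) tc).
have e x : \sum_(i < 2) cometric i i x * (dg i x * (p i x * chi x))
     + g x * (\sum_(i < 2) cometric i i x * pd i (fun x => p i x * chi x) x - p ord_max x * chi x) =
   Uop g dg x * chi x + \sum_(i < 2) cometric i i x * (p i x * g x * pd i chi x).
  have P i : pd i (fun x => p i x * chi x) x = pd i (p i) x * chi x + p i x * pd i chi x.
    exact: pdM (smooth_pco sQ i) (test_smooth tc).
  have -> : \sum_(i < 2) cometric i i x * pd i (fun x => p i x * chi x) x =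
      \sum_(i < 2) cometric i i x * (pd i (p i) x * chi x + p i x * pd i chi x).
    by apply: eq_bigr => i _; rewrite P.
  have := harmonic_divergence sQ (hQ x); rewrite /Uop !(sum_ord2 (fun _ => _)).
  clear P; move: (pd ord0 (p ord0) x) (pd ord_max (p ord_max) x) (pd ord0 chi x) (pd ord_max chi x).
  move: (cometric ord0 ord0 x) (cometric ord_max ord_max x) (p ord0 x) (p ord_max x) (q ord0 x) (q ord_max x).
  move: (dg ord0 x) (dg ord_max x) (g x) (chi x).
  move=> d0 d1 gx c h k p0 p1 q0 q1 dp0 dp1 c0 c1 H.
  transitivity (h * (d0 * (p0 * c)) + k * (d1 * (p1 * c)) + gx * c * (h * dp0 + k * dp1 - p1)
    + gx * (h * (p0 * c0) + k * (p1 * c1))); first by ring.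
  by rewrite H; ring.
by split; [exact: itg_ext e I|apply: etrans E; apply: eq_Int => x; exact: esym (e x)].
Qed.

(** [weighted_flux] with c = dg. The distributional Laplacian puts two derivatives on the test
    function, and [test_lap_ibp] takes one back to exhibit it as the divergence of the weak
    gradient. *)
Lemma lap_flux g dg L g' dg' : h1 g dg -> weak_lap g L -> sqi vol L -> h1 g' dg' ->
  itg vol (fun x => L x * g' x + \sum_(i < 2) cometric i i x * (dg i x * dg' i x)) /\
  \int[vol]_x (L x * g' x + \sum_(i < 2) cometric i i x * (dg i x * dg' i x)) = 0.
Proof.
move=> hg [_ _ wl] sL hv; have [sg sdg _] := hg; apply: weighted_flux => // chi tc.
have [I E] := test_lap_ibp hg tc.
have tL := test_Lap tc.
have I1 := loc2_itg_vol (sqi_vol_loc2 sg) tL; have I2 := loc2_itg_vol (sqi_vol_loc2 sL) tc.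
have := wl _ tc => E2.
transitivity (\int[vol]_x ((\sum_(i < 2) cometric i i x * (dg i x * pd i chi x) + g x * Lap chi x)
   + (L x * chi x - g x * Lap chi x))).
  by apply: eq_Int => x; move: (Lap _ _) (\sum_(i < 2) _) => a b; ring.
by rewrite IntD ?IntB// ?E2 ?E ?subrr ?addr0//; exact: itgB.
Qed.

Lemma div_flux g dg g' dg' : h1 g dg -> h1 g' dg' ->
  itg vol (fun x => Uop g dg x * g' x + \sum_(i < 2) cometric i i x * (p i x * g x * dg' i x)) /\
  \int[vol]_x (Uop g dg x * g' x + \sum_(i < 2) cometric i i x * (p i x * g x * dg' i x)) = 0.
Proof.
move=> hg hv; have [sg sdg _] := hg.
apply: (weighted_flux (c := fun i x => p i x * g x)) => //; first exact: sqi_Uop.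
  by move=> i; exact: sqi_pM.
by move=> chi tc; have [] := test_div_ibp hg tc.
Qed.

(** [W] in components once harmonicity has eliminated the divergence of p. Its zeroth order part is
    not symmetric; the asymmetry is compensated by integrating the first order part by parts. *)
Definition Wr f df (j : 'I_2) (x : R * R) : R :=
  if j == ord0 then \sum_(i < 2) cometric i i x *
    (2 * p i x * df ord_max i x + (p i x ^+ 2 + q i x ^+ 2) * f ord0 x)
  else \sum_(i < 2) cometric i i x *
    (- 2 * p i x * df ord0 i x + 2 * p i x ^+ 2 * f ord_max x - 2 * (p i x * q i x) * f ord0 x).

(** Polarised density of the form: covariant derivatives for A^inf, and the determinants of f and v
    with phi_i^inf, which come from the curvature term. *)
Definition dform f df v dv (x : R * R) : R := \sum_(i < 2) cometric i i x *
  ((df ord0 i x - p i x * f ord_max x) * (dv ord0 i x - p i x * v ord_max x) +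
   (df ord_max i x + p i x * f ord0 x) * (dv ord_max i x + p i x * v ord0 x) +
   (q i x * f ord0 x - p i x * f ord_max x) * (q i x * v ord0 x - p i x * v ord_max x)).

Lemma sqi_Wr f df j : (forall j, h1 (f j) (df j)) -> sqi vol (Wr f df j).
Proof.
move=> hf; have s j' : sqi vol (f j') by case: (hf j').
have sd j' i : sqi vol (fun x => sfac i x * df j' i x) by case: (hf j').
have h0 i := sqi_hpM (sd ord0 i); have h1' i := sqi_hpM (sd ord_max i).
have pp i j' := sqi_hpM (sqi_pM i (s j')); have qq i j' := sqi_hqM (sqi_qM i (s j')).
have pq i j' := sqi_hpM (sqi_qM i (s j')).
rewrite /Wr; elim/ord2_cases: j => /=; apply: sqi_sum => i.
  apply: sqi_ext (sqiD (sqiZ 2 (h1' i)) (sqiD (pp i ord0) (qq i ord0))) => x; ring.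
apply: sqi_ext (sqiD (sqiZ (- 2) (h0 i)) (sqiD (sqiZ 2 (pp i ord_max)) (sqiZ (- 2) (pq i ord0)))) => x.
ring.
Qed.

Lemma itg_bd f df v dv : (forall j, h1 (f j) (df j)) -> (forall j, h1 (v j) (dv j)) ->
  itg vol (dform f df v dv).
Proof.
move=> hf hv; apply: itg_sum => i.
have X (u : 'I_2 -> R * R -> R) du : (forall j, h1 (u j) (du j)) ->
    [/\ sqi vol (fun x => sfac i x * (du ord0 i x - p i x * u ord_max x)),
        sqi vol (fun x => sfac i x * (du ord_max i x + p i x * u ord0 x)) &
        sqi vol (fun x => sfac i x * (q i x * u ord0 x - p i x * u ord_max x))].
  move=> hu; have s j' : sqi vol (u j') by case: (hu j').
  have sd j' : sqi vol (fun x => sfac i x * du j' i x) by case: (hu j').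
  split.
  - by apply: sqi_ext (sqiB (sd ord0) (sqi_pM i (s ord_max))) => x; ring.
  - by apply: sqi_ext (sqiD (sd ord_max) (sqi_pM i (s ord0))) => x; ring.
  - by apply: sqi_ext (sqiB (sqi_qM i (s ord0)) (sqi_pM i (s ord_max))) => x; ring.
have [a1 a2 a3] := X f df hf; have [b1 b2 b3] := X v dv hv.
apply: itg_ext (itgD (itgD (sqi_mul a1 b1) (sqi_mul a2 b2)) (sqi_mul a3 b3)) => x.
rewrite -sfac_sqr; ring.
Qed.

(** The two integrands differ by four expressions of zero integral: one for the Laplacian of each
    component, and the divergence identities for f_2 p against v_1 and for f_1 p against v_2. *)
Lemma green_formula f df (L : 'I_2 -> R * R -> R) v dv :
  (forall j, h1 (f j) (df j)) -> (forall j, weak_lap (f j) (L j)) -> (forall j, sqi vol (L j)) ->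
  (forall j, h1 (v j) (dv j)) ->
  \int[vol]_x (\sum_(j < 2) (- L j x + Wr f df j x) * v j x) = \int[vol]_x dform f df v dv x.
Proof.
move=> hf wl sL hv.
have [I0 E0] := lap_flux (hf ord0) (wl ord0) (sL ord0) (hv ord0).
have [I1 E1] := lap_flux (hf ord_max) (wl ord_max) (sL ord_max) (hv ord_max).
have [I2 E2] := div_flux (hf ord_max) (hv ord0).
have [I3 E3] := div_flux (hf ord0) (hv ord_max).
have Ib := itg_bd hf hv.
set T := (X in \int[vol]_x X x = _).
have e x : T x = dform f df v dv x -
   ((L ord0 x * v ord0 x + \sum_(i < 2) cometric i i x * (df ord0 i x * dv ord0 i x)) +
    (L ord_max x * v ord_max x + \sum_(i < 2) cometric i i x * (df ord_max i x * dv ord_max i x)) -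
    (Uop (f ord_max) (df ord_max) x * v ord0 x + \sum_(i < 2) cometric i i x * (p i x * f ord_max x * dv ord0 i x)) +
    (Uop (f ord0) (df ord0) x * v ord_max x + \sum_(i < 2) cometric i i x * (p i x * f ord0 x * dv ord_max i x))).
  rewrite /T /dform /Uop /Wr !(sum_ord2 (fun _ => _)) /=.
  move: (cometric ord0 ord0 x) (cometric ord_max ord_max x) (p ord0 x) (p ord_max x) (q ord0 x) (q ord_max x)
    (f ord0 x) (f ord_max x) (df ord0 ord0 x) (df ord0 ord_max x) (df ord_max ord0 x) (df ord_max ord_max x).
  move: (L ord0 x) (L ord_max x) (v ord0 x) (v ord_max x) (dv ord0 ord0 x) (dv ord0 ord_max x)
    (dv ord_max ord0 x) (dv ord_max ord_max x); clear; intros; ring.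
rewrite (eq_Int _ e) IntB//; last by apply: itgD => //; apply: itgB => //; exact: itgD.
rewrite IntD//; last by apply: itgB => //; exact: itgD.
by rewrite (IntB (itgD I0 I1) I2) (IntD I0 I1) E0 E1 E2 E3 !(subr0, addr0).
Qed.

Lemma test_h1 (chi : R * R -> R) : test_function chi -> h1 chi (fun i => pd i chi).
Proof.
move=> tc; have sv (g : R * R -> R) : test_function g -> sqi vol g.
  move=> tg; apply/sqi_vol; apply: test_sqi.
  by apply: test_ext (testM (smooth_expR_snd (- 2^-1)) tg) => x; rewrite mulrC.
split; first exact: sv.
  by move=> i; apply: sv; apply: testM; [exact: smooth_sfac|exact: test_pd].
move=> i psi tp; have := Int_pd_test i (testM (test_smooth tc) tp).
rewrite (@eq_Int _ _ _ leb2 _ (fun x => pd i chi x * psi x + chi x * pd i psi x)); last first.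
  by move=> x; exact: pdM (test_smooth tc) (test_smooth tp).
rewrite IntD; last 2 first.
- exact: test_itg (testM (smooth_pd i (test_smooth tc)) tp).
- exact: test_itg (testM (test_smooth tc) (test_pd i tp)).
by move/eqP; rewrite addrC addr_eq0 => /eqP.
Qed.

Lemma h1_zero : h1 (fun=> 0 : R) (fun _ _ => 0 : R).
Proof.
split; first exact: sqi0.
  by move=> i; apply: (sqi_ext _ (sqi0 _)) => x; rewrite mulr0.
move=> i chi _; rewrite (@eq_Int _ _ _ leb2 _ (fun=> 0)) => [|x]; last by rewrite mul0r.
rewrite [in RHS](@eq_Int _ _ _ leb2 _ (fun=> 0)) => [|x]; last by rewrite mul0r.
by rewrite Int0 oppr0.
Qed.

(** The weak form of (H + 1) f = g is tested with a [v] whose only non-zero component is [chi]. The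
    cross term with the other component [j'] is integrated by parts through [test_div_ibp], with the
    sign [s] of the rotation. *)
Lemma weak_solution_lap f df (g : 'I_2 -> R * R -> R) :
  (forall j, h1 (f j) (df j)) -> (forall j, sqi vol (g j)) ->
  (forall v dv, (forall j, h1 (v j) (dv j)) ->
    \int[vol]_x (dform f df v dv x + \sum_(j < 2) f j x * v j x) =
    \int[vol]_x (\sum_(j < 2) g j x * v j x)) ->
  forall j, weak_lap (f j) (fun x => Wr f df j x + f j x - g j x).
Proof.
move=> hf sg H j.
have sf j' : sqi vol (f j') by case: (hf j').
have sR : sqi vol (fun x => Wr f df j x + f j x - g j x).
  by apply: sqiB => //; apply: sqiD => //; exact: sqi_Wr.
split; [exact/loc2_loc_integrable/sqi_vol_loc2|exact/loc2_loc_integrable/sqi_vol_loc2|].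
move=> chi tc; pose v k := if k == j then chi else fun=> 0 : R.
pose dv k i := if k == j then pd i chi else fun=> 0 : R.
have hv k : h1 (v k) (dv k).
  by rewrite /v /dv; case: (k == j); [exact: test_h1|exact: h1_zero].
have Hv := H v dv hv; have Ib := itg_bd hf hv.
have [I0 E0] := test_lap_ibp (hf j) tc.
pose j' : 'I_2 := if j == ord0 then ord_max else ord0.
pose s : R := if j == ord0 then -1 else 1.
have [I1 E1] := test_div_ibp (hf j') tc.
have Rc := loc2_itg_vol (sqi_vol_loc2 sR) tc.
have tL := loc2_itg_vol (sqi_vol_loc2 (sf j)) (test_Lap tc).
have Ifv : itg vol (fun x => \sum_(k < 2) f k x * v k x).
  by apply: itg_sum => k; apply: sqi_mul => //; case: (hv k).
have Igv : itg vol (fun x => \sum_(k < 2) g k x * v k x).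
  by apply: itg_sum => k; apply: sqi_mul => //; case: (hv k).
have e x : dform f df v dv x + \sum_(k < 2) f k x * v k x - \sum_(k < 2) g k x * v k x =
    (\sum_(i < 2) cometric i i x * (df j i x * pd i chi x) + f j x * Lap chi x) +
    s * (Uop (f j') (df j') x * chi x + \sum_(i < 2) cometric i i x * (p i x * f j' x * pd i chi x)) +
    ((Wr f df j x + f j x - g j x) * chi x - f j x * Lap chi x).
  rewrite /dform /Uop /Wr /s /j' !(sum_ord2 (fun _ => _)) /v /dv.
  move: (Lap chi x) => l; clear; elim/ord2_cases: j => /=;
  move: (pd ord0 chi x) (pd ord_max chi x) (g ord0 x) (g ord_max x) (chi x);
  move: (cometric ord0 ord0 x) (cometric ord_max ord_max x) (p ord0 x) (p ord_max x) (q ord0 x) (q ord_max x)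
    (f ord0 x) (f ord_max x) (df ord0 ord0 x) (df ord0 ord_max x) (df ord_max ord0 x) (df ord_max ord_max x);
  intros; ring.
have := Hv; move/(congr1 (fun t => t - \int[vol]_x (\sum_(k < 2) g k x * v k x))).
rewrite subrr -IntB//; last exact: itgD.
move=> E'; have := etrans (esym (eq_Int vol e)) E'; clear E' e.
rewrite (IntD (itgD I0 (itgZ s I1)) (itgB Rc tL)) (IntD I0 (itgZ s I1)) (IntZ s I1) (IntB Rc tL).
by rewrite E0 E1 mulr0 !add0r => /eqP; rewrite subr_eq0 => /eqP ->.
Qed.

End real_operator.

(** * The form domain, its completeness and weak solutions of (H + 1) f = g *)

Section resolvent.
Context {R : realType}.
Variables (Q : R * R -> R * R) (K0 : R).
Hypotheses (sQ : forall k, smooth (crd k \o Q)) (hQ : forall x, tension Q x = 0).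
Hypothesis bQ : forall i x, cometric i i x * (pco Q i x ^+ 2 + qco Q i x ^+ 2) <= K0.
Local Notation plane := (mplane R).
Local Notation p := (pco Q).
Local Notation q := (qco Q).
Local Notation bd := (dform Q).

Local Notation V := (('I_2 -> R * R -> R) * ('I_2 -> 'I_2 -> R * R -> R))%type.
Implicit Types (u v w : V).

(** Elements carry their weak gradient, so the vector space operations are those of plain function
    spaces and no derivative has to be chosen. *)
Definition energy_space v : Prop := forall j, h1 (v.1 j) (v.2 j).

Definition form_density v w (x : R * R) : R :=
  bd v.1 v.2 w.1 w.2 x + \sum_(j < 2) v.1 j x * w.1 j x.

Definition energy_form v w : R := \int[vol]_x form_density v w x.

Definition gradient_density v (x : R * R) : R :=
  \sum_(j < 2) (v.1 j x ^+ 2 + \sum_(i < 2) (sfac i x * v.2 j i x) ^+ 2).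

Lemma itg_form_density v w : energy_space v -> energy_space w -> itg vol (form_density v w).
Proof.
move=> hv hw; apply: itgD; first exact: (itg_bd sQ bQ hv hw).
by apply: itg_sum => j; apply: sqi_mul; [case: (hv j)|case: (hw j)].
Qed.

Lemma itg_gradient_density v : energy_space v -> itg vol (gradient_density v).
Proof.
move=> hv; apply: itg_sum => j; have [[_ sf] sdf _] := hv j.
by apply: itgD => //; apply: itg_sum => i; have [] := sdf i.
Qed.

(** From |df|^2 <= 2 |df + A f|^2 + 2 |A f|^2 with |A|^2 <= K0 in each of the two directions. So the
    form with the L^2 product added controls the H^1 norm for every K0. *)
Lemma form_density_lower v x : gradient_density v x <= (4 * K0 + 3) * form_density v v x.
Proof.
rewrite /gradient_density /form_density /dform !(sum_ord2 (fun _ => _)) -!sfac_sqr.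
have K0p := K0_ge0 bQ.
have [a0 b0] := pq_sqr_le bQ ord0 x; have [a1 b1] := pq_sqr_le bQ ord_max x.
have key (s P f0 f1 d0 d1 : R) : (s * P) ^+ 2 <= K0 ->
   (s * d0) ^+ 2 + (s * d1) ^+ 2 <=
     2 * (s ^+ 2 * ((d0 - P * f1) * (d0 - P * f1) + (d1 + P * f0) * (d1 + P * f0))) +
     2 * K0 * (f0 ^+ 2 + f1 ^+ 2).
  move=> h.
  have h1 : (s * P) ^+ 2 * (f0 ^+ 2 + f1 ^+ 2) <= K0 * (f0 ^+ 2 + f1 ^+ 2).
    by apply: ler_wpM2r => //; apply: addr_ge0; exact: sqr_ge0.
  have h2 := sqr_ge0 (s * (d0 - 2 * P * f1)); have h3 := sqr_ge0 (s * (d1 + 2 * P * f0)).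
  by move: h1 h2 h3; clear; nra.
have k0 := @key (sfac ord0 x) (p ord0 x) (v.1 ord0 x) (v.1 ord_max x) (v.2 ord0 ord0 x) (v.2 ord_max ord0 x) a0.
have k1 := @key (sfac ord_max x) (p ord_max x) (v.1 ord0 x) (v.1 ord_max x) (v.2 ord0 ord_max x) (v.2 ord_max ord_max x) a1.
set F := v.1 ord0 x ^+ 2 + v.1 ord_max x ^+ 2 in k0 k1.
have F0 : 0 <= F by apply: addr_ge0; exact: sqr_ge0.
set X := _ * (_ + _) in k0; set Y := _ * (_ + _) in k1.
have X0 : 0 <= X.
  apply: mulr_ge0; first exact: sqr_ge0.
  by apply: addr_ge0; rewrite -expr2 sqr_ge0.
have Y0 : 0 <= Y.
  apply: mulr_ge0; first exact: sqr_ge0.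
  by apply: addr_ge0; rewrite -expr2 sqr_ge0.
set t0 := q ord0 x * v.1 ord0 x - p ord0 x * v.1 ord_max x.
set t1 := q ord_max x * v.1 ord0 x - p ord_max x * v.1 ord_max x.
have Z0 := sqr_ge0 (sfac ord0 x * t0); have Z1 := sqr_ge0 (sfac ord_max x * t1).
apply: (@le_trans _ _ (F + (2 * X + 2 * K0 * F) + (2 * Y + 2 * K0 * F))).
  move: k0 k1; rewrite /F; clear; move: (X) (Y) => A B; lra.
apply: (@le_trans _ _ ((4 * K0 + 3) * (X + Y + (sfac ord0 x * t0) ^+ 2 + (sfac ord_max x * t1) ^+ 2 + F))).
  have := mulr_ge0 K0p X0; have := mulr_ge0 K0p Y0; have := mulr_ge0 K0p Z0; have := mulr_ge0 K0p Z1.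
  move: K0p F0 X0 Y0 Z0 Z1; clear.
  move: (X) (Y) (F) ((sfac ord0 x * t0) ^+ 2) ((sfac ord_max x * t1) ^+ 2) => A B C D E k0 f0 a0 b0 d0 e0 ke kd kb ka.
  rewrite -subr_ge0 (_ : _ - _ = 4 * (K0 * A) + A + 4 * (K0 * B) + B + 4 * (K0 * D) + 3 * D
    + 4 * (K0 * E) + 3 * E + 2 * C); last by ring.
  by repeat apply: addr_ge0 => //; apply: mulr_ge0.
rewrite le_eqVlt; apply/orP; left; apply/eqP; apply: congr1; rewrite /X /Y /F -/t0 -/t1; clear.
move: t0 t1 (sfac ord0 x) (sfac ord_max x) (p ord0 x) (p ord_max x) (v.1 ord0 x) (v.1 ord_max x).
move: (v.2 ord0 ord0 x) (v.2 ord0 ord_max x) (v.2 ord_max ord0 x) (v.2 ord_max ord_max x); intros; ring.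
Qed.

Lemma form_density_upper v x : form_density v v x <= (8 * K0 + 3) * gradient_density v x.
Proof.
rewrite /gradient_density /form_density /dform !(sum_ord2 (fun _ => _)) -!sfac_sqr.
have K0p := K0_ge0 bQ.
have [a0 b0] := pq_sqr_le bQ ord0 x; have [a1 b1] := pq_sqr_le bQ ord_max x.
have key (s P Z f0 f1 d0 d1 : R) : (s * P) ^+ 2 <= K0 -> (s * Z) ^+ 2 <= K0 ->
   s ^+ 2 * ((d0 - P * f1) * (d0 - P * f1) + (d1 + P * f0) * (d1 + P * f0) +
             (Z * f0 - P * f1) * (Z * f0 - P * f1)) <=
   2 * ((s * d0) ^+ 2 + (s * d1) ^+ 2) + 4 * K0 * (f0 ^+ 2 + f1 ^+ 2).
  move=> h h'.
  have h1 : (s * P) ^+ 2 * (f0 ^+ 2 + f1 ^+ 2) <= K0 * (f0 ^+ 2 + f1 ^+ 2).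
    by apply: ler_wpM2r => //; apply: addr_ge0; exact: sqr_ge0.
  have h1' : (s * P) ^+ 2 * (f1 ^+ 2) <= K0 * (f1 ^+ 2) by apply: ler_wpM2r => //; exact: sqr_ge0.
  have h1'' : (s * Z) ^+ 2 * (f0 ^+ 2) <= K0 * (f0 ^+ 2) by apply: ler_wpM2r => //; exact: sqr_ge0.
  have h2 := sqr_ge0 (s * (d0 + P * f1)); have h3 := sqr_ge0 (s * (d1 - P * f0)).
  have h4 := sqr_ge0 (s * (Z * f0 + P * f1)).
  by move: h1 h1' h1'' h2 h3 h4; clear; nra.
have k0 := @key (sfac ord0 x) (p ord0 x) (q ord0 x) (v.1 ord0 x) (v.1 ord_max x) (v.2 ord0 ord0 x) (v.2 ord_max ord0 x) a0 b0.
have k1 := @key (sfac ord_max x) (p ord_max x) (q ord_max x) (v.1 ord0 x) (v.1 ord_max x) (v.2 ord0 ord_max x) (v.2 ord_max ord_max x) a1 b1.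
have e0 := sqr_ge0 (sfac ord0 x * v.2 ord0 ord0 x); have e1 := sqr_ge0 (sfac ord0 x * v.2 ord_max ord0 x).
have e2 := sqr_ge0 (sfac ord_max x * v.2 ord0 ord_max x); have e3 := sqr_ge0 (sfac ord_max x * v.2 ord_max ord_max x).
have f0 := sqr_ge0 (v.1 ord0 x); have f1 := sqr_ge0 (v.1 ord_max x).
rewrite -!(expr2 (v.1 _ x)).
move: k0 k1; set X := _ * (_ + _ + _); set Y := _ * (_ + _ + _) => k0 k1.
apply: (le_trans (lerD (lerD k0 k1) (lexx _))).
move: e0 e1 e2 e3 f0 f1 K0p; clear.
move: (_ ^+ 2) (_ ^+ 2) (_ ^+ 2) (_ ^+ 2) (_ ^+ 2) (_ ^+ 2) => a b c d e f; intros; nra.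
Qed.

Lemma wpdD i (f g f' g' : R * R -> R) : loc2 f -> loc2 g -> loc2 f' -> loc2 g' ->
  wpd i f g -> wpd i f' g' -> wpd i (fun x => f x + f' x) (fun x => g x + g' x).
Proof.
move=> lf lg lf' lg' H H' chi tc; have tp := test_pd i tc.
transitivity (\int[leb2]_x (f x * pd i chi x + f' x * pd i chi x)).
  by apply: eq_Int => x; rewrite mulrDl.
rewrite IntD; [|exact: loc2_test|exact: loc2_test].
rewrite (H _ tc) (H' _ tc) -opprD -IntD; [|exact: loc2_test|exact: loc2_test].
by apply: congr1; apply: eq_Int => x; rewrite mulrDl.
Qed.

Lemma wpdZ i (a : R) (f g : R * R -> R) : loc2 f -> loc2 g -> wpd i f g ->
  wpd i (fun x => a * f x) (fun x => a * g x).
Proof.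
move=> lf lg H chi tc; have tp := test_pd i tc.
transitivity (\int[leb2]_x (a * (f x * pd i chi x))).
  by apply: eq_Int => x; rewrite mulrA.
rewrite IntZ; last exact: loc2_test.
rewrite (H _ tc) mulrN -IntZ; last exact: loc2_test.
by apply: congr1; apply: eq_Int => x; rewrite mulrA.
Qed.

Lemma energy_spaceD v w : energy_space v -> energy_space w -> energy_space (v + w).
Proof.
move=> hv hw j; have [sf sdf wf] := hv j; have [sg sdg wg] := hw j; split.
- exact (sqiD sf sg).
- move=> i; apply: (sqi_ext _ (sqiD (sdf i) (sdg i))) => x.
  by rewrite -mulrDr.
- move=> i; exact (wpdD (sqi_vol_loc2 sf) (sfac_loc2 (sdf i)) (sqi_vol_loc2 sg) (sfac_loc2 (sdg i)) (wf i) (wg i)).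
Qed.

Lemma energy_spaceZ a v : energy_space v -> energy_space (a *: v).
Proof.
move=> hv j; have [sf sdf wf] := hv j; split.
- exact (sqiZ a sf).
- by move=> i; apply: (sqi_ext _ (sqiZ a (sdf i))) => x; exact (mulrCA _ _ _).
- move=> i; exact (wpdZ a (sqi_vol_loc2 sf) (sfac_loc2 (sdf i)) (wf i)).
Qed.

(** The weights in [A] and [B] turn pairings for Lebesgue measure into pairings for the volume. By
    Cauchy-Schwarz the defect [z] in the limit satisfies z^2 <= e c for every e > 0. *)
Lemma wpd_limit i (f g : R * R -> R) (fn gn : nat -> R * R -> R) :
  sqi vol f -> sqi vol (fun x => sfac i x * g x) ->
  (forall n, sqi vol (fn n)) -> (forall n, sqi vol (fun x => sfac i x * gn n x)) ->
  (forall n, wpd i (fn n) (gn n)) ->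
  (forall e, 0 < e -> exists n, \int[vol]_x ((fn n x - f x) ^+ 2) <= e /\
     \int[vol]_x ((sfac i x * gn n x - sfac i x * g x) ^+ 2) <= e) ->
  wpd i f g.
Proof.
move=> sf sg sfn sgn w H chi tc.
have lf := sqi_vol_loc2 sf; have lg := sfac_loc2 sg.
have lfn n := sqi_vol_loc2 (sfn n); have lgn n := sfac_loc2 (sgn n).
have tp := test_pd i tc.
pose A (x : R * R) := expR (1 * x.2) * pd i chi x.
pose B (x : R * R) := expR ((1 - (if i == ord0 then 1 else 0)) * x.2) * chi x.
have tA : test_function A by apply: testM => //; exact: smooth_expR_snd.
have tB : test_function B by apply: testM => //; exact: smooth_expR_snd.
have [sA _ _] := test_h1 tA; have [sB _ _] := test_h1 tB.
pose z := \int[leb2]_x (f x * pd i chi x) + \int[leb2]_x (g x * chi x).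
suff -> : \int[leb2]_x (f x * pd i chi x) = z - \int[leb2]_x (g x * chi x).
  suff -> : z = 0 by rewrite sub0r.
  pose c := 2 * (\int[vol]_x (A x * A x) + \int[vol]_x (B x * B x)).
  have c0 : 0 <= c.
    by apply: mulr_ge0 => //; apply: addr_ge0; apply: Int_ge0 => x; rewrite -expr2 sqr_ge0.
  have zc e : 0 < e -> z ^+ 2 <= e * c.
    move=> e0; have [n [Hf Hg]] := H e e0.
    have vA : \int[leb2]_x (fn n x * pd i chi x) - \int[leb2]_x (f x * pd i chi x) =
        \int[vol]_x ((fn n x - f x) * A x).
      have m := itg_measurable (sqi_mul (sqiB (sfn n) sf) sA).
      rewrite -IntB; [|exact: loc2_test|exact: loc2_test].
      rewrite (Int_vol m); apply: eq_Int => x; rewrite /A mul1r.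
      move: (pd _ _ _) => t; have := expRxMexpNx_1 x.2; move: (expR x.2) (expR (- x.2)) => E N EN.
      by transitivity ((fn n x - f x) * t * (E * N)); [rewrite EN; ring|ring].
    have vB : \int[leb2]_x (gn n x * chi x) - \int[leb2]_x (g x * chi x) =
        \int[vol]_x ((sfac i x * gn n x - sfac i x * g x) * B x).
      have m := itg_measurable (sqi_mul (sqiB (sgn n) sg) sB).
      rewrite -IntB; [|exact: loc2_test|exact: loc2_test].
      rewrite (Int_vol m); apply: eq_Int => x; rewrite /B /sfac.
      set d : R := if _ then _ else _.
      rewrite (_ : (1 - d) * x.2 = x.2 + - (d * x.2)) ?expRD; last by ring.
      have := expRxMexpNx_1 x.2; have := expRxMexpNx_1 (d * x.2).
      move: (expR x.2) (expR (- x.2)) (expR (d * x.2)) (expR (- (d * x.2))) => E N F G FG EN.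
      by transitivity ((gn n x - g x) * chi x * (E * N) * (F * G)); [rewrite EN FG; ring|ring].
    have wn := w n chi tc.
    have zE : z = - (\int[vol]_x ((fn n x - f x) * A x) +
        \int[vol]_x ((sfac i x * gn n x - sfac i x * g x) * B x)).
      by rewrite -vA -vB /z wn; ring.
    have CA := Int_cauchy_schwarz (sqiB (sfn n) sf) sA.
    have CB := Int_cauchy_schwarz (sqiB (sgn n) sg) sB.
    have A0 : 0 <= \int[vol]_x (A x * A x) by apply: Int_ge0 => x; rewrite -expr2 sqr_ge0.
    have B0 : 0 <= \int[vol]_x (B x * B x) by apply: Int_ge0 => x; rewrite -expr2 sqr_ge0.
    have DA := le_trans CA (ler_wpM2r A0 Hf); have DB := le_trans CB (ler_wpM2r B0 Hg).
    rewrite zE /c; move: DA DB.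
    move: (\int[vol]_x (_ * A x)) (\int[vol]_x (_ * B x)) => a b.
    move: (\int[vol]_x (A x * A x)) (\int[vol]_x (B x * B x)) => a2 b2 DA DB.
    by have := sqr_ge0 (a - b); nra.
  apply/eqP; rewrite -sqrf_eq0 eq_le sqr_ge0 andbT; apply/ler_addgt0Pr => e e0; rewrite add0r.
  have c1 : 0 < c + 1 by rewrite ltr_wpDl.
  apply: le_trans (zc (e / (c + 1)) (divr_gt0 e0 c1)) _.
  by rewrite mulrAC ler_pdivrMr// ler_wpM2l ?(ltW e0)// lerDl.
by rewrite /z addrK.
Qed.

End resolvent.

Section resolvent_existence.
Context {R : realType}.
Variables (Q : R * R -> R * R) (K0 : R).
Hypotheses (sQ : forall k, smooth (crd k \o Q)) (hQ : forall x, tension Q x = 0).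
Hypothesis bQ : forall i x, cometric i i x * (pco Q i x ^+ 2 + qco Q i x ^+ 2) <= K0.
Local Notation plane := (mplane R).
Local Notation p := (pco Q).
Local Notation q := (qco Q).
Local Notation bd := (dform Q).

Local Notation V := (('I_2 -> R * R -> R) * ('I_2 -> 'I_2 -> R * R -> R))%type.
Implicit Types (u v w : V).

Local Notation energy_form := (energy_form Q).
Local Notation form_density := (form_density Q).
Lemma gradient_parts v (e : R) : energy_space v -> \int[vol]_x gradient_density v x <= e ->
  forall j, \int[vol]_x (v.1 j x ^+ 2) <= e /\
    forall i, \int[vol]_x ((sfac i x * v.2 j i x) ^+ 2) <= e.
Proof.
move=> hv le j; have [[_ sf] sdf _] := hv j; have I := itg_gradient_density hv.
have n0 (k : 'I_2) x : 0 <= v.1 k x ^+ 2 + \sum_(i < 2) (sfac i x * v.2 k i x) ^+ 2.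
  by apply: addr_ge0; [exact: sqr_ge0|apply: sumr_ge0 => i _; exact: sqr_ge0].
have b x : v.1 j x ^+ 2 + \sum_(i < 2) (sfac i x * v.2 j i x) ^+ 2 <= gradient_density v x.
  rewrite /gradient_density [leRHS](bigD1 j) //; rewrite lerDl; apply: sumr_ge0 => k _; exact: n0.
split=> [|i]; apply: le_trans le; apply: le_Int => //.
- move=> x; apply: le_trans (b x); rewrite lerDl sumr_ge0// => i _; exact: sqr_ge0.
- by have [] := sdf i.
- move=> x; apply: le_trans (b x); rewrite [X in _ + X](bigD1 i) // addrCA lerDl.
  by apply: addr_ge0; [exact: sqr_ge0|apply: sumr_ge0 => k _; exact: sqr_ge0].
Qed.

Lemma gradient_le v (e : R) : energy_space v ->
  (forall j, \int[vol]_x (v.1 j x ^+ 2) <= e /\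
    forall i, \int[vol]_x ((sfac i x * v.2 j i x) ^+ 2) <= e) ->
  \int[vol]_x gradient_density v x <= 6 * e.
Proof.
move=> hv H; have I j := let: And3 (conj _ sf) _ _ := hv j in sf.
have J j i := let: And3 _ sdf _ := hv j in (sdf i).2.
rewrite Int_sum; last by move=> j; apply: itgD => //; exact: itg_sum.
have B j : \int[vol]_x (v.1 j x ^+ 2 + \sum_(i < 2) (sfac i x * v.2 j i x) ^+ 2) <= 3 * e.
  rewrite IntD//; last exact: itg_sum.
  rewrite Int_sum// (sum_ord2 (fun i => \int[vol]_x _)).
  have [h0 h1] := H j; have := h1 ord0; have := h1 ord_max; move: h0; clear.
  by move: (\int[vol]_x _) (\int[vol]_x _) (\int[vol]_x _) => a b c; lra.
rewrite (sum_ord2 (fun j => \int[vol]_x _)); have := B ord0; have := B ord_max; clear.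
by move: (\int[vol]_x _) (\int[vol]_x _) => a b; lra.
Qed.

Lemma bd_linear a v w u x : bd (a *: v + w).1 (a *: v + w).2 u.1 u.2 x =
  a * bd v.1 v.2 u.1 u.2 x + bd w.1 w.2 u.1 u.2 x.
Proof.
have e1 j : (a *: v + w).1 j x = a * v.1 j x + w.1 j x by [].
have e2 j i : (a *: v + w).2 j i x = a * v.2 j i x + w.2 j i x by [].
rewrite /dform !(sum_ord2 (fun _ => _)) !e1 !e2; clear.
move: (cometric ord0 ord0 x) (p ord0 x) (q ord0 x) (cometric ord_max ord_max x) (p ord_max x) (q ord_max x).
move: (v.1 ord0 x) (v.1 ord_max x) (v.2 ord0 ord0 x) (v.2 ord_max ord0 x) (v.2 ord0 ord_max x) (v.2 ord_max ord_max x).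
move: (w.1 ord0 x) (w.1 ord_max x) (w.2 ord0 ord0 x) (w.2 ord_max ord0 x) (w.2 ord0 ord_max x) (w.2 ord_max ord_max x).
move: (u.1 ord0 x) (u.1 ord_max x) (u.2 ord0 ord0 x) (u.2 ord_max ord0 x) (u.2 ord0 ord_max x) (u.2 ord_max ord_max x).
intros; ring.
Qed.

Lemma bdC v w x : bd v.1 v.2 w.1 w.2 x = bd w.1 w.2 v.1 v.2 x.
Proof. by apply: eq_bigr => i _; congr (_ * (_ + _ + _)); exact: mulrC. Qed.

Lemma bd_ge0 v x : 0 <= bd v.1 v.2 v.1 v.2 x.
Proof.
apply: sumr_ge0 => i _; apply: mulr_ge0; first exact: ltW (cometric_gt0 _ _).
by apply: addr_ge0; [apply: addr_ge0|]; rewrite -expr2 sqr_ge0.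
Qed.

Lemma energy_form_linear a v w u : energy_space v -> energy_space w -> energy_space u ->
  energy_form (a *: v + w) u = a * energy_form v u + energy_form w u.
Proof.
move=> hv hw hu; have Iv := itg_form_density sQ bQ hv hu; have Iw := itg_form_density sQ bQ hw hu.
rewrite /energy_form -(IntZ a Iv) -(IntD (itgZ a Iv) Iw); apply: eq_Int => x.
rewrite /form_density bd_linear !(sum_ord2 (fun j => _ * _)).
have e1 j : (a *: v + w).1 j x = a * v.1 j x + w.1 j x by [].
rewrite !e1; move: (bd _ _ _ _ _) (bd _ _ _ _ _) => b c; ring.
Qed.

Lemma energy_space0 : energy_space (0 : V).
Proof. by move=> j; exact h1_zero. Qed.

(** The two density bounds make Cauchy sequences for the form Cauchy in each component and each
    weighted derivative; [wpd_limit] identifies the limits of the derivatives. *)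
Lemma energy_space_complete (s : nat -> V) : (forall n, energy_space (s n)) ->
  (forall e, 0 < e -> exists N, forall m n, (N <= m)%N -> (N <= n)%N ->
     energy_form (s m - s n) (s m - s n) <= e) ->
  exists v, energy_space v /\ forall e, 0 < e -> exists N, forall n, (N <= n)%N ->
     energy_form (s n - v) (s n - v) <= e.
Proof.
move=> Ss cs.
have SB v w : energy_space v -> energy_space w -> energy_space (v - w).
  move=> hv hw; rewrite -scaleN1r; apply: energy_spaceD => //; exact: energy_spaceZ.
have c1 : 0 < 4 * K0 + 3 by have := K0_ge0 bQ; lra.
have c2 : 0 < 8 * K0 + 3 by have := K0_ge0 bQ; lra.
have low v : energy_space v -> \int[vol]_x gradient_density v x <= (4 * K0 + 3) * energy_form v v.
  move=> hv; have I := itg_form_density sQ bQ hv hv; rewrite -(IntZ _ I); apply: le_Int.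
  - exact: itg_gradient_density.
  - exact: itgZ.
  - by move=> x; exact: (form_density_lower bQ).
have upp v : energy_space v -> energy_form v v <= (8 * K0 + 3) * \int[vol]_x gradient_density v x.
  move=> hv; have I := itg_gradient_density hv; rewrite -(IntZ _ I); apply: le_Int.
  - exact: (itg_form_density sQ bQ).
  - exact: itgZ.
  - by move=> x; exact: (form_density_upper bQ).
have cg e : 0 < e -> exists N, forall m n, (N <= m)%N -> (N <= n)%N ->
    forall j, \int[vol]_x (((s m).1 j x - (s n).1 j x) ^+ 2) <= e /\
      forall i, \int[vol]_x ((sfac i x * (s m).2 j i x - sfac i x * (s n).2 j i x) ^+ 2) <= e.
  move=> e0; have [N HN] := cs _ (divr_gt0 e0 c1); exists N => m n Nm Nn.
  have hD := SB _ _ (Ss m) (Ss n).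
  have le := le_trans (low _ hD) (ler_wpM2l (ltW c1) (HN m n Nm Nn)).
  rewrite mulrCA divff ?gt_eqF// mulr1 in le.
  move=> j; have [h0 h1] := gradient_parts hD le j; split; first exact: h0.
  move=> i; apply: le_trans (h1 i); rewrite le_eqVlt; apply/orP; left; apply/eqP.
  by apply: eq_Int => x; rewrite -mulrBr.
have lf j := @sqi_complete _ _ _ vol (fun n => (s n).1 j)
  (fun n => let: And3 sf _ _ := Ss n j in sf) (fun e e0 =>
   let: ex_intro N HN := cg e e0 in ex_intro _ N (fun m n Nm Nn => (HN m n Nm Nn j).1)).
have lg j i := @sqi_complete _ _ _ vol (fun n x => sfac i x * (s n).2 j i x)
  (fun n => let: And3 _ sdf _ := Ss n j in sdf i) (fun e e0 =>
   let: ex_intro N HN := cg e e0 in ex_intro _ N (fun m n Nm Nn => (HN m n Nm Nn j).2 i)).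
have [f Hf] := choice lf; have [g Hg] := choice (fun ji => lg ji.1 ji.2).
(* What converges is the derivative times [sfac i]; the weight is undone to recover the coordinate
   derivative. *)
pose dg j i x := expR (- (if i == ord0 then 1 else 0) * x.2) * g (j, i) x.
have dgE j i x : sfac i x * dg j i x = g (j, i) x.
  by rewrite /dg mulrCA sfacVM.
pose v : V := (f, dg).
have hv : energy_space v.
  move=> j; have [sf cf] := Hf j.
  have sg i : sqi vol (fun x => sfac i x * dg j i x).
    by have [sg _] := Hg (j, i); apply: sqi_ext sg => x; rewrite dgE.
  split=> // i; have [_ cgi] := Hg (j, i).
  apply: (@wpd_limit R i (f j) (dg j i) (fun n => (s n).1 j) (fun n => (s n).2 j i) sf (sg i)).
  - by move=> n; case: (Ss n j).
  - by move=> n; case: (Ss n j).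
  - by move=> n; case: (Ss n j).
  - move=> e e0; have [N HN] := cf e e0; have [N' HN'] := cgi e e0.
    exists (maxn N N'); split; first by apply: HN; exact: leq_maxl.
    apply: le_trans (HN' (maxn N N') (leq_maxr _ _)); rewrite le_eqVlt; apply/orP; left.
    by apply/eqP; apply: eq_Int => x; rewrite dgE.
exists v; split=> // e e0.
(* Six squares make up [gradient_density]: a value and two derivatives for each of two
   components. *)
have e6 : 0 < e / (8 * K0 + 3) / 6 by rewrite !divr_gt0.
have NF j := (Hf j).2 _ e6; have NG j i := (Hg (j, i)).2 _ e6.
have [NF' HF] := choice NF; have [NG' HG] := choice (fun ji => NG ji.1 ji.2).
exists (maxn (\max_j NF' j) (\max_ji NG' ji)) => n; rewrite geq_max => /andP[nF nG].
have hD := SB _ _ (Ss n) hv.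
apply: le_trans (upp _ hD) _; rewrite -ler_pdivlMl// mulrC.
have -> : e / (8 * K0 + 3) = 6 * (e / (8 * K0 + 3) / 6) by field; rewrite gt_eqF.
apply: gradient_le => // j; split.
  by apply: HF; apply: leq_trans nF; exact: leq_bigmax.
move=> i; apply: le_trans (HG (j, i) n _); last by apply: leq_trans nG; exact: leq_bigmax.
rewrite le_eqVlt; apply/orP; left; apply/eqP; apply: eq_Int => x.
by rewrite -dgE -mulrBr.
Qed.

(** Riesz representation for the form plus the L^2 product. The bound 2 G on the functional is
    Cauchy-Schwarz in each of the two components, and non-negativity of the form bounds the L^2 norm
    by the energy. *)
Lemma resolvent_exists (g : 'I_2 -> R * R -> R) : (forall j, sqi vol (g j)) ->
  exists (f : 'I_2 -> R * R -> R) (df : 'I_2 -> 'I_2 -> R * R -> R), (forall j, h1 (f j) (df j)) /\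
    forall (v : 'I_2 -> R * R -> R) (dv : 'I_2 -> 'I_2 -> R * R -> R), (forall j, h1 (v j) (dv j)) ->
      \int[vol]_x (bd f df v dv x + \sum_(j < 2) f j x * v j x) =
      \int[vol]_x (\sum_(j < 2) g j x * v j x).
Proof.
move=> sg; pose l v := \int[vol]_x (\sum_(j < 2) g j x * v.1 j x).
have Il v : energy_space v -> forall j, itg vol (fun x => g j x * v.1 j x).
  by move=> hv j; apply: sqi_mul => //; case: (hv j).
have lE v : energy_space v -> l v = \sum_(j < 2) \int[vol]_x (g j x * v.1 j x).
  by move=> hv; rewrite /l Int_sum//; exact: Il.
pose G := \sum_(j < 2) \int[vol]_x (g j x * g j x).
have G0 : 0 <= G by apply: sumr_ge0 => j _; apply: Int_ge0 => x; rewrite -expr2 sqr_ge0.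
have zero v w : energy_space v -> energy_space w -> 1 *: v + w = v + w by rewrite scale1r.
have [v [hv H]] : exists v, energy_space v /\ forall w, energy_space w -> energy_form v w = l w.
  apply: (@riesz_representation R _ energy_space energy_form l (2 * G)).
  - exact: energy_spaceD.
  - exact: energy_spaceZ.
  - exact: energy_space0.
  - move=> v w; apply: eq_Int => x; rewrite /form_density bdC; congr (_ + _).
    by apply: eq_bigr => j _; exact: mulrC.
  - move=> u v w hu hv hw; have := energy_form_linear 1 hu hv hw.
    by rewrite scale1r mul1r.
  - move=> a v w hv hw; have := energy_form_linear a hv energy_space0 hw.
    have := energy_form_linear 1 energy_space0 energy_space0 hw.
    rewrite scale1r addr0 mul1r => /eqP; rewrite -subr_eq0 opprD addrA subrr sub0r oppr_eq0 => /eqP ->.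
    by rewrite !addr0.
  - move=> v _; apply: Int_ge0 => x; apply: addr_ge0; first exact: bd_ge0.
    by apply: sumr_ge0 => j _; rewrite -expr2 sqr_ge0.
  - move=> v w hv hw; rewrite (lE _ (energy_spaceD hv hw)) !lE// -big_split /=.
    by apply: eq_bigr => j _; rewrite -(IntD (Il v hv j) (Il w hw j)); apply: eq_Int => x; exact (mulrDr _ _ _).
  - move=> a v hv; rewrite (lE _ (energy_spaceZ a hv)) lE// mulr_sumr.
    by apply: eq_bigr => j _; rewrite -(IntZ a (Il v hv j)); apply: eq_Int => x; exact (mulrCA _ _ _).
  - by apply: mulr_ge0.
  - move=> v hv; rewrite lE//.
    have sv j : sqi vol (v.1 j) by case: (hv j).
    have C j := Int_cauchy_schwarz (sg j) (sv j).
    have vv j : itg vol (fun x => v.1 j x * v.1 j x) := sqi_mul (sv j) (sv j).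
    have E : \sum_(j < 2) \int[vol]_x (v.1 j x * v.1 j x) <= energy_form v v.
      rewrite -Int_sum//; apply: le_Int; [exact: itg_sum|exact: (itg_form_density sQ bQ)|].
      by move=> x; rewrite lerDr; exact: bd_ge0.
    have g0 j : 0 <= \int[vol]_x (g j x * g j x) by apply: Int_ge0 => x; rewrite -expr2 sqr_ge0.
    have v0 j : 0 <= \int[vol]_x (v.1 j x * v.1 j x) by apply: Int_ge0 => x; rewrite -expr2 sqr_ge0.
    apply: (le_trans _ (ler_wpM2l (mulr_ge0 (ler0n _ 2) G0) E)).
    rewrite /G !(sum_ord2 (fun j => \int[vol]_x _)).
    move: (C ord0) (C ord_max) (g0 ord0) (g0 ord_max) (v0 ord0) (v0 ord_max); clear.
    move: (\int[vol]_x (g ord0 x * v.1 ord0 x)) (\int[vol]_x (g ord_max x * v.1 ord_max x)) => a b.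
    move: (\int[vol]_x (g ord0 x * g ord0 x)) (\int[vol]_x (g ord_max x * g ord_max x)) => c d.
    move: (\int[vol]_x (v.1 ord0 x * v.1 ord0 x)) (\int[vol]_x (v.1 ord_max x * v.1 ord_max x)) => e f.
    move=> h1 h2 c0 d0 e0 f0; have := sqr_ge0 (a - b).
    have := mulr_ge0 c0 f0; have := mulr_ge0 d0 e0; nra.
  - exact: energy_space_complete.
exists v.1, v.2; split=> // w dw hw; exact: (H (w, dw) hw).
Qed.

End resolvent_existence.

Lemma ae_all d (T : measurableType d) (R : realType)
    (mu : {measure set T -> \bar R}) (P : T -> Prop) :
  (forall x, P x) -> {ae mu, forall x, P x}.
Proof. by move=> H; exact: nearW. Qed.

(** * Symmetry, maximality and coercivity of the real operator *)

Section real_schroedinger.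
Context {R : realType}.
Variables (Q : R * R -> R * R) (K0 : R).
Hypotheses (sQ : forall k, smooth (crd k \o Q)) (hQ : forall x, tension Q x = 0).
Hypothesis bQ : forall i x, cometric i i x * (pco Q i x ^+ 2 + qco Q i x ^+ 2) <= K0.
Local Notation plane := (mplane R).
Implicit Types (f g : 'I_2 -> R * R -> R).

Definition pairing f g : R := \int[vol]_x (\sum_(j < 2) f j x * g j x).

(** The coefficients of [W] being real, the complex operator is two copies of this one, on real and
    imaginary parts. *)
Definition real_graph f g : Prop :=
  [/\ forall j, sqi vol (f j), forall j, sqi vol (g j) &
    exists (df : 'I_2 -> 'I_2 -> R * R -> R) (L : 'I_2 -> R * R -> R),
      [/\ forall j, h1 (f j) (df j), forall j, weak_lap (f j) (L j), forall j, sqi vol (L j) &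
          forall j, {ae vol, forall x, g j x = - L j x + Wr Q f df j x}]].

Lemma itg_pairing f g : (forall j, sqi vol (f j)) -> (forall j, sqi vol (g j)) ->
  itg vol (fun x => \sum_(j < 2) f j x * g j x).
Proof. by move=> sf sg; apply: itg_sum => j; exact: sqi_mul. Qed.

Lemma pairingC f g : pairing f g = pairing g f.
Proof. by apply: eq_Int => x; apply: eq_bigr => j _; exact: mulrC. Qed.

Lemma pairingD f f' g : (forall j, sqi vol (f j)) -> (forall j, sqi vol (f' j)) ->
  (forall j, sqi vol (g j)) ->
  pairing (fun j x => f j x + f' j x) g = pairing f g + pairing f' g.
Proof.
move=> sf sf' sg; rewrite /pairing -IntD; [|exact: itg_pairing|exact: itg_pairing].
by apply: eq_Int => x; rewrite -big_split; apply: eq_bigr => j _; rewrite mulrDl.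
Qed.

Lemma pairingN f g : (forall j, sqi vol (f j)) -> (forall j, sqi vol (g j)) ->
  pairing (fun j x => - f j x) g = - pairing f g.
Proof.
move=> sf sg; rewrite /pairing -IntN; last exact: itg_pairing.
by apply: eq_Int => x; rewrite -sumrN; apply: eq_bigr => j _; rewrite mulNr.
Qed.

Lemma graph_form f g : real_graph f g -> exists2 df : 'I_2 -> 'I_2 -> R * R -> R,
  forall j, h1 (f j) (df j) & forall v (dv : 'I_2 -> 'I_2 -> R * R -> R), (forall j, h1 (v j) (dv j)) ->
    pairing g v = \int[vol]_x dform Q f df v dv x.
Proof.
move=> [sf sg [df [L [hf wl sL E]]]]; exists df => // v dv hv.
rewrite -(green_formula sQ hQ bQ hf wl sL hv).
have sW j := sqi_Wr sQ bQ j hf.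
have sv j : sqi vol (v j) by case: (hv j).
have sLW j : sqi vol (fun x => - L j x + Wr Q f df j x) by apply: sqiD => //; exact: sqiN.
apply: Int_ae.
- by apply: itg_measurable; exact: itg_pairing.
- by apply: itg_measurable; exact: (@itg_pairing (fun j x => - L j x + Wr Q f df j x) v).
- by apply: ae_imply2 (E ord0) (E ord_max) => x e0 e1; rewrite !(sum_ord2 (fun _ => _)) e0 e1.
Qed.

Lemma graph_symmetric f g f' g' : real_graph f g -> real_graph f' g' ->
  pairing g f' = pairing f g'.
Proof.
move=> G G'; have [df hf H] := graph_form G; have [df' hf' H'] := graph_form G'.
rewrite (H _ _ hf') [RHS]pairingC (H' _ _ hf); apply: eq_Int => x.
exact: (bdC Q (f, df) (f', df')).
Qed.

(** That H f = k - f says (H + 1) f = k. The weak solution has its Laplacian in L^2, hence lies in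
    the domain. *)
Lemma graph_resolvent k : (forall j, sqi vol (k j)) ->
  exists f, real_graph f (fun j x => k j x - f j x).
Proof.
move=> sk; have [f [df [hf H]]] := resolvent_exists sQ bQ sk.
have sf j : sqi vol (f j) by case: (hf j).
have wl := weak_solution_lap sQ hQ bQ hf sk H.
exists f; split=> // [j|]; first exact: sqiB.
exists df, (fun j x => Wr Q f df j x + f j x - k j x); split=> //.
  by move=> j; apply: sqiB => //; apply: sqiD => //; exact: (sqi_Wr sQ bQ).
by move=> j; apply: ae_all => x; move: (Wr _ _ _ _ _) => w; ring.
Qed.

(** The graph relates representatives, while the maximality argument identifies functions only
    almost everywhere. *)
Lemma graph_ae f g f' g' : real_graph f g ->
  (forall j, measurable_fun [set: plane] (f' j)) -> (forall j, measurable_fun [set: plane] (g' j)) ->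
  (forall j, {ae vol, forall x, f j x = f' j x}) -> (forall j, {ae vol, forall x, g j x = g' j x}) ->
  real_graph f' g'.
Proof.
move=> [sf sg [df [L [hf wl sL E]]]] mf' mg' ff gg.
have sf' j : sqi vol (f' j) by exact: sqi_ae (mf' j) (sf j) (ff j).
have sg' j : sqi vol (g' j) by exact: sqi_ae (mg' j) (sg j) (gg j).
have fl j : {ae leb2, forall x, f j x = f' j x} by apply/ae_vol; exact: ff.
have mm (a b : R * R -> R) : measurable_fun [set: plane] a -> measurable_fun [set: plane] b ->
    measurable_fun [set: plane] (fun x => a x * b x) by exact: measurable_funM.
split=> //; exists df, L; split=> //.
- move=> j; have [_ sdf w] := hf j; split=> // i chi tc; rewrite -(w i chi tc).
  have mp := test_measurable (test_pd i tc).
  apply: Int_ae; [exact: mm|exact: mm (sf j).1 mp|].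
  by apply: ae_imply (fl j) => x ->.
- move=> j; have [_ lL w] := wl j; split=> //; first exact/loc2_loc_integrable/sqi_vol_loc2.
  move=> chi tc; rewrite -(w chi tc).
  have mp := test_measurable (test_Lap tc).
  apply: Int_ae; [exact: mm|exact: mm (sf j).1 mp|].
  by apply: ae_imply (ff j) => x ->.
- have fW j : {ae vol, forall x, Wr Q f df j x = Wr Q f' df j x}.
    by apply: ae_imply2 (ff ord0) (ff ord_max) => x e0 e1; rewrite /Wr e0 e1.
  have gE j : {ae vol, forall x, g' j x = - L j x + Wr Q f df j x}.
    by apply: ae_imply2 (gg j) (E j) => x <- e2.
  by move=> j; apply: ae_imply2 (gE j) (fW j) => x -> ->.
Qed.

(* The resolvent at [-1] is surjective: comparing [f] with the solution [f0] of
   [(H + 1) f0 = f + g] shows that [f - f0] is orthogonal to everything. *)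
Lemma graph_maximal f g : (forall j, sqi vol (f j)) -> (forall j, sqi vol (g j)) ->
  (forall f' g', real_graph f' g' -> pairing g' f = pairing f' g) -> real_graph f g.
Proof.
move=> sf sg H.
pose k j x := f j x + g j x; have sk j : sqi vol (k j) by exact: sqiD.
have [f0 G0] := graph_resolvent sk; have [sf0 _ _] := G0.
pose d j x := f j x - f0 j x; have sd j : sqi vol (d j) by exact: sqiB.
(* With (H + 1) u = d, the product <d, d> is <(H + 1) u, f> - <(H + 1) u, f0>. The assumption on f
   and the symmetry between u and f0 turn both terms into <u, f + g>. *)
have [u Gu] := graph_resolvent sd; have [su _ _] := Gu.
have sdu j : sqi vol (fun x => d j x - u j x) by exact: sqiB.
have e1 : pairing (fun j x => d j x - u j x) f = pairing u g := H _ _ Gu.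
have e2 := graph_symmetric Gu G0.
have A a b c : (forall j, sqi vol (a j)) -> (forall j, sqi vol (b j)) -> (forall j, sqi vol (c j)) ->
    pairing (fun j x => a j x - b j x) c = pairing a c - pairing b c.
  move=> sa sb sc; rewrite -(pairingN sb sc) -pairingD//; by move=> j; exact: sqiN.
have z : pairing d d = 0.
  rewrite [LHS]A// [pairing f d]pairingC [pairing f0 d]pairingC.
  move: e1 e2; rewrite !A// [pairing u (fun j x => k j x - f0 j x)]pairingC A//.
  rewrite /k pairingD// [pairing f u]pairingC [pairing g u]pairingC [pairing f0 u]pairingC.
  by move: (pairing d f) (pairing u f) (pairing u g) (pairing d f0) (pairing u f0) => a b c e h; lra.
have dz j : {ae vol, forall x, f0 j x = f j x}.
  have I : itg vol (fun x => \sum_(j < 2) d j x * d j x) by exact: itg_pairing.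
  have := Int_eq0_ae I _ z; move=> /(_ (fun x => sumr_ge0 _ _)) h.
  have {}h : {ae vol, forall x, \sum_(j < 2) d j x * d j x = 0}.
    by apply: h => x j' _; rewrite -expr2 sqr_ge0.
  apply: ae_imply h => x; rewrite (bigD1 j)//= => /eqP.
  have s0 : 0 <= \sum_(i < 2 | i != j) d i x * d i x by apply: sumr_ge0 => i _; rewrite -expr2 sqr_ge0.
  rewrite paddr_eq0//; last by rewrite -expr2 sqr_ge0.
  by move=> /andP[+ _]; rewrite mulf_eq0 orbb subr_eq0 => /eqP ->.
apply: (graph_ae G0) => // [j|j|j].
- by case: (sf j).
- by case: (sg j).
- by apply: ae_imply (dz j) => x ->; rewrite /k; ring.
Qed.

(** The identity is [weighted_flux] for the one-form u dx_2, whose divergence is d_2 u - u. The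
    inequality then uses 4 u d_2 u <= u^2 + 4 (d_2 u)^2. *)
Lemma poincare (u : R * R -> R) du : h1 u du ->
  sqi vol (du ord_max) /\ \int[vol]_x (u x ^+ 2) <= 4 * \int[vol]_x (du ord_max x ^+ 2).
Proof.
move=> hu; have [su sdu _] := hu.
have sd : sqi vol (du ord_max).
  by apply: sqi_ext (sdu ord_max) => x; rewrite /sfac /= mul0r expR0 mul1r.
split=> //.
pose c (i : 'I_2) (x : R * R) : R := if i == ord0 then 0 else u x.
have sc i : sqi vol (fun x => sfac i x * c i x).
  rewrite /c; elim/ord2_cases: i => /=.
    by apply: (sqi_ext _ (@sqi0 _ _ _ _)) => x; rewrite mulr0.
  by apply: sqi_ext su => x; rewrite /sfac /= mul0r expR0 mul1r.
have [I E] : itg vol (fun x => (du ord_max x - u x) * u x + \sum_(i < 2) cometric i i x * (c i x * du i x)) /\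
    \int[vol]_x ((du ord_max x - u x) * u x + \sum_(i < 2) cometric i i x * (c i x * du i x)) = 0.
  apply: weighted_flux => //; first exact: sqiB.
  move=> chi tc.
  pose k (i : 'I_2) : R * R -> R := if i == ord0 then fun=> 0 else chi.
  have tk i : test_function (k i) by rewrite /k; case: ifP => _ //; exact: test0.
  have [_ E] := h1_ibp hu tk; apply: etrans E; apply: eq_Int => x.
  have z : pd ord0 (k ord0) x = 0 by rewrite /k /pd derive_cst.
  rewrite !(sum_ord2 (fun _ => _)) z /c /k /= cometric1.
  by move: (pd ord_max chi x) => a; ring.
have sq : itg vol (fun x => u x * du ord_max x) := sqi_mul su sd.
have e x : (du ord_max x - u x) * u x + \sum_(i < 2) cometric i i x * (c i x * du i x) =
    2 * (u x * du ord_max x) - u x ^+ 2.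
  by rewrite (sum_ord2 (fun _ => _)) /c /= cometric1; ring.
have := etrans (esym (eq_Int vol e)) E.
have [_ iu] := su; have [_ id] := sd.
rewrite (IntB (itgZ 2 sq) iu) => /eqP; rewrite subr_eq0 => /eqP h.
have : 2 * (\int[vol]_x (2 * (u x * du ord_max x))) <=
    \int[vol]_x (u x ^+ 2) + 4 * \int[vol]_x (du ord_max x ^+ 2).
  rewrite -(IntZ 2 (itgZ 2 sq)) -(IntZ 4 id) -(IntD iu (itgZ 4 id)).
  apply: le_Int; [by do 2 apply: itgZ|by apply: itgD => //; exact: itgZ|].
  by move=> x; have := sqr_ge0 (u x - 2 * du ord_max x); move: (u x) (du ord_max x) => a b; nra.
rewrite h; clear; move: (\int[vol]_x (u x ^+ 2)) (\int[vol]_x (du ord_max x ^+ 2)) => a b; lra.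
Qed.

(** Of the form only the derivatives along x_2 are kept, where |d_2 f + A_2 f|^2 >= |d_2 f|^2 / 2 -
    K0 |f|^2. With the constant 4 of [poincare] this leaves 1/8 - 1/16 = 1/16. *)
Lemma graph_coercive f g : K0 <= 1 / 16 -> real_graph f g ->
  1 / 16 * pairing f f <= pairing g f.
Proof.
move=> K16 G; have [df hf H] := graph_form G; rewrite (H _ _ hf).
have P j := poincare (hf j); have sd j := (P j).1.
have sf j : sqi vol (f j) by case: (hf j).
have Ib := itg_bd sQ bQ hf hf.
have If j : itg vol (fun x => f j x ^+ 2) by case: (sf j).
have Id j : itg vol (fun x => df j ord_max x ^+ 2) by case: (sd j).
have B : \int[vol]_x (2^-1 * (df ord0 ord_max x ^+ 2 + df ord_max ord_max x ^+ 2)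
    - 1 / 16 * (f ord0 x ^+ 2 + f ord_max x ^+ 2)) <= \int[vol]_x dform Q f df f df x.
  apply: le_Int => //.
    by apply: itgB; apply: itgZ; exact: itgD.
  move=> x; have [p0 _] := pq_sqr_le bQ ord_max x.
  rewrite /sfac /= mul0r expR0 mul1r in p0.
  have {}p0 := le_trans p0 K16.
  rewrite /dform (sum_ord2 (fun _ => _)) cometric1 mul1r.
  set X := cometric _ _ _ * _.
  have X0 : 0 <= X.
    apply: mulr_ge0; first exact: ltW (cometric_gt0 _ _).
    by apply: addr_ge0; [apply: addr_ge0|]; rewrite -expr2 sqr_ge0.
  move: p0 X0; move: X (pco Q ord_max x) (qco Q ord_max x) (f ord0 x) (f ord_max x) => X a b c d.
  move: (df ord0 ord_max x) (df ord_max ord_max x) => e h a16 X0.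
  have h1 := sqr_ge0 (b * c - a * d); have h2 := sqr_ge0 (e - 2 * a * d); have h3 := sqr_ge0 (h + 2 * a * c).
  have h4 : a ^+ 2 * (c ^+ 2 + d ^+ 2) <= 1 / 16 * (c ^+ 2 + d ^+ 2).
    by apply: ler_wpM2r => //; apply: addr_ge0; exact: sqr_ge0.
  by move: X0 h1 h2 h3 h4; nra.
apply: le_trans B.
rewrite IntB; [|by apply: itgZ; exact: itgD|by apply: itgZ; exact: itgD].
rewrite !IntZ; [|exact: itgD|exact: itgD].
rewrite (IntD (If _) (If _)) (IntD (Id _) (Id _)).
have -> : pairing f f = \int[vol]_x (f ord0 x ^+ 2) + \int[vol]_x (f ord_max x ^+ 2).
  by rewrite -IntD//; apply: eq_Int => x; rewrite (sum_ord2 (fun _ => _)) !expr2.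
have := (P ord0).2; have := (P ord_max).2; clear.
move: (\int[vol]_x (f ord0 x ^+ 2)) (\int[vol]_x (f ord_max x ^+ 2)) => a b.
move: (\int[vol]_x (df ord0 ord_max x ^+ 2)) (\int[vol]_x (df ord_max ord_max x ^+ 2)) => c d; lra.
Qed.

(** Test functions lie in the domain, which makes it dense. Their classical Laplacian is the
    distributional one by integrating by parts twice. *)
Lemma test_graph chi : (forall j, test_function (chi j)) ->
  real_graph chi (fun j x => - Lap (chi j : R * R -> R) x + Wr Q chi (fun j i => pd i (chi j)) j x).
Proof.
move=> tc; have hc j := test_h1 (tc j).
have sL j : sqi vol (fun x => Lap (chi j) x) by case: (test_h1 (test_Lap (tc j))).
have sW j := sqi_Wr sQ bQ j hc.
split=> [j|j|]; first by case: (hc j).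
  by apply: sqiD => //; exact: sqiN.
exists (fun j i => pd i (chi j)), (fun j x => Lap (chi j) x); split=> // j; last exact: ae_all.
split; [by apply/loc2_loc_integrable/sqi_vol_loc2; case: (hc j)|exact/loc2_loc_integrable/sqi_vol_loc2|].
move=> psi tp.
have [I1 E1] := test_lap_ibp (hc j) tp; have [I2 E2] := test_lap_ibp (test_h1 tp) (tc j).
have J : itg vol (fun x => chi j x * Lap psi x).
  by apply: loc2_itg_vol (test_Lap tp); apply: sqi_vol_loc2; case: (hc j).
have J' : itg vol (fun x => Lap (chi j) x * psi x) by exact: loc2_itg_vol (sqi_vol_loc2 (sL j)) tp.
apply/eqP; rewrite -subr_eq0 -IntB//; apply/eqP.
transitivity (\int[vol]_x ((\sum_(i < 2) cometric i i x * (pd i (chi j) x * pd i psi x) + chi j x * Lap psi x)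
  - (\sum_(i < 2) cometric i i x * (pd i psi x * pd i (chi j) x) + psi x * Lap (chi j) x))).
  apply: eq_Int => x; rewrite (eq_bigr _ (fun i _ => congr1 _ (mulrC (pd i psi x) (pd i (chi j) x)))).
  by move: (Lap _ _) (Lap _ _) (\sum_(i < 2) _) => a b c; ring.
by rewrite IntB// E1 E2 subrr.
Qed.

End real_schroedinger.

(** * From real pairs to complex-valued functions *)

Section square_norms.
Context {R : realType}.
Local Notation plane := (mplane R).
Implicit Types f S : R * R -> R.

Lemma L2normE f : L2norm f = ((\int[vol]_x (f x ^+ 2)%:E) `^ 2^-1)%E.
Proof.
rewrite /L2norm unlock; congr (_ `^ _)%E; apply: eq_integral => x _ /=.
by rewrite powR_mulrn// real_normK// num_real.
Qed.

Lemma L2norm_lty f : measurable_fun [set: plane] f -> (L2norm f < +oo)%E <-> sqi vol f.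
Proof.
move=> mf; have m2 : measurable_fun [set: plane] (fun x => f x ^+ 2) by exact: measurable_funX.
have I0 : (0 <= \int[vol]_x (f x ^+ 2)%:E)%E.
  by apply: integral_ge0 => x _; rewrite lee_fin sqr_ge0.
have E : (\int[vol]_x `|(f x ^+ 2)%:E| = \int[vol]_x (f x ^+ 2)%:E)%E.
  by apply: eq_integral => x _; rewrite /= ger0_norm ?sqr_ge0.
rewrite L2normE; split=> [h|[_ /integrableP[_ h]]].
  split=> //; apply/integrableP; split; first exact/measurable_EFinP.
  have n2 : (2 : R) != 0 by rewrite pnatr_eq0.
  have J : (\int[vol]_x (f x ^+ 2)%:E = ((\int[vol]_x (f x ^+ 2)%:E) `^ 2^-1) `^ 2)%E.
    by rewrite -poweRrM mulVf// poweRe1.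
  have : (\int[vol]_x (f x ^+ 2)%:E < +oo)%E by rewrite J; exact: poweR_lty.
  by rewrite -E.
apply: poweR_lty; rewrite -E; exact: h.
Qed.

Lemma L2norm_small f (e : R) : 0 < e -> sqi vol f ->
  \int[vol]_x (f x ^+ 2) <= (e / 2) ^+ 2 -> (L2norm f < e%:E)%E.
Proof.
move=> e0 [_ If] h; rewrite L2normE Int_EFin// poweR_EFin lte_fin.
have e2 : 0 < e / 2 by rewrite divr_gt0.
rewrite powR12_sqrt; last by apply: Int_ge0 => x; rewrite sqr_ge0.
apply: (@le_lt_trans _ _ (e / 2)); last lra.
by rewrite -[leRHS](gtr0_norm e2) -sqrtr_sqr ler_wsqrtr.
Qed.

Lemma sqrt_sqi S : measurable_fun [set: plane] S -> (forall x, 0 <= S x) ->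
  sqi vol (fun x => Num.sqrt (S x)) <-> itg vol S.
Proof.
move=> mS S0.
have E x : Num.sqrt (S x) ^+ 2 = S x by rewrite sqr_sqrtr.
split=> [[_ I]|I]; first by apply: itg_ext I.
split; last by apply: itg_ext I => x; rewrite E.
apply: measurableT_comp mS; apply: continuous_measurable_fun; exact: sqrt_continuous.
Qed.

Lemma L2norm_sqrt_lty S : measurable_fun [set: plane] S -> (forall x, 0 <= S x) ->
  (L2norm (fun x => Num.sqrt (S x)) < +oo)%E <-> itg vol S.
Proof.
move=> mS S0; rewrite -(sqrt_sqi mS S0); apply: L2norm_lty.
apply: measurableT_comp mS; apply: continuous_measurable_fun; exact: sqrt_continuous.
Qed.

End square_norms.

Section complex_graph.
Context {R : realType}.
Variables (Q : R * R -> R * R) (K0 : R).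
Hypotheses (sQ : forall k, smooth (crd k \o Q)) (hQ : forall x, tension Q x = 0).
Hypothesis bQ : forall i x, cometric i i x * (pco Q i x ^+ 2 + qco Q i x ^+ 2) <= K0.
Local Notation plane := (mplane R).
Local Notation CV := ('cV[complex R]_2).
Local Notation Xi := (fun i x => Theta i (Q x)).
Implicit Types f g : R * R -> CV.

Lemma sqnormC_ge0 (v : CV) : 0 <= sqnormC v.
Proof. by apply: sumr_ge0 => j _; apply: addr_ge0; exact: sqr_ge0. Qed.

Lemma part_le_sqnormC (v : CV) j :
  complex.Re (v j 0) ^+ 2 <= sqnormC v /\ complex.Im (v j 0) ^+ 2 <= sqnormC v.
Proof.
have h : complex.Re (v j 0) ^+ 2 + complex.Im (v j 0) ^+ 2 <= sqnormC v.
  rewrite /sqnormC [leRHS](bigD1 j) // lerDl; apply: sumr_ge0 => k _.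
  by apply: addr_ge0; exact: sqr_ge0.
have a := sqr_ge0 (complex.Re (v j 0)); have b := sqr_ge0 (complex.Im (v j 0)).
by split; apply: le_trans h; rewrite ?lerDl ?lerDr.
Qed.

Lemma measurable_sqnormC f :
  (forall j, measurable_fun [set: plane] (re_part f j) /\ measurable_fun [set: plane] (im_part f j)) ->
  measurable_fun [set: plane] (fun x => sqnormC (f x)).
Proof.
move=> m; apply: measurable_sum => j; have [a b] := m j.
by apply: measurable_funD; exact: measurable_funX.
Qed.

Lemma itg_sqnormC f : (forall j, sqi vol (re_part f j) /\ sqi vol (im_part f j)) ->
  itg vol (fun x => sqnormC (f x)).
Proof. by move=> s; apply: itg_sum => j; have [[_ a] [_ b]] := s j; exact: itgD. Qed.

Lemma L2CP f : L2C f <-> forall j, sqi vol (re_part f j) /\ sqi vol (im_part f j).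
Proof.
split=> [[m h] j|s].
  have I := (L2norm_sqrt_lty (measurable_sqnormC m) (fun x => sqnormC_ge0 _)).1 h.
  have [a b] := m j; split; split=> //; apply: itg_le I.
  - exact: measurable_funX.
  - by move=> x; rewrite ger0_norm ?sqr_ge0//; exact: (part_le_sqnormC (f x) j).1.
  - exact: measurable_funX.
  - by move=> x; rewrite ger0_norm ?sqr_ge0//; exact: (part_le_sqnormC (f x) j).2.
have m j : measurable_fun [set: plane] (re_part f j) /\ measurable_fun [set: plane] (im_part f j).
  by have [[a _] [b _]] := s j.
split=> //; apply/(L2norm_sqrt_lty (measurable_sqnormC m) (fun x => sqnormC_ge0 _)).
exact: itg_sqnormC.
Qed.

Definition cplx (a b : 'I_2 -> R * R -> R) (x : R * R) : CV := \col_j Complex (a j x) (b j x).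

Lemma cplxE a b j : (re_part (cplx a b) j = a j) * (im_part (cplx a b) j = b j).
Proof. by split; apply/funext => x; rewrite /re_part /im_part mxE. Qed.

Lemma ReM (a : R) (z : complex R) : complex.Re (real_complex R a * z) = a * complex.Re z.
Proof. by case: z => x y /=; rewrite mul0r subr0. Qed.

Lemma ImM (a : R) (z : complex R) : complex.Im (real_complex R a * z) = a * complex.Im z.
Proof. by case: z => x y /=; rewrite mul0r addr0. Qed.

Lemma ReD (z w : complex R) : complex.Re (z + w) = complex.Re z + complex.Re w.
Proof. by case: z; case: w. Qed.

Lemma ImD (z w : complex R) : complex.Im (z + w) = complex.Im z + complex.Im w.
Proof. by case: z; case: w. Qed.

(** [rho] is the real or the imaginary part: an additive map that commutes with real scalars
    commutes with [W]. *)
Lemma Wpoint_part (F : comNzRingType) (iota : {rmorphism R -> F}) (cj : F -> F) (rho : F -> R)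
    (x : R * R) (v : 'cV[F]_2) (dv : 'I_2 -> 'cV[F]_2) j :
  (forall r, cj (iota r) = iota r) -> {morph rho : z w / z + w >-> z + w} ->
  (forall a z, rho (iota a * z) = a * rho z) ->
  rho (Wpoint Q Xi iota cj x v dv j 0) =
    Wr Q (fun j _ => rho (v j 0)) (fun j i _ => rho (dv i j 0)) j x.
Proof.
move=> cji rD rM; have := Wpoint_entries sQ hQ x v dv cji.
move: (Wpoint Q Xi iota cj x v dv) => w; rewrite !sum_ord2 => -[E0 E1].
elim/ord2_cases: j; rewrite /Wr /= !(sum_ord2 (fun _ => _)).
  rewrite E0 !rD !rM; clear.
  move: (rho _) (rho _) (rho _) (cometric _ _ x) (cometric _ _ x).
  by move: (pco Q _ x) (pco Q _ x) (qco Q _ x) (qco Q _ x) => *; ring.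
move: E1; move: (w ord_max 0) (v ord0 0) (v ord_max 0) (dv ord0 ord0 0) (dv ord_max ord0 0).
move: (cometric ord0 ord0 x) (cometric ord_max ord_max x).
move: (pco Q ord0 x) (pco Q ord_max x) (qco Q ord0 x) (qco Q ord_max x).
move=> p0 p1 q0 q1 h0 h1 y z0 z1 d0 d1 ->; rewrite !rD !rM.
by move: (rho z0) (rho z1) (rho d0) (rho d1); clear => *; ring.
Qed.

Lemma Wpoint_parts (x : R * R) (v : CV) (dv : 'I_2 -> CV) j :
  (complex.Re (Wpoint Q Xi (real_complex R) (@conjc R) x v dv j 0) =
    Wr Q (fun j _ => complex.Re (v j 0)) (fun j i _ => complex.Re (dv i j 0)) j x) *
  (complex.Im (Wpoint Q Xi (real_complex R) (@conjc R) x v dv j 0) =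
    Wr Q (fun j _ => complex.Im (v j 0)) (fun j i _ => complex.Im (dv i j 0)) j x).
Proof.
have cr (r : R) : conjc (real_complex R r) = real_complex R r by rewrite /= oppr0.
split.
- exact: (@Wpoint_part _ (real_complex R) (@conjc R) (@complex.Re R) x v dv j cr ReD ReM).
- exact: (@Wpoint_part _ (real_complex R) (@conjc R) (@complex.Im R) x v dv j cr ImD ImM).
Qed.

Lemma schroedinger_parts f g : schroedinger Q Xi f g ->
  real_graph Q (re_part f) (re_part g) /\ real_graph Q (im_part f) (im_part g).
Proof.
move=> [/L2CP sf /L2CP sg [Df [Lf [w gn wl /L2CP sL E]]]].
have mD i j : measurable_fun [set: plane] (re_part (Df i) j) /\ measurable_fun [set: plane] (im_part (Df i) j).
  by have [[_ [a _] _] [_ [b _] _]] := w i j.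
have mS : measurable_fun [set: plane] (fun x => \sum_(i < 2) cometric i i x * sqnormC (Df i x)).
  apply: measurable_sum => i; apply: measurable_funM; last exact: measurable_sqnormC.
  exact: smooth_measurable (smooth_cometric i).
have h0 i x : 0 <= cometric i i x * sqnormC (Df i x).
  by apply: mulr_ge0; [exact: ltW (cometric_gt0 _ _)|exact: sqnormC_ge0].
have S0 x : 0 <= \sum_(i < 2) cometric i i x * sqnormC (Df i x) by exact: sumr_ge0.
have I := (L2norm_sqrt_lty mS S0).1 gn.
have ms i : measurable_fun [set: plane] (sfac i) by exact: smooth_measurable (smooth_sfac i).
have sD i j : sqi vol (fun x => sfac i x * re_part (Df i) j x) /\ sqi vol (fun x => sfac i x * im_part (Df i) j x).
  have [a b] := mD i j.
  split; (split; [exact: measurable_funM|]); apply: itg_le I;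
    try (by apply: measurable_funX; exact: measurable_funM);
    move=> x; rewrite ger0_norm ?sqr_ge0// exprMn sfac_sqr [leRHS](bigD1 i) //;
    (apply: ler_wpDr; first exact: sumr_ge0);
    (apply: ler_wpM2l; first exact: ltW (cometric_gt0 _ _)).
  - exact: (part_le_sqnormC (Df i x) j).1.
  - exact: (part_le_sqnormC (Df i x) j).2.
split; (split=> [j|j|]; [by case: (sf j)|by case: (sg j)|]).
  exists (fun j i => re_part (Df i) j), (re_part Lf); split.
  - by move=> j; split=> [|i|i]; [case: (sf j)|case: (sD i j)|have [[_ _ +] _] := w i j].
  - by move=> j; case: (wl j).
  - by move=> j; case: (sL j).
  - move=> j; apply: ae_imply E => x e; rewrite /re_part e mxE ReD mxE (Wpoint_parts _ _ _ _).1.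
    by congr (_ + _); case: (Lf x j 0).
exists (fun j i => im_part (Df i) j), (im_part Lf); split.
- by move=> j; split=> [|i|i]; [case: (sf j)|case: (sD i j)|have [_ [_ _ +]] := w i j].
- by move=> j; case: (wl j).
- by move=> j; case: (sL j).
- move=> j; apply: ae_imply E => x e; rewrite /im_part e mxE ImD mxE (Wpoint_parts _ _ _ _).2.
  by congr (_ + _); case: (Lf x j 0).
Qed.

Lemma parts_schroedinger f g :
  real_graph Q (re_part f) (re_part g) -> real_graph Q (im_part f) (im_part g) ->
  schroedinger Q Xi f g.
Proof.
move=> [sf sg [df [L [hf wl sL E]]]] [sf' sg' [df' [L' [hf' wl' sL' E']]]].
split; [by apply/L2CP => j; split|by apply/L2CP => j; split|].
pose Df i := cplx (fun j => df j i) (fun j => df' j i).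
exists Df, (cplx L L').
have rD i j : re_part (Df i) j = df j i by rewrite cplxE.
have iD i j : im_part (Df i) j = df' j i by rewrite cplxE.
have li (u : R * R -> R) : sqi vol u -> loc_integrable u by move=> s; exact/loc2_loc_integrable/sqi_vol_loc2.
have ld (u : R * R -> R) i : sqi vol (fun x => sfac i x * u x) -> loc_integrable u.
  by move=> s; exact/loc2_loc_integrable/(sfac_loc2 (i := i)).
split.
- move=> i j; rewrite rD iD; have [a b c] := hf j; have [a' b' c'] := hf' j.
  by split; split=> //; [exact: li|exact: ld (b i)|exact: c|exact: li|exact: ld (b' i)|exact: c'].
- have I : itg vol (fun x => \sum_(i < 2) cometric i i x * sqnormC (Df i x)).
    apply: itg_sum => i.
    apply: (itg_ext (f := fun x => \sum_(j < 2) ((sfac i x * df j i x) ^+ 2 + (sfac i x * df' j i x) ^+ 2))).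
      move=> x; rewrite /sqnormC mulr_sumr; apply: eq_bigr => j _.
      by rewrite !mxE /= -sfac_sqr; ring.
    by apply: itg_sum => j; have [_ b _] := hf j; have [_ b' _] := hf' j; apply: itgD; [case: (b i)|case: (b' i)].
  apply/L2norm_sqrt_lty => //; first exact: itg_measurable I.
  by move=> x; apply: sumr_ge0 => i _; apply: mulr_ge0; [exact: ltW (cometric_gt0 _ _)|exact: sqnormC_ge0].
- by move=> j; rewrite !cplxE; split; [exact: wl|exact: wl'].
- by apply/L2CP => j; rewrite !cplxE.
- have C : {ae vol, forall x, forall j, re_part g j x = - L j x + Wr Q (re_part f) df j x /\
      im_part g j x = - L' j x + Wr Q (im_part f) df' j x}.
    have c j : {ae vol, forall x, re_part g j x = - L j x + Wr Q (re_part f) df j x /\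
      im_part g j x = - L' j x + Wr Q (im_part f) df' j x} by apply: ae_imply2 (E j) (E' j).
    by apply: ae_imply2 (c ord0) (c ord_max) => x c0 c1; exact: ord2_cases.
  apply: ae_imply C => x C; apply/matrixP => j k; rewrite ord1.
  have [r i] := C j; apply/eqP; rewrite eq_complex; apply/andP; split; apply/eqP.
    rewrite mxE ReD mxE (Wpoint_parts _ _ _ _).1; apply: etrans r _; congr (_ + _).
      by rewrite mxE.
    by rewrite /Wr !(sum_ord2 (fun _ => _)) !mxE.
  rewrite mxE ImD mxE (Wpoint_parts _ _ _ _).2; apply: etrans i _; congr (_ + _).
    by rewrite mxE.
  by rewrite /Wr !(sum_ord2 (fun _ => _)) !mxE.
Qed.

Lemma innerCE f g : L2C f -> L2C g ->
  innerC f g = Complex (pairing (re_part f) (re_part g) + pairing (im_part f) (im_part g))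
                       (pairing (im_part f) (re_part g) - pairing (re_part f) (im_part g)).
Proof.
move=> /L2CP sf /L2CP sg.
have I (a b : 'I_2 -> R * R -> R) : (forall j, sqi vol (a j)) -> (forall j, sqi vol (b j)) ->
  itg vol (fun x => \sum_(j < 2) a j x * b j x) by exact: itg_pairing.
have rf j := (sf j).1; have jf j := (sf j).2; have rg j := (sg j).1; have jg j := (sg j).2.
rewrite /innerC; apply/eqP; rewrite eq_complex /=; apply/andP; split; apply/eqP.
  rewrite /pairing -(IntD (I _ _ rf rg) (I _ _ jf jg)); apply: eq_Int => x.
  rewrite /dotp !(sum_ord2 (fun _ => _)) ReD /re_part /im_part; clear.
  by case: (f x ord0 0) (f x ord_max 0) (g x ord0 0) (g x ord_max 0) => a b [c d] [e h] [k l] /=; ring.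
rewrite /pairing -(IntB (I _ _ jf rg) (I _ _ rf jg)); apply: eq_Int => x.
rewrite /dotp !(sum_ord2 (fun _ => _)) ImD /re_part /im_part; clear.
by case: (f x ord0 0) (f x ord_max 0) (g x ord0 0) (g x ord_max 0) => a b [c d] [e h] [k l] /=; ring.
Qed.

End complex_graph.

(** * Self-adjointness and strict positivity of the complex operator *)

Section self_adjointness.
Context {R : realType}.
Variables (Q : R * R -> R * R) (K0 : R).
Hypotheses (sQ : forall k, smooth (crd k \o Q)) (hQ : forall x, tension Q x = 0).
Hypothesis bQ : forall i x, cometric i i x * (pco Q i x ^+ 2 + qco Q i x ^+ 2) <= K0.
Local Notation plane := (mplane R).
Local Notation Xi := (fun i x => Theta i (Q x)).

Lemma pairing0 (f : 'I_2 -> R * R -> R) : pairing (fun _ _ => 0) f = 0.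
Proof.
rewrite -[RHS](@Int0 _ _ _ (@vol R)); apply: eq_Int => x.
by rewrite big1// => j _; rewrite mul0r.
Qed.

Lemma real_graph0 : real_graph Q (fun _ _ => 0) (fun _ _ => 0).
Proof.
apply: (graph_maximal sQ hQ bQ) => [j|j|f g G]; try exact: sqi0.
by rewrite pairingC pairing0 pairingC pairing0.
Qed.

Lemma schroedinger_self_adjoint : self_adjoint (schroedinger Q Xi).
Proof.
have L0 (a : 'I_2 -> R * R -> R) : (forall j, sqi vol (a j)) -> L2C (cplx a (fun _ _ => 0)).
  by move=> sa; apply/L2CP => j; rewrite !cplxE; split => //; exact: sqi0.
split.
- by move=> f g [].
(* Four real functions are approximated, each with a quarter of (e/2)^2; the factor 1/2 makes the
   final inequality strict. *)
- move=> f e /L2CP sf e0; have e8 : 0 < (e / 2) ^+ 2 / 4 by rewrite divr_gt0 ?exprn_gt0 ?divr_gt0.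
  have A j : exists chi, test_function chi /\
      \int[vol]_x ((re_part f j x - chi x) ^+ 2) <= (e / 2) ^+ 2 / 4.
    by have [c tc lc] := test_dense_vol (sf j).1 e8; exists c.
  have B j : exists chi, test_function chi /\
      \int[vol]_x ((im_part f j x - chi x) ^+ 2) <= (e / 2) ^+ 2 / 4.
    by have [c tc lc] := test_dense_vol (sf j).2 e8; exists c.
  have [c Hc] := choice A; have [d Hd] := choice B.
  have G1 := test_graph sQ bQ (fun j => (Hc j).1).
  have G2 := test_graph sQ bQ (fun j => (Hd j).1).
  exists (cplx c d), (cplx (fun j x => - Lap (c j : R * R -> R) x + Wr Q c (fun j i => pd i (c j)) j x)
     (fun j x => - Lap (d j : R * R -> R) x + Wr Q d (fun j i => pd i (d j)) j x)).
  split.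
    have Ec a b : re_part (cplx a b : R * R -> _) = a by apply/funext => j; rewrite cplxE.
    have Ed a b : im_part (cplx a b : R * R -> _) = b by apply/funext => j; rewrite cplxE.
    by apply: parts_schroedinger => //; rewrite ?Ec ?Ed.
  have sc j : sqi vol (c j) by have [] := test_h1 (Hc j).1.
  have sd j : sqi vol (d j) by have [] := test_h1 (Hd j).1.
  have P x j : (f x - cplx c d x) j 0 = Complex (re_part f j x - c j x) (im_part f j x - d j x).
    by rewrite !mxE /re_part /im_part; case: (f x j 0).
  have E x : sqnormC (f x - cplx c d x) =
      \sum_(j < 2) ((re_part f j x - c j x) ^+ 2 + (im_part f j x - d j x) ^+ 2).
    by apply: eq_bigr => j _; rewrite P.
  have i1 j : itg vol (fun x => (re_part f j x - c j x) ^+ 2) by case: (sqiB (sf j).1 (sc j)).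
  have i2 j : itg vol (fun x => (im_part f j x - d j x) ^+ 2) by case: (sqiB (sf j).2 (sd j)).
  have IE : itg vol (fun x => sqnormC (f x - cplx c d x)).
    by apply: (itg_ext (fsym E)); apply: itg_sum => j; exact: itgD.
  have s2 : sqi vol (fun x => Num.sqrt (sqnormC (f x - cplx c d x))).
    apply/sqrt_sqi => //; first exact: itg_measurable IE.
    by move=> x; exact: sqnormC_ge0.
  apply: L2norm_small => //.
  rewrite (@eq_Int _ _ _ vol _ (fun x => \sum_(j < 2) ((re_part f j x - c j x) ^+ 2 + (im_part f j x - d j x) ^+ 2))).
    rewrite Int_sum => [|j]; last exact: itgD.
    rewrite (sum_ord2 (fun j => \int[vol]_x _)) !IntD//.
    have := (Hc ord0).2; have := (Hc ord_max).2; have := (Hd ord0).2; have := (Hd ord_max).2.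
    move: (\int[vol]_x _) (\int[vol]_x _) (\int[vol]_x _) (\int[vol]_x _) ((e / 2) ^+ 2).
    by clear => a b a' b' q; lra.
  by move=> x; rewrite sqr_sqrtr ?sqnormC_ge0// E.
- move=> f g Lf Lg; have sf := (L2CP f).1 Lf; have sg := (L2CP g).1 Lg; split.
    move=> /(schroedinger_parts sQ hQ)[Gr Gi] f' g' G'.
    have [Gr' Gi'] := schroedinger_parts sQ hQ G'; have [Lf' Lg' _] := G'.
    rewrite !innerCE//.
    rewrite (graph_symmetric sQ hQ bQ Gr' Gr) (graph_symmetric sQ hQ bQ Gi' Gi).
    by rewrite (graph_symmetric sQ hQ bQ Gi' Gr) (graph_symmetric sQ hQ bQ Gr' Gi).
  move=> H.
  (* Testing with purely real functions suffices: the real and imaginary parts of the complex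
     identity then give one equation for the real part of f and one for its imaginary part. *)
  have K a b : real_graph Q a b -> pairing b (re_part f) = pairing a (re_part g) /\
      pairing b (im_part f) = pairing a (im_part g).
    move=> G; have [sa sb _] := G.
    have Ec a' b' : re_part (cplx a' b' : R * R -> _) = a' by apply/funext => j; rewrite cplxE.
    have Ed a' b' : im_part (cplx a' b' : R * R -> _) = b' by apply/funext => j; rewrite cplxE.
    have S : schroedinger Q Xi (cplx a (fun _ _ => 0)) (cplx b (fun _ _ => 0)).
      by apply: parts_schroedinger; rewrite ?Ec ?Ed//; exact: real_graph0.
    have := H _ _ S; rewrite (innerCE (L0 _ sb) Lf) (innerCE (L0 _ sa) Lg) !Ec !Ed !pairing0.
    rewrite !addr0 !sub0r => -[-> /eqP]; rewrite eqr_opp => /eqP ->.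
    by [].
  apply: parts_schroedinger => //.
    apply: (graph_maximal sQ hQ bQ) => [j|j|a b /K []//]; [exact: (sf j).1|exact: (sg j).1].
  apply: (graph_maximal sQ hQ bQ) => [j|j|a b /K []//]; [exact: (sf j).2|exact: (sg j).2].
Qed.

Lemma schroedinger_positive : K0 <= 1 / 16 -> strictly_positive (schroedinger Q Xi).
Proof.
move=> K16; exists (1 / 16); first by rewrite divr_gt0.
move=> f g G; have [Lf Lg _] := G; have [Gr Gi] := schroedinger_parts sQ hQ G.
have Cr := graph_coercive sQ hQ bQ K16 Gr; have Ci := graph_coercive sQ hQ bQ K16 Gi.
(* By symmetry <H f, f> has zero imaginary part, as the order of the complex numbers demands. *)
have sy := graph_symmetric sQ hQ bQ Gi Gr.
rewrite (innerCE Lf Lf) (innerCE Lg Lf) sy [pairing (im_part f) (re_part f)]pairingC.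
rewrite [pairing (im_part f) (re_part g)]pairingC !subrr lecE !(ReM, ImM) /= mulr0 eqxx /=.
by rewrite mulrDr lerD.
Qed.

End self_adjointness.

Theorem lemma4p4 (R : realType) :
  exists2 mu_star : R, 0 < mu_star &
  forall (rho R0 mu1 : R) (Q : R * R -> R * R),
  admissible rho R0 Q ->
  (L2norm (norm_nabla_d 0 Q) < mu1%:E)%E ->
  (Linfnorm (exp_weighted_d rho Q) < mu1%:E)%E ->
  (Linfnorm (norm_nabla_d 2 Q) + Linfnorm (norm_nabla_d 1 Q) < mu1%:E)%E ->
  let Xi : 'I_2 -> R * R -> 'cV[R]_2 := fun i x => Theta i (Q x) in
  [/\ (forall (T : R) (u : R -> R * R -> R * R) (ut : R -> R * R -> 'cV[R]_2)
         (U : R * R * (R * R) -> R * R)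
         (Om : 'I_2 -> R * R * (R * R) -> 'cV[R]_2),
       0 < T ->
       wave_map_solution T Q u ut ->
       caloric_gauge T Q Xi u U Om ->
       forall (s t : R) (x : R * R), 0 < s -> 0 < t < T ->
       let z : R * R * (R * R) := (s, t, x) in
       let phis : R * R * (R * R) -> 'cV[R]_2 := phi U Om ds in
       let phis_slice : R * R -> 'cV[R]_2 := fun y => phis (s, t, y) in
       let At := conn U Om dt in
       let h (i : 'I_2) : R := cometric i i x in
       let Ainf (i : 'I_2) := conn_inf Q Xi i x in
       let Acon (i : 'I_2) (z' : R * R * (R * R)) : 'M[R]_2 :=
         conn U Om (dx i) z' - conn_inf Q Xi i z'.2 in
       let pinf (i : 'I_2) := phi_inf Q Xi i x in
       let pcon (i : 'I_2) : 'cV[R]_2 := phi U Om (dx i) z - phi_inf Q Xi i x in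
       'D_(edir dt) (fun z' => 'D_(edir dt) phis z') z
         - Lap phis_slice x + Wreal Q Xi phis_slice x
       = - 2 *: (At z *m 'D_(edir dt) phis z)
         - At z *m (At z *m phis z)
         - 'D_(edir dt) At z *m phis z
         + 'D_(edir ds) (wave_tension U Om) z
         + frame_coord U Om z
             (curv (U z) (dmap U (edir dt) z) (dmap U (edir ds) z)
                   (dmap U (edir dt) z))
         + 2 *: (\sum_(i < 2) h i *: (Acon i z *m 'D_(edir (dx i)) phis z))
         + \sum_(i < 2) h i *: (Acon i z *m (Ainf i *m phis z))
         + \sum_(i < 2) h i *: (Ainf i *m (Acon i z *m phis z))
         + \sum_(i < 2) h i *: (Acon i z *m (Acon i z *m phis z))
         + \sum_(i < 2) h i *:
             (('D_(edir (dx i)) (Acon i) z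
               - \sum_(k < 2) chris k i i x *: Acon k z) *m phis z)
         + \sum_(i < 2) h i *: wedge id (phis z) (pinf i) (pcon i)
         + \sum_(i < 2) h i *: wedge id (phis z) (pcon i) (pinf i)
         + \sum_(i < 2) h i *: wedge id (phis z) (pcon i) (pcon i)),
      self_adjoint (schroedinger Q Xi) &
      0 < mu1 < mu_star -> strictly_positive (schroedinger Q Xi)].
Proof.
(* For 0 < mu1 < 1/4 the bound K0 = mu1^2 is at most 1/16, the range of [graph_coercive]. *)
exists (1 / 4); first by rewrite divr_gt0.
move=> rho R0 mu1 Q adm hL2 hinf h3 Xi.
have [[sQ hQ] _ _ _ _ rho0 _] := adm.
have bQ := coefficients_bounded sQ rho0 hinf.
split.
- move=> T u ut U Om T0 wm cg.
  exact: (heat_tension_equation (derivable_conn_inf sQ) cg).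
- exact: (schroedinger_self_adjoint sQ hQ bQ).
- move=> /andP[m0 m4]; apply: (schroedinger_positive sQ hQ bQ).
  by nra.
Qed.
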